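(* Let $\delta\in(0,1)$. There exists a constant $C$, only depending on $\delta$, $\underline{a}$ and $\aleph$, such that \[ \|a-0\|_{L^2(0,1)\oplus L^2(0,1)}\le C\,\|\Lambda(a)-\Lambda(0)\|^{\delta/[2(2+\delta)]} \] for each $a\in\underline{\mathscr{A}}$, where $\|\cdot\|$ on the right is the operator norm in $\mathscr{B}(\mathcal{U}_0,L^2(\Gamma_1\times(0,\tau)))$.
   Context: $\tau>0$, $\Omega=(0,1)\times(0,1)$, $\Gamma_0=((0,1)\times\{1\})\cup(\{1\}\times(0,1))$, $\Gamma_1=((0,1)\times\{0\})\cup(\{0\}\times(0,1))$, and $\partial_\nu$ is the derivative along the unit normal vector $\nu$ pointing outward of $\Omega$. A function $a$ on $\Gamma_1$ is identified with the pair $(a_1,a_2)$, where $a_1=a_1(x)=a|_{(0,1)\times\{0\}}$ and $a_2=a_2(y)=a|_{\{0\}\times(0,1)}$. Fix $1/2<\alpha\le 1$ and $0<\underline{a}\le\aleph$, and set \[ \mathscr{A}=\{b=(b_1,b_2)\in C^\alpha([0,1])\oplus C^\alpha([0,1]);\ b_1(0)=b_2(0),\ b_j\ge 0\}, \] \[ \underline{\mathscr{A}}=\{b=(b_1,b_2)\in\mathscr{A}\cap(H^1(0,1)\oplus H^1(0,1));\ \underline{a}\le b_1,b_2,\ \|b\|^2_{H^1(0,1)\oplus H^1(0,1)}\le\aleph\}. \] Let $V=\{u\in H^1(\Omega);\ u=0\text{ on }\Gamma_0\}$, and for $a\in\mathscr{A}$ let $A_a(v,w)=(w,\Delta v)$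 on $V\oplus L^2(\Omega)$ with domain $D(A_a)=\{(v,w)\in V\oplus V;\ \Delta v\in L^2(\Omega),\ \partial_\nu v=-aw\text{ on }\Gamma_1\}$, equipped with its graph norm. For $(u_0,u_1)\in D(A_a)$, $u(a,(u_0,u_1))$ is the unique solution, with $(u,\partial_tu)\in C([0,\infty),D(A_a))\cap C^1([0,\infty),V\oplus L^2(\Omega))$, of \[ \partial_t^2u-\Delta u=0\ \text{in }\Omega\times(0,\tau),\quad u=0\ \text{on }\Gamma_0\times(0,\tau),\quad\partial_\nu u+a\partial_tu=0\ \text{on }\Gamma_1\times(0,\tau),\quad u(\cdot,0)=u_0,\ \partial_tu(\cdot,0)=u_1. \] Let $\mathcal{U}_0=\{v\in V;\ \Delta v\in L^2(\Omega),\ \partial_\nu v=0\text{ on }\Gamma_1\}$ with norm $\|u_0\|_{\mathcal{U}_0}=(\|u_0\|_V^2+\|\Delta u_0\|_{L^2(\Omega)}^2)^{1/2}$; then $\mathcal{U}_0\times\{0\}\subset D(A_a)$ for every $a\in\mathscr{A}$. The initial-to-boundary operator is $\Lambda(a):u_0\in\mathcal{U}_0\mapsto\partial_\nu u(a,(u_0,0))\in L^2(\Gamma_1\times(0,\tau))$, which is bounded ($\Lambda(0)$ is the operator for $a=0$). $\mathscr{B}(X,Y)$ denotes the bounded linear operators from $X$ to $Y$ with the operator norm. *)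

(* Defs.v *)
From HB Require Import structures.
From mathcomp Require Import all_boot all_order all_algebra.
From mathcomp Require Import all_classical all_reals all_analysis.

Set Implicit Arguments.
Unset Strict Implicit.
Unset Printing Implicit Defensive.

Import Order.TTheory GRing.Theory Num.Theory.
Import numFieldNormedType.Exports.

Local Open Scope classical_set_scope.
Local Open Scope ring_scope.

(* Elements of a Lebesgue or Sobolev space are represented by real-valued
   functions, of which only the restriction to the relevant domain matters, up
   to a null set.  Norms take values in \bar R, and a normed space is given by
   a set S of functions together with a norm N. *)

Section FunctionSpaces.
Context {R : realType}.

Definition lebesgue2 := (@lebesgue_measure R \x @lebesgue_measure R)%E.

Definition L2 d (T : measurableType d) (m : {measure set T -> \bar R})
    (D : set T) : set (T -> R) :=
  [set f | f \_ D \in Lfun m 2%:E].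

Definition L2norm d (T : measurableType d) (m : {measure set T -> \bar R})
    (D : set T) (f : T -> R) : \bar R :=
  'N[m]_2%:E [EFin \o (f \_ D)]%E.

(* Euclidean combination of two norms: the norm of a direct sum. *)
Definition hypot (x y : \bar R) : \bar R := ((x ^+ 2 + y ^+ 2) `^ 2^-1)%E.

Definition L2norm2 d (T : measurableType d) (m : {measure set T -> \bar R})
    (D : set T) (g : (T -> R) * (T -> R)) : \bar R :=
  hypot (L2norm m D g.1) (L2norm m D g.2).

Definition halfline : set R := [set t | 0 <= t].

Definition continuous_halfline (E : lmodType R) (S : set E) (N : E -> \bar R)
    (f : R -> E) : Prop :=
  forall t, 0 <= t -> S (f t) /\
    N (f s - f t) @[s --> within halfline (nbhs t)] --> 0%E.

(* At t = 0 the derivative is one-sided. *)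
Definition derivative_halfline (E : lmodType R) (N : E -> \bar R)
    (f f' : R -> E) : Prop :=
  forall t, 0 <= t ->
    N ((s - t)^-1 *: (f s - f t) - f' t)
      @[s --> within halfline (dnbhs t)] --> 0%E.

Definition C1_halfline (E : lmodType R) (S : set E) (N : E -> \bar R)
    (f f' : R -> E) : Prop :=
  [/\ continuous_halfline S N f, derivative_halfline N f f' &
      continuous_halfline S N f'].

Definition opnorm (E F : lmodType R) (S : set E) (N : E -> \bar R)
    (N' : F -> \bar R) (L : E -> F) : \bar R :=
  ereal_sup [set N' (L x) | x in [set x | S x /\ (N x <= 1)%E]].

End FunctionSpaces.

Section Interval.
Context {R : realType}.
Local Notation mu := (@lebesgue_measure R).
Implicit Types (b : R -> R) (a : (R -> R) * (R -> R)).

Definition unit_itv : set R := `]0, 1[%classic.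

Definition test_fun1 : set (R -> R) :=
  [set phi | (forall n x, derivable (derive1n n phi) x 1) /\
    exists2 K : set R, compact K /\ K `<=` unit_itv &
      forall x, ~ K x -> phi x = 0].

Definition is_weak_deriv1 b b' : Prop :=
  L2 mu unit_itv b' /\
  forall phi, test_fun1 phi ->
    \int[mu]_(x in unit_itv) (b x * derive1 phi x) =
    - \int[mu]_(x in unit_itv) (b' x * phi x).

Definition weak_deriv1 b : R -> R := xget (cst 0) [set b' | is_weak_deriv1 b b'].

Definition H1_itv : set (R -> R) :=
  [set b | L2 mu unit_itv b /\ exists b', is_weak_deriv1 b b'].

Definition H1norm_itv b : \bar R :=
  hypot (L2norm mu unit_itv b) (L2norm mu unit_itv (weak_deriv1 b)).

Definition hoelder_continuous (alpha : R) b : Prop :=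
  exists K : R, forall x y, x \in `[0, 1] -> y \in `[0, 1] ->
    `|b x - b y| <= K * (`|x - y| `^ alpha).

(* A function a on the part Gamma_1 of the boundary is the pair (a_1, a_2) of
   its restrictions to the bottom and left sides. *)
Definition coeff (alpha : R) : set ((R -> R) * (R -> R)) :=
  [set a | [/\ hoelder_continuous alpha a.1, hoelder_continuous alpha a.2, a.1 0 = a.2 0 &
    forall x, x \in `[0, 1] -> 0 <= a.1 x /\ 0 <= a.2 x]].

Definition coeff_bounded (alpha abar aleph : R) : set ((R -> R) * (R -> R)) :=
  [set a | [/\ coeff alpha a, H1_itv a.1 /\ H1_itv a.2,
    forall x, x \in `[0, 1] -> abar <= a.1 x /\ abar <= a.2 x &
    (hypot (H1norm_itv a.1) (H1norm_itv a.2) ^+ 2 <= aleph%:E)%E]].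

End Interval.

Section Square.
Context {R : realType}.
Local Notation mu := (@lebesgue_measure R).
Local Notation mu2 := (@lebesgue2 R).
Implicit Types (u v w f : R * R -> R) (p : R * R).
Implicit Types (a g : (R -> R) * (R -> R)).

Definition Omega : set (R * R) := unit_itv `*` unit_itv.

(* The first variable is indexed by false, the second one by true. *)
Definition slice (i : bool) f p : R -> R :=
  fun t => if i then f (p.1, t) else f (t, p.2).

Definition coordinate (i : bool) p : R := if i then p.2 else p.1.

Definition pd (i : bool) f : R * R -> R := fun p =>
  derive1 (slice i f p) (coordinate i p).

(* All iterated partial derivatives exist and are continuous on R^2. *)
Definition smooth f : Prop :=
  forall s : seq bool, let h := foldr pd f s in
    continuous h /\ forall i p, derivable (slice i h p) (coordinate i p) 1.

Definition test_fun : set (R * R -> R) :=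
  [set phi | smooth phi /\
    exists2 K : set (R * R), compact K /\ K `<=` Omega &
      forall p, ~ K p -> phi p = 0].

Definition L2_Omega : set (R * R -> R) := L2 mu2 Omega.
Definition L2norm_Omega : (R * R -> R) -> \bar R := L2norm mu2 Omega.

Definition is_weak_d (i : bool) u f : Prop :=
  L2_Omega f /\
  forall phi, test_fun phi ->
    \int[mu2]_(p in Omega) (u p * pd i phi p) =
    - \int[mu2]_(p in Omega) (f p * phi p).

Definition weak_d (i : bool) u : R * R -> R := xget (cst 0) [set f | is_weak_d i u f].

Definition H1_Omega : set (R * R -> R) :=
  [set u | L2_Omega u /\ forall i, exists f, is_weak_d i u f].

Definition H1norm u : \bar R :=
  hypot (L2norm_Omega u)
        (hypot (L2norm_Omega (weak_d false u)) (L2norm_Omega (weak_d true u))).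

Definition is_laplacian u f : Prop :=
  L2_Omega f /\
  forall phi, test_fun phi ->
    \int[mu2]_(p in Omega)
      (u p * (pd false (pd false phi) p + pd true (pd true phi) p)) =
    \int[mu2]_(p in Omega) (f p * phi p).

Definition has_laplacian u : Prop := exists f, is_laplacian u f.

Definition laplacian u : R * R -> R := xget (cst 0) [set f | is_laplacian u f].

Definition bottom_side (x : R) : R * R := (x, 0).
Definition left_side (y : R) : R * R := (0, y).
Definition top_side (x : R) : R * R := (x, 1).
Definition right_side (y : R) : R * R := (1, y).

(* The trace on a side is the continuous extension to H1(Omega) of the
   restriction to that side of functions that are smooth up to the boundary. *)
Definition is_trace (side : R -> R * R) u (g : R -> R) : Prop :=
  [/\ H1_Omega u, L2 mu unit_itv g &
  exists phi : nat -> R * R -> R,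
    [/\ forall n, smooth (phi n),
        H1norm (phi n - u) @[n --> \oo] --> 0%E &
        L2norm mu unit_itv ((phi n \o side) - g) @[n --> \oo] --> 0%E]].

Definition trace_on (side : R -> R * R) u : R -> R :=
  xget (cst 0) [set g | is_trace side u g].

Definition V_space : set (R * R -> R) :=
  [set u | [/\ H1_Omega u, is_trace top_side u (cst 0) &
    is_trace right_side u (cst 0)]].

(* The normal derivative on Gamma_1 is defined by the generalized Green
   formula, tested against the elements of V, whose traces on the rest of the
   boundary vanish. *)
Definition normal_deriv v g : Prop :=
  [/\ L2 mu unit_itv g.1, L2 mu unit_itv g.2 &
  forall phi, V_space phi ->
    \int[mu2]_(p in Omega)
      (laplacian v p * phi p + weak_d false v p * weak_d false phi p
       + weak_d true v p * weak_d true phi p) =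
    \int[mu]_(x in unit_itv) (g.1 x * trace_on bottom_side phi x) +
    \int[mu]_(y in unit_itv) (g.2 y * trace_on left_side phi y)].

Definition V_L2 : set ((R * R -> R) * (R * R -> R)) :=
  [set U | V_space U.1 /\ L2_Omega U.2].

Definition V_L2norm (U : (R * R -> R) * (R * R -> R)) : \bar R :=
  hypot (H1norm U.1) (L2norm_Omega U.2).

Definition A_op (U : (R * R -> R) * (R * R -> R)) :
    (R * R -> R) * (R * R -> R) :=
  (U.2, laplacian U.1).

Definition A_dom a : set ((R * R -> R) * (R * R -> R)) :=
  [set U | [/\ V_space U.1, V_space U.2, has_laplacian U.1 &
    normal_deriv U.1 (fun x => - (a.1 x * trace_on bottom_side U.2 x),
                      fun y => - (a.2 y * trace_on left_side U.2 y))]].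

Definition A_graph_norm (U : (R * R -> R) * (R * R -> R)) : \bar R :=
  hypot (V_L2norm U) (V_L2norm (A_op U)).

(* The boundary conditions are part of the domain of A_a. *)
Definition is_wave (tau : R) a (u0 u1 : R * R -> R) (u : R -> R * R -> R) : Prop :=
  exists ut utt : R -> R * R -> R,
  [/\ continuous_halfline (A_dom a) A_graph_norm (fun t => (u t, ut t)),
      C1_halfline V_L2 V_L2norm
        (fun t => (u t, ut t)) (fun t => (ut t, utt t)),
      forall t, 0 < t < tau -> utt t = laplacian (u t) %[ae mu2 in Omega],
      u 0 = u0 %[ae mu2 in Omega] &
      ut 0 = u1 %[ae mu2 in Omega]].

Definition wave (tau : R) a (u0 u1 : R * R -> R) : R -> R * R -> R :=
  xget (cst (cst 0)) [set u | is_wave tau a u0 u1 u].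

Definition U0_space : set (R * R -> R) :=
  [set v | [/\ V_space v, has_laplacian v & normal_deriv v (cst 0, cst 0)]].

Definition U0norm v : \bar R :=
  hypot (H1norm v) (L2norm_Omega (laplacian v)).

(* A function on Gamma_1 x (0, tau) is the pair of its restrictions to the
   bottom and left sides, as functions of the position and of time. *)
Definition lateral (tau : R) : set (R * R) := unit_itv `*` `]0, tau[%classic.

Definition lateral_normal_deriv (tau : R) (u : R -> R * R -> R)
    (h : (R * R -> R) * (R * R -> R)) : Prop :=
  [/\ L2 mu2 (lateral tau) h.1, L2 mu2 (lateral tau) h.2 &
  \forall t \ae mu, 0 < t < tau ->
    normal_deriv (u t) (fun x => h.1 (x, t), fun y => h.2 (y, t))].

Definition Lambda (tau : R) a (u0 : R * R -> R) : (R * R -> R) * (R * R -> R) :=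
  xget (cst 0, cst 0)
    [set h | lateral_normal_deriv tau (wave tau a u0 (cst 0)) h].

Definition Lambda_norm (tau : R)
    (L : (R * R -> R) -> (R * R -> R) * (R * R -> R)) : \bar R :=
  opnorm U0_space U0norm (L2norm2 mu2 (lateral tau)) L.

End Square.

(* Main.v *)
Require Import Defs.
From mathcomp Require Import all_boot all_order all_algebra.
From mathcomp Require Import all_classical all_reals all_analysis.
From mathcomp Require Import measurable_realfun.
From mathcomp Require Import ring lra zify.

(** The coefficient a is bounded from below by abar, and its L2 norm is at most the
    square root of aleph.  So it is enough to bound the norm of Lambda(a) - Lambda(0)
    from below by a constant c > 0 that depends on tau and abar only
    (Lambda_lower_bound): for every theta >= 0 the right-hand side is then at least
    C c^theta, and C = sqrt(aleph) / c^theta will do.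

    The lower bound comes from one initial datum, the first eigenfunction
    phi = k cos(pi x / 2) cos(pi y / 2) of the Laplacian with the mixed boundary
    conditions, with eigenvalue omega^2.  Without damping its wave is
    cos(omega t) phi; in particular Lambda(0) phi = 0.  With damping, Lambda(a) phi
    is - a u_t on Gamma_1.  Suppose that its norm is a small number e.  The
    difference w = u - cos(omega t) phi vanishes at time 0, and the derivative of its
    energy is at most the pairing on Gamma_1 of a u_t with the velocity of
    cos(omega t) phi; so the energy of w is at most of order e, and the trace of w at
    most of order sqrt(e).  On the other hand a u_t is small and a >= abar, so the
    trace of u has moved by at most e / abar, up to a factor, at a time T <= tau.
    Hence the traces of phi and cos(omega T) phi differ by at most a multiple of
    sqrt(e) + e (energy_estimate).  As cos(omega T) < 1 for T = min(tau, 1), e cannot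
    be arbitrarily small (lower_constant).

    For this argument the operator Lambda(a) must be known to be given by a wave,
    and the largest part of the file builds that wave and its boundary values.
    The operator A_a is dissipative for the energy, and its resolvent equation is a
    variational problem solved by Riesz's theorem (wave_generator).  The implicit
    Euler scheme with dyadic steps converges (semigroup_orbit) from every datum whose
    image under A_a is approached by the domain of the square of A_a; here that image
    is (0, - omega^2 phi), and cutting phi off near the boundary gives the
    approximations (wave_curves).  The velocity is continuous in time with values
    in V, so its trace is a continuous curve in L2, which a jointly measurable
    function represents (lateral_version); therefore - a u_t is a lateral normal
    derivative, and it is the only one (Lambda_spec).  Traces, weak derivatives and
    the spaces are handled through the limits of smooth functions in Vtuple. *)

Set Implicit Arguments.
Unset Strict Implicit.
Unset Printing Implicit Defensive.

Import Order.TTheory GRing.Theory Num.Theory.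
Import numFieldNormedType.Exports.

Local Open Scope classical_set_scope.
Local Open Scope ring_scope.

(** * Linear identities in modules *)

Section LinearExpressions.
Context {R : comNzRingType} {E : lmodType R}.

Inductive lin_expr :=
  | LinVar of nat | LinZero | LinAdd of lin_expr & lin_expr
  | LinOpp of lin_expr | LinScale of R & lin_expr.

Fixpoint lin_eval (env : seq E) (e : lin_expr) : E :=
  match e with
  | LinVar i => env`_i
  | LinZero => 0
  | LinAdd e1 e2 => lin_eval env e1 + lin_eval env e2
  | LinOpp e1 => - lin_eval env e1
  | LinScale c e1 => c *: lin_eval env e1
  end.

Fixpoint lin_coef (e : lin_expr) (i : nat) : R :=
  match e with
  | LinVar j => if i == j then 1 else 0
  | LinZero => 0
  | LinAdd e1 e2 => lin_coef e1 i + lin_coef e2 i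
  | LinOpp e1 => - lin_coef e1 i
  | LinScale c e1 => c * lin_coef e1 i
  end.

Lemma lin_evalE env e :
  lin_eval env e = \sum_(i < size env) lin_coef e i *: env`_i.
Proof.
elim: e => /= [j| |e1 -> e2 ->|e ->|c e ->].
- have [jn|nj] := ltnP j (size env); last first.
    rewrite nth_default// big1// => i _; case: eqP => [ij|]; last by rewrite scale0r.
    by have := ltn_ord i; rewrite ij ltnNge nj.
  rewrite (bigD1 (Ordinal jn))//= eqxx scale1r big1 ?addr0// => i.
  by rewrite -val_eqE/= => /negbTE ->; rewrite scale0r.
- by rewrite big1// => i _; rewrite scale0r.
- by rewrite -big_split; apply: eq_bigr => i _; rewrite scalerDl.
- by rewrite -sumrN; apply: eq_bigr => i _; rewrite scaleNr.
- by rewrite scaler_sumr; apply: eq_bigr => i _; rewrite scalerA.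
Qed.

Fixpoint lin_same (n : nat) (e1 e2 : lin_expr) : Prop :=
  if n is n'.+1 then lin_coef e1 n' = lin_coef e2 n' /\ lin_same n' e1 e2
  else True.

Lemma lin_same_eval env e1 e2 : lin_same (size env) e1 e2 ->
  lin_eval env e1 = lin_eval env e2.
Proof.
move=> h; rewrite !lin_evalE; apply: eq_bigr => i _; congr (_ *: _).
elim: (size env) h i => [|n IHn] /=; first by move=> _ [].
move=> [hn /IHn h] [i /=]; rewrite ltnS leq_eqVlt => /orP[/eqP -> //|ni].
exact: h (Ordinal ni).
Qed.

End LinearExpressions.

Ltac lin_index x env :=
  match env with
  | cons x _ => constr:(0%N)
  | cons _ ?env' => let i := lin_index x env' in constr:(S i)
  end.

Ltac lin_vars env t :=
  match t with
  | GRing.add ?u ?v => let env := lin_vars env u in lin_vars env v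
  | GRing.opp ?u => lin_vars env u
  | GRing.scale ?c ?u => lin_vars env u
  | GRing.zero => env
  | 0%R => env
  | _ => match env with
         | context[cons t _] => env
         | _ => constr:(cons t env)
         end
  end.

Ltac lin_reify R env t :=
  match t with
  | GRing.add ?u ?v => let a := lin_reify R env u in let b := lin_reify R env v in
                       constr:(@LinAdd R a b)
  | GRing.opp ?u => let a := lin_reify R env u in constr:(@LinOpp R a)
  | GRing.scale ?c ?u => let a := lin_reify R env u in constr:(@LinScale R c a)
  | 0%R => constr:(@LinZero R)
  | _ => let i := lin_index t env in constr:(@LinVar R i)
  end.

(** Reduces an equality between two linear combinations in a module to the
    equalities between the coefficients of each vector. *)
Ltac lin_coefs R :=
  match goal with
  | |- @eq ?E ?u ?v =>
    let env := lin_vars (@nil E) u in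
    let env := lin_vars env v in
    let a := lin_reify R env u in
    let b := lin_reify R env v in
    change (lin_eval env a = lin_eval env b);
    apply: lin_same_eval; rewrite /=; do ?split
  end.

Ltac lin R := lin_coefs R; try by (ring || field).

(** * Semi-inner products and the Riesz representation *)

Section SemiInnerProduct.
Context {R : realType} {E : lmodType R}.
Implicit Types (S : set E) (b : E -> E -> R) (x y z : E).

(** The carrier is a set of vectors, and the form may vanish on nonzero vectors of
    it, because functions that differ on a null set remain distinct here. *)
Record semi_inner S b : Prop := SemiInner {
  si0 : S 0;
  siD : forall x y, S x -> S y -> S (x + y);
  siZ : forall c x, S x -> S (c *: x);
  siC : forall x y, S x -> S y -> b x y = b y x;
  siDl : forall x y z, S x -> S y -> S z -> b (x + y) z = b x z + b y z;
  siZl : forall c x y, S x -> S y -> b (c *: x) y = c * b x y;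
  si_ge0 : forall x, S x -> 0 <= b x x }.

Definition snorm b x : R := Num.sqrt (b x x).

Definition scauchy b (u : nat -> E) := forall e, 0 < e ->
  exists n0, forall m n, (n0 <= m)%N -> (n0 <= n)%N -> snorm b (u m - u n) < e.

Definition stends b (u : nat -> E) x := forall e, 0 < e ->
  exists n0, forall n, (n0 <= n)%N -> snorm b (u n - x) < e.

Definition scomplete S b := forall u : nat -> E, (forall n, S (u n)) ->
  scauchy b u -> exists2 x, S x & stends b u x.

Variables (S : set E) (b : E -> E -> R).
Hypothesis hb : semi_inner S b.

Let S0 := si0 hb.
Let SD := siD hb.
Let SZ := siZ hb.

Lemma siN x : S x -> S (- x).
Proof. by move=> Sx; rewrite -scaleN1r; exact: SZ. Qed.

Lemma siB x y : S x -> S y -> S (x - y).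
Proof. by move=> Sx Sy; apply: SD => //; exact: siN. Qed.

Lemma siBl x y z : S x -> S y -> S z -> b (x - y) z = b x z - b y z.
Proof.
move=> Sx Sy Sz; rewrite (siDl hb)//; last exact: siN.
by rewrite -scaleN1r (siZl hb)// mulN1r.
Qed.

Lemma siDr x y z : S x -> S y -> S z -> b z (x + y) = b z x + b z y.
Proof. by move=> Sx Sy Sz; rewrite (siC hb) ?(siDl hb) ?(siC hb Sz)//; exact: SD. Qed.

Lemma siZr c x y : S x -> S y -> b y (c *: x) = c * b y x.
Proof. by move=> Sx Sy; rewrite (siC hb) ?(siZl hb) ?(siC hb Sy)//; exact: SZ. Qed.

Lemma si_line x y t : S x -> S y ->
  b (x + t *: y) (x + t *: y) = b x x + 2 * t * b x y + t ^+ 2 * b y y.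
Proof.
move=> Sx Sy; have Sty := SZ t Sy.
rewrite (siDl hb) ?siDr ?(siZl hb) ?siZr//; try exact: SD.
by rewrite (siC hb Sy Sx); ring.
Qed.

Lemma snorm_ge0 x : 0 <= snorm b x. Proof. exact: sqrtr_ge0. Qed.

Lemma snorm_sqr x : S x -> snorm b x ^+ 2 = b x x.
Proof. by move=> Sx; rewrite sqr_sqrtr// (si_ge0 hb). Qed.

Lemma snorm_le x c : S x -> 0 <= c -> (snorm b x <= c) = (b x x <= c ^+ 2).
Proof. by move=> Sx c0; rewrite -snorm_sqr// ler_sqr ?nnegrE ?snorm_ge0. Qed.

Lemma si_cs x y : S x -> S y -> `|b x y| <= snorm b x * snorm b y.
Proof.
move=> Sx Sy.
have H t := si_ge0 hb (SD Sx (SZ t Sy)).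
have {}H t : 0 <= b x x + 2 * t * b x y + t ^+ 2 * b y y by rewrite -si_line.
have hx := si_ge0 hb Sx; have hy := si_ge0 hb Sy.
rewrite /snorm -sqrtrM// -sqrtr_sqr; apply: ler_wsqrtr.
have [y0|y0] := eqVneq (b y y) 0.
  rewrite y0 mulr0; suff -> : b x y = 0 by rewrite expr0n.
  have [//|xy0] := eqVneq (b x y) 0.
  have := H (- (b x x + 1) / (2 * b x y)); rewrite y0.
  have -> : 2 * (- (b x x + 1) / (2 * b x y)) * b x y = - (b x x + 1) by field.
  by rewrite mulr0 addr0; lra.
have y1 : 0 < b y y by rewrite lt_neqAle eq_sym y0.
have := H (- b x y / b y y).
have -> : b x x + 2 * (- b x y / b y y) * b x y + (- b x y / b y y) ^+ 2 * b y y
  = (b x x * b y y - b x y ^+ 2) / b y y by field.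
by rewrite pmulr_lge0 ?invr_gt0// subr_ge0.
Qed.

Lemma snormZ c x : S x -> snorm b (c *: x) = `|c| * snorm b x.
Proof.
move=> Sx; rewrite /snorm (siZl hb) ?siZr//; last exact: SZ.
by rewrite mulrA -expr2 sqrtrM ?sqr_ge0// sqrtr_sqr.
Qed.

Lemma snormN x : S x -> snorm b (- x) = snorm b x.
Proof. by move=> Sx; rewrite -scaleN1r snormZ// normrN1 mul1r. Qed.

Lemma snorm0 : snorm b 0 = 0.
Proof. by have := snormZ 0 S0; rewrite scale0r normr0 mul0r. Qed.

Lemma snormD x y : S x -> S y -> snorm b (x + y) <= snorm b x + snorm b y.
Proof.
move=> Sx Sy; rewrite -ler_sqr ?nnegrE ?addr_ge0 ?snorm_ge0//.
have := si_line 1 Sx Sy; rewrite scale1r snorm_sqr; last exact: SD.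
move=> ->; rewrite sqrrD !snorm_sqr//.
have := le_trans (ler_norm _) (si_cs Sx Sy); rewrite mulr2n; lra.
Qed.

Lemma snormBC x y : S x -> S y -> snorm b (x - y) = snorm b (y - x).
Proof. by move=> Sx Sy; rewrite -opprB snormN//; exact: siB. Qed.

Lemma snormB x y z : S x -> S y -> S z ->
  snorm b (x - z) <= snorm b (x - y) + snorm b (y - z).
Proof.
move=> Sx Sy Sz; have -> : x - z = (x - y) + (y - z) by rewrite addrA subrK.
by apply: snormD; exact: siB.
Qed.

Lemma snormB_le x y : S x -> S y -> snorm b x <= snorm b y + snorm b (x - y).
Proof.
move=> Sx Sy; rewrite -{1}(subrK y x) addrC; apply: snormD => //; exact: siB.
Qed.

Lemma si_eq x y k : S x -> S y -> S k -> snorm b (x - y) = 0 -> b x k = b y k.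
Proof.
move=> Sx Sy Sk e; apply/eqP; rewrite -subr_eq0 -(siBl Sx Sy Sk) -normr_eq0.
by rewrite eq_le normr_ge0 andbT -(mul0r (snorm b k)) -e; exact: (si_cs (siB Sx Sy) Sk).
Qed.

Lemma si_close k x y e : S k -> S x -> S y -> snorm b (x - y) < e ->
  `|b k x - b k y| <= e * snorm b k.
Proof.
move=> Sk Sx Sy d; rewrite !(siC hb Sk)// -(siBl Sx Sy Sk) mulrC.
rewrite (siC hb (siB Sx Sy) Sk); apply: le_trans (si_cs Sk (siB Sx Sy)) _.
by apply: ler_wpM2l; [exact: snorm_ge0|exact: ltW].
Qed.

(** The representing vector minimises b x x - 2 l x; by the parallelogram identity
    a minimising sequence is a Cauchy sequence. *)
Lemma riesz (l : E -> R) (C : R) : scomplete S b ->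
  (forall x y, S x -> S y -> l (x + y) = l x + l y) ->
  (forall c x, S x -> l (c *: x) = c * l x) ->
  (forall x, S x -> `|l x| <= C * snorm b x) ->
  exists2 v, S v & forall x, S x -> b v x = l x.
Proof.
move=> Sc lD lZ lC.
pose J x := b x x - 2 * l x.
have Jge x : S x -> - C ^+ 2 <= J x.
  move=> Sx; rewrite /J -snorm_sqr//.
  have := le_trans (ler_norm _) (lC _ Sx).
  by have := sqr_ge0 (snorm b x - C); rewrite sqrrB; nra.
have Jline x y t : S x -> S y ->
    J (x + t *: y) = J x + 2 * t * (b x y - l y) + t ^+ 2 * b y y.
  by move=> Sx Sy; rewrite /J si_line// lD ?lZ//; [ring|exact: SZ].
pose A := [set J x | x in S].
have Ainf : has_inf A.
  split; first by exists (J 0), 0.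
  by exists (- C ^+ 2) => _ [x Sx <-]; exact: Jge.
have mle x : S x -> inf A <= J x.
  by move=> Sx; apply: ge_inf; [case: Ainf|exists x].
have /choice[u uP] (n : nat) : exists x, S x /\ J x < inf A + n.+1%:R^-1.
  have [] := @inf_adherent _ A n.+1%:R^-1 _ Ainf; first by rewrite invr_gt0.
  by move=> _ [x Sx <-] h; exists x.
have Su n : S (u n) by case: (uP n).
have cu m n : b (u m - u n) (u m - u n) <= 2 * (m.+1%:R^-1 + n.+1%:R^-1).
  have h := mle _ (SD (Su n) (SZ 2^-1 (siB (Su m) (Su n)))).
  rewrite Jline// in h; last exact: siB.
  have e : J (u m) = J (u n + 1 *: (u m - u n)).
    by rewrite scale1r addrC subrK.
  rewrite Jline// in e; last exact: siB.
  have [_ hm] := uP m; have [_ hn] := uP n.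
  rewrite expr1n mul1r mulr1 in e; rewrite divff// mul1r in h.
  have e4 : (2^-1 : R) ^+ 2 = 4^-1 by field.
  rewrite e4 in h; move: h e hm hn; move: (m.+1%:R^-1) (n.+1%:R^-1) => p q; lra.
have invlt e : 0 < e -> exists n0, forall n, (n0 <= n)%N -> n.+1%:R^-1 < e :> R.
  move=> e0; exists (Num.truncn e^-1) => n ln.
  rewrite invf_plt ?posrE//.
  by apply: lt_le_trans (truncnS_gt _) _; rewrite ler_nat ltnS.
have [v Sv vP] : exists2 v, S v & stends b u v.
  apply: Sc => // e e0; have e20 : 0 < e ^+ 2 / 4 by rewrite divr_gt0 ?exprn_gt0.
  have [n0 n0P] := invlt _ e20.
  exists n0 => m n lm ln; rewrite -ltr_sqr ?nnegrE ?snorm_ge0 ?ltW//.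
  rewrite snorm_sqr; last exact: siB.
  apply: le_lt_trans (cu m n) _.
  by have := n0P _ lm; have := n0P _ ln;
    move: (m.+1%:R^-1) (n.+1%:R^-1) => p q; lra.
exists v => // x Sx.
have key t : 0 <= 2 * t * (b v x - l x) + t ^+ 2 * b x x.
  rewrite leNgt; apply/negP => e0.
  set e := (X in X < 0) in e0.
  pose d := (- e) / (2 * (1 + 2 * `|t| * snorm b x)).
  have nx := snorm_ge0 x.
  have de : d * (2 * (1 + 2 * `|t| * snorm b x)) = - e.
    by rewrite /d divfK// gt_eqF// mulr_gt0// ltr_pwDl// !mulr_ge0.
  have d0 : 0 < d by rewrite divr_gt0 ?oppr_gt0// mulr_gt0// ltr_pwDl// !mulr_ge0.
  clearbody d; have [n1 n1P] := invlt _ d0; have [n2 n2P] := vP _ d0.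
  pose n := maxn n1 n2.
  have h1 := n1P n (leq_maxl _ _); have h2 := n2P n (leq_maxr _ _).
  have h := mle _ (SD (Su n) (SZ t Sx)); rewrite Jline// in h.
  have [_ hn] := uP n; move: (n.+1%:R^-1) h1 hn => iv h1 hn.
  have : `|b (u n - v) x| <= d * snorm b x.
    apply: (le_trans (si_cs (siB (Su n) Sv) Sx)).
    by apply: ler_wpM2r => //; exact: ltW.
  have -> : b (u n - v) x = b (u n) x - b v x.
    by rewrite (siDl hb)//; [rewrite -scaleN1r (siZl hb)// mulN1r|exact: siN].
  move=> hd.
  have ht : 2 * t * (b (u n) x - b v x) <= 2 * `|t| * (d * snorm b x).
    apply: le_trans (ler_norm _) _; rewrite !normrM ger0_norm//.
    by apply: ler_wpM2l => //; exact: mulr_ge0.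
  set p := b (u n) x in h ht; set q := b v x in e e0 de ht.
  have : inf A < inf A + d + 2 * t * (p - l x) + t ^+ 2 * b x x by lra.
  have -> : inf A + d + 2 * t * (p - l x) + t ^+ 2 * b x x =
    inf A + d + 2 * t * (p - q) + e by rewrite /e; ring.
  move: ht; have -> : 2 * `|t| * (d * snorm b x) = - e / 2 - d.
    by rewrite -de; field.
  by lra.
apply/eqP; rewrite -subr_eq0; apply/eqP; set s := b v x - l x in key *.
have bx := si_ge0 hb Sx.
have [//|s0] := eqVneq s 0.
have := key (- s / (1 + b x x)).
have h1 : 1 + b x x != 0 by rewrite gt_eqF// ltr_pwDl.
have -> : 2 * (- s / (1 + b x x)) * s + (- s / (1 + b x x)) ^+ 2 * b x x =
  - (s ^+ 2 * (2 + b x x)) / (1 + b x x) ^+ 2 by field.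
rewrite mulNr oppr_ge0 pmulr_lle0 ?invr_gt0 ?exprn_gt0 ?ltr_pwDl//.
rewrite pmulr_lle0; last by lra.
by rewrite le_eqVlt ltNge sqr_ge0 orbF sqrf_eq0 (negbTE s0).
Qed.

End SemiInnerProduct.

(** * Dissipative generators and the implicit Euler scheme *)

Section Semigroup.
Context {R : realType} {E : lmodType R}.
Implicit Types (x y z : E).

(** The graph of an unbounded operator to which the theorem of Lumer and Phillips
    applies; it is closed under equality up to null vectors of b. *)
Record generator (S : set E) (b : E -> E -> R) (G : E -> E -> Prop) : Prop :=
Generator {
  gen_dom : forall x y, G x y -> S x /\ S y;
  gen_lin : forall c x y x' y', G x y -> G x' y' -> G (x + c *: x') (y + c *: y');
  gen_diss : forall x y, G x y -> b x y <= 0;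
  gen_range : forall h f, 0 < h -> S f ->
    exists x y, G x y /\ snorm b (x - h *: y - f) = 0;
  gen_closed : forall x y x' y', G x y -> S x' -> S y' ->
    snorm b (x - x') = 0 -> snorm b (y - y') = 0 -> G x' y' }.

Variables (S : set E) (b : E -> E -> R) (G : E -> E -> Prop).
Hypothesis hb : semi_inner S b.
Hypothesis Sc : scomplete S b.
Hypothesis hG : generator S b G.

Local Notation N := (snorm b).
Let S0 := si0 hb.
Let SD := siD hb.
Let SZ := siZ hb.
Let SB := siB hb.
Let GS1 x y (h : G x y) := (gen_dom hG h).1.
Let GS2 x y (h : G x y) := (gen_dom hG h).2.
Let N0 := snorm_ge0 b.

Lemma genB x y x' y' : G x y -> G x' y' -> G (x - x') (y - y').
Proof.
move=> h h'; have := gen_lin hG (-1) h h'; rewrite !scaleN1r.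
exact.
Qed.

Lemma genZ c x y : G x y -> G (c *: x) (c *: y).
Proof.
move=> h; have := gen_lin hG c (genB h h) h.
by rewrite !subrr !add0r.
Qed.

(** Dissipativity makes the resolvents contractions. *)
Lemma gen_contract x y h : 0 <= h -> G x y -> N x <= N (x - h *: y).
Proof.
move=> h0 g; rewrite -ler_sqr ?nnegrE//.
have [Sx Sy] := gen_dom hG g; rewrite !(snorm_sqr hb)//; last exact/SB/SZ.
rewrite -scaleNr (si_line hb)// sqrrN.
have := gen_diss hG g; have := si_ge0 hb Sy.
move: (b x y) (b y y) (b x x) => p q r q0 p0.
have : 0 <= h * - p by apply: mulr_ge0 => //; lra.
by have := mulr_ge0 (sqr_ge0 h) q0; lra.
Qed.

(** The resolvent of G, that is, one step of the implicit Euler scheme of size h. *)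
Definition euler (h : R) (f : E) : E := xget 0 [set x | G x (h^-1 *: (x - f))].

Lemma euler_gen h f : 0 < h -> S f -> G (euler h f) (h^-1 *: (euler h f - f)).
Proof.
move=> h0 Sf; rewrite /euler; case: xgetP => [x _ //|].
have hn0 : h != 0 by rewrite gt_eqF.
have [x [y [g e]]] := gen_range hG h0 Sf.
have [Sx Sy] := gen_dom hG g.
move=> /(_ x) []; apply: (gen_closed hG g) => //; first exact/SZ/SB.
  by rewrite subrr (snorm0 hb).
have -> : y - h^-1 *: (x - f) = - h^-1 *: (x - h *: y - f) by lin R.
by rewrite (snormZ hb) ?e ?mulr0//; do !apply: SB => //; exact: SZ.
Qed.

Lemma euler_S h f : 0 < h -> S f -> S (euler h f).
Proof. by move=> h0 /(euler_gen h0) /GS1. Qed.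

(** All the estimates on the Euler scheme come from this comparison with an
    arbitrary point of the graph. *)
Lemma euler_dist h f p y : 0 < h -> S f -> G p y ->
  N (euler h f - p) <= N (f - (p - h *: y)).
Proof.
move=> h0 Sf g; have hn0 : h != 0 by rewrite gt_eqF.
apply: le_trans (gen_contract (ltW h0) (genB (euler_gen h0 Sf) g)) _.
rewrite le_eqVlt; apply/orP; left; apply/eqP; congr (N _); lin R.
Qed.

Lemma euler_contract h f g : 0 < h -> S f -> S g ->
  N (euler h f - euler h g) <= N (f - g).
Proof.
move=> h0 Sf Sg; have hn0 : h != 0 by rewrite gt_eqF.
apply: le_trans (euler_dist h0 Sf (euler_gen h0 Sg)) _.
rewrite le_eqVlt; apply/orP; left; apply/eqP; congr (N _); lin R.
Qed.

Lemma euler_le h f : 0 < h -> S f -> N (euler h f) <= N f.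
Proof.
move=> h0 Sf; have g00 : G 0 0 by have := genZ 0 (euler_gen h0 Sf); rewrite !scale0r.
by have := euler_dist h0 Sf g00; rewrite scaler0 !subr0.
Qed.

Lemma euler_comm h x y : 0 < h -> G x y -> G (euler h x) (euler h y).
Proof.
move=> h0 g; have hn0 : h != 0 by rewrite gt_eqF.
have [Sx Sy] := gen_dom hG g.
have gx := euler_gen h0 Sx.
set z := h^-1 *: (euler h x - x) in gx.
have Sz := GS2 gx.
apply: (gen_closed hG gx); [exact: euler_S|exact: euler_S|by rewrite subrr (snorm0 hb)|].
have gz : G z (h^-1 *: (z - y)) by exact: genZ (genB gx g).
apply/eqP; rewrite eq_le N0 andbT (snormBC hb)//; last exact: euler_S.
apply: le_trans (euler_dist h0 Sy gz) _.
have -> : y - (z - h *: (h^-1 *: (z - y))) = 0 by lin R.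
by rewrite (snorm0 hb).
Qed.

Lemma euler_step h x y : 0 < h -> G x y -> N (euler h x - x) <= h * N y.
Proof.
move=> h0 g; have [Sx Sy] := gen_dom hG g.
apply: le_trans (euler_dist h0 Sx g) _.
by rewrite opprB addrC subrK (snormZ hb)// gtr0_norm.
Qed.

Lemma iter_euler_S h n x : 0 < h -> S x -> S (iter n (euler h) x).
Proof. by move=> h0 Sx; elim: n => //= n IHn; exact: euler_S. Qed.

Lemma iter_euler_comm h n x y : 0 < h -> G x y ->
  G (iter n (euler h) x) (iter n (euler h) y).
Proof. by move=> h0 g; elim: n => //= n IHn; exact: euler_comm. Qed.

Lemma iter_euler_contract h n f g : 0 < h -> S f -> S g ->
  N (iter n (euler h) f - iter n (euler h) g) <= N (f - g).
Proof.
move=> h0 Sf Sg; elim: n => //= n IHn; apply: le_trans IHn.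
by apply: euler_contract => //; exact: iter_euler_S.
Qed.

Lemma iter_euler_le h n f : 0 < h -> S f -> N (iter n (euler h) f) <= N f.
Proof.
move=> h0 Sf; elim: n => //= n IHn; apply: le_trans IHn.
by apply: euler_le => //; exact: iter_euler_S.
Qed.

Lemma iter_euler_step h n x y : 0 < h -> G x y ->
  N (iter n (euler h) x - x) <= n%:R * h * N y.
Proof.
move=> h0 g; have [Sx Sy] := gen_dom hG g.
elim: n => [|n IHn]; first by rewrite /= subrr (snorm0 hb) !mul0r.
have Sn := iter_euler_S n h0 Sx.
apply: le_trans (snormB hb (euler_S h0 Sn) Sn Sx) _.
rewrite -[n.+1]addn1 natrD !mulrDl addrC mul1r; apply: lerD => //.
apply: le_trans (euler_step h0 (iter_euler_comm n h0 g)) _.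
by apply: ler_wpM2l; [exact: ltW|exact: iter_euler_le].
Qed.

(** Halving the step changes one step of the scheme by O(h ^+ 2) on the domain
    of the square of the generator. *)
Lemma euler_half k x y z : 0 < k -> G x y -> G y z ->
  N (euler (2 * k) x - euler k (euler k x)) <= k ^+ 2 * N z.
Proof.
move=> k0 g1 g2; have kn0 : k != 0 by rewrite gt_eqF.
have k20 : 0 < 2 * k by rewrite mulr_gt0.
have [[Sx Sy] Sz] := (gen_dom hG g1, GS2 g2).
set p := euler k x; set q := euler k p.
have Sp : S p by exact: euler_S.
have gq := euler_gen k0 Sp; have gp := euler_gen k0 Sx; rewrite -/p -/q in gq gp.
apply: le_trans (euler_dist k20 Sx gq) _.
have e : x - (q - 2 * k *: (k^-1 *: (q - p))) =
   - (2 *: p - q - x) by lin R.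
rewrite e (snormN hb); last exact: SB (SB (SZ _ Sp) (GS1 gq)) Sx.
have Sq := GS1 gq.
(* both difference quotients belong to the domain, and their difference is
   k times the image by the generator of the second one *)
pose dp := k^-1 *: (p - x); pose dq := k^-1 *: (q - p).
have gdq : G dq (k^-1 *: (dq - dp)) by apply: genZ; exact: genB gq gp.
have -> : 2 *: p - q - x = - k ^+ 2 *: (k^-1 *: (dq - dp)).
  rewrite /dq /dp; lin R.
rewrite (snormZ hb); last exact: GS2 gdq.
rewrite normrN normrX gtr0_norm//; apply: ler_wpM2l; first exact: sqr_ge0.
pose e1 := k^-1 *: (dp - y); pose e2 := k^-1 *: (dq - dp).
have g1' : G dp e1 by apply: genZ; exact: genB gp g1.
have ge1 : G e1 (k^-1 *: (e1 - z)) by apply: genZ; exact: genB g1' g2.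
have ge2 : G e2 (k^-1 *: (e2 - e1)) by apply: genZ; exact: genB gdq g1'.
rewrite -/e2; apply: (@le_trans _ _ (N e1)).
  apply: le_trans (gen_contract (ltW k0) ge2) _.
  rewrite le_eqVlt; apply/orP; left; apply/eqP; congr (N _); lin R.
apply: le_trans (gen_contract (ltW k0) ge1) _.
rewrite le_eqVlt; apply/orP; left; apply/eqP; congr (N _); lin R.
Qed.

Lemma iter_euler_half k n x y z : 0 < k -> G x y -> G y z ->
  N (iter n (euler (2 * k)) x - iter (n.*2) (euler k) x) <= n%:R * k ^+ 2 * N z.
Proof.
move=> k0 g1 g2; have k20 : 0 < 2 * k by rewrite mulr_gt0.
have [[Sx Sy] Sz] := (gen_dom hG g1, GS2 g2).
elim: n => [|n IHn]; first by rewrite /= subrr (snorm0 hb) !mul0r.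
rewrite doubleS /=; set p := iter n _ x in IHn *; set q := iter _ (euler k) x in IHn *.
have Sp : S p by exact: iter_euler_S.
have Sq : S q by exact: iter_euler_S.
have S2 := euler_S k20 Sq.
apply: le_trans (snormB hb (euler_S k20 Sp) S2 (euler_S k0 (euler_S k0 Sq))) _.
rewrite -(natr1 n) [_ * k ^+ 2]mulrDl mulrDl mul1r; apply: lerD.
  by apply: le_trans IHn; exact: euler_contract.
apply: le_trans (euler_half k0 (iter_euler_comm _ k0 g1) (iter_euler_comm _ k0 g2)) _.
by apply: ler_wpM2l; [exact: sqr_ge0|exact: iter_euler_le].
Qed.

(** Second-order accuracy of the scheme at the origin. *)
Lemma iter_euler_taylor h n x y z : 0 < h -> G x y -> G y z ->
  N (iter n (euler h) x - x - (n%:R * h) *: y) <= (n%:R * h) ^+ 2 * N z.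
Proof.
move=> h0 g1 g2; have hn0 : h != 0 by rewrite gt_eqF.
have [[Sx Sy] Sz] := (gen_dom hG g1, GS2 g2).
elim: n => [|n IHn].
  by rewrite /= subrr mul0r scale0r subr0 (snorm0 hb) expr0n mul0r.
set u := iter n (euler h) x in IHn *; rewrite /= -/u.
have Su : S u by exact: iter_euler_S.
have gu : G u (iter n (euler h) y) by exact: iter_euler_comm.
have gd : G (euler h u) (h^-1 *: (euler h u - u)) by exact: euler_gen.
set w := iter n.+1 (euler h) y.
have gw : G (euler h u) w by exact: euler_comm.
have Sw := GS2 gw.
have dw : N (h^-1 *: (euler h u - u) - w) = 0.
  apply/eqP; rewrite eq_le N0 andbT (snormBC hb)//; last exact: GS2 gd.
  have gz : G (h^-1 *: (euler h u - u))
      (h^-1 *: (h^-1 *: (euler h u - u) - iter n (euler h) y)).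
    by apply: genZ; exact: genB gd gu.
  apply: le_trans (euler_dist h0 (GS2 gu) gz) _.
  rewrite (_ : _ - _ = 0) ?(snorm0 hb)//; lin R.
have SA : S (u - x - (n%:R * h) *: y) by exact: SB (SB Su Sx) (SZ _ Sy).
have -> : euler h u - x - (n.+1%:R * h) *: y = (u - x - (n%:R * h) *: y) +
    h *: ((h^-1 *: (euler h u - u) - w) + (w - y)) by rewrite -(natr1 n); lin R.
have SD1 : S (h^-1 *: (euler h u - u) - w) by exact: SB (GS2 gd) Sw.
apply: le_trans (snormD hb SA (SZ h (SD SD1 (SB Sw Sy)))) _.
rewrite (snormZ hb) ?gtr0_norm//; last exact: SD SD1 (SB Sw Sy).
have := snormD hb SD1 (SB Sw Sy); rewrite dw add0r => le1.
have := iter_euler_step n.+1 h0 g2; rewrite -/w => le2.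
have {le1 le2} le3 := ler_wpM2l (ltW h0) (le_trans le1 le2).
apply: le_trans (lerD IHn le3) _; rewrite -(natr1 n).
move: (N0 z) (ler0n R n); move: (N z) (n%:R) => c m c0 m0.
have -> : (m * h) ^+ 2 * c + h * ((m + 1) * h * c) = (m ^+ 2 + m + 1) * (h ^+ 2 * c) by ring.
have -> : ((m + 1) * h) ^+ 2 * c = (m + 1) ^+ 2 * (h ^+ 2 * c) by ring.
by apply: ler_wpM2r; [rewrite mulr_ge0 ?sqr_ge0|lra].
Qed.

End Semigroup.

(** * Convergence of the scheme to a semigroup *)

Section SemigroupLimit.
Context {R : realType} {E : lmodType R}.
Implicit Types (x y z : E).
Variables (S : set E) (b : E -> E -> R) (G : E -> E -> Prop).
Hypothesis hb : semi_inner S b.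
Hypothesis Sc : scomplete S b.
Hypothesis hG : generator S b G.

Local Notation N := (snorm b).
Let S0 := si0 hb.
Let SD := siD hb.
Let SZ := siZ hb.
Let SB := siB hb.
Let GS1 x y (h : G x y) := (gen_dom hG h).1.
Let GS2 x y (h : G x y) := (gen_dom hG h).2.
Let N0 := snorm_ge0 b.

Lemma stendsD u v x y : (forall n, S (u n)) -> (forall n, S (v n)) -> S x -> S y ->
  stends b u x -> stends b v y -> stends b (fun n => u n + v n) (x + y).
Proof.
move=> Su Sv Sx Sy hu hv e e0; have e20 : 0 < e / 2 by rewrite divr_gt0.
have [n1 h1] := hu _ e20; have [n2 h2] := hv _ e20.
exists (maxn n1 n2) => n; rewrite geq_max => /andP[/h1 {}h1 /h2 {}h2].
have -> : u n + v n - (x + y) = (u n - x) + (v n - y) by lin R.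
apply: le_lt_trans (snormD hb (SB (Su n) Sx) (SB (Sv n) Sy)) _; lra.
Qed.

Lemma stendsZ c u x : (forall n, S (u n)) -> S x ->
  stends b u x -> stends b (fun n => c *: u n) (c *: x).
Proof.
move=> Su Sx hu e e0; have c0 : 0 < `|c| + 1 by rewrite ltr_wpDl.
have [n0 h] := hu _ (divr_gt0 e0 c0); exists n0 => n /h {}h.
rewrite -scalerBr (snormZ hb); last exact: SB.
move: h; rewrite ltr_pdivlMr// => h; have := N0 (u n - x); lra.
Qed.

Lemma stendsB u v x y : (forall n, S (u n)) -> (forall n, S (v n)) -> S x -> S y ->
  stends b u x -> stends b v y -> stends b (fun n => u n - v n) (x - y).
Proof.
move=> Su Sv Sx Sy hu hv.
have := stendsZ (-1) Sv Sy hv; rewrite scaleN1r.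
under [X in stends _ X _]eq_fun do rewrite scaleN1r.
by apply: stendsD => //; [move=> n|]; exact: (siN hb).
Qed.

Lemma stends_le u x c : (forall n, S (u n)) -> S x -> stends b u x ->
  (forall e, 0 < e -> exists n0, forall n, (n0 <= n)%N -> N (u n) <= c + e) ->
  N x <= c.
Proof.
move=> Su Sx hu hc; rewrite leNgt; apply/negP => cN.
have d0 : 0 < (N x - c) / 2 by rewrite divr_gt0// subr_gt0.
have [n1 h1] := hu _ d0; have [n2 h2] := hc _ d0.
have := h1 _ (leq_maxl n1 n2); have := h2 _ (leq_maxr n1 n2).
set n := maxn _ _; have := snormB_le hb Sx (Su n).
by rewrite (snormBC hb)//; lra.
Qed.

Lemma gen_graph_closed u v x y : S x -> S y -> (forall n, G (u n) (v n)) ->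
  stends b u x -> stends b v y -> G x y.
Proof.
move=> Sx Sy g hu hv.
have Su n := GS1 (g n); have Sv n := GS2 (g n).
have gp := euler_gen hb hG ltr01 (SB Sx Sy).
set p := euler G 1 (x - y) in gp; rewrite invr1 scale1r in gp.
have Sp := GS1 gp.
have px : N (p - x) = 0.
  apply/eqP; rewrite eq_le N0 andbT.
  apply: (@stends_le (fun n => p - u n)) => //; try by [exact: SB|move=> n; exact: SB].
    by apply: stendsB => // e e0; exists 0%N => n _; rewrite subrr (snorm0 hb).
  move=> e e0; have [n0 h] := stendsB Su Sv Sx Sy hu hv e0; exists n0 => n /h {}h.
  rewrite add0r; apply/ltW; apply: le_lt_trans (euler_dist hb hG ltr01 (SB Sx Sy) (g n)) _.
  by rewrite scale1r (snormBC hb)//; exact: SB.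
apply: (gen_closed hG gp) => //.
have -> : p - (x - y) - y = p - x by lin R.
exact: px.
Qed.

(** The closure of the domain of the square of G, on which the scheme converges. *)
Definition approachable x := S x /\ forall e, 0 < e ->
  exists x' y' z', [/\ G x' y', G y' z' & N (x - x') < e].

Lemma dom_approachable x y : G x y -> approachable x.
Proof.
move=> g; split=> [|e e0]; first exact: GS1 g.
have y0 : 0 < N y + 1 by rewrite ltr_wpDl.
pose h := e / (N y + 1); have h0 : 0 < h by rewrite divr_gt0.
exists (euler G h x), (euler G h y), (h^-1 *: (euler G h y - y)).
split; [exact: (euler_comm hb hG)|exact: (euler_gen hb hG h0 (GS2 g))|].
rewrite (snormBC hb); [|exact: GS1 g|exact: (euler_S hb hG h0 (GS1 g))].
apply: le_lt_trans (euler_step hb hG h0 g) _.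
by rewrite /h mulrAC -mulrA gtr_pMr// ltr_pdivrMr// mul1r ltrDl.
Qed.

Definition dyadic m : R := (2 ^+ m)^-1.
Definition dstep m (t : R) : nat := Num.truncn (t * 2 ^+ m).
Definition scheme m x (t : R) := iter (dstep m t) (euler G (dyadic m)) x.

Lemma dyadic_gt0 m : 0 < dyadic m.
Proof. by rewrite invr_gt0 exprn_gt0. Qed.

Lemma dyadicS m : dyadic m = 2 * dyadic m.+1.
Proof. by rewrite /dyadic exprS; field; rewrite expf_neq0. Qed.

Lemma dyadic_lt e : 0 < e -> exists n0, forall n, (n0 <= n)%N -> dyadic n < e.
Proof.
move=> e0; exists (Num.truncn e^-1) => n ln.
rewrite invf_plt ?posrE ?exprn_gt0//.
apply: lt_le_trans (truncnS_gt _) _; rewrite -natrX ler_nat.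
by apply: leq_ltn_trans ln _; exact: ltn_expl.
Qed.

Lemma dstep_le m t : 0 <= t -> (dstep m t)%:R * dyadic m <= t.
Proof.
move=> t0; rewrite ler_pdivrMr ?exprn_gt0// truncn_le mulr_ge0//.
Qed.

Lemma dstep_gt m t : t < (dstep m t)%:R * dyadic m + dyadic m.
Proof.
rewrite -{2}[dyadic m]mul1r -mulrDl natr1 ltr_pdivlMr ?exprn_gt0//.
exact: truncnS_gt.
Qed.

Lemma dstepS m t : 0 <= t ->
  dstep m.+1 t = (dstep m t).*2 \/ dstep m.+1 t = (dstep m t).*2.+1.
Proof.
move=> t0; have h1 := dstep_le m t0; have h2 := dstep_gt m t.
have h3 := dstep_le m.+1 t0; have h4 := dstep_gt m.+1 t.
have d0 := dyadic_gt0 m.+1; rewrite !(dyadicS m) in h1 h2.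
suff : ((dstep m t).*2 <= dstep m.+1 t < (dstep m t).*2.+2)%N by lia.
move: (dstep m t) (dstep m.+1 t) (dyadic _) d0 h1 h2 h3 h4 => n n' d d0 h1 h2 h3 h4.
rewrite -ltnS; apply/andP; split; rewrite -(ltr_nat R).
  by rewrite -(ltr_pM2r d0) -[n'.+1]addn1 natrD -mul2n natrM; lra.
by rewrite -(ltr_pM2r d0) -[n.*2.+2]addn2 natrD -mul2n natrM; lra.
Qed.

Lemma dstep_mono m s t : 0 <= s -> s <= t -> (dstep m s <= dstep m t)%N.
Proof.
move=> s0 st; by apply: le_truncn; rewrite ler_wpM2r// exprn_ge0.
Qed.


Lemma scheme_S m x t : S x -> S (scheme m x t).
Proof. exact: (iter_euler_S hb hG _ (dyadic_gt0 m)). Qed.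

Lemma scheme_gen m x y t : G x y -> G (scheme m x t) (scheme m y t).
Proof. exact: (iter_euler_comm hb hG _ (dyadic_gt0 m)). Qed.

Lemma scheme_le m x t : S x -> N (scheme m x t) <= N x.
Proof. exact: (iter_euler_le hb hG _ (dyadic_gt0 m)). Qed.

Lemma scheme_contract m x x' t : S x -> S x' ->
  N (scheme m x t - scheme m x' t) <= N (x - x').
Proof. exact: (iter_euler_contract hb hG _ (dyadic_gt0 m)). Qed.

(** Passing from one dyadic level to the next halves every step, and adds at most
    one step of the finer size. *)
Lemma scheme_step m x y z t : 0 <= t -> G x y -> G y z ->
  N (scheme m x t - scheme m.+1 x t) <= dyadic m * (t * N z + N y).
Proof.
move=> t0 g1 g2; have [[Sx Sy] Sz] := (gen_dom hG g1, GS2 g2).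
have k0 := dyadic_gt0 m.+1; have h1 := dstep_le m t0.
rewrite /scheme !(dyadicS m) in h1 *; set k := dyadic m.+1 in k0 h1 *.
set n := dstep m t in h1 *.
have H : N (iter n (euler G (2 * k)) x - iter n.*2 (euler G k) x) <= k * (t * N z).
  apply: le_trans (iter_euler_half hb hG n k0 g1 g2) _.
  rewrite [k * (_ * _)]mulrA; apply: ler_wpM2r; first exact: N0.
  move: (ler0n R n) h1; move: (n%:R) => p p0 h1; nra.
have NN1 : 0 <= k * N y by apply: mulr_ge0 => //; exact: ltW.
have NN2 : 0 <= k * (t * N z) by apply: mulr_ge0; [exact: ltW|exact: mulr_ge0].
have [->|->] := dstepS m t0; rewrite -/n.
  by apply: le_trans H _; lra.
have k20 : 0 < 2 * k by lra.
apply: le_trans (snormB hb (iter_euler_S hb hG n k20 Sx)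
  (iter_euler_S hb hG n.*2 k0 Sx) (iter_euler_S hb hG n.*2.+1 k0 Sx)) _.
have : N (iter n.*2 (euler G k) x - iter n.*2.+1 (euler G k) x) <= k * N y.
  rewrite (snormBC hb); try exact: (iter_euler_S hb hG _ k0 Sx).
  apply: le_trans (euler_step hb hG k0 (iter_euler_comm hb hG n.*2 k0 g1)) _.
  by apply: ler_wpM2l; [exact: ltW|exact: (iter_euler_le hb hG _ k0 Sy)].
by lra.
Qed.

Lemma scheme_diff m j x y z t : 0 <= t -> G x y -> G y z ->
  N (scheme m x t - scheme (m + j) x t) <=
    2 * (dyadic m - dyadic (m + j)) * (t * N z + N y).
Proof.
move=> t0 g1 g2; have Sx := GS1 g1.
elim: j => [|j IHj]; first by rewrite addn0 !subrr (snorm0 hb) mulr0 mul0r.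
apply: le_trans (snormB hb (scheme_S m t Sx) (scheme_S (m + j) t Sx)
  (scheme_S _ t Sx)) _.
rewrite addnS; have := scheme_step (m + j) t0 g1 g2.
by move: IHj; rewrite !(dyadicS (m + j)); lra.
Qed.

(** On the domain of the square of G the differences between levels form a
    geometric sum; contractivity extends the convergence to its closure. *)
Lemma scheme_cauchy x B e : approachable x -> 0 < e -> exists M,
  forall m m' t, (M <= m)%N -> (M <= m')%N -> 0 <= t <= B ->
    N (scheme m x t - scheme m' x t) < e.
Proof.
move=> [Sx ax] e0; have e40 : 0 < e / 4 by rewrite divr_gt0.
have [x' [y' [z' [g1 g2 xx']]]] := ax _ e40.
have Sx' := GS1 g1.
pose C := `|B| * N z' + N y' + 1.
have C0 : 0 < C by rewrite ltr_wpDl// addr_ge0// mulr_ge0.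
have [M hM] := dyadic_lt (divr_gt0 e0 (mulr_gt0 (ltr0n _ 4) C0)).
exists M => m m' t.
wlog mm' : m m' / (m <= m')%N.
  move=> H Mm Mm' tB; have [mm'|/ltnW mm'] := leqP m m'; first exact: H.
  by rewrite (snormBC hb); [exact: H|exact: scheme_S|exact: scheme_S].
move=> Mm _ /andP[t0 tB].
have S1 m1 : S (scheme m1 x t) by exact: scheme_S.
have S2 m1 : S (scheme m1 x' t) by exact: scheme_S.
apply: le_lt_trans (snormB hb (S1 m) (S2 m) (S1 m')) _.
have := snormB hb (S2 m) (S2 m') (S1 m').
have := scheme_contract m t Sx Sx'; have := scheme_contract m' t Sx' Sx.
rewrite (snormBC hb Sx' Sx).
have := scheme_diff m (m' - m) t0 g1 g2; rewrite subnKC//.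
have := hM _ Mm; rewrite ltr_pdivlMr ?mulr_gt0//.
have d1 := dyadic_gt0 m'; have d2 := dyadic_gt0 m.
have tC : t * N z' + N y' <= C.
  rewrite /C -addrA; apply: lerD; last by rewrite lerDl.
  by apply: ler_wpM2r => //; apply: le_trans tB _; exact: ler_norm.
have tC0 : 0 <= t * N z' + N y' by rewrite addr_ge0// mulr_ge0.
have : 2 * (dyadic m - dyadic m') * (t * N z' + N y') <= 2 * dyadic m * C.
  apply: ler_pM => //; last by lra.
  by rewrite mulr_ge0// subr_ge0 /dyadic lef_pV2 ?posrE ?exprn_gt0// ler_weXn2l// ler1n.
by lra.
Qed.

Definition flow x t := xget 0 [set p | S p /\ stends b (fun m => scheme m x t) p].

Lemma flowP x t : approachable x -> 0 <= t ->
  S (flow x t) /\ stends b (fun m => scheme m x t) (flow x t).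
Proof.
move=> ax t0; rewrite /flow; case: xgetP => [p _ //|].
have [|p Sp hp] := Sc (fun m => scheme_S m t ax.1).
  move=> e e0; have [M hM] := scheme_cauchy t ax e0.
  by exists M => m n *; apply: hM => //; rewrite t0 lexx.
by move=> /(_ p) [].
Qed.

Lemma flow_S x t : approachable x -> 0 <= t -> S (flow x t).
Proof. by move=> ax t0; case: (flowP ax t0). Qed.

(** The resolvents commute with G, whose graph is closed. *)
Lemma flow_gen x y t : G x y -> approachable y -> 0 <= t -> G (flow x t) (flow y t).
Proof.
move=> g ay t0; have ax := dom_approachable g.
apply: (@gen_graph_closed (fun m => scheme m x t) (fun m => scheme m y t)).
- exact: flow_S.
- exact: flow_S.
- by move=> m; exact: scheme_gen.
- by case: (flowP ax t0).
- by case: (flowP ay t0).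
Qed.

Lemma flow0 x : approachable x -> N (flow x 0 - x) = 0.
Proof.
move=> ax; apply/eqP; rewrite eq_le N0 andbT.
have [Sf hf] := flowP ax (lexx 0).
have Sx := ax.1.
apply: (@stends_le (fun m => scheme m x 0 - x)).
- by move=> m; exact: SB (scheme_S _ _ _) _.
- exact: SB.
- apply: stendsB => //; first by move=> m; exact: scheme_S.
  by move=> e e0; exists 0%N => n _; rewrite subrr (snorm0 hb).
- move=> e e0; exists 0%N => n _.
  by rewrite /scheme /dstep mul0r truncn0 /= subrr (snorm0 hb) add0r ltW.
Qed.

Lemma flow_contract x x' t : approachable x -> approachable x' -> 0 <= t ->
  N (flow x t - flow x' t) <= N (x - x').
Proof.
move=> ax ax' t0; have [Sf hf] := flowP ax t0; have [Sf' hf'] := flowP ax' t0.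
have Sx := ax.1; have Sx' := ax'.1.
apply: (@stends_le (fun m => scheme m x t - scheme m x' t)).
- by move=> m; exact: SB (scheme_S _ _ _) (scheme_S _ _ _).
- exact: SB.
- by apply: stendsB => // m; exact: scheme_S.
- move=> e e0; exists 0%N => n _; apply: le_trans (scheme_contract _ _ _ _) _ => //.
  by rewrite lerDl ltW.
Qed.

(** Between two times the scheme performs a number of steps, starting from its
    current position, whose total length tends to the elapsed time. *)
Lemma scheme_iter m x s t : 0 <= s <= t ->
  scheme m x t = iter (dstep m t - dstep m s) (euler G (dyadic m)) (scheme m x s).
Proof.
by move=> /andP[s0 st]; rewrite /scheme -iterD subnK//; exact: dstep_mono.
Qed.

Lemma dstep_sub m s t : 0 <= s <= t ->
  `|(dstep m t - dstep m s)%:R * dyadic m - (t - s)| <= dyadic m.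
Proof.
move=> /andP[s0 st]; rewrite natrB; last exact: dstep_mono.
have := dstep_le m s0; have := dstep_le m (le_trans s0 st).
have := dstep_gt m s; have := dstep_gt m t; have := dyadic_gt0 m.
by rewrite ler_norml mulrBl; lra.
Qed.

Lemma flow_lip x y s t : G x y -> 0 <= s <= t ->
  N (flow x t - flow x s) <= (t - s) * N y.
Proof.
move=> g st; have [s0 st'] := andP st; have t0 := le_trans s0 st'.
have ax := dom_approachable g; have Sx := GS1 g.
have [Sf hf] := flowP ax t0; have [Sf' hf'] := flowP ax s0.
apply: (@stends_le (fun m => scheme m x t - scheme m x s)).
- by move=> m; exact: SB (scheme_S _ _ _) (scheme_S _ _ _).
- exact: SB.
- by apply: stendsB => // m; exact: scheme_S.
- move=> e e0; have y0 : 0 < N y + 1 by rewrite ltr_wpDl.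
  have [n0 hn] := dyadic_lt (divr_gt0 e0 y0); exists n0 => m /hn.
  rewrite ltr_pdivlMr// => hm.
  rewrite (scheme_iter m x st).
  apply: le_trans (iter_euler_step hb hG _ (dyadic_gt0 m) (scheme_gen m s g)) _.
  have := dstep_sub m st; rewrite ler_norml => /andP[_].
  have := scheme_le m s (GS2 g); have := dyadic_gt0 m; move: hm.
  have := ler0n R (dstep m t - dstep m s); move: (_%:R) => p p0 hm d0 hN hp.
  apply: (@le_trans _ _ ((t - s + dyadic m) * N y)); last by lra.
  by apply: ler_pM => //; [rewrite mulr_ge0// ltW|lra].
Qed.

(** The limit of the second-order estimate for the scheme restarted at time s. *)
Lemma flow_taylor x y z s t : G x y -> G y z -> 0 <= s <= t ->
  N (flow x t - flow x s - (t - s) *: flow y s) <= (t - s) ^+ 2 * N z.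
Proof.
move=> g1 g2 st; have [s0 st'] := andP st; have t0 := le_trans s0 st'.
have ax := dom_approachable g1; have ay := dom_approachable g2.
have Sx := GS1 g1; have Sy := GS1 g2.
have [Sf hf] := flowP ax t0; have [Sf' hf'] := flowP ax s0.
have [Sg hg] := flowP ay s0.
have S1 u m r : S u -> S (scheme m u r) by exact: scheme_S.
apply: (@stends_le (fun m => scheme m x t - scheme m x s - (t - s) *: scheme m y s)).
- by move=> m; exact: SB (SB (S1 _ _ _ Sx) (S1 _ _ _ Sx)) (SZ _ (S1 _ _ _ Sy)).
- exact: SB (SB Sf Sf') (SZ _ Sg).
- apply: stendsB; [|move=> m; exact/SZ/S1|exact: SB|exact: SZ| |].
  + by move=> m; exact: SB (S1 _ _ _ Sx) (S1 _ _ _ Sx).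
  + by apply: stendsB => // m; exact: S1.
  + by apply: stendsZ => // m; exact: S1.
- move=> e e0; pose C := N y + 2 * (t - s) * N z + N z + 1.
  have ts : 0 <= t - s by rewrite subr_ge0.
  have C0 : 0 < C by rewrite ltr_wpDl// !addr_ge0// mulr_ge0// mulr_ge0.
  have [n0 hn] := dyadic_lt (divr_gt0 e0 C0).
  have [n1 hn1] := dyadic_lt ltr01.
  exists (maxn n0 n1) => m; rewrite geq_max => /andP[/hn hm /hn1 hm1].
  move: hm; rewrite ltr_pdivlMr// => hm.
  have d0 := dyadic_gt0 m; have hd := dstep_sub m st.
  have := iter_euler_taylor hb hG (dstep m t - dstep m s) d0
    (scheme_gen m s g1) (scheme_gen m s g2).
  rewrite -scheme_iter//.
  set p := _%:R * dyadic m in hd *; set A := _ - _ - _ *: _ => hA.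
  have SA : S A by exact: SB (SB (S1 _ _ _ Sx) (S1 _ _ _ Sx)) (SZ _ (S1 _ _ _ Sy)).
  have -> : scheme m x t - scheme m x s - (t - s) *: scheme m y s =
    A + (p - (t - s)) *: scheme m y s by rewrite /A; lin R.
  apply: le_trans (snormD hb SA (SZ _ (S1 _ _ _ Sy))) _.
  rewrite (snormZ hb); last exact: S1.
  have h1 : `|p - (t - s)| * N (scheme m y s) <= dyadic m * N y.
    by apply: ler_pM => //; exact: scheme_le.
  have h2 : p ^+ 2 * N (scheme m z s) <= (t - s + dyadic m) ^+ 2 * N z.
    have p0 : 0 <= p by rewrite mulr_ge0// ltW.
    apply: ler_pM => //; [exact: sqr_ge0| |exact: (scheme_le _ _ (GS2 g2))].
    by rewrite ler_sqr ?nnegrE//; move: hd; rewrite ler_norml; lra.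
  apply: le_trans (lerD (le_trans hA h2) h1) _.
  have h3 : dyadic m ^+ 2 * N z <= dyadic m * N z.
    by apply: ler_wpM2r => //; rewrite expr2 ler_piMl// ltW.
  by move: hm; rewrite /C sqrrD; lra.
Qed.

Lemma euler_diff h n p y p' y' : 0 < h -> G p y -> G p' y' ->
  N ((iter n (euler G h) p - p) - (iter n (euler G h) p' - p')) <=
    n%:R * h * N (y - y').
Proof.
move=> h0 g g'; have hn0 : h != 0 by rewrite gt_eqF.
elim: n => [|n IHn]; first by rewrite /= !subrr (snorm0 hb) !mul0r.
set q := iter n _ p in IHn *; set q' := iter n _ p' in IHn *; rewrite /= -/q -/q'.
have gq : G q (iter n (euler G h) y) by exact: (iter_euler_comm hb hG).
have gq' : G q' (iter n (euler G h) y') by exact: (iter_euler_comm hb hG).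
have [Sq Sw] := gen_dom hG gq; have [Sq' Sw'] := gen_dom hG gq'.
have Sp := GS1 g; have Sp' := GS1 g'.
set w := iter n _ y in gq Sw *; set w' := iter n _ y' in gq' Sw' *.
have h1 := euler_gen hb hG h0 Sq; have h2 := euler_gen hb hG h0 Sq'.
have h3 := genB hG h1 h2; have h4 := genB hG gq gq'.
set e := h^-1 *: (_ - q) - _ in h3.
have gE : G e (h^-1 *: (e - (w - w'))).
  have := genZ hG h^-1 (genB hG h3 h4); congr (G _ _); rewrite /e; lin R.
have Se := GS1 gE.
have Ne : N e <= N (y - y').
  apply: le_trans (gen_contract hb hG (ltW h0) gE) _.
  have -> : e - h *: (h^-1 *: (e - (w - w'))) = w - w' by lin R.
  exact: (iter_euler_contract hb hG n h0 (GS2 g) (GS2 g')).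
have -> : euler G h q - p - (euler G h q' - p') = (q - p - (q' - p')) + h *: e.
  by rewrite /e; lin R.
apply: le_trans (snormD hb (SB (SB Sq Sp) (SB Sq' Sp')) (SZ h Se)) _.
rewrite -(natr1 n) !mulrDl mul1r; apply: lerD => //.
by rewrite (snormZ hb)// gtr0_norm//; apply: ler_wpM2l => //; exact: ltW.
Qed.

(** The increment of an orbit is controlled by the image of its starting point
    only, because the resolvents are contractions. *)
Lemma flow_diff x y x' y' s t : G x y -> G x' y' -> 0 <= s <= t ->
  N ((flow x t - flow x s) - (flow x' t - flow x' s)) <= (t - s) * N (y - y').
Proof.
move=> g g' st; have [s0 st'] := andP st; have t0 := le_trans s0 st'.
have ax := dom_approachable g; have ax' := dom_approachable g'.
have Sx := GS1 g; have Sx' := GS1 g'.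
have [Sf hf] := flowP ax t0; have [Sf' hf'] := flowP ax s0.
have [Sh hh] := flowP ax' t0; have [Sh' hh'] := flowP ax' s0.
have S1 u m r : S u -> S (scheme m u r) by exact: scheme_S.
apply: (@stends_le (fun m => (scheme m x t - scheme m x s) -
  (scheme m x' t - scheme m x' s))).
- by move=> m; apply: SB; apply: SB; exact: S1.
- by apply: SB; exact: SB.
- apply: stendsB; try by [move=> m; apply: SB; exact: S1|exact: SB].
    by apply: stendsB => // m; exact: S1.
  by apply: stendsB => // m; exact: S1.
- move=> e e0; have y0 : 0 < N (y - y') + 1 by rewrite ltr_wpDl.
  have [n0 hn] := dyadic_lt (divr_gt0 e0 y0); exists n0 => m /hn.
  rewrite ltr_pdivlMr// => hm.
  rewrite !(scheme_iter m _ st).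
  apply: le_trans (euler_diff _ (dyadic_gt0 m) (scheme_gen m s g) (scheme_gen m s g')) _.
  have := dstep_sub m st; rewrite ler_norml => /andP[_].
  have := scheme_contract m s (GS2 g) (GS2 g'); have := dyadic_gt0 m; move: hm.
  have := ler0n R (dstep m t - dstep m s); move: (_%:R) => p p0 hm d0 hN hp.
  apply: (@le_trans _ _ ((t - s + dyadic m) * N (y - y'))); last by lra.
  by apply: ler_pM => //; [rewrite mulr_ge0// ltW|lra].
Qed.

(** On the domain of the square of G the orbit is differentiable by flow_taylor,
    with a remainder that depends on the second image of its starting point;
    flow_diff transfers the estimate to x by approximation of (x, y) in the graph. *)
Lemma semigroup_orbit x y : G x y -> approachable y ->
  exists u v : R -> E, [/\ N (u 0 - x) = 0, N (v 0 - y) = 0,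
    forall t, 0 <= t -> G (u t) (v t),
    forall t e, 0 <= t -> 0 < e -> exists2 d, 0 < d &
      forall s, 0 <= s -> `|s - t| < d -> N (v s - v t) <= e &
    forall t e, 0 <= t -> 0 < e -> exists2 d, 0 < d &
      forall s, 0 <= s -> `|s - t| < d ->
        N (u s - u t - (s - t) *: v t) <= e * `|s - t| ].
Proof.
move=> g ay; have ax := dom_approachable g.
have Sv t : 0 <= t -> S (flow y t) by exact: flow_S.
have Su t : 0 <= t -> S (flow x t) by exact: flow_S.
have vcont t e : 0 <= t -> 0 < e -> exists2 d, 0 < d &
    forall s, 0 <= s -> `|s - t| < d -> N (flow y s - flow y t) <= e.
  move=> t0 e0; have e40 : 0 < e / 4 by rewrite divr_gt0.
  have [y' [z' [_ [g1 _ yy']]]] := ay.2 _ e40.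
  have ay' := dom_approachable g1.
  have z0 : 0 < 4 * (N z' + 1) by rewrite mulr_gt0// ltr_wpDl.
  exists (e / (4 * (N z' + 1))); first by rewrite divr_gt0.
  move=> s s0; rewrite ltr_pdivlMr// => sd.
  have lip : N (flow y' s - flow y' t) <= `|s - t| * N z'.
    have [st|ts] := leP t s.
      by rewrite ger0_norm ?subr_ge0//; apply: flow_lip; rewrite ?t0.
    rewrite ltr0_norm ?subr_lt0// opprB (snormBC hb); try exact: flow_S.
    by apply: flow_lip; rewrite ?s0 ?ltW.
  have h1 := flow_contract ay ay' s0; have h2 := flow_contract ay' ay t0.
  rewrite (snormBC hb ay'.1 ay.1) in h2.
  have h3 := snormB hb (Sv s s0) (flow_S ay' s0) (Sv t t0).
  have h4 := snormB hb (flow_S ay' s0) (flow_S ay' t0) (Sv t t0).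
  have : 0 <= `|s - t| by [].
  by move: sd; lra.
exists (flow x), (flow y); split => //.
- exact: flow0.
- exact: flow0.
- by move=> t t0; exact: flow_gen.
move=> t e t0 e0; have e80 : 0 < e / 8 by rewrite divr_gt0.
(* graph approximation of (x, y) by points of the domain of the square *)
have [x' [y' [z' [g1 g2 yy']]]] :
    exists x' y' z', [/\ G x' y', G y' z' & N (y - y') < e / 8].
  have e240 : 0 < e / 32 by rewrite divr_gt0.
  have [p [q [_ [gpq _ yp]]]] := ay.2 _ e240.
  have q0 : 0 < 32 * (N q + 1) by rewrite mulr_gt0// ltr_wpDl.
  pose h := e / (32 * (N q + 1)); have h0 : 0 < h by rewrite divr_gt0.
  have Sy := ay.1; have Sp := GS1 gpq.
  have Sey := euler_S hb hG h0 Sy; have Sep := euler_S hb hG h0 Sp.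
  exists (euler G h x), (euler G h y), (h^-1 *: (euler G h y - y)); split.
  - exact: (euler_comm hb hG).
  - exact: (euler_gen hb hG).
  - have h1 := snormB hb Sy Sp Sey; have h2 := snormB hb Sp Sep Sey.
    have h3 := euler_contract hb hG h0 Sp Sy; have h4 := euler_step hb hG h0 gpq.
    rewrite (snormBC hb Sp Sy) in h3; rewrite (snormBC hb Sep Sp) in h4.
    have h5 : h * N q <= e / 32.
      rewrite /h mulrAC ler_pdivrMr//; have := N0 q; have := e0; nra.
    by lra.
have ax' := dom_approachable g1; have ay' := dom_approachable g2.
have [d1 d10 hd1] := vcont t _ t0 e80.
have z0 : 0 < 8 * (N z' + 1) by rewrite mulr_gt0// ltr_wpDl.
have d20 : 0 < e / (8 * (N z' + 1)) by rewrite divr_gt0.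
exists (Num.min d1 (e / (8 * (N z' + 1)))); first by rewrite lt_min d10.
move=> s s0; rewrite lt_min => /andP[sd1]; rewrite ltr_pdivlMr// => sd2.
have ns : 0 <= `|s - t| by [].
(* the estimate with the derivative taken at the left end point *)
have key r r' : 0 <= r -> r <= r' -> `|r' - r| = `|s - t| ->
    N (flow x r' - flow x r - (r' - r) *: flow y r) <= e / 2 * `|s - t|.
  move=> r0 rr' ers.
  have rr0 : 0 <= r <= r' by rewrite r0.
  have r'0 := le_trans r0 rr'.
  rewrite (ger0_norm (_ : 0 <= r' - r)) ?subr_ge0// in ers.
  have Sd : S (flow y' r - flow y r) by apply: SB; exact: flow_S.
  have -> : flow x r' - flow x r - (r' - r) *: flow y r =
    ((flow x r' - flow x r) - (flow x' r' - flow x' r)) +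
    ((flow x' r' - flow x' r - (r' - r) *: flow y' r) +
     (r' - r) *: (flow y' r - flow y r)) by lin R.
  have S1 : S (flow x r' - flow x r - (flow x' r' - flow x' r)).
    by apply: SB; apply: SB; exact: flow_S.
  have S2 : S (flow x' r' - flow x' r - (r' - r) *: flow y' r).
    by apply: SB; [apply: SB; exact: flow_S|apply: SZ; exact: flow_S].
  have := snormD hb S1 (SD S2 (SZ (r' - r) Sd)).
  have := snormD hb S2 (SZ (r' - r) Sd).
  rewrite (snormZ hb)// ger0_norm ?subr_ge0//.
  have := flow_diff g g1 rr0; have := flow_taylor g1 g2 rr0.
  have := flow_contract ay' ay r0; rewrite (snormBC hb ay'.1 ay.1) ers.
  have := N0 z'; move: ns yy' sd2; move: (`|s - t|) => a a0 yy' sd2.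
  move: (N z') sd2 => c sd2 c0 h1 h2 h3 h4 h5.
  have h6 : a * N (flow y' r - flow y r) <= a * (e / 8) by apply: ler_wpM2l => //; lra.
  have h7 : a * N (y - y') <= a * (e / 8) by apply: ler_wpM2l => //; lra.
  have h8 : a ^+ 2 * c <= a * (e / 8).
    by rewrite expr2 -mulrA; apply: ler_wpM2l => //; lra.
  by have := mulr_ge0 a0 (ltW e0); lra.
have [ts|st] := leP t s.
  apply: le_trans (key t s t0 ts erefl) _.
  by apply: ler_wpM2r => //; have := e0; lra.
have k := key s t s0 (ltW st) (distrC _ _).
have Svd : S (flow y s - flow y t) by apply: SB; exact: flow_S.
have -> : flow x s - flow x t - (s - t) *: flow y t =
  - (flow x t - flow x s - (t - s) *: flow y s) + (s - t) *: (flow y s - flow y t).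
  by lin R.
have S3 : S (flow x t - flow x s - (t - s) *: flow y s).
  by apply: SB; [apply: SB; exact: flow_S|apply: SZ; exact: flow_S].
apply: le_trans (snormD hb (siN hb S3) (SZ (s - t) Svd)) _.
rewrite (snormN hb)// (snormZ hb)//.
have := ler_wpM2l ns (hd1 _ s0 sd1); have := mulr_ge0 ns (ltW e0).
by lra.
Qed.

End SemigroupLimit.

(** * Square-integrable functions *)

Section L2Space.
Context d (T : measurableType d) (R : realType) (m : {measure set T -> \bar R}).
Variable D : set T.
Hypothesis mD : measurable D.
Implicit Types f g h : T -> R.

Local Notation integ f := (m.-integrable D (EFin \o f)).

Lemma ae_mono (P Q : T -> Prop) : {ae m, forall x, P x} ->
  (forall x, P x -> Q x) -> {ae m, forall x, Q x}.
Proof. by move=> h PQ; apply: filterS h. Qed.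

Lemma ae_and (P Q : T -> Prop) : {ae m, forall x, P x} -> {ae m, forall x, Q x} ->
  {ae m, forall x, P x /\ Q x}.
Proof. by move=> hP hQ; apply: filterS2 hP hQ. Qed.

Definition L2dot f g : R := \int[m]_(x in D) (f x * g x).

Lemma L2P f : L2 m D f <->
  measurable_fun D f /\ integ (fun x => f x ^+ 2).
Proof.
have E2 : (EFin \o (fun x => (f \_ D) x ^+ 2)) =
    ((EFin \o (fun x => f x ^+ 2)) \_ D : T -> \bar R).
  by apply/funext => x; rewrite /= /patch; case: ifP => //; rewrite expr0n.
split=> [h|[mf i2]].
  move: (h); rewrite /L2/= inE => /andP[]; rewrite inE/= => mf _; split.
    exact/(measurable_restrictT _ _).2.
  apply/(integrable_mkcond _ mD).2; rewrite -E2; exact: Lfun2_integrable_sqr.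
move/(integrable_mkcond _ mD) : i2; rewrite -E2 => /integrableP[_ i2].
rewrite /L2/= inE; apply/andP; rewrite !inE/=; split.
  exact/(measurable_restrictT _ _).1.
rewrite /finite_norm unlock; apply: poweR_lty.
apply: le_lt_trans i2; rewrite le_eqVlt; apply/orP; left; apply/eqP.
by apply: eq_integral => x _ /=; rewrite powR_mulrn// normrX.
Qed.

Lemma L2_measurable f : L2 m D f -> measurable_fun D f.
Proof. by case/L2P. Qed.

Lemma L2_integ_mul f g : L2 m D f -> L2 m D g -> integ (fun x => f x * g x).
Proof.
move=> hf hg; have := Lfun2_mul_Lfun1 hf hg => /Lfun1_integrable.
move=> h; apply/(integrable_mkcond _ mD).2; move: h; congr (integrable _ _ _).
apply/funext => x; rewrite /= /patch; case: ifP => //; by rewrite mulr0.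
Qed.

Lemma L2D f g : L2 m D f -> L2 m D g -> L2 m D (f + g).
Proof.
move=> hf hg; apply/L2P; split.
  by apply: measurable_funD; exact: L2_measurable.
have := integrableD mD (L2_integ_mul hf hf)
  (integrableD mD (L2_integ_mul hg hg) (integrableZl mD 2 (L2_integ_mul hf hg))).
by apply: eq_integrable => // x _ /=; rewrite -!EFinM -!EFinD fctE; congr EFin; ring.
Qed.

Lemma L2Z c f : L2 m D f -> L2 m D (c *: f).
Proof.
move=> hf; apply/L2P; split.
  by apply: measurable_funM => //; exact: L2_measurable.
have := integrableZl mD (c ^+ 2) (L2_integ_mul hf hf).
by apply: eq_integrable => // x _ /=; rewrite -!EFinM fctE; congr EFin; rewrite -[c *: f x]/(c * f x); ring.
Qed.

Lemma L2_0 : L2 m D 0.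
Proof.
apply/L2P; split; first exact: measurable_cst.
by rewrite [X in _.-integrable _ X](_ : _ = cst 0%E) ?integrable0//;
  apply/funext => x /=; rewrite expr0n.
Qed.

Lemma L2dot_inner : semi_inner (L2 m D) L2dot.
Proof.
split.
- exact: L2_0.
- exact: L2D.
- exact: L2Z.
- by move=> f g _ _; apply: eq_Rintegral => x _; rewrite mulrC.
- move=> f g h hf hg hh; rewrite /L2dot -RintegralD//; last first.
  + exact: L2_integ_mul.
  + exact: L2_integ_mul.
  by apply: eq_Rintegral => x _; rewrite fctE mulrDl.
- move=> c f g hf hg; rewrite /L2dot -RintegralZl//; last exact: L2_integ_mul.
  by apply: eq_Rintegral => x _; rewrite mulrA.
- by move=> f _; apply: Rintegral_ge0 => x _; exact: sqr_ge0.
Qed.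

Lemma L2norm_snorm f : L2 m D f -> L2norm m D f = (snorm L2dot f)%:E.
Proof.
move=> hf; rewrite /L2norm unlock.
have -> : (\int[m]_x `|(EFin \o f \_ D) x| `^ 2 = (L2dot f f)%:E)%E.
  rewrite /L2dot /Rintegral fineK; last first.
    exact: integrable_fin_num (L2_integ_mul hf hf).
  rewrite [RHS]integral_mkcond; apply: eq_integral => x _ /=.
  rewrite powR_mulrn// /patch; case: ifP => _ /=.
    by rewrite -normrX ger0_norm ?sqr_ge0// expr2.
  by rewrite normr0 expr0n.
by rewrite poweR_EFin powR12_sqrt// (si_ge0 L2dot_inner).
Qed.

Lemma integ_cst c : (m D < +oo)%E -> integ (cst c).
Proof.
move=> fD; apply/integrableP; split; first exact/measurable_EFinP/measurable_cst.
by rewrite (integral_cst _ mD `|c|%:E) lte_mul_pinfty// lee_fin.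
Qed.

Lemma L2_cst c : (m D < +oo)%E -> L2 m D (cst c).
Proof.
move=> fD; apply/L2P; split; first exact: measurable_cst.
exact: (integ_cst (c ^+ 2) fD).
Qed.

Lemma L2_bounded f M : (m D < +oo)%E -> measurable_fun D f ->
  (forall x, D x -> `|f x| <= M) -> L2 m D f.
Proof.
move=> fD mf fM; apply/L2P; split => //.
apply: (@le_integrable _ _ _ m D mD _ (EFin \o cst (M ^+ 2))) => //.
- by apply/measurable_EFinP; exact: measurable_funX.
- move=> x /fM fxM /=; rewrite lee_fin !ger0_norm ?sqr_ge0//.
  by rewrite -real_normK ?num_real// lerXn2r ?nnegrE// (le_trans _ fxM).
- exact: integ_cst.
Qed.

Lemma L2_mul_bounded f g M : measurable_fun D g ->
  (forall x, D x -> `|g x| <= M) -> L2 m D f -> L2 m D (fun x => g x * f x).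
Proof.
move=> mg gM hf; have mf := L2_measurable hf; apply/L2P; split.
  exact: measurable_funM.
apply: (@le_integrable _ _ _ m D mD _ (fun x => (M ^+ 2)%:E * (f x * f x)%:E)%E) => //.
- by apply/measurable_EFinP; apply: measurable_funX; exact: measurable_funM.
- move=> x /gM gxM /=; rewrite lee_fin.
  rewrite -(expr2 (f x)) exprMn (ger0_norm (mulr_ge0 (sqr_ge0 _) (sqr_ge0 _))).
  rewrite (ger0_norm (mulr_ge0 (sqr_ge0 _) (sqr_ge0 _))).
  apply: ler_wpM2r; first exact: sqr_ge0.
  by rewrite -real_normK ?num_real// lerXn2r ?nnegrE// (le_trans _ gxM).
- exact: integrableZl (L2_integ_mul hf hf).
Qed.

Lemma L2dot_ae f g h : L2 m D f -> L2 m D g -> L2 m D h ->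
  {ae m, forall x, D x -> f x = g x} -> L2dot f h = L2dot g h.
Proof.
move=> hf hg hh fg; rewrite /L2dot /Rintegral; congr fine; apply: ae_eq_integral => //.
- exact: measurable_int (L2_integ_mul hf hh).
- exact: measurable_int (L2_integ_mul hg hh).
- by apply: filterS fg => x e Dx /=; rewrite e.
Qed.

Lemma snorm_ae f g : L2 m D f -> L2 m D g ->
  (snorm L2dot (f - g) = 0 <-> {ae m, forall x, D x -> f x = g x}).
Proof.
move=> hf hg; have hfg : L2 m D (f - g) by exact: siB L2dot_inner _ _ hf hg.
split=> [h|h].
  have h0 : (\int[m]_(x in D) ((f - g) x * (f - g) x)%:E = 0)%E.
    rewrite -[LHS]fineK; last exact: integrable_fin_num (L2_integ_mul hfg hfg).
    have e : L2dot (f - g) (f - g) = 0 by rewrite -(snorm_sqr L2dot_inner)// h expr0n.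
    by rewrite (_ : fine _ = 0)//; exact: e.
  have m0 : measurable_fun D (EFin \o (fun x => (f - g) x * (f - g) x)).
    exact: measurable_int (L2_integ_mul hfg hfg).
  have /(ae_eq_integral_abs m mD m0).1 :
      (\int[m]_(x in D) `|(EFin \o (fun x => ((f - g) x * (f - g) x)%R)) x| = 0)%E.
    rewrite -[RHS]h0; apply: eq_integral => x _ /=.
    by rewrite ger0_norm// -expr2 sqr_ge0.
  apply: filterS => x hx Dx; have /= [/eqP] := hx Dx.
  by rewrite mulf_eq0 orbb subr_eq0 => /eqP.
rewrite /snorm; suff -> : L2dot (f - g) (f - g) = 0 by rewrite sqrtr0.
rewrite (L2dot_ae hfg L2_0 hfg); last first.
  by apply: filterS h => x e /e; rewrite !fctE => ->; rewrite subrr.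
by rewrite /L2dot; under eq_Rintegral do rewrite fctE mul0r; rewrite Rintegral_cst// mul0r.
Qed.


(** Riesz-Fischer: a subsequence whose increments are summable in norm
    converges almost everywhere, and Fatou's lemma turns its pointwise limit
    into a limit in norm. *)
Lemma L2_complete : (m D < +oo)%E -> scomplete (L2 m D) L2dot.
Proof.
move=> fD u Lu cu.
have ip := L2dot_inner.
have p0 k : 0 < (2 ^+ k)^-1 :> R by rewrite invr_gt0 exprn_gt0.
have /choice[th thP] := fun k => cu _ (p0 k).
pose idx k := (\sum_(i < k.+1) th i)%N.
have idx_ge j k : (j <= k)%N -> (th j <= idx k)%N.
  by move=> jk; rewrite /idx (bigD1 (Ordinal (jk : (j < k.+1)%N)))//= leq_addr.
pose v k := u (idx k).
have Lv k : L2 m D (v k) by exact: Lu.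
have vn j k n : (j <= k)%N -> (th j <= n)%N -> snorm L2dot (v k - u n) <= (2 ^+ j)^-1.
  by move=> jk jn; apply/ltW/thP => //; exact: idx_ge.
pose w k x := `|v k.+1 x - v k x|.
have mv k : measurable_fun D (v k) by exact: L2_measurable.
have mw k : measurable_fun D (w k).
  by apply: measurableT_comp => //; apply: measurable_funB.
pose C := snorm L2dot (cst 1).
have Iw k : (\int[m]_(x in D) (w k x)%:E <= ((2 ^+ k)^-1 * C)%:E)%E.
  have Lvv : L2 m D (v k.+1 - v k) by exact: siB ip _ _ (Lv _) (Lv _).
  have Lw : L2 m D (w k).
    apply/L2P; split => //; have := L2_integ_mul Lvv Lvv.
    apply: eq_integrable => // x _ /=.
    by rewrite /w -normrX ger0_norm ?sqr_ge0// expr2.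
  have i1 := L2_integ_mul Lw (L2_cst 1 fD).
  have -> : (\int[m]_(x in D) (w k x)%:E = (L2dot (w k) (cst 1))%:E)%E.
    rewrite /L2dot /Rintegral fineK; last exact: integrable_fin_num i1.
    by apply: eq_integral => x _ /=; rewrite mulr1.
  rewrite lee_fin; apply: le_trans (ler_norm _) _.
  apply: le_trans (si_cs ip Lw (L2_cst 1 fD)) _.
  apply: ler_wpM2r; first exact: snorm_ge0.
  have -> : snorm L2dot (w k) = snorm L2dot (v k.+1 - v k).
    congr (Num.sqrt _); apply: eq_Rintegral => x _.
    by rewrite /w -normrM ger0_norm// -expr2 sqr_ge0.
  by apply: vn => //; exact: idx_ge.
pose G x := (\sum_(k <oo) (w k x)%:E)%E.
have mG : measurable_fun D G.
  apply: ge0_emeasurable_sum => [k x _ _|k _]; first by rewrite lee_fin /w.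
  exact/measurable_EFinP.
have G0 x : D x -> (0 <= G x)%E by move=> _; apply: nneseries_ge0 => k _ _; rewrite lee_fin /w.
have iG : m.-integrable D G.
  apply/integrableP; split => //.
  have -> : (\int[m]_(x in D) `|G x| = \int[m]_(x in D) G x)%E.
    by apply: eq_integral => x /set_mem /G0 /gee0_abs.
  rewrite integral_nneseries//; [|by move=> k; exact/measurable_EFinP|
    by move=> k x _; rewrite lee_fin /w].
  apply: le_lt_trans (lee_nneseries _ _) _.
  - by move=> k _ _; apply: integral_ge0 => x _; rewrite lee_fin /w.
  - by move=> k _; exact: Iw k.
  have /cvg_lim : (\sum_(0 <= k < n) ((2 ^+ k)^-1 * C)%:E)%E @[n --> \oo] --> (2 * C)%:E.
    have /(_ (2 * C) 0%N) := @cvg_geometric_eseries_half R.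
    rewrite expr0 divr1; apply: cvg_trans; apply: near_eq_cvg; apply: nearW => n /=.
    apply: eq_bigr => k _; congr EFin.
    by rewrite addn1 expnS natrM natrX; field; rewrite expf_neq0.
  by move=> ->//; rewrite ltry.
have aeG := integrable_ae mD iG.
pose f x := fine (limn_esup (fun k => (v k x)%:E)).
have mf : measurable_fun D f.
  apply: (measurableT_comp (fine_measurable measurableT)).
  by apply: measurable_fun_limn_esup => k; exact/measurable_EFinP.
have vf : {ae m, forall x, D x -> v k x @[k --> \oo] --> f x}.
  apply: filterS aeG => x fG Dx; have {}fG := fG Dx.
  have cs : cvgn [normed series (fun k => v k.+1 x - v k x)].
    apply: nondecreasing_is_cvgn.
      by apply: nondecreasing_series => *; exact: normr_ge0.
    exists (fine (G x)) => _ [n _ <-].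
    rewrite -lee_fin fineK// /series/= -sumEFin.
    by apply: nneseries_lim_ge.
  have /cvg_ex[l vl] : cvgn (v ^~ x).
    move/normed_cvg : cs => cs.
    have -> : v ^~ x = cst (v 0%N x) \+ series (fun k => v k.+1 x - v k x).
      apply/funext => n /=; rewrite /series/= telescope_sumr// addrC subrK//.
    by apply: is_cvgD => //; exact: is_cvg_cst.
  rewrite /f (cvg_limn_einf_sup (_ : _ --> l%:E)).2//.
  by apply: cvg_EFin; [exact: nearW|].
have fin n j : (th j <= n)%N -> (\int[m]_(x in D) ((f x - u n x) ^+ 2)%:E <=
    (((2 ^+ j)^-1) ^+ 2)%:E)%E.
  move=> jn.
  pose g k x := ((v (k + j)%N x - u n x) ^+ 2)%:E.
  have mu' : measurable_fun D (u n) by exact: L2_measurable.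
  have mg k : measurable_fun D (g k).
    apply/measurable_EFinP; apply: measurable_funX; exact: measurable_funB.
  have g0 k x : D x -> (0 <= g k x)%E by rewrite lee_fin sqr_ge0.
  have := fatou m mD mg g0.
  have -> : (\int[m]_(x in D) limn_einf (g ^~ x) =
      \int[m]_(x in D) ((f x - u n x) ^+ 2)%:E)%E.
    apply: ae_eq_integral => //.
    - by under eq_fun do rewrite -[limn_einf _]oppeK -limn_esupN;
        apply: measurableT_comp => //; apply: measurable_fun_limn_esup => k;
        exact: measurableT_comp.
    - by apply/measurable_EFinP; apply: measurable_funX; exact: measurable_funB.
    apply: filterS vf => x vfx Dx; have {}vfx := vfx Dx.
    rewrite (cvg_limn_einf_sup (_ : _ --> ((f x - u n x) ^+ 2)%:E)).1//.
    apply: cvg_EFin; first exact: nearW.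
    have hcv : v (k + j)%N x - u n x @[k --> \oo] --> f x - u n x.
      apply: cvgB; last exact: cvg_cst.
      by rewrite (cvg_shiftn j (fun k => v k x)).
    exact: (cvgM hcv hcv).
  move=> /le_trans; apply.
  rewrite limn_einf_lim; apply: lime_le; first exact: is_cvg_einfs.
  apply: nearW => k; apply: (@le_trans _ _ (\int[m]_(x in D) g k x)%E).
    by apply: ereal_inf_lbound; exists k => //=.
  have Lkn : L2 m D (v (k + j)%N - u n) by exact: siB ip _ _ (Lv _) (Lu _).
  have -> : (\int[m]_(x in D) g k x = (L2dot (v (k + j)%N - u n) (v (k + j)%N - u n))%:E)%E.
    rewrite /L2dot /Rintegral fineK; last exact: integrable_fin_num (L2_integ_mul Lkn Lkn).
    by apply: eq_integral => x _.
  rewrite lee_fin -(snorm_le ip)//.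
  by apply: vn => //; exact: leq_addl.
have Lfu n j : (th j <= n)%N -> L2 m D (f - u n).
  move=> /fin h; apply/L2P; have mfu : measurable_fun D (f - u n).
    by apply: measurable_funB => //; exact: L2_measurable.
  split => //; apply/integrableP; split.
    by apply/measurable_EFinP; exact: measurable_funX.
  apply: le_lt_trans (ltry (((2 ^+ j)^-1) ^+ 2)); apply: le_trans h.
  rewrite le_eqVlt; apply/orP; left; apply/eqP; apply: eq_integral => x _ /=.
  by rewrite ger0_norm// sqr_ge0.
have Lf : L2 m D f.
  have -> : f = (f - u (th 0%N)) + u (th 0%N) by rewrite subrK.
  by apply: L2D => //; exact: (Lfu _ 0%N).
exists f => // e e0.
have [j je] : exists j, (2 ^+ j)^-1 < e :> R.
  exists (Num.truncn e^-1); rewrite invf_plt ?posrE ?exprn_gt0//.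
  apply: lt_le_trans (truncnS_gt _) _; rewrite -natrX ler_nat.
  by rewrite ltn_expl.
exists (th j) => n jn; rewrite (snormBC ip)//; apply: le_lt_trans je.
have L3 := Lfu _ _ jn.
rewrite (snorm_le ip)// -lee_fin.
apply: le_trans (fin _ _ jn); rewrite le_eqVlt; apply/orP; left; apply/eqP.
rewrite /L2dot /Rintegral fineK; last exact: integrable_fin_num (L2_integ_mul L3 L3).
by apply: eq_integral => x _ /=.
Qed.

End L2Space.

(** * Smooth functions of one variable *)

Section SmoothFunctions.
Context {R : realType}.
Implicit Types (f g : R -> R) (B : set (R -> R)).

Definition smooth1 f := forall n x, derivable (derive1n n f) x 1.

Inductive algebra B : (R -> R) -> Prop :=
  | alg_base f : B f -> algebra B f
  | alg_cst c : algebra B (cst c)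
  | alg_add f g : algebra B f -> algebra B g -> algebra B (f \+ g)
  | alg_mul f g : algebra B f -> algebra B g -> algebra B (f \* g).

Lemma is_derive_derive1 f f' : (forall x : R, is_derive x 1 f (f' x)) ->
  f^`()%classic = f'.
Proof. by move=> h; apply/funext => x; rewrite derive1E; apply: derive_val. Qed.

(** A set of functions whose derivatives lie in the algebra that it generates
    consists of smooth functions: the algebra is closed under derivation. *)
Lemma algebra_smooth B :
  (forall f, B f -> exists2 f', algebra B f' & forall x : R, is_derive x 1 f (f' x)) ->
  forall f, algebra B f -> smooth1 f.
Proof.
move=> BB.
have key f : algebra B f ->
    exists2 f', algebra B f' & forall x : R, is_derive x 1 f (f' x).
  elim=> {f} [f /BB //|c|f g Bf [f' Bf' df] Bg [g' Bg' dg]|f g Bf [f' Bf' df] Bg [g' Bg' dg]].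
  - by exists (cst 0); [exact: alg_cst|move=> x; exact: is_derive_cst].
  - exists (f' \+ g'); first exact: alg_add.
    by move=> x; exact: is_deriveD.
  - exists ((f \* g') \+ (g \* f')); first by apply: alg_add; exact: alg_mul.
    by move=> x; exact: is_deriveM.
move=> f Bf n x.
suff Bn : algebra B (derive1n n f) by have [f' _ /(_ x)[]] := key _ Bn.
elim: n => [|n]; first by rewrite derive1n0.
by rewrite derive1nS => /key[f' Bf' /is_derive_derive1 ->].
Qed.

Lemma smooth1_derive f : smooth1 f -> smooth1 f^`()%classic.
Proof. by move=> sf n x; rewrite -derive1Sn; exact: sf. Qed.

Lemma smooth1_derivable f (x : R) : smooth1 f -> derivable f x 1.
Proof. by move=> sf; have := sf 0%N x; rewrite derive1n0. Qed.

Lemma smooth1_is_derive f (x : R) : smooth1 f -> is_derive x 1 f (f^`()%classic x).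
Proof.
move=> sf; apply: DeriveDef; first exact: smooth1_derivable.
by rewrite derive1E.
Qed.

Lemma smooth1_continuous f : smooth1 f -> continuous f.
Proof.
move=> sf x; apply: differentiable_continuous; apply/derivable1_diffP.
exact: smooth1_derivable.
Qed.

Lemma smooth1_algebra f : algebra smooth1 f -> smooth1 f.
Proof.
apply: algebra_smooth => {}f sf; exists (f^`()%classic).
  by apply: alg_base; exact: smooth1_derive.
by move=> x; exact: smooth1_is_derive.
Qed.

Lemma smooth1M f g : smooth1 f -> smooth1 g -> smooth1 (f \* g).
Proof. by move=> sf sg; apply: smooth1_algebra; apply: alg_mul; exact: alg_base. Qed.

Lemma smooth1D f g : smooth1 f -> smooth1 g -> smooth1 (f \+ g).
Proof. by move=> sf sg; apply: smooth1_algebra; apply: alg_add; exact: alg_base. Qed.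

Lemma smooth1_cst c : smooth1 (cst c).
Proof. by apply: smooth1_algebra; exact: alg_cst. Qed.

Lemma is_derive_affine (a b x : R) : is_derive x 1 (fun y => a * y + b) a.
Proof.
have h1 : is_derive x 1 (fun y : R => a * y) a.
  have := @is_deriveZ _ _ _ id a x 1 1 (is_derive_id x 1).
  by rewrite /GRing.scale/= mulr1.
by have := is_deriveD h1 (is_derive_cst b x 1); rewrite addr0.
Qed.

Lemma smooth1_affine f a b : smooth1 f -> smooth1 (fun x => f (a * x + b)).
Proof.
move=> sf.
pose B := [set h : R -> R | exists2 g, smooth1 g & h = fun x => g (a * x + b)].
apply: (@algebra_smooth B); last by apply: alg_base; exists f.
move=> _ [g sg ->].
exists (cst a \* (fun x => g^`()%classic (a * x + b))).
  apply: alg_mul; first exact: alg_cst.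
  by apply: alg_base; exists (g^`()%classic) => //; exact: smooth1_derive.
move=> x; rewrite /= mulrC.
exact: (is_derive1_comp (smooth1_is_derive _ sg) (is_derive_affine a b x)).
Qed.

Lemma smooth1_trig : smooth1 sin /\ smooth1 cos.
Proof.
pose B := [set f : R -> R | f = sin \/ f = cos].
have H : forall f, algebra B f -> smooth1 f.
  apply: algebra_smooth => f [->|->].
    by exists cos; [apply: alg_base; right|exact: is_derive_sin].
  exists (cst (-1) \* sin); first by apply: alg_mul; [exact: alg_cst|apply: alg_base; left].
  by move=> x /=; rewrite mulN1r; exact: is_derive_cos.
by split; apply: H; apply: alg_base; [left|right].
Qed.

(** The functions x ^- k * exp (- 1 / x), extended by 0. *)
Definition flat (k : nat) (x : R) : R :=
  if 0 < x then x^-1 ^+ k * expR (- x^-1) else 0.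

Lemma flat_le k x : `|flat k x| <= k.+1%:R ^+ k.+1 * `|x|.
Proof.
rewrite /flat; case: ltP => x0; last by rewrite normr0 mulr_ge0// exprn_ge0.
rewrite !gtr0_norm// ?mulr_gt0 ?exprn_gt0 ?expR_gt0 ?invr_gt0//.
have t0 : 0 < x^-1 by rewrite invr_gt0.
have xt : x = x^-1^-1 by rewrite invrK.
rewrite {3}xt; move: (x^-1) t0 => t t0.
have k0 : 0 < k.+1%:R :> R by [].
have s0 : 0 <= t / k.+1%:R by rewrite divr_ge0// ltW.
have h1 : t / k.+1%:R <= expR (t / k.+1%:R).
  by apply: le_trans (expR_ge1Dx _); rewrite lerDr.
have h : (t / k.+1%:R) ^+ k.+1 <= expR t.
  have -> : expR t = expR (t / k.+1%:R) ^+ k.+1.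
    by rewrite -expRM_natl mulrC divfK// gt_eqF.
  by apply: lerXn2r; rewrite ?nnegrE ?expR_ge0.
move: h; rewrite exprMn exprVn ler_pdivrMr ?exprn_gt0// => h.
rewrite expRN ler_pdivrMr ?expR_gt0// mulrAC ler_pdivlMr//.
by rewrite -exprSr mulrC.
Qed.

(** The family is closed under derivation up to linear combinations, which makes
    its first member smooth. *)
Lemma flat_derive k (x : R) :
  is_derive x (1 : R) (flat k) (flat k.+2 x - k%:R * flat k.+1 x).
Proof.
have [x0|x0|->] := ltgtP x 0.
- have -> : flat k.+2 x - k%:R * flat k.+1 x = 0.
    by rewrite /flat ltNge (ltW x0)/= mulr0 subr0.
  apply: near_eq_is_derive (is_derive_cst 0 x 1).
  near=> y; rewrite /flat ltNge; suff -> : y <= 0 by [].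
  by apply: ltW; near: y; exact: lt_nbhsl.
- have xn0 : x != 0 by rewrite gt_eqF.
  have dV : is_derive x 1 (fun y : R => y^-1) (- x^-1 ^+ 2).
    have := @is_deriveV _ id x 1 1 xn0 (is_derive_id x 1).
    by rewrite /GRing.scale/= mulr1 exprVn.
  have dN : is_derive x 1 (fun y : R => - y^-1) (x^-1 ^+ 2).
    by have := is_deriveN dV; rewrite opprK.
  have dE : is_derive x 1 (fun y : R => expR (- y^-1)) (expR (- x^-1) * x^-1 ^+ 2).
    exact: (is_derive1_comp (is_derive_expR _) dN).
  have dX : is_derive x 1 (fun y : R => y^-1 ^+ k) (k%:R * x^-1 ^+ k.-1 * - x^-1 ^+ 2).
    have := is_deriveX k dV; congr is_derive.
    by apply/funext => y; rewrite /= fctE; elim: k => //= n IHn; rewrite exprS exprS IHn.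
  have main : is_derive x 1 (fun y : R => y^-1 ^+ k * expR (- y^-1))
      (flat k.+2 x - k%:R * flat k.+1 x).
    have := is_deriveM dX dE; congr is_derive.
    rewrite /flat x0 /GRing.scale/=; case: k {dX} => [|k] /=.
      by rewrite !mul0r mulr0 addr0 subr0 expr0 mul1r mulrC.
    by rewrite !exprS; ring.
  apply: near_eq_is_derive main.
  near=> y; rewrite /flat; suff -> : 0 < y by [].
  by near: y; exact: lt_nbhsr.
- rewrite {2 3}/flat ltxx mulr0 subr0.
  have f0 n : flat n 0 = 0 by rewrite /flat ltxx.
  have cv : h^-1 *: ((flat k \o shift 0) (h *: 1) - flat k 0) @[h --> 0^'] --> (0 : R).
    have C0 : 0 <= k.+2%:R ^+ k.+2 :> R by rewrite exprn_ge0.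
    apply/cvgr0Pnorm_le => e e0.
    near=> h; rewrite /= /GRing.scale/= mulr1 addr0 f0 subr0.
    have hn0 : h != 0 by near: h; exact: nbhs_dnbhs_neq.
    apply: (@le_trans _ _ (k.+2%:R ^+ k.+2 * `|h|)).
      apply: le_trans (flat_le k.+1 h); rewrite /flat; case: ifP => _.
        by rewrite exprS mulrA.
      by rewrite mulr0.
    rewrite -ler_pdivlMl ?exprn_gt0//; near: h; apply: dnbhs0_le.
    by rewrite mulr_gt0// invr_gt0 exprn_gt0.
  apply: DeriveDef; first by apply/cvg_ex; exists 0.
  by apply/cvg_lim.
Unshelve. all: by end_near.
Qed.

Lemma smooth1_flat k : smooth1 (flat k).
Proof.
pose B := [set f : R -> R | exists n, f = flat n].
apply: (@algebra_smooth B); last by apply: alg_base; exists k.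
move=> _ [n ->]; exists (flat n.+2 \+ (cst (- n%:R) \* flat n.+1)).
  apply: alg_add; first by apply: alg_base; exists n.+2.
  by apply: alg_mul; [exact: alg_cst|apply: alg_base; exists n.+1].
by move=> x /=; rewrite mulNr; exact: flat_derive.
Qed.

Lemma flat0_itv x : 0 <= flat 0 x <= 1.
Proof.
rewrite /flat; case: ltP => x0; last by rewrite lexx ler01.
by rewrite mul1r expR_ge0/= -expR0 ler_expR oppr_le0 invr_ge0 ltW.
Qed.

Lemma flat0_gt0 x : 0 < x -> 0 < flat 0 x.
Proof. by move=> x0; rewrite /flat x0 mul1r expR_gt0. Qed.

End SmoothFunctions.

(** * Measurability and integrals on the square *)

Section Dynkin.
Context d d' (T : measurableType d) (U : measurableType d') (R : realType).
Variable m : {measure set T -> \bar R}.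

(** The sets with vanishing integral form a Dynkin system. *)
Lemma integral_dynkin (D : set T) (f : T -> \bar R) (h : T -> U)
    (C : set (set U)) : measurable D -> m.-integrable D f ->
  measurable_fun setT h -> setI_closed C -> @measurable _ U = <<s C >> ->
  (forall A, C A -> (\int[m]_(x in D `&` h @^-1` A) f x = 0)%E) ->
  (\int[m]_(x in D) f x = 0)%E ->
  forall A, measurable A -> (\int[m]_(x in D `&` h @^-1` A) f x = 0)%E.
Proof.
move=> mD fi mh CI CE C0 D0.
pose H := [set A : set U | measurable A /\ (\int[m]_(x in D `&` h @^-1` A) f x = 0)%E].
have mhA A : measurable A -> measurable (h @^-1` A).
  by move=> mA; rewrite -[X in measurable X]setTI; exact: mh.
suff : <<d C >> `<=` H.
  rewrite setI_closed_g_dynkin_g_sigma_algebra// -CE => sub A mA.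
  by have [] := sub A mA.
apply: smallest_sub; last first.
  by move=> A CA; split; [rewrite CE; exact: sub_sigma_algebra|exact: C0].
split.
- by split; [exact: measurableT|rewrite preimage_setT setIT].
- move=> A [mA A0]; split; first exact: measurableC.
  have mA' := mhA _ mA; have mCA := mhA _ (measurableC mA).
  have DE : D = (D `&` h @^-1` A) `|` (D `&` h @^-1` (~` A)).
    by rewrite -setIUr -preimage_setU setUCr preimage_setT setIT.
  move: D0; rewrite {1}DE integral_setU//.
  + by rewrite A0 add0e.
  + exact: measurableI.
  + exact: measurableI.
  + by rewrite -DE; exact: measurable_int fi.
  + by apply/disj_setPS => x [[_ hA] [_ nhA]].
- move=> F tF HF; split; first by apply: bigcupT_measurable => n; case: (HF n).
  rewrite preimage_bigcup setI_bigcupr integral_bigcup.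
  + by rewrite eseries0// => n _ _; case: (HF n).
  + apply/trivIsetP => i j _ _ ij; rewrite setIACA setIid.
    have /trivIsetP/(_ i j Logic.I Logic.I ij) Fij := tF.
    by rewrite -preimage_setI Fij preimage_set0 setI0.
  + by move=> k; apply: measurableI => //; apply: mhA; case: (HF k).
  + rewrite -setI_bigcupr; apply: integrableS fi => //.
    apply: measurableI => //; apply: bigcup_measurable => k _.
    by apply: mhA; case: (HF k).
Qed.

End Dynkin.

Section Square2.
Context {R : realType}.
Local Notation mu := (@lebesgue_measure R).
Local Notation mu2 := (@lebesgue2 R).
Implicit Types (f g : R -> R) (u v w : R * R -> R).

Lemma open_measurable2 (U : set (R * R)) : open U -> measurable U.
Proof.
move=> oU.
pose rect (q : (rat * rat) * (rat * rat)) : set (R * R) :=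
  `]ratr q.1.1, ratr q.1.2[%classic `*` `]ratr q.2.1, ratr q.2.2[%classic.
pose F q := if `[< rect q `<=` U >] then rect q else set0.
have -> : U = \bigcup_q F q.
  apply/seteqP; split=> [[x y] Uxy|p [q _]]; last first.
    by rewrite /F; case: asboolP => // rU /rU.
  have [[A B] /= [nA nB] AB] : nbhs (x, y) U by exact: open_nbhs_nbhs.
  have [e1 /= e10 h1] := (nbhs_ballP _ _).1 nA.
  have [e2 /= e20 h2] := (nbhs_ballP _ _).1 nB.
  have pick (z e : R) : 0 < e -> exists q1 q2 : rat,
      ratr q1 < z < ratr q2 /\ forall t : R, ratr q1 < t < ratr q2 -> ball z e t.
    move=> e0; have [q1 h] := @rat_in_itvoo R (z - e) z (ltac:(by rewrite ltrBlDr ltrDl)).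
    have [q2 h'] := @rat_in_itvoo R z (z + e) (ltac:(by rewrite ltrDl)).
    move: h h'; rewrite !in_itv/= => /andP[a1 a2] /andP[a3 a4].
    exists q1, q2; rewrite a2 a3; split => // t /andP[a5 a6].
    by rewrite /ball/= ltr_distlC; apply/andP; split; lra.
  have [q1 [q2 [hx Hx]]] := pick x e1 e10.
  have [q3 [q4 [hy Hy]]] := pick y e2 e20.
  exists ((q1, q2), (q3, q4)) => //; rewrite /F; case: asboolP.
    by move=> _; split; rewrite /= in_itv.
  case=> -[s t] [/= hs ht]; apply: AB; split; [apply: h1|apply: h2].
    by apply: Hx; rewrite in_itv/= in hs.
  by apply: Hy; rewrite in_itv/= in ht.
apply: countable_bigcupT_measurable => [|q]; first exact: countableP.
rewrite /F; case: asboolP => _ //.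
by apply: measurableX; exact: measurable_itv.
Qed.

Lemma continuous_measurable2 u : continuous u -> measurable_fun setT u.
Proof.
move=> cu mD; apply: (measurability _ (RGenOInfty.measurableE R)) => //.
move=> /= _ [_ [a ->] <-]; rewrite setTI; apply: open_measurable2.
by apply: open_comp => [x _|]; [exact: cu|exact: interval_open].
Qed.

Lemma measurable_unit_itv : measurable (@unit_itv R).
Proof. exact: measurable_itv. Qed.

Lemma measurable_Omega : measurable (@Omega R).
Proof. by apply: measurableX; exact: measurable_itv. Qed.

Lemma mu_unit_itv : mu unit_itv = 1%E.
Proof. by rewrite lebesgue_measure_itv/= lte_fin ltr01 oppr0 adde0. Qed.

Lemma mu_unit_itv_fin : (mu unit_itv < +oo)%E.
Proof. by rewrite mu_unit_itv ltry. Qed.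

Lemma mu2_Omega : mu2 Omega = 1%E.
Proof.
rewrite /lebesgue2 product_measure1E//; [|exact: measurable_itv|exact: measurable_itv].
by transitivity (mu unit_itv * mu unit_itv)%E; [|rewrite !mu_unit_itv mule1].
Qed.

Lemma mu2_Omega_fin : (mu2 Omega < +oo)%E.
Proof. by rewrite mu2_Omega ltry. Qed.

Lemma continuous_bounded_square u : continuous u ->
  exists2 M, 0 <= M & forall p, 0 <= p.1 <= 1 -> 0 <= p.2 <= 1 -> `|u p| <= M.
Proof.
move=> cu; pose K : set (R * R) := `[0, 1]%classic `*` `[0, 1]%classic.
have cK : compact K by apply: compact_setX; exact: segment_compact.
have K0 : K !=set0 by exists (0, 0); split; rewrite /= in_itv/= lexx ler01.
have cn : {within K, continuous (fun p => `|u p|)}.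
  apply: continuous_subspaceT => p; apply: continuous_comp; first exact: cu.
  exact: norm_continuous.
have [c _ hc] := compact_EVT_max K0 cK cn.
exists `|u c|; first exact: normr_ge0.
by move=> p p1 p2; apply: hc; rewrite inE; split; rewrite /= in_itv.
Qed.

Lemma continuous_bounded_segment f (a b : R) : {within `[a, b], continuous f} ->
  exists2 M, 0 <= M & forall x, a <= x <= b -> `|f x| <= M.
Proof.
move=> cf; have [ab|ba] := leP a b; last first.
  by exists 0 => // x /andP[ax xb]; have := le_trans ax xb; rewrite leNgt ba.
have K0 : (`[a, b]%classic : set R) !=set0 by exists a; rewrite /= in_itv/= lexx.
have cn : {within `[a, b], continuous (fun p => `|f p|)}.
  move=> x; apply: continuous_comp; first exact: cf.
  exact: norm_continuous.
have [c _ hc] := compact_EVT_max K0 (@segment_compact _ _ _) cn.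
exists `|f c|; first exact: normr_ge0.
by move=> x xab; apply: hc; rewrite inE/= in_itv.
Qed.

Lemma Omega_itv (p : R * R) : Omega p -> (0 < p.1 < 1) /\ (0 < p.2 < 1).
Proof. by case=> /=; rewrite /unit_itv/= !in_itv. Qed.

Lemma L2_continuous u : continuous u -> L2_Omega u.
Proof.
move=> cu; have [M _ hM] := continuous_bounded_square cu.
apply: (@L2_bounded _ _ R mu2 _ measurable_Omega _ M) => //; first exact: mu2_Omega_fin.
  by apply: measurable_funTS; exact: continuous_measurable2.
move=> p /Omega_itv[/andP[a1 a2] /andP[a3 a4]].
by apply: hM; rewrite !ltW.
Qed.

Lemma L2_continuous1 f : continuous f -> L2 mu unit_itv f.
Proof.
move=> cf.
have [M _ hM] := @continuous_bounded_segment f 0 1 (continuous_subspaceT cf).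
apply: (@L2_bounded _ _ R mu _ measurable_unit_itv _ M) => //; first exact: mu_unit_itv_fin.
  by apply: measurable_funTS; exact: continuous_measurable_fun.
by move=> x; rewrite /unit_itv/= in_itv/= => /andP[a1 a2]; apply: hM; rewrite !ltW.
Qed.

Lemma Rfubini1 (A B : set R) u : measurable A -> measurable B ->
  mu2.-integrable (A `*` B) (EFin \o u) ->
  \int[mu2]_(p in A `*` B) u p = \int[mu]_(x in A) \int[mu]_(y in B) u (x, y).
Proof.
move=> mA mB iu; have mAB := measurableX mA mB.
pose F := ((EFin \o u) \_ (A `*` B) : R * R -> \bar R).
have iF : mu2.-integrable setT F by have := (@integrable_mkcond _ _ R mu2 (A `*` B) (EFin \o u) mAB).1 iu.
pose G x := (\int[mu]_(y in B) (u (x, y))%:E)%E.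
have e x : (G \_ A) x = fubini_F mu F x.
  rewrite /fubini_F /F /G /patch; case: ifPn => xA.
    rewrite [LHS]integral_mkcond; apply: eq_integral => y _; rewrite /patch.
    suff -> : ((x, y) \in A `*` B) = (y \in B) by [].
    apply/idP/idP; rewrite !inE; first by case.
    by move=> yB; split=> //; exact: set_mem.
  rewrite integral0_eq// => y _; case: ifPn => //; rewrite inE => -[/= /mem_set].
  by rewrite (negbTE xA).
have eG : G \_ A = fubini_F mu F by apply/funext.
rewrite /Rintegral [in LHS]integral_mkcond -/F -(integral12_prod_meas1 iF); congr fine.
transitivity (\int[mu]_x (G \_ A) x)%E; first by apply: eq_integral => x _; rewrite e.
rewrite [RHS]integral_mkcond; apply: ae_eq_integral => //.
- by rewrite eG; exact: measurable_fubini_F iF.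
- have -> : (fun x => (fine (G x))%:E) \_ A = (fun x => (fine (fubini_F mu F x))%:E).
    by apply/funext => x; rewrite -e /patch; case: ifP.
  apply/measurable_EFinP; apply: (measurableT_comp (fine_measurable measurableT)).
  exact: measurable_fubini_F iF.
- have := integrable_ae measurableT (integrable_fubini_F iF).
  apply: filterS => x /(_ Logic.I) fx _.
  have {}fx : (G \_ A) x \is a fin_num by rewrite e.
  by move: fx; rewrite /patch; case: ifP => // _ fx; rewrite fineK.
Qed.

End Square2.

(** * Smooth approximations of indicator functions *)

Section TestFunctions.
Context {R : realType}.
Local Notation mu := (@lebesgue_measure R).
Local Notation mu2 := (@lebesgue2 R).
Implicit Types (f g : R -> R) (u v w : R * R -> R).

Lemma Rfubini2 (A B : set R) u : measurable A -> measurable B ->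
  mu2.-integrable (A `*` B) (EFin \o u) ->
  \int[mu2]_(p in A `*` B) u p = \int[mu]_(y in B) \int[mu]_(x in A) u (x, y).
Proof.
move=> mA mB iu; have mAB := measurableX mA mB.
pose F := ((EFin \o u) \_ (A `*` B) : R * R -> \bar R).
have iF : mu2.-integrable setT F.
  by have := (@integrable_mkcond _ _ R mu2 (A `*` B) (EFin \o u) mAB).1 iu.
pose G y := (\int[mu]_(x in A) (u (x, y))%:E)%E.
have e y : (G \_ B) y = fubini_G mu F y.
  rewrite /fubini_G /F /G /patch; case: ifPn => yB.
    rewrite [LHS]integral_mkcond; apply: eq_integral => x _; rewrite /patch.
    suff -> : ((x, y) \in A `*` B) = (x \in A) by [].
    apply/idP/idP; rewrite !inE; first by case.
    by move=> xA; split=> //; exact: set_mem.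
  rewrite integral0_eq// => x _; case: ifPn => //; rewrite inE => -[/= _ /mem_set].
  by rewrite (negbTE yB).
have eG : G \_ B = fubini_G mu F by apply/funext.
rewrite /Rintegral [in LHS]integral_mkcond -/F -(integral21_prod_meas1 iF); congr fine.
transitivity (\int[mu]_y (G \_ B) y)%E; first by apply: eq_integral => x _; rewrite e.
rewrite [RHS]integral_mkcond; apply: ae_eq_integral => //.
- by rewrite eG; exact: measurable_fubini_G iF.
- have -> : (fun x => (fine (G x))%:E) \_ B = (fun x => (fine (fubini_G mu F x))%:E).
    by apply/funext => x; rewrite -e /patch; case: ifP.
  apply/measurable_EFinP; apply: (measurableT_comp (fine_measurable measurableT)).
  exact: measurable_fubini_G iF.
- apply: filterS (ae_integrable2 iF) => x ix _.
  have fx : (G \_ B) x \is a fin_num by rewrite e; exact: integrable_fin_num ix.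
  by move: fx; rewrite /patch; case: ifP => // _ fx; rewrite fineK.
Qed.

(** A product that is positive exactly on the interval with end points a + d
    and b - d, where d = 1 / (n + 1). *)
Definition hump (a b : R) n (x : R) : R :=
  flat 0 (1 * x + - (a + n.+1%:R^-1)) * flat 0 (-1 * x + (b - n.+1%:R^-1)).

(** Smooth approximations of the indicator function of an interval; the power
    drives the value to 1 wherever the hump is positive. *)
Definition plateau (a b : R) n (x : R) : R := 1 - (1 - hump a b n x) ^+ n.

Lemma hump_itv a b n x : 0 <= hump a b n x <= 1.
Proof.
have /andP[h1 h2] := flat0_itv (1 * x + - (a + n.+1%:R^-1)).
have /andP[h3 h4] := flat0_itv (-1 * x + (b - n.+1%:R^-1)).
by rewrite mulr_ge0//= -[leRHS]mulr1 ler_pM.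
Qed.

Lemma plateau_itv a b n x : 0 <= plateau a b n x <= 1.
Proof.
have /andP[h1 h2] := hump_itv a b n x.
have h3 : 0 <= 1 - hump a b n x by rewrite subr_ge0.
have h4 : 1 - hump a b n x <= 1 by rewrite lerBlDr lerDl.
rewrite /plateau subr_ge0 exprn_ile1//= lerBlDr lerDl exprn_ge0//.
Qed.

Lemma plateau_support a b n x : ~ (a + n.+1%:R^-1 <= x <= b - n.+1%:R^-1) ->
  plateau a b n x = 0.
Proof.
move=> nx; rewrite /plateau; suff -> : hump a b n x = 0 by rewrite subr0 expr1n subrr.
rewrite /hump /flat; case: ltP => h1; last by rewrite mul0r.
case: ltP => h2; last by rewrite mulr0.
exfalso; apply: nx; move: h1 h2; move: (n.+1%:R^-1) => p h1 h2.
by apply/andP; split; lra.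
Qed.

Lemma smooth1_exprn f n : smooth1 f -> smooth1 (fun x => f x ^+ n).
Proof.
move=> sf; elim: n => [|n IHn].
  have -> : (fun x => f x ^+ 0) = cst 1 by apply/funext => x; rewrite expr0.
  exact: smooth1_cst.
have -> : (fun x => f x ^+ n.+1) = f \* (fun x => f x ^+ n).
  by apply/funext => x; rewrite exprS.
exact: smooth1M.
Qed.

Lemma smooth1_plateau a b n : smooth1 (plateau a b n).
Proof.
have sh : smooth1 (hump a b n).
  have h1 := @smooth1_affine _ _ 1 (- (a + n.+1%:R^-1)) (@smooth1_flat R 0).
  have h2 := @smooth1_affine _ _ (-1) (b - n.+1%:R^-1) (@smooth1_flat R 0).
  exact: (smooth1M h1 h2).
have s1 : smooth1 (fun x => 1 - hump a b n x).
  have -> : (fun x => 1 - hump a b n x) = cst 1 \+ (cst (-1) \* hump a b n).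
    by apply/funext => x /=; rewrite mulN1r.
  by apply: smooth1D; [exact: smooth1_cst|exact: (smooth1M (@smooth1_cst R (-1)) sh)].
have -> : plateau a b n = cst 1 \+ (cst (-1) \* (fun x => (1 - hump a b n x) ^+ n)).
  by apply/funext => x /=; rewrite mulN1r.
apply: smooth1D; [exact: smooth1_cst|apply: smooth1M; first exact: smooth1_cst].
exact: smooth1_exprn.
Qed.

Lemma flat0_mono (x y : R) : x <= y -> flat 0 x <= flat 0 y.
Proof.
move=> xy; rewrite {1}/flat; case: ltP => x0; last by have /andP[] := flat0_itv y.
have y0 := lt_le_trans x0 xy.
by rewrite /flat y0 !expr0 !mul1r ler_expR lerN2 lef_pV2 ?posrE.
Qed.

Lemma invS_cvg0 : n.+1%:R^-1 @[n --> \oo] --> (0 : R).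
Proof. exact: cvg_harmonic. Qed.

Lemma plateau_cvg a b x :
  plateau a b n x @[n --> \oo] --> (\1_(`]a, b[%classic : set R) x : R).
Proof.
rewrite indicE; have -> : (x \in (`]a, b[%classic : set R)) = (a < x < b).
  by apply/idP/idP; rewrite inE /= in_itv.
case: (boolP (a < x < b)) => xab; last first.
  have -> : (plateau a b) ^~ x = cst 0.
    apply/funext => n /=; apply: plateau_support; apply/negP; apply: contra xab.
    have n0 : 0 < n.+1%:R^-1 :> R by rewrite invr_gt0.
    by move: (n.+1%:R^-1) n0 => p p0 /andP[h1 h2]; apply/andP; split; lra.
  exact: cvg_cst.
have /andP[ax xb] := xab.
pose c := Num.min (x - a) (b - x) / 2.
have c0 : 0 < c by rewrite divr_gt0// lt_min !subr_gt0 ax xb.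
have cxa : 2 * c <= x - a by rewrite /c mulrC divfK// ge_min lexx.
have cbx : 2 * c <= b - x by rewrite /c mulrC divfK// ge_min lexx orbT.
pose r := flat 0 c * flat 0 c.
have r0 : 0 < r by rewrite mulr_gt0// flat0_gt0.
have r1 : r <= 1 by have /andP[h1 h2] := flat0_itv c; rewrite -[leRHS]mulr1 ler_pM.
suff h : (1 - hump a b n x) ^+ n @[n --> \oo] --> (0 : R).
  have h2 : 1 - (1 - hump a b n x) ^+ n @[n --> \oo] --> (1 - 0 : R).
    by apply: cvgB => //; exact: cvg_cst.
  by rewrite subr0 in h2; exact: h2.
apply: (@squeeze_cvgr _ _ _ _ (cst 0) (fun n => (1 - r) ^+ n)).
- near=> n; have /andP[h1 h2] := hump_itv a b n x.
  have h3 : 0 <= 1 - hump a b n x by rewrite subr_ge0.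
  rewrite /cst exprn_ge0//=; apply: lerXn2r; rewrite ?nnegrE ?subr_ge0//.
  rewrite lerD2l lerN2 /r /hump.
  have nc : n.+1%:R^-1 < c.
    near: n; have /cvgrPdist_lt/(_ _ c0) := invS_cvg0.
    by apply: filterS => n; rewrite sub0r normrN gtr0_norm// invr_gt0.
  have f0 y : 0 <= flat 0 y :> R by have /andP[] := flat0_itv y.
  by apply: ler_pM => //; apply: flat0_mono; move: nc; move: (n.+1%:R^-1) => p; lra.
- exact: cvg_cst.
- apply: cvg_trans (@cvg_geometric R 1 (1 - r) _); last first.
    by rewrite ltr_norml; apply/andP; split; lra.
  by apply: near_eq_cvg; apply: nearW => n; rewrite /= mul1r.
Unshelve. all: by end_near.
Qed.

Lemma plateau_test1 a b n : 0 <= a -> b <= 1 -> test_fun1 (plateau a b n).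
Proof.
move=> a0 b1; split; first exact: smooth1_plateau.
exists (`[a + n.+1%:R^-1, b - n.+1%:R^-1]%classic); last first.
  by move=> x; rewrite /= in_itv/= => /plateau_support.
split; first exact: segment_compact.
move=> x; rewrite /unit_itv /= !in_itv/=.
have : 0 < n.+1%:R^-1 :> R by rewrite invr_gt0.
by move: (n.+1%:R^-1) => p p0 /andP[h1 h2]; apply/andP; split; lra.
Qed.

End TestFunctions.

(** * Tensor products and smoothness on the plane *)

Section Tensor.
Context {R : realType}.
Local Notation mu := (@lebesgue_measure R).
Local Notation mu2 := (@lebesgue2 R).
Implicit Types (f g : R -> R) (u v w : R * R -> R).

Lemma test1_smooth f : test_fun1 f -> smooth1 f.
Proof. by case. Qed.

Definition tensor f g : R * R -> R := fun p => f p.1 * g p.2.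


Lemma is_derive_tensor1 f (c x : R) : smooth1 f ->
  is_derive x 1 (fun t => f t * c) (f^`()%classic x * c).
Proof.
move=> sf; rewrite mulrC.
have := is_deriveM (smooth1_is_derive x sf) (is_derive_cst c x 1).
by rewrite /GRing.scale/= mulr0 add0r.
Qed.

Lemma is_derive_tensor2 f (c x : R) : smooth1 f ->
  is_derive x 1 (fun t => c * f t) (c * f^`()%classic x).
Proof.
move=> sf; have := is_deriveM (is_derive_cst c x 1) (smooth1_is_derive x sf).
by rewrite /GRing.scale/= mulr0 addr0.
Qed.

Lemma is_derive1E f (x df : R) : is_derive x (1 : R) f df -> f^`()%classic x = df.
Proof. by move=> h; rewrite derive1E; apply: derive_val. Qed.

Lemma derivable_tensor i f g (p : R * R) : smooth1 f -> smooth1 g ->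
  derivable (slice i (tensor f g) p) (coordinate i p) 1.
Proof.
move=> sf sg; case: i; rewrite /slice /coordinate /tensor /=.
  by have [] := is_derive_tensor2 (f p.1) p.2 sg.
by have [] := is_derive_tensor1 (g p.2) p.1 sf.
Qed.

Lemma pd_tensor i f g : smooth1 f -> smooth1 g -> pd i (tensor f g) =
  if i then tensor f g^`()%classic else tensor f^`()%classic g.
Proof.
move=> sf sg; apply/funext => p; case: i; rewrite /pd /slice /coordinate /tensor /=.
  exact: (is_derive1E (is_derive_tensor2 (f p.1) p.2 sg)).
exact: (is_derive1E (is_derive_tensor1 (g p.2) p.1 sf)).
Qed.

Lemma continuous_tensor f g : continuous f -> continuous g -> continuous (tensor f g).
Proof.
move=> cf cg p; apply: cvgM.
  by apply: (@continuous_comp _ _ _ fst f); [exact: cvg_fst|exact: cf].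
by apply: (@continuous_comp _ _ _ snd g); [exact: cvg_snd|exact: cg].
Qed.

Lemma smooth_tensor f g : smooth1 f -> smooth1 g -> smooth (tensor f g).
Proof.
move=> sf sg s.
suff [f' [g' [sf' sg' ->]]] : exists f' g', [/\ smooth1 f', smooth1 g' &
    foldr pd (tensor f g) s = tensor f' g'].
  split; last by move=> i p; exact: derivable_tensor.
  by apply: continuous_tensor; exact: smooth1_continuous.
elim: s => [|i s [f' [g' [sf' sg' e]]]]; first by exists f, g.
rewrite /= e pd_tensor//; case: i.
  by exists f', (g'^`()%classic); split; [exact: sf'|exact: smooth1_derive|].
by exists (f'^`()%classic), g'; split; [exact: smooth1_derive|exact: sg'|].
Qed.

Lemma test_tensor f g : test_fun1 f -> test_fun1 g -> test_fun (tensor f g).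
Proof.
move=> [sf [K [cK KI] Kf]] [sg [K' [cK' K'I] Kg]]; split; first exact: (smooth_tensor sf sg).
exists (K `*` K'); first by split; [exact: compact_setX|move=> p [/KI ? /K'I ?]; split].
move=> p nK; rewrite /tensor; have [/Kg ->|k2] := pselect (~ K' p.2); first by rewrite mulr0.
rewrite Kf ?mul0r// => k1; apply: nK; split => //; exact: contrapT.
Qed.

Lemma smooth_pd i u : smooth u -> smooth (pd i u).
Proof. by move=> su s; have := su (rcons s i); rewrite foldr_rcons. Qed.

Lemma smooth_continuous u : smooth u -> continuous u.
Proof. by move=> /(_ [::])[]. Qed.

Lemma smooth_is_derive i u p : smooth u ->
  is_derive (coordinate i p) (1 : R) (slice i u p) (pd i u p).
Proof.
move=> /(_ [::])[_ /(_ i p) /= h]; apply: DeriveDef => //.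
by rewrite /pd derive1E.
Qed.

Lemma test_smooth u : test_fun u -> smooth u.
Proof. by case. Qed.

Lemma test_pd i u : test_fun u -> test_fun (pd i u).
Proof.
move=> [su [K [cK KO] Ku]]; split; first exact: smooth_pd.
exists K => // -[p1 p2] nKp.
have clK : closed K by apply: compact_closed => //; exact: norm_hausdorff.
have up : \forall q \near (p1, p2), u q = 0.
  have := open_nbhs_nbhs (conj (closed_openC clK) nKp).
  by apply: filterS => q /Ku.
have : \forall t \near coordinate i (p1, p2), (cst 0 : R -> R) t = slice i u (p1, p2) t.
  rewrite /slice; case: i => /=.
    have h : (p1, t) @[t --> p2] --> (p1, p2) by exact: (cvg_pair (cvg_cst _) cvg_id).
    have hu : \forall t \near p2, u (p1, t) = 0 := h _ up.
    by apply: filterS hu => t /= ->.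
  have h : (t, p2) @[t --> p1] --> (p1, p2) by exact: (cvg_pair cvg_id (cvg_cst _)).
  have hu : \forall t \near p1, u (t, p2) = 0 := h _ up.
  by apply: filterS hu => t /= ->.
move=> h; rewrite /pd derive1E; apply: derive_val.
by apply: (near_eq_is_derive h); exact: is_derive_cst.
Qed.

End Tensor.

(** * Test functions separate square-integrable functions *)

Section Separating.
Context {R : realType}.
Local Notation mu := (@lebesgue_measure R).
Local Notation mu2 := (@lebesgue2 R).
Implicit Types (f g : R -> R) (u v w : R * R -> R).

(** Products of plateaus approximate the indicator functions of the rectangles,
    which generate the Borel sets, so that w integrates to zero on all of them. *)
Lemma test_separating w : L2_Omega w ->
  (forall phi, test_fun phi -> \int[mu2]_(p in Omega) (w p * phi p) = 0) ->
  {ae mu2, forall p, Omega p -> w p = 0}.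
Proof.
move=> Lw w0; have mO := @measurable_Omega R.
have iw : mu2.-integrable Omega (EFin \o w).
  have := L2_integ_mul (m := mu2) mO Lw (L2_cst (m := mu2) mO 1 (@mu2_Omega_fin R)).
  by apply: eq_integrable => // p _ /=; rewrite mulr1.
have rect0 a b : 0 <= a -> 0 <= b ->
    (\int[mu2]_(p in Omega `&` (`]a, +oo[%classic `*` `]b, +oo[%classic)) (w p)%:E = 0)%E.
  move=> a0 b0; set A : set (R * R) := _ `*` _.
  have mA : measurable A by apply: measurableX; exact: measurable_itv.
  pose phi n := tensor (plateau a 1 n) (plateau b 1 n).
  have tphi n : test_fun (phi n) by apply: test_tensor; exact: plateau_test1.
  have mphi n : measurable_fun Omega (phi n).
    apply: measurable_funTS; apply: continuous_measurable2.
    exact: smooth_continuous (test_smooth (tphi n)).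
  have mw : measurable_fun Omega w by exact: (L2_measurable (m := mu2) mO Lw).
  have mind : measurable_fun (Omega : set (R * R)) (\1_A : R * R -> R).
    by apply: measurable_funTS; exact: measurable_indic.
  have [|||||_ _] := @dominated_convergence _ _ R mu2 Omega mO
    (fun n p => (w p * phi n p)%:E) (fun p => (w p * \1_A p)%:E) (fun p => `|w p|%:E).
  - by move=> n; apply/measurable_EFinP; exact: (measurable_funM mw (mphi n)).
  - by apply/measurable_EFinP; exact: (measurable_funM mw mind).
  - apply: nearW => p /Omega_itv[/andP[p1 p2] /andP[p3 p4]].
    apply: cvg_EFin; first exact: nearW.
    apply: cvgM; first exact: cvg_cst.
    have -> : \1_A p = \1_(`]a, 1[%classic : set R) p.1 * \1_(`]b, 1[%classic : set R) p.2 :> R.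
      rewrite !indicE -natrM mulnb; congr (nat_of_bool _)%:R.
      by apply/idP/andP; rewrite !inE /A /= !in_itv/= !andbT p2 p4 !andbT.
    by apply: cvgM; exact: plateau_cvg.
  - exact: integrable_abse iw.
  - apply: nearW => p n _ /=; rewrite lee_fin normrM ler_piMr//.
    rewrite /phi /tensor; have /andP[h1 h2] := plateau_itv a 1 n p.1.
    have /andP[h3 h4] := plateau_itv b 1 n p.2.
    by rewrite ger0_norm ?mulr_ge0// -[leRHS]mulr1 ler_pM.
  move=> cv.
  have z n : (\int[mu2]_(p in Omega) (w p * phi n p)%:E = 0)%E.
    rewrite -[LHS]fineK; last first.
      apply: integrable_fin_num => //.
      by apply: (L2_integ_mul (m := mu2) mO Lw); apply: L2_continuous; exact: smooth_continuous (test_smooth (tphi n)).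
    by have := w0 _ (tphi n); rewrite /Rintegral => ->.
  have : (fun n => \int[mu2]_(p in Omega) (w p * phi n p)%:E)%E @ \oo --> 0%E.
    by under eq_fun do rewrite z; exact: cvg_cst.
  move=> /(cvg_unique _ cv) => /(_ (@ereal_hausdorff R)) <-.
  rewrite integral_mkcondr; apply: eq_integral => p _.
  by rewrite /patch /= indicE; case: (p \in A); rewrite ?mulr1 ?mulr0.
have e c (t : R) : 0 < t ->
    (`]c, +oo[%classic : set R) t = (`]Num.max c 0, +oo[%classic : set R) t.
  by move=> t0; rewrite /= !in_itv/= !andbT gt_max t0 andbT.
have rect1 a b :
    (\int[mu2]_(p in Omega `&` (`]a, +oo[%classic `*` `]b, +oo[%classic)) (w p)%:E = 0)%E.
  rewrite -[RHS](rect0 (Num.max a 0) (Num.max b 0)) ?le_max ?lexx ?orbT//.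
  congr (integral _ _ _); apply/seteqP; split => p [Op [h1 h2]];
    case: (Omega_itv Op) => /andP[z1 _] /andP[z2 _]; split => //; split.
  - by rewrite -e.
  - by rewrite -e.
  - by rewrite e.
  - by rewrite e.
have CI : setI_closed (@RGenOInfty.G R).
  move=> _ _ [x ->] [y ->]; exists (Num.max x y).
  apply/seteqP; split=> t /=; rewrite !in_itv/= !andbT gt_max.
    by move=> [-> ->].
  by move=> /andP.
have all1 : (Omega : set (R * R)) `<=` `]-1, +oo[%classic `*` `]-1, +oo[%classic.
  move=> p /Omega_itv[/andP[z1 _] /andP[z2 _]].
  by split; rewrite /= in_itv/= andbT; [move: z1|move: z2] => /(lt_trans _); apply; lra.
have mitv (b : R) : measurable (`]b, +oo[%classic : set R) by exact: measurable_itv.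
have step1 (b : R) (A : set R) : measurable A ->
    (\int[mu2]_(p in Omega `&` (A `*` `]b, +oo[%classic)) (w p)%:E = 0)%E.
  have sE (B : set R) : Omega `&` (B `*` `]b, +oo[%classic) =
      (Omega `&` (setT `*` `]b, +oo[%classic)) `&` (fst @^-1` B) :> set (R * R).
    by apply/seteqP; split => p /=; [case=> ? []|case=> [[? []]]].
  have mD : measurable (Omega `&` (setT `*` `]b, +oo[%classic) : set (R * R)).
    by apply: measurableI => //; apply: measurableX.
  move=> mA; rewrite sE; apply: (@integral_dynkin _ _ _ _ R mu2 _ (EFin \o w) fst _ mD _
    measurable_fst CI (RGenOInfty.measurableE R)) => //.
  - exact: integrableS iw.
  - by move=> _ [a ->]; rewrite -sE rect1.
  - rewrite -[RHS](rect1 (-1) b) (sE (`]-1, +oo[%classic)); congr (integral _ _ _).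
    by apply/seteqP; split => p; [move=> h; split; [exact: h|exact: (all1 p h.1).1]|case].
have step2 (A B : set R) : measurable A -> measurable B ->
    (\int[mu2]_(p in Omega `&` (A `*` B)) (w p)%:E = 0)%E.
  move=> mA.
  have sE (C : set R) : Omega `&` (A `*` C) =
      (Omega `&` (A `*` setT)) `&` (snd @^-1` C) :> set (R * R).
    by apply/seteqP; split => p /=; [case=> ? []|case=> [[? []]]].
  have mD : measurable (Omega `&` (A `*` setT) : set (R * R)).
    by apply: measurableI => //; apply: measurableX.
  move=> mB; rewrite sE; apply: (@integral_dynkin _ _ _ _ R mu2 _ (EFin \o w) snd _ mD _
    measurable_snd CI (RGenOInfty.measurableE R)) => //.
  - exact: integrableS iw.
  - by move=> _ [b ->]; rewrite -sE step1.
  - rewrite -[RHS](step1 (-1) A mA) (sE (`]-1, +oo[%classic)); congr (integral _ _ _).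
    by apply/seteqP; split => p; [move=> h; split; [exact: h|exact: (all1 p h.1).2]|case].
have step3 (A : set (R * R)) : measurable A -> (\int[mu2]_(p in Omega `&` A) (w p)%:E = 0)%E.
  apply: (@integral_dynkin _ _ _ _ R mu2 _ (EFin \o w) id _ mO iw _ _
     (measurable_prod_measurableType _ _)) => //.
  - by move=> _ _ [A1 mA1 [A2 mA2 <-]] [B1 mB1 [B2 mB2 <-]];
      exists (A1 `&` B1); [exact: measurableI|exists (A2 `&` B2); [exact: measurableI|rewrite setXI]].
  - by move=> _ [A1 mA1 [A2 mA2 <-]]; exact: step2.
  - have := step2 setT setT measurableT measurableT; by rewrite setXTT setIT.
have aew : ae_eq mu2 Omega (EFin \o w) (cst 0%E).
  have := @integral_ae_eq _ _ R mu2 Omega mO (cst 0%E) (EFin \o w) iw (measurable_cst _).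
  apply => E EO mE.
  have := step3 E mE; rewrite setIidr// => ->.
  by rewrite integral0.
apply: (filterS _ aew) => p h Op; by have [] := h Op.
Qed.

(** The same argument with intervals in place of rectangles. *)
Lemma test1_separating g : L2 mu unit_itv g ->
  (forall phi, test_fun1 phi -> \int[mu]_(x in unit_itv) (g x * phi x) = 0) ->
  {ae mu, forall x, unit_itv x -> g x = 0}.
Proof.
move=> Lg g0; have mI := @measurable_unit_itv R.
have mg : measurable_fun unit_itv g by exact: (L2_measurable (m := mu) mI Lg).
have ig : mu.-integrable unit_itv (EFin \o g).
  have := L2_integ_mul (m := mu) mI Lg (L2_cst (m := mu) mI 1 (@mu_unit_itv_fin R)).
  by apply: eq_integrable => // p _ /=; rewrite mulr1.
have itv0 a : 0 <= a -> (\int[mu]_(x in unit_itv `&` `]a, +oo[%classic) (g x)%:E = 0)%E.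
  move=> a0; set A : set R := `]a, +oo[%classic.
  have mA : measurable A by exact: measurable_itv.
  have tphi n : test_fun1 (plateau a 1 n) by exact: plateau_test1.
  have cphi n : continuous (plateau a 1 n).
    by apply: smooth1_continuous; exact: smooth1_plateau.
  have mphi n : measurable_fun unit_itv (plateau a 1 n).
    by apply: measurable_funTS; apply: continuous_measurable_fun; exact: cphi.
  have mind : measurable_fun unit_itv (\1_A : R -> R).
    by apply: measurable_funTS; exact: measurable_indic.
  have [|||||_ _] := @dominated_convergence _ _ R mu unit_itv mI
    (fun n p => (g p * plateau a 1 n p)%:E) (fun p => (g p * \1_A p)%:E) (fun p => `|g p|%:E).
  - by move=> n; apply/measurable_EFinP; exact: (measurable_funM mg (mphi n)).
  - by apply/measurable_EFinP; exact: (measurable_funM mg mind).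
  - apply: nearW => p; rewrite /unit_itv /= in_itv/= => /andP[p1 p2].
    apply: cvg_EFin; first exact: nearW.
    apply: cvgM; first exact: cvg_cst.
    have -> : \1_A p = \1_(`]a, 1[%classic : set R) p :> R.
      rewrite !indicE; congr (nat_of_bool _)%:R.
      by apply/idP/idP; rewrite !inE /A /= !in_itv/= !andbT p2 andbT.
    exact: plateau_cvg.
  - exact: integrable_abse ig.
  - apply: nearW => p n _ /=; rewrite lee_fin normrM ler_piMr//.
    by have /andP[h1 h2] := plateau_itv a 1 n p; rewrite ger0_norm.
  move=> cv.
  have z n : (\int[mu]_(p in unit_itv) (g p * plateau a 1 n p)%:E = 0)%E.
    rewrite -[LHS]fineK; last first.
      apply: integrable_fin_num => //.
      by apply: (L2_integ_mul (m := mu) mI Lg); apply: L2_continuous1; exact: cphi.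
    by have := g0 _ (tphi n); rewrite /Rintegral => ->.
  have : (fun n => \int[mu]_(p in unit_itv) (g p * plateau a 1 n p)%:E)%E @ \oo --> 0%E.
    by under eq_fun do rewrite z; exact: cvg_cst.
  move=> /(cvg_unique _ cv) => /(_ (@ereal_hausdorff R)) <-.
  rewrite integral_mkcondr; apply: eq_integral => p _.
  by rewrite /patch /= indicE; case: (p \in A); rewrite ?mulr1 ?mulr0.
have itv1 a : (\int[mu]_(x in unit_itv `&` `]a, +oo[%classic) (g x)%:E = 0)%E.
  rewrite -[RHS](itv0 (Num.max a 0)) ?le_max ?lexx ?orbT//.
  congr (integral _ _ _); apply/seteqP; split => p [Op h1]; split => //; move: Op h1;
    by rewrite /unit_itv /= !in_itv/= !andbT gt_max => /andP[-> _]; rewrite andbT.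
have CI : setI_closed (@RGenOInfty.G R).
  move=> _ _ [x ->] [y ->]; exists (Num.max x y).
  apply/seteqP; split=> t /=; rewrite !in_itv/= !andbT gt_max.
    by move=> [-> ->].
  by move=> /andP.
have step (A : set R) : measurable A ->
    (\int[mu]_(p in unit_itv `&` id @^-1` A) (g p)%:E = 0)%E.
  apply: (@integral_dynkin _ _ _ _ R mu _ (EFin \o g) id _ mI ig _ CI
    (RGenOInfty.measurableE R)) => //.
  - by move=> _ [a ->]; exact: itv1.
  - rewrite -[RHS](itv1 (-1)); congr (integral _ _ _).
    apply/seteqP; split => p; last by case.
    move=> h; split => //; move: h; rewrite /unit_itv /= !in_itv/= andbT.
    by move=> /andP[/(lt_trans _) + _]; apply; lra.
have aew : ae_eq mu unit_itv (EFin \o g) (cst 0%E).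
  have := @integral_ae_eq _ _ R mu unit_itv mI (cst 0%E) (EFin \o g) ig (measurable_cst _).
  apply => E EO mE.
  have := step E mE; rewrite preimage_id setIidr// => ->.
  by rewrite integral0.
by apply: (filterS _ aew) => p h Op; have [] := h Op.
Qed.

End Separating.

(** * Integration along the sides of the square *)

Section Sides.
Context {R : realType}.
Local Notation mu := (@lebesgue_measure R).
Local Notation mu2 := (@lebesgue2 R).
Local Notation I := (@unit_itv R).
Local Notation mO := (@measurable_Omega R).
Local Notation mI := (@measurable_unit_itv R).
Local Notation dotO := (L2dot mu2 Omega).
Local Notation dot1 := (L2dot mu I).
Implicit Types (f g : R -> R) (u v w : R * R -> R).

Definition ipO : semi_inner (@L2_Omega R) dotO := L2dot_inner mu2 mO.
Definition ip1 : semi_inner (L2 mu I) dot1 := L2dot_inner mu mI.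

Lemma ftc (f f' : R -> R) (a b : R) : (forall x : R, is_derive x 1 f (f' x)) ->
  continuous f' -> a < b -> \int[mu]_(x in `]a, b[%classic) f' x = f b - f a.
Proof.
move=> df cf' ab.
have cf : continuous f.
  by move=> x; apply: differentiable_continuous; apply/derivable1_diffP; case: (df x).
have mf' : measurable_fun (`]a, b[%classic : set R) f'.
  by apply: measurable_funTS; exact: continuous_measurable_fun.
have FTC := @continuous_FTC2 R f' f a b ab.
rewrite /Rintegral integral_itv_obnd_cbnd; last exact/measurable_EFinP.
rewrite integral_itv_bndo_bndc; last first.
  by apply/measurable_EFinP; apply: measurable_funTS; exact: continuous_measurable_fun.
rewrite FTC//.
- exact: continuous_subspaceT.
- split.
  + by move=> x _; case: (df x).
  + by apply: cvg_at_right_filter; exact: cf.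
  + by apply: cvg_at_left_filter; exact: cf.
- by move=> x _; exact: is_derive1E.
Qed.

(** The point with coordinate s in the direction i, and t in the other one: t runs
    along the sides orthogonal to the direction i. *)
Definition side_pt (i : bool) (s t : R) : R * R := if i then (t, s) else (s, t).

Lemma side_pt_continuous i s : continuous (side_pt i s).
Proof.
by move=> t; case: i; [exact: (cvg_pair cvg_id (cvg_cst _))|exact: (cvg_pair (cvg_cst _) cvg_id)].
Qed.

Lemma side_pt_continuous2 i t : continuous ((side_pt i)^~ t).
Proof.
by move=> s; case: i; [exact: (cvg_pair (cvg_cst _) cvg_id)|exact: (cvg_pair cvg_id (cvg_cst _))].
Qed.

Lemma continuous_side i s u : continuous u -> continuous (u \o side_pt i s).
Proof. by move=> cu t; apply: continuous_comp; [exact: side_pt_continuous|exact: cu]. Qed.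

Lemma continuous_side2 i t u : continuous u -> continuous (fun s => u (side_pt i s t)).
Proof.
move=> cu s; apply: (@continuous_comp _ _ _ ((side_pt i)^~ t) u); last exact: cu.
exact: side_pt_continuous2.
Qed.

Lemma continuous_coordinate i : continuous (@coordinate R i).
Proof. by move=> p; case: i; [exact: cvg_snd|exact: cvg_fst]. Qed.

Lemma integ_continuous u : continuous u -> mu2.-integrable Omega (EFin \o u).
Proof.
move=> cu; have := L2_integ_mul (m := mu2) mO (L2_continuous cu)
  (L2_cst (m := mu2) mO 1 (@mu2_Omega_fin R)).
by apply: eq_integrable; [exact: mO|move=> p _ /=; rewrite mulr1].
Qed.

Lemma integ_continuous1 f : continuous f -> mu.-integrable I (EFin \o f).
Proof.
move=> cf; have := L2_integ_mul (m := mu) mI (L2_continuous1 cf) (L2_cst (m := mu) mI 1 (@mu_unit_itv_fin R)).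
by apply: eq_integrable; [exact: mI|move=> p _ /=; rewrite mulr1].
Qed.

Lemma Rfubini_side i u : mu2.-integrable Omega (EFin \o u) ->
  \int[mu2]_(p in Omega) u p = \int[mu]_(t in I) \int[mu]_(s in I) u (side_pt i s t).
Proof.
move=> iu; case: i; first exact: (Rfubini1 mI mI iu).
exact: (Rfubini2 mI mI iu).
Qed.

Lemma Rfubini_integrable i u : mu2.-integrable Omega (EFin \o u) ->
  mu.-integrable I (EFin \o (fun t => \int[mu]_(s in I) u (side_pt i s t))).
Proof.
move=> iu; pose F := ((EFin \o u) \_ Omega : R * R -> \bar R).
have iF : mu2.-integrable setT F.
  by have := (@integrable_mkcond _ _ R mu2 Omega (EFin \o u) mO).1 iu.
pose G t := (\int[mu]_(s in I) (u (side_pt i s t))%:E)%E.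
pose K := if i then fubini_F mu F else fubini_G mu F.
have iK : mu.-integrable setT K.
  rewrite /K; case: (i); first exact: integrable_fubini_F iF.
  have mF := measurable_int _ iF.
  apply/integrableP; split; first exact: measurable_fubini_G iF.
  have fin : (\int[mu]_y \int[mu]_x `|F (x, y)| < +oo)%E :=
    (@integrable21ltyP _ _ _ _ R mu mu F mF).1 iF.
  refine (le_lt_trans _ fin); apply: ge0_le_integral => //.
  - by apply: measurableT_comp => //; exact: measurable_fubini_G iF.
  - refine (@measurable_fun_fubini_tonelli_G _ _ (measurableTypeR R) (measurableTypeR R)
      R mu (abse \o F) _ _); last by move=> p; exact: abse_ge0.
    exact: (measurableT_comp (@abse_measurable R setT) mF).
  - move=> y _; apply: le_abse_integral => //.
    exact: (measurableT_comp mF (measurable_pair2 y)).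
have e t : (G \_ I) t = K t.
  rewrite /K /fubini_F /fubini_G /F /G /patch; case: ifPn => tI; case: i {G K iK}.
  - rewrite [LHS]integral_mkcond; apply: eq_integral => y _; rewrite /patch.
    suff -> : ((t, y) \in Omega) = (y \in I) by [].
    apply/idP/idP; rewrite !inE; first by case.
    by move=> yB; split=> //; exact: set_mem.
  - rewrite [LHS]integral_mkcond; apply: eq_integral => y _; rewrite /patch.
    suff -> : ((y, t) \in Omega) = (y \in I) by [].
    apply/idP/idP; rewrite !inE; first by case.
    by move=> yB; split=> //; exact: set_mem.
  - rewrite integral0_eq// => y _; case: ifPn => //; rewrite inE => -[/= /mem_set].
    by rewrite (negbTE tI).
  - rewrite integral0_eq// => y _; case: ifPn => //; rewrite inE => -[/= _ /mem_set].
    by rewrite (negbTE tI).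
refine ((@integrable_mkcond _ _ R mu I _ mI).2 _).
have fE : (EFin \o (fun t => \int[mu]_(s in I) u (side_pt i s t))) \_ I =
    (fun t => (fine (K t))%:E).
  by apply/funext => t; rewrite -e /patch; case: ifP.
rewrite fE; apply: (@le_integrable _ _ R mu setT measurableT _ K _ _ iK).
  apply/measurable_EFinP; apply: (measurableT_comp (fine_measurable measurableT)).
  exact: measurable_int iK.
by move=> t _; case: (K t) => [r| |] //=; rewrite leey.
Qed.

Lemma Rintegral_unit_cst c : \int[mu]_(x in I) c = c.
Proof.
transitivity (c * fine (mu I)); last by rewrite mu_unit_itv mulr1.
exact: (Rintegral_cst mu mI c).
Qed.

(** Regularity in the direction i only, which products inherit. *)
Definition c1 i u u' := [/\ continuous u, continuous u' &
  forall s t, is_derive s (1 : R) (fun s' => u (side_pt i s' t)) (u' (side_pt i s t))].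

Lemma c1_smooth i u : smooth u -> c1 i u (pd i u).
Proof.
move=> su; split; first exact: smooth_continuous.
  exact: smooth_continuous (smooth_pd i su).
move=> s t; have := smooth_is_derive i (side_pt i s t) su.
by case: i.
Qed.

Lemma c1M i u u' v v' : c1 i u u' -> c1 i v v' ->
  c1 i (fun p => u p * v p) (fun p => u p * v' p + v p * u' p).
Proof.
move=> [cu cu' du] [cv cv' dv]; split.
- by move=> p; apply: cvgM; [exact: cu|exact: cv].
- by move=> p; apply: cvgD; apply: cvgM; [exact: cu|exact: cv'|exact: cv|exact: cu'].
- by move=> s t; exact: (is_deriveM (du s t) (dv s t)).
Qed.

(** The fundamental theorem of calculus on each segment in the direction i,
    integrated in the other variable. *)
Lemma int_c1 i u u' : c1 i u u' -> \int[mu2]_(p in Omega) u' p =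
  \int[mu]_(t in I) (u (side_pt i 1 t) - u (side_pt i 0 t)).
Proof.
move=> [cu cu' du]; rewrite (Rfubini_side i); last exact: integ_continuous.
apply: eq_Rintegral => t _.
apply: (ftc (fun s => du s t)) => //; exact: continuous_side2.
Qed.

Lemma int_coordinate i f : continuous f ->
  \int[mu2]_(p in Omega) f (coordinate (~~ i) p) = \int[mu]_(t in I) f t.
Proof.
move=> cf; rewrite (Rfubini_side i); last first.
  apply: integ_continuous => p.
  by apply: (@continuous_comp _ _ _ (coordinate (~~ i)) f); [exact: continuous_coordinate|exact: cf].
by apply: eq_Rintegral => t _; case: i; exact: (Rintegral_unit_cst (f t)).
Qed.

Definition extend i s u : R * R -> R := fun p => u (side_pt i s (coordinate (~~ i) p)).

Lemma continuous_extend i s u : continuous u -> continuous (extend i s u).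
Proof.
move=> cu p; rewrite /extend.
apply: (@continuous_comp _ _ _ (coordinate (~~ i)) (u \o side_pt i s)).
  exact: continuous_coordinate.
exact: continuous_side.
Qed.

Lemma snorm_extend i s u : continuous u ->
  snorm dotO (extend i s u) = snorm dot1 (u \o side_pt i s).
Proof.
move=> cu; congr (Num.sqrt _).
rewrite /L2dot -(@int_coordinate i (fun t => (u \o side_pt i s) t * (u \o side_pt i s) t)) //.
by move=> t; apply: cvgM; exact: continuous_side.
Qed.

(** The variation of u along a segment is at most the integral of its
    derivative; integrating its square over the square bounds the traces. *)
Lemma trace_ineq i s u u' : 0 <= s <= 1 -> c1 i u u' ->
  snorm dotO (u - extend i s u) <= snorm dotO u'.
Proof.
move=> s01 [cu cu' du].
pose D t := \int[mu]_(r in I) (u' (side_pt i r t) * u' (side_pt i r t)).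
have L1 t : L2 mu I (fun r => u' (side_pt i r t)).
  by apply: L2_continuous1; exact: continuous_side2.
have bound t (x y : R) : 0 <= x <= 1 -> 0 <= y <= 1 -> x < y ->
    (u (side_pt i y t) - u (side_pt i x t)) ^+ 2 <= D t.
  move=> /andP[x0 x1] /andP[y0 y1] xy.
  have xyI : (`]x, y[%classic : set R) `<=` I.
    move=> r; rewrite /unit_itv /= !in_itv/= => /andP[r1 r2].
    by rewrite (le_lt_trans x0 r1) (lt_le_trans r2 y1).
  have cr : continuous (fun r => u' (side_pt i r t)) by exact: continuous_side2.
  have mxy : measurable (`]x, y[%classic : set R) by exact: measurable_itv.
  have iI := integ_continuous1 cr.
  have ixy : mu.-integrable (`]x, y[%classic : set R) (EFin \o (fun r => u' (side_pt i r t))).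
    have mI' := mI; by apply: integrableS iI.
  rewrite -(ftc (fun s => du s t) cr xy).
  have iaI : mu.-integrable I (EFin \o (fun r => `|u' (side_pt i r t)|)).
    by apply: integ_continuous1 => r; apply: continuous_comp; [exact: cr|exact: norm_continuous].
  have h1 := @le_normr_Rintegral _ _ R mu _ _ mxy ixy.
  have h2 : \int[mu]_(r in `]x, y[%classic) `|u' (side_pt i r t)| <=
      \int[mu]_(r in I) `|u' (side_pt i r t)|.
    rewrite /Rintegral; apply: fine_le.
    - by apply: integrable_fin_num => //; have mI' := mI; by apply: integrableS iaI.
    - by apply: integrable_fin_num => //; exact: mI.
    - apply: ge0_subset_integral => //; first exact: mI.
      by case/integrableP: iaI.
  have La : L2 mu I (fun r => `|u' (side_pt i r t)|).
    by apply: L2_continuous1 => r; apply: continuous_comp; [exact: cr|exact: norm_continuous].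
  have h3 := si_cs ip1 La (L2_cst (m := mu) mI 1 (@mu_unit_itv_fin R)).
  have n1 : snorm dot1 (cst 1) = 1.
    by rewrite /snorm /L2dot; under eq_Rintegral do rewrite mulr1; rewrite Rintegral_unit_cst sqrtr1.
  have h4 : \int[mu]_(r in I) `|u' (side_pt i r t)| <= snorm dot1 (fun r => `|u' (side_pt i r t)|).
    rewrite n1 mulr1 in h3; apply: le_trans h3; apply: le_trans (ler_norm _).
    by rewrite le_eqVlt; apply/orP; left; apply/eqP; apply: eq_Rintegral => r _; rewrite mulr1.
  have := le_trans h1 (le_trans h2 h4).
  rewrite -[leRHS]ger0_norm ?snorm_ge0// -ler_sqr ?nnegrE//.
  rewrite !real_normK ?num_real// (snorm_sqr ip1)// => h5; apply: le_trans h5 _.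
  rewrite le_eqVlt; apply/orP; left; apply/eqP; apply: eq_Rintegral => r _.
  by rewrite -normrM ger0_norm// -expr2 sqr_ge0.
have cd : continuous (u - extend i s u).
  by move=> p; apply: cvgB; [exact: cu|exact: continuous_extend].
have Ld := L2_continuous cd; have Lu' := L2_continuous cu'.
rewrite (snorm_le ipO)//; last exact: snorm_ge0.
rewrite (snorm_sqr ipO)// /L2dot (Rfubini_side i); last exact: (L2_integ_mul (m := mu2) mO).
rewrite [leRHS](Rfubini_side i); last exact: (L2_integ_mul (m := mu2) mO).
have ptw t r : I r -> (u - extend i s u) (side_pt i r t) ^+ 2 <= D t.
  rewrite /unit_itv /= in_itv/= => /andP[r0 r1].
  have -> : (u - extend i s u) (side_pt i r t) = u (side_pt i r t) - u (side_pt i s t).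
    by case: i {D L1 bound cd Ld du}.
  have [rs|sr|->] := ltgtP r s.
  - by rewrite -sqrrN opprB; apply: bound => //; rewrite !ltW.
  - by apply: bound => //; rewrite !ltW.
  - by rewrite subrr expr0n; apply: Rintegral_ge0 => ? _; exact: sqr_ge0.
apply: le_Rintegral; first exact: mI.
- exact: (Rfubini_integrable i (L2_integ_mul (m := mu2) mO Ld Ld)).
- exact: (Rfubini_integrable i (L2_integ_mul (m := mu2) mO Lu' Lu')).
move=> t _; rewrite -[leRHS]Rintegral_unit_cst; apply: le_Rintegral.
- exact: mI.
- have cs : continuous (fun r => (u - extend i s u) (side_pt i r t)) by exact: continuous_side2.
  exact: (L2_integ_mul (m := mu) mI (L2_continuous1 cs) (L2_continuous1 cs)).
- by apply: integ_continuous1 => x; exact: cvg_cst.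
- by move=> r Ir; rewrite -expr2; exact: ptw.
Qed.

End Sides.

(** * Smooth functions and weak derivatives *)

Section Sobolev.
Context {R : realType}.
Local Notation mu := (@lebesgue_measure R).
Local Notation mu2 := (@lebesgue2 R).
Local Notation I := (@unit_itv R).
Local Notation mO := (@measurable_Omega R).
Local Notation mI := (@measurable_unit_itv R).
Local Notation dotO := (L2dot mu2 Omega).
Local Notation dot1 := (L2dot mu I).
Local Notation nO := (snorm dotO).
Local Notation n1 := (snorm dot1).
Local Notation ipO := (@ipO R).
Local Notation ip1 := (@ip1 R).
Local Notation L2I := (L2 mu I).
Local Notation F := (R * R -> R).
Implicit Types (u v w : F) (f : bool -> F) (g : bool -> R -> R).

(** A wrapper that makes the definition of smoothness opaque to proof search. *)
Record Smooth u : Prop := MkSmooth { Smooth_def : smooth u }.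

Lemma Smooth_pd i u : Smooth u -> Smooth (pd i u).
Proof. by case=> su; constructor; exact: smooth_pd. Qed.

Lemma Smooth_continuous u : Smooth u -> continuous u.
Proof. by case=> su; exact: smooth_continuous su. Qed.

Lemma Smooth_c1 i u : Smooth u -> c1 i u (pd i u).
Proof. by case=> su; exact: c1_smooth. Qed.

Lemma Smooth_is_derive i u p : Smooth u ->
  is_derive (coordinate i p) (1 : R) (slice i u p) (pd i u p).
Proof. by case=> su; exact: smooth_is_derive. Qed.

Lemma Smooth_intro u : (forall s : seq bool, continuous (foldr pd u s) /\
  forall i p, derivable (slice i (foldr pd u s) p) (coordinate i p) 1) -> Smooth u.
Proof. by move=> h; constructor; exact: h. Qed.

Lemma Smooth_foldr s u : Smooth u -> Smooth (foldr pd u s).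
Proof. by move=> su; elim: s => //= i s IHs; exact: Smooth_pd. Qed.

Lemma Smooth_derivable i u p : Smooth u -> derivable (slice i u p) (coordinate i p) 1.
Proof. by move=> /(Smooth_is_derive i p)[]. Qed.

Lemma pdD i u v : Smooth u -> Smooth v -> pd i (u + v) = pd i u + pd i v.
Proof.
move=> su sv; apply/funext => p.
have := is_deriveD (Smooth_is_derive i p su) (Smooth_is_derive i p sv).
by move=> h; rewrite /pd; case: i h => h; exact: (is_derive1E h).
Qed.

Lemma pdZ i c u : Smooth u -> pd i (c *: u) = c *: pd i u.
Proof.
move=> su; apply/funext => p.
have := is_deriveZ c (Smooth_is_derive i p su).
by move=> h; rewrite /pd; case: i h => h; exact: (is_derive1E h).
Qed.

Lemma SmoothZ c u : Smooth u -> Smooth (c *: u).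
Proof.
move=> su; apply: Smooth_intro => s.
have -> : foldr pd (c *: u) s = c *: foldr pd u s.
  by elim: s => [//|i s /= ->]; rewrite pdZ//; exact: Smooth_foldr.
have sf := Smooth_foldr s su; split.
  by move=> p; apply: cvgZr; exact: (Smooth_continuous sf).
move=> i p; have h : derivable (c *: slice i (foldr pd u s) p) (coordinate i p) 1.
  by apply: derivableZ; exact: Smooth_derivable.
by case: i h.
Qed.

Lemma SmoothD u v : Smooth u -> Smooth v -> Smooth (u + v).
Proof.
move=> su sv; apply: Smooth_intro => s.
have fu := Smooth_foldr s su; have fv := Smooth_foldr s sv.
have -> : foldr pd (u + v) s = foldr pd u s + foldr pd v s.
  elim: s {fu fv} => [//|i s /= ->]; rewrite pdD//; exact: Smooth_foldr.
split.
  by move=> p; apply: cvgD; [exact: (Smooth_continuous fu)|exact: (Smooth_continuous fv)].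
move=> i p; have h : derivable (slice i (foldr pd u s) p + slice i (foldr pd v s) p)
    (coordinate i p) 1 by apply: derivableD; exact: Smooth_derivable.
by case: i h.
Qed.

Lemma Smooth_lin c u v : Smooth u -> Smooth v -> Smooth (u + c *: v).
Proof. by move=> su sv; apply: SmoothD => //; exact: SmoothZ. Qed.

Lemma SmoothB u v : Smooth u -> Smooth v -> Smooth (u - v).
Proof. by move=> su sv; have := Smooth_lin (-1) su sv; rewrite scaleN1r. Qed.

Lemma pd_lin i c u v : Smooth u -> Smooth v -> pd i (u + c *: v) = pd i u + c *: pd i v.
Proof. by move=> su sv; rewrite pdD ?pdZ//; exact: SmoothZ. Qed.

Lemma pdB i u v : Smooth u -> Smooth v -> pd i (u - v) = pd i u - pd i v.
Proof. by move=> su sv; have := pd_lin i (-1) su sv; rewrite !scaleN1r. Qed.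

Lemma test_Smooth u : test_fun u -> Smooth u.
Proof. by case=> su _; constructor. Qed.

Lemma Smooth_L2 u : Smooth u -> L2_Omega u.
Proof. by move=> su; apply: L2_continuous; exact: Smooth_continuous su. Qed.

Lemma Smooth_L2side i s u : Smooth u -> L2I (u \o side_pt i s).
Proof.
by move=> su; apply: L2_continuous1; apply: continuous_side; exact: Smooth_continuous su.
Qed.

Lemma Smooth_trace i s u : 0 <= s <= 1 -> Smooth u ->
  n1 (u \o side_pt i s) <= nO u + nO (pd i u).
Proof.
move=> s01 su; have cu := Smooth_continuous su; rewrite -snorm_extend//.
have L1 := L2_continuous (continuous_extend (i := i) (s := s) cu).
apply: le_trans (snormB_le ipO L1 (Smooth_L2 su)) _.
rewrite (snormBC ipO)//; last exact: Smooth_L2.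
by rewrite lerD2l; exact: trace_ineq s01 (Smooth_c1 i su).
Qed.

Lemma Smooth_trace' i s u : 0 <= s <= 1 -> Smooth u ->
  nO u <= n1 (u \o side_pt i s) + nO (pd i u).
Proof.
move=> s01 su; have cu := Smooth_continuous su; rewrite -snorm_extend//.
have L1 := L2_continuous (continuous_extend (i := i) (s := s) cu).
apply: le_trans (snormB_le ipO (Smooth_L2 su) L1) _.
by rewrite lerD2l; exact: trace_ineq s01 (Smooth_c1 i su).
Qed.

Lemma test_side i s t u : test_fun u -> s = 0 \/ s = 1 -> u (side_pt i s t) = 0.
Proof.
move=> [_ [K [_ KO] Ku]] hs; apply: Ku => /KO /Omega_itv.
by case: i; case: hs => -> /=; rewrite !ltxx ?andbF /=; case=> //; case/andP.
Qed.

Lemma int_by_parts i u phi : Smooth u -> test_fun phi ->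
  dotO u (pd i phi) = - dotO (pd i u) phi.
Proof.
move=> su tphi; have sphi := test_Smooth tphi.
have cc := c1M (Smooth_c1 i su) (Smooth_c1 i sphi).
have := int_c1 cc; rewrite [RHS](_ : _ = 0); last first.
  rewrite -[RHS]Rintegral_unit_cst; apply: eq_Rintegral => t _.
  by rewrite (test_side i t tphi (or_intror erefl)) (test_side i t tphi (or_introl erefl))
    !mulr0 subrr.
rewrite RintegralD; [|exact: mO| |].
- move=> /eqP; rewrite addr_eq0 => /eqP e; rewrite /L2dot e; congr (- _).
  by apply: eq_Rintegral => p _; rewrite mulrC.
- exact: (L2_integ_mul (m := mu2) mO (Smooth_L2 su) (Smooth_L2 (Smooth_pd i sphi))).
- exact: (L2_integ_mul (m := mu2) mO (Smooth_L2 sphi) (Smooth_L2 (Smooth_pd i su))).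
Qed.

Lemma is_weak_dE i u v : is_weak_d i u v <-> L2_Omega v /\
  forall phi, test_fun phi -> dotO u (pd i phi) = - dotO v phi.
Proof. by []. Qed.

(** Integration by parts: a test function vanishes on the boundary. *)
Lemma weak_d_Smooth i u : Smooth u -> is_weak_d i u (pd i u).
Proof.
move=> su; apply/is_weak_dE; split; first exact: Smooth_L2 (Smooth_pd i su).
by move=> phi; exact: int_by_parts.
Qed.

Lemma dot_separating v w : L2_Omega v -> L2_Omega w ->
  (forall phi, test_fun phi -> dotO v phi = dotO w phi) -> nO (v - w) = 0.
Proof.
move=> Lv Lw vw; apply/(snorm_ae (m := mu2) mO Lv Lw).
have Lvw : L2_Omega (v - w) := siB ipO Lv Lw.
have h : {ae mu2, forall p, Omega p -> (v - w) p = 0}.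
  apply: (test_separating Lvw) => phi tphi.
  have Lphi := Smooth_L2 (test_Smooth tphi).
  rewrite -/(dotO (v - w) phi) (siDl ipO)//; last exact: (siN ipO).
  by rewrite -scaleN1r (siZl ipO)// vw// mulN1r subrr.
apply: (ae_mono h) => p hp Op; apply/eqP; rewrite -subr_eq0; apply/eqP.
exact: hp.
Qed.

Lemma weak_d_unique i u v w : is_weak_d i u v -> is_weak_d i u w -> nO (v - w) = 0.
Proof.
move=> /is_weak_dE[Lv hv] /is_weak_dE[Lw hw]; apply: dot_separating => // phi tphi.
by apply: oppr_inj; rewrite -hv// -hw.
Qed.

Lemma weak_d_lin i c u v u' v' : L2_Omega u -> L2_Omega u' ->
  is_weak_d i u v -> is_weak_d i u' v' ->
  is_weak_d i (u + c *: u') (v + c *: v').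
Proof.
move=> Lu Lu' /is_weak_dE[Lv hv] /is_weak_dE[Lv' hv']; apply/is_weak_dE.
split; first exact: (siD ipO Lv (siZ ipO _ Lv')).
move=> phi tphi; have Lp := Smooth_L2 (test_Smooth tphi).
have Lpd := Smooth_L2 (Smooth_pd i (test_Smooth tphi)).
rewrite !(siDl ipO) ?(siZl ipO) ?hv ?hv'//; try exact: (siZ ipO).
by rewrite opprD mulrN.
Qed.

End Sobolev.

(** * Functions of V with their gradients and traces *)

Section TraceSpace.
Context {R : realType}.
Local Notation mu := (@lebesgue_measure R).
Local Notation mu2 := (@lebesgue2 R).
Local Notation I := (@unit_itv R).
Local Notation mO := (@measurable_Omega R).
Local Notation mI := (@measurable_unit_itv R).
Local Notation dotO := (L2dot mu2 Omega).
Local Notation dot1 := (L2dot mu I).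
Local Notation nO := (snorm dotO).
Local Notation n1 := (snorm dot1).
Local Notation ipO := (@ipO R).
Local Notation ip1 := (@ip1 R).
Local Notation L2I := (L2 mu I).
Local Notation F := (R * R -> R).
Implicit Types (u v w : F) (f : bool -> F) (g : bool -> R -> R).

Lemma small_eq0 (x C : R) : (forall e, 0 < e -> `|x| <= e * C) -> x = 0.
Proof.
move=> h; apply/eqP; rewrite -normr_eq0; apply: contraT => x0.
have {}x0 : 0 < `|x| by rewrite lt_neqAle eq_sym x0 normr_ge0.
have C0 : 0 < `|C| + 1 by rewrite ltr_wpDl.
have := h (`|x| / (2 * (`|C| + 1))).
rewrite divr_gt0 ?mulr_gt0// => /(_ isT) h1.
have h2 : `|x| / (2 * (`|C| + 1)) * C <= `|x| / (2 * (`|C| + 1)) * (`|C| + 1).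
  apply: ler_wpM2l; first by rewrite divr_ge0// mulr_ge0// ltW.
  by have := ler_norm C; lra.
have h3 : `|x| / (2 * (`|C| + 1)) * (`|C| + 1) = `|x| / 2 by field; rewrite gt_eqF.
lra.
Qed.

Lemma small_le (x y C : R) : (forall e, 0 < e -> x <= y + C * e) -> x <= y.
Proof.
move=> h; rewrite leNgt; apply/negP => yx.
have C0 : 0 < `|C| + 1 by rewrite ltr_wpDl.
have e0 : 0 < (x - y) / (2 * (`|C| + 1)) by rewrite divr_gt0 ?mulr_gt0// subr_gt0.
have h1 := h _ e0.
have h2 : C * ((x - y) / (2 * (`|C| + 1))) <= (`|C| + 1) * ((x - y) / (2 * (`|C| + 1))).
  by apply: ler_wpM2r; [exact: ltW|have := ler_norm C; lra].
have h3 : (`|C| + 1) * ((x - y) / (2 * (`|C| + 1))) = (x - y) / 2 by field; rewrite gt_eqF.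
lra.
Qed.

Lemma lin_error (E : lmodType R) (S : set E) b (hb : semi_inner S b) (c d e : R) (p q x y : E) :
  S p -> S q -> S x -> S y -> snorm b (p - x) < d -> snorm b (q - y) < d ->
  (1 + `|c|) * d <= e -> snorm b ((p + c *: q) - (x + c *: y)) < e.
Proof.
move=> Sp Sq Sx Sy h1 h2; apply: lt_le_trans.
have -> : (p + c *: q) - (x + c *: y) = (p - x) + c *: (q - y) by lin R.
have Sqy := siB hb Sq Sy.
apply: le_lt_trans (snormD hb (siB hb Sp Sx) (siZ hb c Sqy)) _.
rewrite (snormZ hb)// mulrDl mul1r; apply: ltr_leD => //.
by apply: ler_wpM2l => //; exact: ltW.
Qed.

(** The elements of V, together with their gradient f and their traces g: the trace
    g i is taken on the side of Gamma_1 orthogonal to the direction i.  Carrying f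
    and g along makes the bilinear forms of the energy exactly additive, whereas
    derivatives and traces chosen by their characteristic properties are linear
    only up to null sets. *)
Definition Vtuple u f g := [/\ L2_Omega u, forall i, L2_Omega (f i), forall i, L2I (g i) &
  forall e, 0 < e -> exists phi, [/\ Smooth phi, nO (phi - u) < e,
    forall i, nO (pd i phi - f i) < e,
    forall i, n1 (phi \o side_pt i 0 - g i) < e &
    forall i, n1 (phi \o side_pt i 1) < e]].

Lemma Vtuple_lin c u f g u' f' g' : Vtuple u f g -> Vtuple u' f' g' ->
  Vtuple (u + c *: u') (f + c *: f') (g + c *: g').
Proof.
move=> [Lu Lf Lg ap] [Lu' Lf' Lg' ap']; split.
- exact: (siD ipO Lu (siZ ipO _ Lu')).
- by move=> i; exact: (siD ipO (Lf i) (siZ ipO _ (Lf' i))).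
- by move=> i; exact: (siD ip1 (Lg i) (siZ ip1 _ (Lg' i))).
move=> e e0; have c0 : 0 < 1 + `|c| by rewrite ltr_wpDr.
have d0 : 0 < e / (1 + `|c|) by rewrite divr_gt0.
have de : (1 + `|c|) * (e / (1 + `|c|)) <= e by rewrite mulrC divfK// gt_eqF.
have [p [sp p1 p2 p3 p4]] := ap _ d0; have [q [sq q1 q2 q3 q4]] := ap' _ d0.
have Lp i : L2_Omega (pd i p) by exact: Smooth_L2 (Smooth_pd i sp).
have Lq i : L2_Omega (pd i q) by exact: Smooth_L2 (Smooth_pd i sq).
have Ls i s := Smooth_L2side i s sp; have Ls' i s := Smooth_L2side i s sq.
exists (p + c *: q); split.
- exact: Smooth_lin.
- by apply: (lin_error ipO _ _ _ _ p1 q1 de) => //; exact: Smooth_L2.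
- by move=> i; rewrite pd_lin//; exact: (lin_error ipO _ _ _ _ (p2 i) (q2 i) de).
- by move=> i; exact: (lin_error ip1 (Ls i 0) (Ls' i 0) (Lg i) (Lg' i) (p3 i) (q3 i) de).
- move=> i; have := @lin_error _ _ _ ip1 c _ _ _ _ 0 0 (Ls i 1) (Ls' i 1)
    (si0 ip1) (si0 ip1) _ _ de.
  by rewrite !subr0 scaler0 addr0 subr0; apply; [exact: p4|exact: q4].
Qed.

Lemma Vtuple_weak_d i u f g : Vtuple u f g -> is_weak_d i u (f i).
Proof.
move=> [Lu Lf _ ap]; apply/is_weak_dE; split => // phi tphi.
have sphi := test_Smooth tphi; have Lphi := Smooth_L2 sphi.
have Lpd := Smooth_L2 (Smooth_pd i sphi).
apply/eqP; rewrite -subr_eq0 opprK; apply/eqP.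
apply: (@small_eq0 _ (nO (pd i phi) + nO phi)) => e e0.
have [p [sp p1 p2 _ _]] := ap _ e0.
have Lp := Smooth_L2 sp; have Lpp := Smooth_L2 (Smooth_pd i sp).
have -> : dotO u (pd i phi) + dotO (f i) phi =
    - (dotO (p - u) (pd i phi) + dotO (pd i p - f i) phi).
  have e1 := int_by_parts i sp tphi.
  by rewrite !(siBl ipO)// e1; ring.
rewrite normrN; apply: le_trans (ler_normD _ _) _.
have h1 := si_cs ipO (siB ipO Lp Lu) Lpd.
have h2 := si_cs ipO (siB ipO Lpp (Lf i)) Lphi.
have := ler_wpM2r (snorm_ge0 dotO (pd i phi)) (ltW p1).
have := ler_wpM2r (snorm_ge0 dotO phi) (ltW (p2 i)).
by move: h1 h2; rewrite mulrDr; lra.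
Qed.

(** Poincare's inequality: the trace on the opposite side vanishes. *)
Lemma Vtuple_poincare i u f g : Vtuple u f g -> nO u <= nO (f i).
Proof.
move=> [Lu Lf _ ap]; apply: (@small_le _ _ 3) => e /ap [p [sp p1 p2 _ p4]].
have Lp := Smooth_L2 sp; have Lpp := Smooth_L2 (Smooth_pd i sp).
have h1 := snormB_le ipO Lu Lp; have h2 := snormB_le ipO Lpp (Lf i).
have h3 := Smooth_trace' i (s := 1) (ltac:(by rewrite ler01 lexx)) sp.
rewrite (snormBC ipO Lu Lp) in h1.
by have := p2 i; have := p4 i; lra.
Qed.

(** The trace inequality, in which Poincare's inequality absorbs the function. *)
Lemma Vtuple_trace i u f g : Vtuple u f g -> n1 (g i) <= 2 * nO (f i).
Proof.
move=> Vu; have := Vtuple_poincare i Vu; case: Vu => Lu Lf Lg ap poin.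
apply: (@small_le _ _ 3) => e /ap [p [sp p1 p2 p3 _]].
have Lp := Smooth_L2 sp; have Lpp := Smooth_L2 (Smooth_pd i sp).
have h1 := snormB_le ip1 (Lg i) (Smooth_L2side i 0 sp).
rewrite (snormBC ip1 (Lg i) (Smooth_L2side i 0 sp)) in h1.
have h2 := snormB_le ipO Lpp (Lf i); have h4 := snormB_le ipO Lp Lu.
have h3 := Smooth_trace i (s := 0) (ltac:(by rewrite lexx ler01)) sp.
by have := p2 i; have := p3 i; lra.
Qed.

Lemma Vtuple_closed (u : nat -> F) (f : nat -> bool -> F) (g : nat -> bool -> R -> R) u' f' g' :
  (forall n, Vtuple (u n) (f n) (g n)) ->
  L2_Omega u' -> (forall i, L2_Omega (f' i)) -> (forall i, L2I (g' i)) ->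
  stends dotO u u' -> (forall i, stends dotO (fun n => f n i) (f' i)) ->
  (forall i, stends dot1 (fun n => g n i) (g' i)) -> Vtuple u' f' g'.
Proof.
move=> V Lu' Lf' Lg' cu cf cg; split => // e e0.
have e20 : 0 < e / 2 by rewrite divr_gt0.
have [k0 h0] := cu _ e20.
have [k1 h1] := cf true _ e20; have [k2 h2] := cf false _ e20.
have [k3 h3] := cg true _ e20; have [k4 h4] := cg false _ e20.
pose n := maxn k0 (maxn (maxn k1 k2) (maxn k3 k4)).
have [Lu Lf Lg ap] := V n; have [p [sp p1 p2 p3 p4]] := ap _ e20.
have Lp := Smooth_L2 sp.
exists p; split => //.
- have := h0 n (leq_maxl _ _); have := snormB ipO Lp Lu Lu'; lra.
- move=> i; have Lpp := Smooth_L2 (Smooth_pd i sp).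
  have hf : nO (f n i - f' i) < e / 2.
    by case: (i); [apply: h1|apply: h2]; rewrite /n; lia.
  by have := snormB ipO Lpp (Lf i) (Lf' i); have := p2 i; lra.
- move=> i; have Lpp := Smooth_L2side i 0 sp.
  have hf : n1 (g n i - g' i) < e / 2.
    by case: (i); [apply: h3|apply: h4]; rewrite /n; lia.
  by have := snormB ip1 Lpp (Lg i) (Lg' i); have := p3 i; lra.
- by move=> i; have := p4 i; lra.
Qed.

Lemma Vtuple_Smooth u : Smooth u -> (forall i t, u (side_pt i 1 t) = 0) ->
  Vtuple u (pd^~ u) (fun i => u \o side_pt i 0).
Proof.
move=> su u1; split.
- exact: Smooth_L2.
- by move=> i; exact: Smooth_L2 (Smooth_pd i su).
- by move=> i; exact: Smooth_L2side.
move=> e e0; exists u; split => //.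
- by rewrite subrr (snorm0 ipO).
- by move=> i; rewrite subrr (snorm0 ipO).
- by move=> i; rewrite subrr (snorm0 ip1).
- move=> i; have -> : u \o side_pt i 1 = 0 by apply/funext => t; exact: u1.
  by rewrite (snorm0 ip1).
Qed.

Lemma Vtuple_test u : test_fun u -> Vtuple u (pd^~ u) 0.
Proof.
move=> tu; have := Vtuple_Smooth (test_Smooth tu) (fun i t => test_side i t tu (or_intror erefl)).
congr (Vtuple _ _ _); apply/funext => i; apply/funext => t /=.
exact: (test_side i t tu (or_introl erefl)).
Qed.

(** The energy norm controls all the components, so that V is complete. *)
Lemma Vtuple_cauchy (u : nat -> F) (f : nat -> bool -> F) (g : nat -> bool -> R -> R) :
  (forall n, Vtuple (u n) (f n) (g n)) ->
  (forall i, scauchy dotO (fun n => f n i)) ->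
  exists u' f' g', [/\ Vtuple u' f' g', stends dotO u u',
    forall i, stends dotO (fun n => f n i) (f' i) &
    forall i, stends dot1 (fun n => g n i) (g' i)].
Proof.
move=> V cf.
have VB m n : Vtuple (u m - u n) (f m - f n) (g m - g n).
  by have := Vtuple_lin (-1) (V m) (V n); rewrite !scaleN1r.
have cu : scauchy dotO u.
  move=> e /(cf true)[n0 h]; exists n0 => m n lm ln.
  exact: le_lt_trans (Vtuple_poincare true (VB m n)) (h m n lm ln).
have cg i : scauchy dot1 (fun n => g n i).
  move=> e e0; have e20 : 0 < e / 2 by rewrite divr_gt0.
  have [n0 h] := cf i _ e20; exists n0 => m n lm ln.
  have h1 := Vtuple_trace i (VB m n); have := h m n lm ln.
  by move: h1; rewrite -[(g m - g n) i]/(g m i - g n i) -[(f m - f n) i]/(f m i - f n i); lra.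
have cO := @L2_complete _ _ R mu2 Omega mO (@mu2_Omega_fin R).
have cI := @L2_complete _ _ R mu I mI (@mu_unit_itv_fin R).
have Lu n : L2_Omega (u n) by case: (V n).
have Lf n i : L2_Omega (f n i) by case: (V n).
have Lg n i : L2I (g n i) by case: (V n).
have [u' Lu' hu] := cO u Lu cu.
have /choice[f' hf] : forall i, exists v : F, L2_Omega v /\ stends dotO (fun n => f n i) v.
  by move=> i; have [v Lv hv] := cO (fun n => f n i) (fun n => Lf n i) (cf i); exists v.
have /choice[g' hg] : forall i, exists v : R -> R, L2I v /\ stends dot1 (fun n => g n i) v.
  by move=> i; have [v Lv hv] := cI (fun n => g n i) (fun n => Lg n i) (cg i); exists v.
exists u', f', g'; split => //.
- apply: (Vtuple_closed V) => //; try by [move=> i; case: (hf i)|move=> i; case: (hg i)].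
- by move=> i; case: (hf i).
- by move=> i; case: (hg i).
Qed.

End TraceSpace.

(** * Sobolev norms and traces *)

Section SobolevNorms.
Context {R : realType}.
Local Notation mu := (@lebesgue_measure R).
Local Notation mu2 := (@lebesgue2 R).
Local Notation I := (@unit_itv R).
Local Notation mO := (@measurable_Omega R).
Local Notation mI := (@measurable_unit_itv R).
Local Notation dotO := (L2dot mu2 Omega).
Local Notation dot1 := (L2dot mu I).
Local Notation nO := (snorm dotO).
Local Notation n1 := (snorm dot1).
Local Notation ipO := (@ipO R).
Local Notation ip1 := (@ip1 R).
Local Notation L2I := (L2 mu I).
Local Notation F := (R * R -> R).
Implicit Types (u v w : F) (f : bool -> F) (g : bool -> R -> R).

Lemma hypot_fin (x y : R) : hypot x%:E y%:E = (Num.sqrt (x ^+ 2 + y ^+ 2))%:E.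
Proof.
rewrite /hypot -!EFin_expe -EFinD poweR_EFin powR12_sqrt//.
by rewrite addr_ge0 ?sqr_ge0.
Qed.

Lemma sqrt_hypot_le (x y : R) : 0 <= x -> 0 <= y -> Num.sqrt (x ^+ 2 + y ^+ 2) <= x + y.
Proof.
move=> x0 y0; rewrite -[leRHS]ger0_norm ?addr_ge0// -sqrtr_sqr; apply: ler_wsqrtr.
by rewrite sqrrD -addrA lerD2l lerDr mulrn_wge0// mulr_ge0.
Qed.

Lemma le_sqrt_hypotl (x y : R) : 0 <= x -> x <= Num.sqrt (x ^+ 2 + y ^+ 2).
Proof.
move=> x0; rewrite -[leLHS]ger0_norm// -sqrtr_sqr; apply: ler_wsqrtr.
by rewrite lerDl sqr_ge0.
Qed.

Lemma le_sqrt_hypotr (x y : R) : 0 <= y -> y <= Num.sqrt (x ^+ 2 + y ^+ 2).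
Proof. by rewrite addrC; exact: le_sqrt_hypotl. Qed.

Lemma cvge0_near (T : Type) (G : set_system T) (FG : Filter G) (h : T -> R) :
  (forall x, 0 <= h x) -> (forall e, 0 < e -> \forall x \near G, h x <= e) ->
  (h x)%:E @[x --> G] --> 0%E.
Proof.
move=> h0 H; apply: cvg_EFin; first exact: nearW.
apply/cvgr0Pnorm_le => e e0; apply: filterS (H _ e0) => x.
by rewrite ger0_norm.
Qed.

Lemma cvge0_seq (h : nat -> R) : (forall n, 0 <= h n) ->
  (h n)%:E @[n --> \oo] --> 0%E ->
  forall e, 0 < e -> exists n0, forall n, (n0 <= n)%N -> h n < e.
Proof.
move=> h0 /fine_cvgP[_ /cvgr0Pnorm_lt H] e e0.
have [n0 _ hn] := H _ e0; exists n0 => n /hn /=.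
by rewrite ger0_norm.
Qed.

Lemma snorm_eq (E : lmodType R) (S : set E) b (hb : semi_inner S b) (x y : E) :
  S x -> S y -> snorm b (x - y) = 0 -> snorm b x = snorm b y.
Proof.
move=> Sx Sy e; apply/eqP; rewrite eq_le; apply/andP; split.
  by have := snormB_le hb Sx Sy; rewrite e addr0.
by have := snormB_le hb Sy Sx; rewrite (snormBC hb Sy Sx) e addr0.
Qed.

Lemma weak_d_spec i u v : is_weak_d i u v ->
  [/\ is_weak_d i u (weak_d i u), L2_Omega (weak_d i u) & nO (weak_d i u - v) = 0].
Proof.
move=> h; have h' : is_weak_d i u (weak_d i u).
  by rewrite /weak_d; case: xgetP => [w _ //|/(_ v)].
by split => //; [case: h'|exact: weak_d_unique h' h].
Qed.

Lemma L2normO v : L2_Omega v -> L2norm_Omega v = (nO v)%:E.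
Proof. exact: (L2norm_snorm (m := mu2) mO). Qed.

Lemma L2normI (h : R -> R) : L2I h -> L2norm mu I h = (n1 h)%:E.
Proof. exact: (L2norm_snorm (m := mu) mI). Qed.

Definition h1norm u f := Num.sqrt (nO u ^+ 2 +
  Num.sqrt (nO (f false) ^+ 2 + nO (f true) ^+ 2) ^+ 2).

Lemma H1normE u f : L2_Omega u -> (forall i, is_weak_d i u (f i)) ->
  H1norm u = (h1norm u f)%:E.
Proof.
move=> Lu hf.
have [_ L0 e0] := weak_d_spec (hf false); have [_ L1 e1] := weak_d_spec (hf true).
have Lf i : L2_Omega (f i) by case: (hf i).
have n0 : L2norm_Omega (weak_d false u) = (nO (f false))%:E.
  by rewrite (L2normO L0) (snorm_eq ipO L0 (Lf _) e0).
have n1 : L2norm_Omega (weak_d true u) = (nO (f true))%:E.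
  by rewrite (L2normO L1) (snorm_eq ipO L1 (Lf _) e1).
have n2 := etrans (congr2 hypot n0 n1) (hypot_fin _ _).
exact: (etrans (congr2 hypot (L2normO Lu) n2) (hypot_fin _ _)).
Qed.

Lemma h1norm_le u f : h1norm u f <= nO u + (nO (f false) + nO (f true)).
Proof.
apply: le_trans (sqrt_hypot_le (snorm_ge0 _ _) (sqrtr_ge0 _)) _.
by rewrite lerD2l; apply: sqrt_hypot_le; exact: snorm_ge0.
Qed.

Lemma le_h1norm0 u f : nO u <= h1norm u f.
Proof. by apply: le_sqrt_hypotl; exact: snorm_ge0. Qed.

Lemma le_h1norm i u f : nO (f i) <= h1norm u f.
Proof.
apply: le_trans (le_sqrt_hypotr _ (sqrtr_ge0 _)).
by case: i; [apply: le_sqrt_hypotr|apply: le_sqrt_hypotl]; exact: snorm_ge0.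
Qed.

Lemma Vtuple_H1 u f g : Vtuple u f g -> H1_Omega u.
Proof.
move=> V; split; first by case: V.
by move=> i; exists (f i); exact: Vtuple_weak_d V.
Qed.

Lemma weak_dB i phi u v : Smooth phi -> L2_Omega u -> is_weak_d i u v ->
  is_weak_d i (phi - u) (pd i phi - v).
Proof.
move=> sp Lu h; have := weak_d_lin (-1) (Smooth_L2 sp) Lu (weak_d_Smooth i sp) h.
by rewrite !scaleN1r.
Qed.

(** The approximations in the definition of Vtuple also converge in the norm that
    is defined from chosen weak derivatives. *)
Lemma Vtuple_traces i u f g : Vtuple u f g ->
  is_trace (side_pt i 0) u (g i) /\ is_trace (side_pt i 1) u (cst 0).
Proof.
move=> V; have Hu := Vtuple_H1 V; have wd j := Vtuple_weak_d j V.
case: (V) => Lu Lf Lg ap.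
have n0 n : 0 < n.+1%:R^-1 :> R by rewrite invr_gt0.
have /choice[phi hphi] := fun n => ap _ (n0 n).
have sphi n : smooth (phi n) by case: (hphi n) => -[].
have inv e : 0 < e -> \forall n \near \oo, n.+1%:R^-1 <= e :> R.
  move=> e0; have /cvgr0Pnorm_le/(_ _ e0) := @invS_cvg0 R.
  by apply: filterS => n; rewrite ger0_norm// invr_ge0.
have cH : H1norm (phi n - u) @[n --> \oo] --> 0%E.
  have e n : H1norm (phi n - u) = (h1norm (phi n - u) (fun i => pd i (phi n) - f i))%:E.
    have [sp _ _ _ _] := hphi n.
    by apply: H1normE => [|j]; [exact: (siB ipO (Smooth_L2 sp) Lu)|exact: weak_dB].
  under eq_fun do rewrite e.
  apply: cvge0_near => [n|r r0]; first exact: sqrtr_ge0.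
  have r30 : 0 < r / 3 by rewrite divr_gt0.
  apply: filterS (inv _ r30) => n hn; apply: le_trans (h1norm_le _ _) _.
  have [_ h1 h2 _ _] := hphi n; have := h2 true; have := h2 false.
  move: h1 hn; move: (n.+1%:R^-1) (nO (phi n - u)) (nO (pd true (phi n) - f true))
    (nO (pd false (phi n) - f false)).
  by clear => *; lra.
split; (split; [by []| |exists phi; split => //]).
- by case: V.
- have e n : L2norm mu I ((phi n \o side_pt i 0) - g i) = (n1 (phi n \o side_pt i 0 - g i))%:E.
    have [sp _ _ _ _] := hphi n.
    exact: (L2normI (siB ip1 (Smooth_L2side i 0 sp) (Lg i))).
  under eq_fun do rewrite e.
  apply: cvge0_near => [n|r r0]; first exact: sqrtr_ge0.
  by apply: filterS (inv _ r0) => n; apply: le_trans; have [_ _ _ h _] := hphi n; exact/ltW/h.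
- exact: si0 ip1.
- have e n : L2norm mu I ((phi n \o side_pt i 1) - cst 0) = (n1 (phi n \o side_pt i 1))%:E.
    have [sp _ _ _ _] := hphi n; rewrite -[cst 0]/(0 : R -> R) subr0.
    exact: (L2normI (Smooth_L2side i 1 sp)).
  under eq_fun do rewrite e.
  apply: cvge0_near => [n|r r0]; first exact: sqrtr_ge0.
  by apply: filterS (inv _ r0) => n; apply: le_trans; have [_ _ _ _ h] := hphi n; exact/ltW/h.
Qed.

Lemma Vtuple_V u f g : Vtuple u f g -> V_space u.
Proof.
move=> V; split; first exact: Vtuple_H1 V.
  exact: (Vtuple_traces true V).2.
exact: (Vtuple_traces false V).2.
Qed.

Lemma is_traceP i s u f (g : R -> R) : L2_Omega u -> (forall i, is_weak_d i u (f i)) ->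
  is_trace (side_pt i s) u g ->
  forall e, 0 < e -> exists phi, [/\ Smooth phi, nO (phi - u) < e,
    forall i, nO (pd i phi - f i) < e & n1 (phi \o side_pt i s - g) < e].
Proof.
move=> Lu hf [_ Lg [phi [sphi cH cT]]] e e0.
have sp n : Smooth (phi n) by constructor; exact: sphi.
have eH n : H1norm (phi n - u) = (h1norm (phi n - u) (fun i => pd i (phi n) - f i))%:E.
  by apply: H1normE => [|j]; [exact: (siB ipO (Smooth_L2 (sp n)) Lu)|exact: weak_dB].
have eT n : L2norm mu I ((phi n \o side_pt i s) - g) = (n1 (phi n \o side_pt i s - g))%:E.
  exact: (L2normI (siB ip1 (Smooth_L2side i s (sp n)) Lg)).
have [k1 h1] := @cvge0_seq (fun n => h1norm (phi n - u) (fun i => pd i (phi n) - f i))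
  (fun n => sqrtr_ge0 _) (ltac:(by under eq_fun do rewrite -eH)) e e0.
have [k2 h2] := @cvge0_seq (fun n => n1 (phi n \o side_pt i s - g))
  (fun n => sqrtr_ge0 _) (ltac:(by under eq_fun do rewrite -eT)) e e0.
pose n := maxn k1 k2.
have {}h1 := h1 n (leq_maxl _ _); have {}h2 := h2 n (leq_maxr _ _).
exists (phi n); split => //.
- exact: le_lt_trans (le_h1norm0 _ _) h1.
- move=> j; exact: le_lt_trans (le_h1norm j _ _) h1.
Qed.

(** Two approximating sequences get close in the Sobolev norm, hence also on the
    side by the trace inequality. *)
Lemma trace_unique i s u (g g' : R -> R) : 0 <= s <= 1 -> is_trace (side_pt i s) u g ->
  is_trace (side_pt i s) u g' -> n1 (g - g') = 0.
Proof.
move=> s01 tg tg'; have [[Lu /choice[f hf]] Lg _] := tg; have [_ Lg' _] := tg'.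
have Lf j : L2_Omega (f j) by case: (hf j).
apply/eqP; rewrite eq_le snorm_ge0 andbT.
apply: (@small_le R _ _ 6) => e e0; rewrite add0r.
have [p [sp p1 p2 p3]] := is_traceP Lu hf tg e0.
have [q [sq q1 q2 q3]] := is_traceP Lu hf tg' e0.
have Lp := Smooth_L2 sp; have Lq := Smooth_L2 sq.
have Lpi := Smooth_L2 (Smooth_pd i sp); have Lqi := Smooth_L2 (Smooth_pd i sq).
have Lps := Smooth_L2side i s sp; have Lqs := Smooth_L2side i s sq.
have := Smooth_trace i s01 (SmoothB sp sq); rewrite pdB//.
have -> : (p - q) \o side_pt i s = (p \o side_pt i s) - (q \o side_pt i s) by [].
have h1 := snormB ipO Lp Lu Lq; rewrite (snormBC ipO Lu Lq) in h1.
have h2 := snormB ipO Lpi (Lf i) Lqi; rewrite (snormBC ipO (Lf i) Lqi) in h2.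
have h3 := snormB ip1 Lg Lps Lg'; rewrite (snormBC ip1 Lg Lps) in h3.
have h4 := snormB ip1 Lps Lqs Lg'.
move: h1 h2 h3 h4 p1 (p2 i) p3 q1 (q2 i) q3.
move: (nO (p - q)) (nO (p - u)) (nO (q - u)) (nO (pd i p - pd i q)) (nO (pd i p - f i))
  (nO (pd i q - f i)) (n1 ((p \o side_pt i s : R -> R) - (q \o side_pt i s : R -> R)))
  (n1 (g - g')) (n1 ((p \o side_pt i s : R -> R) - g))
  (n1 ((p \o side_pt i s : R -> R) - g')) (n1 ((q \o side_pt i s : R -> R) - g')).
by clear => *; lra.
Qed.

(** The two vanishing traces come with two sequences of approximations, which get
    close in the Sobolev norm; by the trace inequality the traces of the first one
    tend to zero on both sides, and have limits on the two other sides. *)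
Lemma V_Vtuple u : V_space u -> exists f g, Vtuple u f g.
Proof.
move=> [[Lu /choice[f hf]] tT tR]; have Lf j : L2_Omega (f j) by case: (hf j).
have both e : 0 < e -> exists phi, [/\ Smooth phi, nO (phi - u) < e,
    forall i, nO (pd i phi - f i) < e & forall i, n1 (phi \o side_pt i 1) < e].
  move=> e0; have e50 : 0 < e / 5 by rewrite divr_gt0.
  have [p [sp p1 p2 p3]] := @is_traceP true 1 u f _ Lu hf tT _ e50.
  have [q [sq q1 q2 q3]] := @is_traceP false 1 u f _ Lu hf tR _ e50.
  rewrite -[cst 0]/(0 : R -> R) subr0 in p3; rewrite -[cst 0]/(0 : R -> R) subr0 in q3.
  have e5e : e / 5 < e by rewrite ltr_pdivrMr// ltr_pMr// ltr1n.
  exists p; split => //; first exact: lt_trans e5e.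
    by move=> i; exact: lt_trans (p2 i) e5e.
  case; first exact: lt_trans e5e.
  have Lp := Smooth_L2 sp; have Lq := Smooth_L2 sq.
  have Lpi := Smooth_L2 (Smooth_pd false sp); have Lqi := Smooth_L2 (Smooth_pd false sq).
  have Lps := Smooth_L2side false 1 sp; have Lqs := Smooth_L2side false 1 sq.
  have := Smooth_trace false (s := 1) (ltac:(by rewrite ler01 lexx)) (SmoothB sp sq).
  rewrite pdB//; have -> : (p - q) \o side_pt false 1 =
    (p \o side_pt false 1) - (q \o side_pt false 1) by [].
  have h1 := snormB ipO Lp Lu Lq; rewrite (snormBC ipO Lu Lq) in h1.
  have h2 := snormB ipO Lpi (Lf false) Lqi; rewrite (snormBC ipO (Lf false) Lqi) in h2.
  have h3 := snormB_le ip1 Lps Lqs.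
  move: h1 h2 h3 p1 (p2 false) q1 (q2 false) q3.
  move: (nO (p - q)) (nO (p - u)) (nO (q - u)) (nO (pd false p - pd false q))
    (nO (pd false p - f false)) (nO (pd false q - f false)) (n1 (q \o side_pt false 1))
    (n1 (p \o side_pt false 1)) 
    (n1 ((p \o side_pt false 1 : R -> R) - (q \o side_pt false 1 : R -> R))).
  by clear => *; lra.
(* the traces on the other two sides form a Cauchy sequence *)
have n0 n : 0 < n.+1%:R^-1 :> R by rewrite invr_gt0.
have /choice[phi hphi] := fun n => both _ (n0 n).
have inv e : 0 < e -> exists k, forall n, (k <= n)%N -> n.+1%:R^-1 < e :> R.
  move=> e0; have /cvgr0Pnorm_lt/(_ _ e0)[k _ hk] := @invS_cvg0 R.
  by exists k => n /hk /=; rewrite ger0_norm// invr_ge0.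
have sp n : Smooth (phi n) by case: (hphi n).
have Lp n := Smooth_L2 (sp n).
have Lpi n i := Smooth_L2 (Smooth_pd i (sp n)).
have Lps n i := Smooth_L2side i 0 (sp n).
have cg i : scauchy dot1 (fun n => phi n \o side_pt i 0).
  move=> e e0; have e50 : 0 < e / 5 by rewrite divr_gt0.
  have [k hk] := inv _ e50; exists k => m n /hk lm /hk ln.
  change (n1 ((phi m \o side_pt i 0 : R -> R) - (phi n \o side_pt i 0 : R -> R)) < e).
  have := Smooth_trace i (s := 0) (ltac:(by rewrite lexx ler01)) (SmoothB (sp m) (sp n)).
  rewrite pdB//; have -> : (phi m - phi n) \o side_pt i 0 =
    (phi m \o side_pt i 0) - (phi n \o side_pt i 0) by [].
  have h1 := snormB ipO (Lp m) Lu (Lp n); rewrite (snormBC ipO Lu (Lp n)) in h1.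
  have h2 := snormB ipO (Lpi m i) (Lf i) (Lpi n i).
  rewrite (snormBC ipO (Lf i) (Lpi n i)) in h2.
  have [_ a1 a2 _] := hphi m; have [_ b1 b2 _] := hphi n.
  have := a2 i; have := b2 i; move: a1 b1 lm ln h1 h2 e0.
  move: (m.+1%:R^-1) (n.+1%:R^-1) (nO (phi m - phi n)) (nO (phi m - u)) (nO (phi n - u))
    (nO (pd i (phi m) - pd i (phi n))) (nO (pd i (phi m) - f i)) (nO (pd i (phi n) - f i))
    (n1 ((phi m \o side_pt i 0 : R -> R) - (phi n \o side_pt i 0 : R -> R))).
  by clear => *; lra.
have cI := @L2_complete _ _ R mu I mI (@mu_unit_itv_fin R).
have /choice[g hg] : forall i, exists v : R -> R, L2I v /\ stends dot1 (fun n => phi n \o side_pt i 0) v.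
  by move=> i; have [v Lv hv] := cI _ (fun n => Lps n i) (cg i); exists v.
exists f, g; split => //; first by move=> i; case: (hg i).
move=> e e0; have [k hk] := inv _ e0.
have [k1 h1] := (hg true).2 _ e0; have [k2 h2] := (hg false).2 _ e0.
pose n := maxn k (maxn k1 k2); exists (phi n).
have ln : n.+1%:R^-1 < e by apply: hk; rewrite /n; lia.
have [_ a1 a2 a3] := hphi n; split => //.
- exact: lt_trans ln.
- by move=> i; apply: lt_trans ln.
- by case; [apply: h1|apply: h2]; rewrite /n; lia.
- by move=> i; apply: lt_trans ln.
Qed.

Definition side_of (i : bool) : R -> R * R := if i then bottom_side else left_side.

Lemma trace_onP i u f g : Vtuple u f g ->
  L2I (trace_on (side_of i) u) /\ n1 (trace_on (side_of i) u - g i) = 0.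
Proof.
move=> V; have [tr _] := Vtuple_traces i V.
have -> : side_of i = side_pt i 0 by case: (i).
have h : is_trace (side_pt i 0) u (trace_on (side_pt i 0) u).
  by rewrite /trace_on; case: xgetP => [w _ //|/(_ (g i))].
split; first by case: h.
by apply: (trace_unique _ h tr); rewrite lexx ler01.
Qed.

End SobolevNorms.

(** * The energy space and the wave operator *)

Section WaveGenerator.
Context {R : realType}.
Local Notation mu := (@lebesgue_measure R).
Local Notation mu2 := (@lebesgue2 R).
Local Notation I := (@unit_itv R).
Local Notation mO := (@measurable_Omega R).
Local Notation mI := (@measurable_unit_itv R).
Local Notation dotO := (L2dot mu2 Omega).
Local Notation dot1 := (L2dot mu I).
Local Notation nO := (snorm dotO).
Local Notation n1 := (snorm dot1).
Local Notation ipO := (@ipO R).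
Local Notation ip1 := (@ip1 R).
Local Notation L2I := (L2 mu I).
Local Notation F := (R * R -> R).
Implicit Types (u v w : F) (f : bool -> F) (g : bool -> R -> R).

Variables (af : bool -> R -> R) (M : R).
Hypothesis maf : forall i, measurable_fun I (af i).
Hypothesis afM : forall i x, I x -> 0 <= af i x <= M.

Let M0 : 0 <= M.
Proof.
have /(afM true)/andP[h1 h2] : I 2^-1 by rewrite /unit_itv /= in_itv/=; lra.
exact: le_trans h1 h2.
Qed.

Definition gdot f f' := dotO (f false) (f' false) + dotO (f true) (f' true).

(** The boundary form of the damping coefficient on one side. *)
Definition wside i (g g' : R -> R) := dot1 (fun x => af i x * g x) g'.

Definition wdot g g' := wside false (g false) (g' false) + wside true (g true) (g' true).

Lemma wdotE g g' : wdot g g' = wside false (g false) (g' false) + wside true (g true) (g' true).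
Proof. by []. Qed.

Lemma L2_af i (g : R -> R) : L2I g -> L2I (fun x => af i x * g x).
Proof.
move=> Lg; apply: (L2_mul_bounded (m := mu) mI (maf i) _ Lg (M := M)) => x /(afM i)/andP[h1 h2].
by rewrite ger0_norm.
Qed.

Lemma wsideC i (g g' : R -> R) : L2I g -> L2I g' -> wside i g g' = wside i g' g.
Proof. by move=> Lg Lg'; apply: eq_Rintegral => x _; ring. Qed.

Lemma wside_ge0 i (g : R -> R) : 0 <= wside i g g.
Proof.
apply: Rintegral_ge0 => x /(afM i)/andP[h _].
by rewrite -mulrA -expr2 mulr_ge0// sqr_ge0.
Qed.

Lemma wside_lin i c (g g' k : R -> R) : L2I g -> L2I g' -> L2I k ->
  wside i (g + c *: g') k = wside i g k + c * wside i g' k.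
Proof.
move=> Lg Lg' Lk; rewrite /wside.
have -> : (fun x => af i x * (g + c *: g') x) =
    (fun x => af i x * g x) + c *: (fun x => af i x * g' x).
  apply/funext => x.
  by change (af i x * (g x + c * g' x) = af i x * g x + c * (af i x * g' x)); ring.
have L1 := L2_af i Lg; have L2 := L2_af i Lg'.
by rewrite (siDl ip1 L1 (siZ ip1 c L2) Lk) (siZl ip1 c L2 Lk).
Qed.

Lemma wside_le i (g g' : R -> R) : L2I g -> L2I g' -> `|wside i g g'| <= M * n1 g * n1 g'.
Proof.
move=> Lg Lg'; apply: le_trans (si_cs ip1 (L2_af i Lg) Lg') _.
apply: ler_wpM2r; first exact: snorm_ge0.
rewrite (snorm_le ip1 (L2_af i Lg)); last by rewrite mulr_ge0// snorm_ge0.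
rewrite exprMn (snorm_sqr ip1 Lg) /L2dot -RintegralZl; last 2 first.
- exact: mI.
- exact: (L2_integ_mul (m := mu) mI Lg Lg).
apply: le_Rintegral; first exact: mI.
- exact: (L2_integ_mul (m := mu) mI (L2_af i Lg) (L2_af i Lg)).
- have := L2_integ_mul (m := mu) mI (siZ ip1 (M ^+ 2) Lg) Lg.
  by apply: eq_integrable; [exact: mI|move=> x _ /=; rewrite -mulrA].
move=> x /(afM i)/andP[h1 h2].
have -> : af i x * g x * (af i x * g x) = af i x ^+ 2 * (g x * g x) by ring.
by apply: ler_wpM2r; [rewrite -expr2 sqr_ge0|apply: lerXn2r; rewrite ?nnegrE].
Qed.

Lemma gdot_lin c f f' k : (forall i, L2_Omega (f i)) -> (forall i, L2_Omega (f' i)) ->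
  (forall i, L2_Omega (k i)) -> gdot (f + c *: f') k = gdot f k + c * gdot f' k.
Proof.
move=> Lf Lf' Lk; rewrite /gdot.
have e i : dotO ((f + c *: f') i) (k i) = dotO (f i) (k i) + c * dotO (f' i) (k i).
  have -> : (f + c *: f') i = f i + c *: f' i by [].
  by rewrite (siDl ipO (Lf i) (siZ ipO c (Lf' i)) (Lk i)) (siZl ipO c (Lf' i) (Lk i)).
by rewrite !e; ring.
Qed.

Lemma gdotC f k : (forall i, L2_Omega (f i)) -> (forall i, L2_Omega (k i)) ->
  gdot f k = gdot k f.
Proof. by move=> Lf Lk; rewrite /gdot !(siC ipO (Lf _) (Lk _)). Qed.

Lemma gdot_ge i f : (forall i, L2_Omega (f i)) -> nO (f i) ^+ 2 <= gdot f f.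
Proof.
move=> Lf; rewrite (snorm_sqr ipO (Lf i)) /gdot.
by case: i; rewrite ?lerDl ?lerDr (si_ge0 ipO (Lf _)).
Qed.

(** The state space V x L2, a state being (u, grad u, u_t), with the energy as
    the square of its norm. *)
Definition state := (F * (bool -> F) * F)%type.
Implicit Types X Y : state.

Definition in_state X := (exists g, Vtuple X.1.1 X.1.2 g) /\ L2_Omega X.2.
Definition energy X Y := gdot X.1.2 Y.1.2 + dotO X.2 Y.2.

Lemma energyE X Y : energy X Y = gdot X.1.2 Y.1.2 + dotO X.2 Y.2.
Proof. by []. Qed.

(** The generator of the damped wave equation in weak form: it maps (u, u_t) to
    (u_t, Laplacian of u), the normal derivative of u being -a u_t. *)
Definition wave_op X Y := exists g h, [/\ Vtuple X.1.1 X.1.2 g,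
  Vtuple Y.1.1 Y.1.2 h, L2_Omega X.2 /\ L2_Omega Y.2, nO (X.2 - Y.1.1) = 0 &
  forall p q r, Vtuple p q r -> dotO Y.2 p + gdot X.1.2 q = - wdot h r].

Lemma Vtuple_L2 u f g : Vtuple u f g ->
  [/\ L2_Omega u, forall i, L2_Omega (f i) & forall i, L2I (g i)].
Proof. by case. Qed.

Lemma Vtuple0 : Vtuple (0 : F) 0 0.
Proof.
split => [|i|i|e e0]; [exact: si0 ipO|exact: si0 ipO|exact: si0 ip1|].
have sz : Smooth (tensor (cst 0) (cst 0) : F).
  by constructor; apply: smooth_tensor; exact: smooth1_cst.
have e0' : 0 *: (tensor (cst 0) (cst 0)) = 0 :> F by rewrite scale0r.
have s0 : Smooth (0 : F) by rewrite -e0'; exact: SmoothZ.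
have pd0 i : pd i (0 : F) = 0 by rewrite -{1}e0' pdZ// scale0r.
exists 0; split => [//||i|i|i]; rewrite ?pd0 ?subr0 ?(snorm0 ipO)//.
- by rewrite (snorm0 ip1).
- by rewrite (snorm0 ip1).
Qed.

Lemma VtupleB u f g u' f' g' : Vtuple u f g -> Vtuple u' f' g' ->
  Vtuple (u - u') (f - f') (g - g').
Proof. by move=> V V'; have := Vtuple_lin (-1) V V'; rewrite !scaleN1r. Qed.

Lemma VtupleZ c u f g : Vtuple u f g -> Vtuple (c *: u) (c *: f) (c *: g).
Proof. by move=> V; have := Vtuple_lin c Vtuple0 V; rewrite !add0r. Qed.

Lemma energy_inner : semi_inner in_state energy.
Proof.
have LL X : in_state X -> (forall i, L2_Omega (X.1.2 i)) by move=> [[g /Vtuple_L2[]]].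
split.
- by split; [exists 0; exact: Vtuple0|exact: si0 ipO].
- move=> X Y [[g Vg] LX] [[h Vh] LY]; split; last exact: (siD ipO LX LY).
  by exists (g + h); have := Vtuple_lin 1 Vg Vh; rewrite !scale1r.
- by move=> c X [[g Vg] LX]; split; [exists (c *: g); exact: (VtupleZ c Vg)|exact: (siZ ipO c LX)].
- move=> X Y SX SY; rewrite /energy (gdotC (LL _ SX) (LL _ SY)).
  by rewrite (siC ipO SX.2 SY.2).
- move=> X Y Z SX SY SZ.
  have e1 : dotO (X + Y).2 Z.2 = dotO X.2 Z.2 + dotO Y.2 Z.2 := siDl ipO SX.2 SY.2 SZ.2.
  have e2 : gdot (X + Y).1.2 Z.1.2 = gdot X.1.2 Z.1.2 + gdot Y.1.2 Z.1.2.
    by have := gdot_lin 1 (LL _ SX) (LL _ SY) (LL _ SZ); rewrite scale1r mul1r.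
  by rewrite /energy e1 e2; move: (dotO _ _) (dotO _ _) (gdot _ _) => *; ring.
- move=> c X Y SX SY.
  have e1 : dotO (c *: X).2 Y.2 = c * dotO X.2 Y.2 := siZl ipO c SX.2 SY.2.
  have e0 : gdot 0 Y.1.2 = 0.
    have := gdot_lin (-1) (LL _ SX) (LL _ SX) (LL _ SY).
    by rewrite scaleN1r subrr mulN1r subrr.
  have e2 : gdot (c *: X).1.2 Y.1.2 = c * gdot X.1.2 Y.1.2.
    by have := @gdot_lin c 0 _ _ (fun=> si0 ipO) (LL _ SX) (LL _ SY); rewrite !add0r e0 add0r.
  by rewrite /energy e1 e2 -mulrDr.
- move=> X SX; rewrite /energy !addr_ge0 ?(si_ge0 ipO SX.2)//.
    exact: (si_ge0 ipO (LL _ SX _)).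
  exact: (si_ge0 ipO (LL _ SX _)).
Qed.

Lemma snorm_energy_ge i X : in_state X -> nO (X.1.2 i) <= snorm energy X.
Proof.
move=> SX; have Lf : forall i, L2_Omega (X.1.2 i) by case: SX => [[g /Vtuple_L2[]]].
rewrite -ler_sqr ?nnegrE ?snorm_ge0// (snorm_sqr energy_inner SX).
apply: le_trans (gdot_ge i Lf) _; rewrite /energy lerDl; exact: (si_ge0 ipO SX.2).
Qed.

Lemma snorm_energy_ge2 X : in_state X -> nO X.2 <= snorm energy X.
Proof.
move=> SX; have Lf : forall i, L2_Omega (X.1.2 i) by case: SX => [[g /Vtuple_L2[]]].
rewrite -ler_sqr ?nnegrE ?snorm_ge0// (snorm_sqr energy_inner SX) (snorm_sqr ipO SX.2).
by rewrite /energy lerDr; exact: le_trans (sqr_ge0 _) (gdot_ge true Lf).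
Qed.

Lemma snorm_energy_le X : in_state X ->
  snorm energy X <= nO (X.1.2 false) + nO (X.1.2 true) + nO X.2.
Proof.
move=> SX; have Lf : forall i, L2_Omega (X.1.2 i) by case: SX => [[g /Vtuple_L2[]]].
have a0 := snorm_ge0 dotO (X.1.2 false); have b0 := snorm_ge0 dotO (X.1.2 true).
have c0 := snorm_ge0 dotO X.2.
rewrite (snorm_le energy_inner SX); last by rewrite !addr_ge0.
rewrite /energy /gdot -!(snorm_sqr ipO (Lf _)) -(snorm_sqr ipO SX.2).
move: a0 b0 c0; move: (nO (X.1.2 false)) (nO (X.1.2 true)) (nO X.2) => a b c; clear => a0 b0 c0.
have := mulr_ge0 a0 b0; have := mulr_ge0 a0 c0; have := mulr_ge0 b0 c0.
have -> : (a + b + c) ^+ 2 = a ^+ 2 + b ^+ 2 + c ^+ 2 + 2 * (a * b + a * c + b * c) by ring.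
by lra.
Qed.

Lemma energy_complete : scomplete in_state energy.
Proof.
move=> X SX cX.
have /choice[g Vg] : forall n, exists g, Vtuple (X n).1.1 (X n).1.2 g by move=> n; case: (SX n).
have cf i : scauchy dotO (fun n => (X n).1.2 i).
  move=> e /cX[n0 h]; exists n0 => m n lm ln; apply: le_lt_trans (h m n lm ln).
  exact: (snorm_energy_ge i (siB energy_inner (SX m) (SX n))).
have cw : scauchy dotO (fun n => (X n).2).
  move=> e /cX[n0 h]; exists n0 => m n lm ln; apply: le_lt_trans (h m n lm ln).
  exact: (snorm_energy_ge2 (siB energy_inner (SX m) (SX n))).
have [u [f [g' [V cu cf' cg]]]] := Vtuple_cauchy Vg cf.
have [w Lw hw] := @L2_complete _ _ R mu2 Omega mO (@mu2_Omega_fin R) (fun n => (X n).2)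
  (fun n => (SX n).2) cw.
have SY : in_state (u, f, w) by split; [exists g'|].
exists (u, f, w) => // e e0; have e30 : 0 < e / 3 by rewrite divr_gt0.
have [k1 h1] := cf' false _ e30; have [k2 h2] := cf' true _ e30; have [k3 h3] := hw _ e30.
exists (maxn k1 (maxn k2 k3)) => n; rewrite !geq_max => /and3P[/h1 {}h1 /h2 {}h2 /h3 {}h3].
apply: le_lt_trans (snorm_energy_le (siB energy_inner (SX n) SY)) _.
have -> : e = e / 3 + e / 3 + e / 3 by field.
by apply: ltrD; first exact: ltrD.
Qed.

Lemma wside_eq i (p q k : R -> R) : L2I p -> L2I q -> L2I k -> n1 (p - q) = 0 ->
  wside i p k = wside i q k.
Proof.
move=> Lp Lq Lk e; apply/eqP; rewrite -subr_eq0 -normr_eq0 eq_le normr_ge0 andbT.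
have := wside_lin i (-1) Lp Lq Lk; rewrite scaleN1r mulN1r => <-.
by apply: le_trans (wside_le i (siB ip1 Lp Lq) Lk) _; rewrite e mulr0 mul0r.
Qed.

End WaveGenerator.

(** * The wave operator generates a semigroup *)

Section Resolvent.
Context {R : realType}.
Local Notation mu := (@lebesgue_measure R).
Local Notation mu2 := (@lebesgue2 R).
Local Notation I := (@unit_itv R).
Local Notation mO := (@measurable_Omega R).
Local Notation mI := (@measurable_unit_itv R).
Local Notation dotO := (L2dot mu2 Omega).
Local Notation dot1 := (L2dot mu I).
Local Notation nO := (snorm dotO).
Local Notation n1 := (snorm dot1).
Local Notation ipO := (@ipO R).
Local Notation ip1 := (@ip1 R).
Local Notation L2I := (L2 mu I).
Local Notation F := (R * R -> R).
Implicit Types (u v w : F) (f : bool -> F) (g : bool -> R -> R).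

Variables (af : bool -> R -> R) (M : R).
Hypothesis maf : forall i, measurable_fun I (af i).
Hypothesis afM : forall i x, I x -> 0 <= af i x <= M.
Local Notation wside := (wside af).
Local Notation wdot := (wdot af).
Local Notation state := (@state R).
Local Notation energy := (@energy R).
Local Notation energy_inner := (@energy_inner R).
Local Notation tuple5 := (F * (bool -> F) * (bool -> R -> R))%type.

Let M0 : 0 <= M.
Proof.
have /(afM true)/andP[h1 h2] : I 2^-1 by rewrite /unit_itv /= in_itv/=; lra.
exact: le_trans h1 h2.
Qed.

Lemma wdot_lin c g g' k : (forall i, L2I (g i)) -> (forall i, L2I (g' i)) ->
  (forall i, L2I (k i)) -> wdot (g + c *: g') k = wdot g k + c * wdot g' k.
Proof.
move=> Lg Lg' Lk.
have e i : wside i ((g + c *: g') i) (k i) = wside i (g i) (k i) + c * wside i (g' i) (k i).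
  exact: (wside_lin maf afM i c (Lg i) (Lg' i) (Lk i)).
rewrite !wdotE !e.
by move: (wside _ _ _) (wside _ _ _) (wside _ _ _) (wside _ _ _) => *; ring.
Qed.

Lemma wdotC g k : (forall i, L2I (g i)) -> (forall i, L2I (k i)) -> wdot g k = wdot k g.
Proof. by move=> Lg Lk; congr (_ + _); exact: wsideC. Qed.

Lemma wdot_ge0 g : 0 <= wdot g g.
Proof. by apply: addr_ge0; exact: (wside_ge0 afM). Qed.

(** Eliminating the velocity from (1 - h A) X = X0 leaves a variational problem
    for the displacement, of which this is the bilinear form. *)
Definition resolvent_form (h : R) (Y Z : tuple5) :=
  dotO Y.1.1 Z.1.1 + h ^+ 2 * gdot Y.1.2 Z.1.2 + h * wdot Y.2 Z.2.

Definition in_V (Z : tuple5) := Vtuple Z.1.1 Z.1.2 Z.2.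

Lemma resolvent_form_lin h c Y Y' Z : in_V Y -> in_V Y' -> in_V Z ->
  resolvent_form h (Y + c *: Y') Z = resolvent_form h Y Z + c * resolvent_form h Y' Z.
Proof.
move=> /Vtuple_L2[Lu Lf Lg] /Vtuple_L2[Lu' Lf' Lg'] /Vtuple_L2[Lp Lq Lr].
have e1 : dotO (Y + c *: Y').1.1 Z.1.1 = dotO Y.1.1 Z.1.1 + c * dotO Y'.1.1 Z.1.1.
  exact: (etrans (siDl ipO Lu (siZ ipO c Lu') Lp) (congr1 _ (siZl ipO c Lu' Lp))).
have e2 : gdot (Y + c *: Y').1.2 Z.1.2 = gdot Y.1.2 Z.1.2 + c * gdot Y'.1.2 Z.1.2.
  exact: (gdot_lin c Lf Lf' Lq).
have e3 : wdot (Y + c *: Y').2 Z.2 = wdot Y.2 Z.2 + c * wdot Y'.2 Z.2.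
  exact: (wdot_lin c Lg Lg' Lr).
rewrite /resolvent_form e1 e2 e3.
move: (dotO _ _) (dotO _ _) (gdot _ _) (gdot _ _) (wdot _ _) (wdot _ _); clear => *; ring.
Qed.

Lemma in_V_lin c Y Y' : in_V Y -> in_V Y' -> in_V (Y + c *: Y').
Proof. exact: Vtuple_lin. Qed.

Lemma in_V0 : in_V 0.
Proof. exact: Vtuple0. Qed.

Lemma resolvent_inner h : 0 < h -> semi_inner in_V (resolvent_form h).
Proof.
move=> h0; split.
- exact: in_V0.
- by move=> Y Z VY VZ; have := in_V_lin 1 VY VZ; rewrite scale1r.
- by move=> c Y VY; have := in_V_lin c in_V0 VY; rewrite add0r.
- move=> Y Z /Vtuple_L2[Lu Lf Lg] /Vtuple_L2[Lp Lq Lr].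
  by rewrite /resolvent_form (siC ipO Lu Lp) (gdotC Lf Lq) (wdotC Lg Lr).
- move=> Y Y' Z VY VY' VZ; have := resolvent_form_lin h 1 VY VY' VZ.
  by rewrite scale1r mul1r.
- move=> c Y Z VY VZ; have := resolvent_form_lin h c in_V0 VY VZ; rewrite add0r => ->.
  have := resolvent_form_lin h (-1) VY VY VZ; rewrite scaleN1r subrr mulN1r subrr => ->.
  by rewrite add0r.
- move=> Y /Vtuple_L2[Lu Lf Lg]; apply: addr_ge0; first apply: addr_ge0.
  + exact: (si_ge0 ipO Lu).
  + by apply: mulr_ge0; [exact: sqr_ge0|exact: (le_trans (sqr_ge0 _) (gdot_ge true Lf))].
  + by apply: mulr_ge0; [exact: ltW|exact: wdot_ge0].
Qed.

Lemma resolvent_ge h Y i : 0 < h -> in_V Y ->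
  nO Y.1.1 <= snorm (resolvent_form h) Y /\ h * nO (Y.1.2 i) <= snorm (resolvent_form h) Y.
Proof.
move=> h0 VY; have [Lu Lf Lg] := Vtuple_L2 VY.
have ip := resolvent_inner h0.
have w0 : 0 <= h * wdot Y.2 Y.2 by apply: mulr_ge0; [exact: ltW|exact: wdot_ge0].
have g0 : h ^+ 2 * nO (Y.1.2 i) ^+ 2 <= h ^+ 2 * gdot Y.1.2 Y.1.2.
  by apply: ler_wpM2l; [exact: sqr_ge0|exact: gdot_ge].
have g1 : 0 <= h ^+ 2 * nO (Y.1.2 i) ^+ 2 by apply: mulr_ge0; exact: sqr_ge0.
have u0 : 0 <= dotO Y.1.1 Y.1.1 := si_ge0 ipO Lu.
have bn : resolvent_form h Y Y = snorm (resolvent_form h) Y ^+ 2 by rewrite (snorm_sqr ip VY).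
split; rewrite -ler_sqr ?nnegrE ?mulr_ge0 ?snorm_ge0 ?(ltW h0)// -bn.
  rewrite (snorm_sqr ipO Lu) /resolvent_form.
  by move: w0 g0 g1; move: (dotO _ _) (h * _) (h ^+ 2 * _) (h ^+ 2 * _); clear => *; lra.
rewrite exprMn /resolvent_form.
by move: w0 g0 g1 u0; move: (dotO _ _) (h * _) (h ^+ 2 * _) (h ^+ 2 * _); clear => *; lra.
Qed.

Lemma resolvent_le h Y : 0 < h -> in_V Y -> snorm (resolvent_form h) Y <=
  Num.sqrt (1 + h ^+ 2 + 4 * h * M) * (nO (Y.1.2 false) + nO (Y.1.2 true)).
Proof.
move=> h0 VY; have [Lu Lf Lg] := Vtuple_L2 VY.
have ip := resolvent_inner h0; have h1 := ltW h0.
have a0 := snorm_ge0 dotO (Y.1.2 false); have b0 := snorm_ge0 dotO (Y.1.2 true).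
have k0 : 0 <= 1 + h ^+ 2 + 4 * h * M.
  by rewrite !addr_ge0 ?sqr_ge0// mulr_ge0// mulr_ge0.
rewrite (snorm_le ip VY); last by rewrite mulr_ge0 ?sqrtr_ge0// addr_ge0.
rewrite exprMn sqr_sqrtr//.
have pu : dotO Y.1.1 Y.1.1 <= nO (Y.1.2 false) ^+ 2.
  rewrite -(snorm_sqr ipO Lu); apply: lerXn2r; rewrite ?nnegrE ?snorm_ge0//.
  exact: Vtuple_poincare VY.
have pw i : wside i (Y.2 i) (Y.2 i) <= 4 * M * nO (Y.1.2 i) ^+ 2.
  apply: le_trans (le_trans (ler_norm _) (wside_le maf afM i (Lg i) (Lg i))) _.
  have tr := Vtuple_trace i VY; have n0 := snorm_ge0 dot1 (Y.2 i).
  have := ler_pM n0 n0 tr tr; move: M0.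
  move: (n1 (Y.2 i)) (nO (Y.1.2 i)) => x y m0 hxy.
  rewrite -mulrA; apply: le_trans (ler_wpM2l m0 hxy) _.
  by rewrite le_eqVlt; apply/orP; left; apply/eqP; ring.
have pw0 := pw false; have pw1 := pw true; move: pu pw0 pw1.
rewrite /resolvent_form /gdot -!(snorm_sqr ipO (Lf _)) !wdotE.
move: (dotO _ _) (wside _ _ _) (wside _ _ _) => A B1 B2.
move: (nO (Y.1.2 false)) (nO (Y.1.2 true)) a0 b0 => a b a0 b0 pu pw0 pw1.
have ab := mulr_ge0 a0 b0; have q1 := sqr_ge0 a; have q2 := sqr_ge0 b.
have -> : (1 + h ^+ 2 + 4 * h * M) * (a + b) ^+ 2 =
  (a ^+ 2 + b ^+ 2 + 2 * (a * b)) + h ^+ 2 * (a ^+ 2 + b ^+ 2) + 2 * (h ^+ 2 * (a * b)) +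
  h * (4 * M * a ^+ 2 + 4 * M * b ^+ 2) + 8 * (h * (M * (a * b))) by ring.
have r1 : 0 <= h ^+ 2 * (a * b) by apply: mulr_ge0 => //; exact: sqr_ge0.
have r2 : 0 <= h * (M * (a * b)) by do !apply: mulr_ge0.
have r3 : h * (B2 + B1) <= h * (4 * M * a ^+ 2 + 4 * M * b ^+ 2).
  exact: (ler_wpM2l h1 (lerD pw0 pw1)).
by move: r1 r2 r3 pu ab q1 q2; lra.
Qed.

Lemma resolvent_complete h : 0 < h -> scomplete in_V (resolvent_form h).
Proof.
move=> h0 Z VZ cZ; have ip := resolvent_inner h0.
have cf i : scauchy dotO (fun n => (Z n).1.2 i).
  move=> e e0; have he : 0 < h * e by apply: mulr_gt0.
  have [n0 hn] := cZ _ he; exists n0 => m n lm ln.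
  rewrite -(ltr_pM2l h0); apply: le_lt_trans (hn m n lm ln).
  exact: (resolvent_ge i h0 (siB ip (VZ m) (VZ n))).2.
have [u [f [g [V cu cf' cg]]]] := Vtuple_cauchy VZ cf.
exists (u, f, g) => // e e0.
pose K := Num.sqrt (1 + h ^+ 2 + 4 * h * M) + 1.
have K0 : 0 < K by rewrite ltr_wpDl ?sqrtr_ge0.
have d0 : 0 < e / (2 * K) by rewrite divr_gt0// mulr_gt0.
have [k1 h1] := cf' false _ d0; have [k2 h2] := cf' true _ d0.
exists (maxn k1 k2) => n; rewrite geq_max => /andP[/h1 {}h1 /h2 {}h2].
apply: le_lt_trans (resolvent_le h0 (siB ip (VZ n) (V : in_V (u, f, g)))) _.
have n0 : 0 <= nO ((Z n).1.2 false - f false) + nO ((Z n).1.2 true - f true).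
  by rewrite addr_ge0 ?snorm_ge0.
apply: (@le_lt_trans _ _ (K * (nO ((Z n).1.2 false - f false) + nO ((Z n).1.2 true - f true)))).
  by apply: ler_wpM2r => //; rewrite /K lerDl.
have -> : e = K * (e / (2 * K) + e / (2 * K)) by field; rewrite gt_eqF.
by rewrite ltr_pM2l//; exact: ltrD.
Qed.

(** Riesz's theorem for resolvent_form gives the displacement u; the velocity is
    its difference quotient (u - u0) / h. *)
Lemma wave_range h (X : state) : 0 < h -> in_state X ->
  exists Y Z, wave_op af Y Z /\ snorm energy (Y - h *: Z - X) = 0.
Proof.
move=> h0 [[g0 V0] Lw]; have ip := resolvent_inner h0.
have hn0 : h != 0 by rewrite gt_eqF.
set u0 := X.1.1 in V0; set f0 := X.1.2 in V0; set w0 := X.2 in Lw.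
have [Lu0 Lf0 Lg0] := Vtuple_L2 V0.
pose p0 := u0 + h *: w0; have Lp0 : L2_Omega p0 := siD ipO Lu0 (siZ ipO h Lw).
pose l (Z : tuple5) := dotO p0 Z.1.1 + h * wdot g0 Z.2.
pose C := nO p0 + 2 * M * n1 (g0 false) + 2 * M * n1 (g0 true).
have [||||[[u f] g] V VE] := @riesz _ _ _ _ ip l C.
- exact: resolvent_complete.
- move=> Y Z /Vtuple_L2[Lu Lf Lg] /Vtuple_L2[Lp Lq Lr].
  have e1 : dotO p0 (Y + Z).1.1 = dotO p0 Y.1.1 + dotO p0 Z.1.1 := siDr ipO Lu Lp Lp0.
  have e2 : wdot g0 (Y + Z).2 = wdot g0 Y.2 + wdot g0 Z.2.
    have LYZ i : L2I ((Y + Z).2 i) := siD ip1 (Lg i) (Lr i).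
    rewrite (wdotC Lg0 LYZ) (wdotC Lg0 Lg) (wdotC Lg0 Lr).
    by have := wdot_lin 1 Lg Lr Lg0; rewrite scale1r mul1r.
  by rewrite /l e1 e2; move: (dotO _ _) (dotO _ _) (wdot _ _); clear => *; ring.
- move=> c Z /Vtuple_L2[Lp Lq Lr].
  have e1 : dotO p0 (c *: Z).1.1 = c * dotO p0 Z.1.1 := siZr ipO c Lp Lp0.
  have e2 : wdot g0 (c *: Z).2 = c * wdot g0 Z.2.
    have LZ i : L2I ((c *: Z).2 i) := siZ ip1 c (Lr i).
    rewrite (wdotC Lg0 LZ) (wdotC Lg0 Lr).
    have L0 i : L2I ((0 : bool -> R -> R) i) := si0 ip1.
    have := wdot_lin c L0 Lr Lg0; rewrite add0r => ->.
    have := wdot_lin (-1) Lr Lr Lg0; rewrite scaleN1r subrr mulN1r subrr => ->.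
    by rewrite add0r.
  by rewrite /l e1 e2; move: (dotO _ _) (wdot _ _); clear => *; ring.
- move=> Z VZ; have [Lp Lq Lr] := Vtuple_L2 VZ.
  have b1 := si_cs ipO Lp0 Lp; have [r1 _] := resolvent_ge true h0 VZ.
  have bw i : `|h * wside i (g0 i) (Z.2 i)| <=
      2 * M * n1 (g0 i) * snorm (resolvent_form h) Z.
    rewrite normrM (gtr0_norm h0).
    have [_ r2] := resolvent_ge i h0 VZ.
    have := wside_le maf afM i (Lg0 i) (Lr i); have := Vtuple_trace i VZ.
    have := snorm_ge0 dot1 (g0 i); move: M0 r2; move: (snorm _ Z) (nO _) (n1 (Z.2 i)) (n1 (g0 i)).
    move: `|_| => A S a b c m0 r2 c0 tr wl.
    have h1 : h * b <= 2 * S by have := ler_wpM2l (ltW h0) tr; lra.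
    have h2 : h * A <= M * c * (h * b) by have := ler_wpM2l (ltW h0) wl; lra.
    apply: le_trans h2 _; have := ler_wpM2l (mulr_ge0 m0 c0) h1; lra.
  have := bw false; have := bw true; rewrite /l /C !wdotE mulrDr.
  move: b1 r1 (snorm_ge0 dotO p0); move: (snorm _ Z) (nO p0) (nO Z.1.1) (n1 _) (n1 _).
  move: (dotO _ _) (h * _) (h * _) => A B1 B2 S a b c d b1 r1 a0 hb1 hb2.
  apply: le_trans (ler_normD _ _) _.
  have := ler_normD B1 B2; have := ler_wpM2l a0 r1; lra.
have [Lu Lf Lg] := Vtuple_L2 (V : Vtuple u f g).
pose v := h^-1 *: (u - u0); pose k := h^-1 *: (f - f0); pose r := h^-1 *: (g - g0).
have Vv : Vtuple v k r by exact: VtupleZ (VtupleB V V0).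
have [Lv Lk Lr] := Vtuple_L2 Vv.
pose L := h^-1 *: (v - w0); have LL : L2_Omega L := siZ ipO _ (siB ipO Lv Lw).
exists (u, f, v), (v, k, L); split; last first.
  have -> : (u, f, v) - h *: (v, k, L) - X = 0.
    have -> : X = (u0, f0, w0) by rewrite /u0 /f0 /w0; case: X {V0 Lw u0 f0 w0 Lu0 Lf0 Lg0 p0 Lp0 l C VE v k r Vv Lv Lk Lr L LL} => -[].
    congr (_, _, _) => /=; rewrite /L /k /v; lin R.
  exact: (snorm0 energy_inner).
exists g, r; split => //=; first by rewrite subrr (snorm0 ipO).
move=> p q s Vp; have [Lp Lq Ls] := Vtuple_L2 Vp.
have E := VE (p, q, s) Vp; rewrite /l /resolvent_form /= in E.
have e1 : dotO L p = h^-1 * (dotO v p - dotO w0 p).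
  by rewrite (siZl ipO _ (siB ipO Lv Lw) Lp) (siBl ipO Lv Lw Lp).
have e2 : dotO v p = h^-1 * (dotO u p - dotO u0 p).
  by rewrite (siZl ipO _ (siB ipO Lu Lu0) Lp) (siBl ipO Lu Lu0 Lp).
have e3 : dotO p0 p = dotO u0 p + h * dotO w0 p.
  by rewrite (siDl ipO Lu0 (siZ ipO h Lw) Lp) (siZl ipO h Lw Lp).
have e4 : wdot r s = h^-1 * (wdot g s - wdot g0 s).
  have -> : r = h^-1 *: g + (- h^-1) *: g0 by rewrite /r scalerBr scaleNr.
  have Lhg i : L2I ((h^-1 *: g) i) := siZ ip1 _ (Lg i).
  rewrite (wdot_lin _ Lhg Lg0 Ls).
  have L0 i : L2I ((0 : bool -> R -> R) i) := si0 ip1.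
  have := wdot_lin h^-1 L0 Lg Ls; rewrite add0r => ->.
  have := wdot_lin (-1) Lg Lg Ls; rewrite scaleN1r subrr mulN1r subrr => ->.
  by rewrite add0r; ring.
rewrite e1 e2 e4; rewrite e3 in E; move: E.
move: (dotO u p) (dotO u0 p) (dotO w0 p) (gdot f q) (wdot g s) (wdot g0 s) => A B1 C1 D1 E1 F1 E.
have -> : D1 = (B1 + h * C1 + h * F1 - A - h * E1) / h ^+ 2.
  have -> : B1 + h * C1 + h * F1 - A - h * E1 = h ^+ 2 * D1 by move: E; lra.
  by field.
by field.
Qed.

(** Dissipativity is Green's formula: the energy is lost through the damped sides
    at the rate given by wdot. *)
Lemma wave_generator : generator (@in_state R) energy (wave_op af).
Proof.
split.
- move=> X Y [g [h [V1 V2 [Lw Ll] _ _]]]; split; (split; last by []); [by exists g|by exists h].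
- move=> c X Y X' Y' [g [h [V1 V2 [Lw Ll] e id]]] [g' [h' [V1' V2' [Lw' Ll'] e' id']]].
  have [Lu Lf Lg] := Vtuple_L2 V1; have [Lv Lk Lh] := Vtuple_L2 V2.
  have [Lu' Lf' Lg'] := Vtuple_L2 V1'; have [Lv' Lk' Lh'] := Vtuple_L2 V2'.
  exists (g + c *: g'), (h + c *: h'); split.
  + exact: (Vtuple_lin c V1 V1').
  + exact: (Vtuple_lin c V2 V2').
  + by split; [exact: (siD ipO Lw (siZ ipO c Lw'))|exact: (siD ipO Ll (siZ ipO c Ll'))].
  + have -> : (X + c *: X').2 - (Y + c *: Y').1.1 = (X.2 - Y.1.1) + c *: (X'.2 - Y'.1.1).
      by rewrite scalerBr addrACA -opprD.
    apply/eqP; rewrite eq_le snorm_ge0 andbT.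
    have L1 := siB ipO Lw Lv; have L2 := siB ipO Lw' Lv'.
    apply: le_trans (snormD ipO L1 (siZ ipO c L2)) _.
    by rewrite e (snormZ ipO c L2) e' mulr0 addr0.
  + move=> p q r Vp; have [Lp Lq Lr] := Vtuple_L2 Vp.
    have e1 : dotO (Y + c *: Y').2 p = dotO Y.2 p + c * dotO Y'.2 p.
      exact: (etrans (siDl ipO Ll (siZ ipO c Ll') Lp) (congr1 _ (siZl ipO c Ll' Lp))).
    have e2 : gdot (X + c *: X').1.2 q = gdot X.1.2 q + c * gdot X'.1.2 q.
      exact: (gdot_lin c Lf Lf' Lq).
    rewrite e1 e2 (wdot_lin c Lh Lh' Lr); have := id _ _ _ Vp; have := id' _ _ _ Vp.
    move: (dotO Y.2 p) (dotO Y'.2 p) (gdot X.1.2 q) (gdot X'.1.2 q) => b1 b2 b3 b4 h2 h1.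
    have -> : b1 + c * b2 + (b3 + c * b4) = (b1 + b3) + c * (b2 + b4) by ring.
    by rewrite h1 h2; ring.
- move=> X Y [g [h [V1 V2 [Lw Ll] e id]]].
  have [Lu Lf Lg] := Vtuple_L2 V1; have [Lv Lk Lh] := Vtuple_L2 V2.
  rewrite !energyE (si_eq ipO Lw Lv Ll e) (siC ipO Lv Ll) addrC (id _ _ _ V2).
  by rewrite oppr_le0; exact: wdot_ge0.
- exact: wave_range.
- move=> X Y X' Y' gXY SX' SY' eX eY.
  have [g [h [V1 V2 [Lw Ll] e id]]] := gXY.
  have [[g' V1'] Lw'] := SX'; have [[h' V2'] Ll'] := SY'.
  have [Lu Lf Lg] := Vtuple_L2 V1; have [Lv Lk Lh] := Vtuple_L2 V2.
  have [Lu' Lf' Lg'] := Vtuple_L2 V1'; have [Lv' Lk' Lh'] := Vtuple_L2 V2'.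
  have SX : in_state X by split; [exists g|].
  have SY : in_state Y by split; [exists h|].
  have DX := siB energy_inner SX SX'; have DY := siB energy_inner SY SY'.
  have zero (x : R) : 0 <= x -> x <= 0 -> x = 0 by move=> *; apply/eqP; rewrite eq_le; apply/andP.
  have ef i : nO (X.1.2 i - X'.1.2 i) = 0.
    by apply: zero; [exact: snorm_ge0|rewrite -eX; exact: (snorm_energy_ge i DX)].
  have ek i : nO (Y.1.2 i - Y'.1.2 i) = 0.
    by apply: zero; [exact: snorm_ge0|rewrite -eY; exact: (snorm_energy_ge i DY)].
  have ew : nO (X.2 - X'.2) = 0.
    by apply: zero; [exact: snorm_ge0|rewrite -eX; exact: (snorm_energy_ge2 DX)].
  have el : nO (Y.2 - Y'.2) = 0.
    by apply: zero; [exact: snorm_ge0|rewrite -eY; exact: (snorm_energy_ge2 DY)].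
  have V2B := VtupleB V2 V2'.
  have ev : nO (Y.1.1 - Y'.1.1) = 0.
    by apply: zero; [exact: snorm_ge0|rewrite -(ek true); exact: (Vtuple_poincare true V2B)].
  have eh i : n1 (h i - h' i) = 0.
    apply: zero; [exact: snorm_ge0|]; apply: le_trans (Vtuple_trace i V2B) _.
    by rewrite [nO _](ek i) mulr0.
  exists g', h'; split => //.
  + apply: zero; first exact: snorm_ge0.
    have t1 := snormB ipO Lw' Lw Lv'; have t2 := snormB ipO Lw Lv Lv'.
    rewrite (snormBC ipO Lw' Lw) ew in t1; rewrite e ev in t2.
    by apply: le_trans t1 _; rewrite add0r; apply: le_trans t2 _; rewrite addr0.
  + move=> p q r Vp; have [Lp Lq Lr] := Vtuple_L2 Vp.
    have <- := si_eq ipO Ll Ll' Lp el; rewrite /gdot.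
    have <- := si_eq ipO (Lf false) (Lf' false) (Lq false) (ef false).
    have <- := si_eq ipO (Lf true) (Lf' true) (Lq true) (ef true).
    rewrite !wdotE.
    have <- := wside_eq maf afM false (Lh false) (Lh' false) (Lr false) (eh false).
    have <- := wside_eq maf afM true (Lh true) (Lh' true) (Lr true) (eh true).
    exact: (id _ _ _ Vp).
Qed.

End Resolvent.

(** * Green's formula and the domain of the wave operator *)

Section Green.
Context {R : realType}.
Local Notation mu := (@lebesgue_measure R).
Local Notation mu2 := (@lebesgue2 R).
Local Notation I := (@unit_itv R).
Local Notation mO := (@measurable_Omega R).
Local Notation mI := (@measurable_unit_itv R).
Local Notation dotO := (L2dot mu2 Omega).
Local Notation dot1 := (L2dot mu I).
Local Notation nO := (snorm dotO).
Local Notation n1 := (snorm dot1).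
Local Notation ipO := (@ipO R).
Local Notation ip1 := (@ip1 R).
Local Notation L2I := (L2 mu I).
Local Notation F := (R * R -> R).
Implicit Types (u v w : F) (f : bool -> F) (g : bool -> R -> R).

Lemma sum_close (e x1 y1 x2 y2 x3 y3 y4 c1 c2 c3 c4 : R) :
  `|y1 - x1| <= e * c1 -> `|y2 - x2| <= e * c2 -> `|y3 - x3| <= e * c3 -> `|y4| <= e * c4 ->
  y1 + y2 = y4 - y3 -> `|x1 + x2 + x3| <= e * (c1 + c2 + c3 + c4).
Proof.
rewrite !ler_norml !(mulrDr e) => /andP[h1 h2] /andP[h3 h4] /andP[h5 h6] /andP[h7 h8] h9.
by apply/andP; split; lra.
Qed.

Lemma green_Smooth i u v : Smooth u -> Smooth v ->
  dotO (pd i u) v + dotO u (pd i v) =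
  dot1 (u \o side_pt i 1) (v \o side_pt i 1) - dot1 (u \o side_pt i 0) (v \o side_pt i 0).
Proof.
move=> su sv; have := int_c1 (c1M (Smooth_c1 i su) (Smooth_c1 i sv)).
rewrite RintegralB; last 3 first.
- exact: mI.
- exact: (L2_integ_mul (m := mu) mI (Smooth_L2side i 1 su) (Smooth_L2side i 1 sv)).
- exact: (L2_integ_mul (m := mu) mI (Smooth_L2side i 0 su) (Smooth_L2side i 0 sv)).
rewrite RintegralD; last 3 first.
- exact: mO.
- exact: (L2_integ_mul (m := mu2) mO (Smooth_L2 su) (Smooth_L2 (Smooth_pd i sv))).
- exact: (L2_integ_mul (m := mu2) mO (Smooth_L2 sv) (Smooth_L2 (Smooth_pd i su))).
by move=> h; rewrite addrC (siC ipO (Smooth_L2 (Smooth_pd i su)) (Smooth_L2 sv)); exact: h.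
Qed.

(** Green's formula against a function of V: the boundary terms on Gamma_0
    vanish in the limit of the smooth approximations. *)
Lemma green i u p q r : Smooth u -> Vtuple p q r ->
  dotO (pd i (pd i u)) p + dotO (pd i u) (q i) = - dot1 (pd i u \o side_pt i 0) (r i).
Proof.
move=> su V; have [Lp Lq Lr happ] := V.
have s1 := Smooth_pd i su; have s2 := Smooth_pd i s1.
have L1 := Smooth_L2 s1; have L2 := Smooth_L2 s2.
have B0 := Smooth_L2side i 0 s1; have B1 := Smooth_L2side i 1 s1.
apply/eqP; rewrite -subr_eq0 opprK; apply/eqP.
apply: (@small_eq0 _ _ (nO (pd i (pd i u)) + nO (pd i u) + n1 (pd i u \o side_pt i 0) +
  n1 (pd i u \o side_pt i 1))) => e e0.
have [phi [sp a1 /(_ i) a2 /(_ i) a3 /(_ i) a4]] := happ _ e0.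
have Lphi := Smooth_L2 sp; have Lpi := Smooth_L2 (Smooth_pd i sp).
have C0 := Smooth_L2side i 0 sp; have C1 := Smooth_L2side i 1 sp.
have L4 : `|dot1 (pd i u \o side_pt i 1) (phi \o side_pt i 1)| <= e * n1 (pd i u \o side_pt i 1).
  by rewrite mulrC; apply: le_trans (si_cs ip1 B1 C1) (ler_wpM2l (snorm_ge0 _ _) (ltW a4)).
exact: (sum_close (si_close ipO L2 Lphi Lp a1) (si_close ipO L1 Lpi (Lq i) a2)
  (si_close ip1 B0 C0 (Lr i) a3) L4 (green_Smooth i s1 sp)).
Qed.

Definition lap u : F := pd false (pd false u) + pd true (pd true u).

Lemma Smooth_lap u : Smooth u -> Smooth (lap u).
Proof. by move=> su; apply: SmoothD; do 2!apply: Smooth_pd. Qed.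

(** Without normal derivative on Gamma_1, no boundary term is left. *)
Lemma green_neumann u p q r : Smooth u -> Vtuple p q r ->
  (forall i t, pd i u (side_pt i 0 t) = 0) -> dotO (lap u) p + gdot (pd^~ u) q = 0.
Proof.
move=> su V nu; have [Lp _ Lr _] := V.
have L2 i := Smooth_L2 (Smooth_pd i (Smooth_pd i su)).
have e0 : dotO (lap u) p = dotO (pd false (pd false u)) p + dotO (pd true (pd true u)) p.
  exact: (siDl ipO (L2 false) (L2 true) Lp).
have e i : dotO (pd i (pd i u)) p + dotO (pd i u) (q i) = 0.
  rewrite (green i su V).
  have -> : pd i u \o side_pt i 0 = 0 by apply/funext => t; rewrite /= nu.
  have := siBl ip1 (Lr i) (Lr i) (Lr i); rewrite !subrr => ->; exact: oppr0.
have sum4 (x a b c d : R) : x = a + c -> a + b = 0 -> c + d = 0 -> x + (b + d) = 0.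
  by move=> -> h1 h2; rewrite addrACA h1 h2 addr0.
exact: (sum4 _ _ _ _ _ e0 (e false) (e true)).
Qed.

Lemma wave_op_smooth af u w : Smooth u ->
  (forall i t, u (side_pt i 1 t) = 0) -> (forall i t, pd i u (side_pt i 0 t) = 0) ->
  Vtuple w (pd^~ w) 0 -> wave_op af (u, pd^~ u, w) (w, pd^~ w, lap u).
Proof.
move=> su u1 nu Vw; exists (fun i => u \o side_pt i 0), 0; split => //=.
- exact: Vtuple_Smooth.
- by split; [case: Vw|exact: Smooth_L2 (Smooth_lap su)].
- by rewrite subrr (snorm0 ipO).
move=> p q r V; rewrite (green_neumann su V nu); have [_ _ Lr _] := V.
have z i : wside af i 0 (r i) = 0.
  rewrite /wside; have -> : (fun x => af i x * (0 : R -> R) x) = 0.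
    by apply/funext => x; exact: mulr0.
  by have := siBl ip1 (Lr i) (Lr i) (Lr i); rewrite !subrr.
by rewrite /wdot !z addr0 oppr0.
Qed.

Lemma laplacian_spec u l : is_laplacian u l ->
  [/\ is_laplacian u (laplacian u), L2_Omega (laplacian u) & nO (laplacian u - l) = 0].
Proof.
move=> h; have h' : is_laplacian u (laplacian u).
  by rewrite /laplacian; case: xgetP => [w _ //|/(_ l)].
split => //; first by case: h'.
by apply: dot_separating; [case: h'|case: h|move=> phi tp; rewrite /L2dot -h'.2// -h.2].
Qed.

(** The weak derivatives, the Laplacian and the traces in the definition of the
    normal derivative may be replaced by any representatives. *)
Lemma normal_derivP u f g l (k : bool -> R -> R) : Vtuple u f g -> is_laplacian u l ->
  (forall i, L2I (k i)) ->
  (normal_deriv u (k true, k false) <-> forall p q r, Vtuple p q r ->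
    dotO l p + gdot f q = dot1 (k true) (r true) + dot1 (k false) (r false)).
Proof.
move=> V hl Lk; have [Lu Lf _ _] := V.
have [_ LL el] := laplacian_spec hl; have Ll := hl.1.
have wu i := weak_d_spec (Vtuple_weak_d i V).
have key p q r : Vtuple p q r ->
    (\int[mu2]_(x in Omega) (laplacian u x * p x + weak_d false u x * weak_d false p x
       + weak_d true u x * weak_d true p x) = dotO l p + gdot f q) /\
    (\int[mu]_(x in I) (k true x * trace_on bottom_side p x) +
     \int[mu]_(y in I) (k false y * trace_on left_side p y) =
     dot1 (k true) (r true) + dot1 (k false) (r false)).
  move=> Vp; have [Lp Lq Lr _] := Vp.
  have wp i := weak_d_spec (Vtuple_weak_d i Vp).
  have Wu i : L2_Omega (weak_d i u) by case: (wu i).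
  have Wp i : L2_Omega (weak_d i p) by case: (wp i).
  have i0 := L2_integ_mul (m := mu2) mO LL Lp.
  have i1 j := L2_integ_mul (m := mu2) mO (Wu j) (Wp j).
  split.
    have eL : \int[mu2]_(x in Omega) (laplacian u x * p x + weak_d false u x * weak_d false p x
       + weak_d true u x * weak_d true p x) = dotO (laplacian u) p +
       dotO (weak_d false u) (weak_d false p) + dotO (weak_d true u) (weak_d true p).
      rewrite RintegralD; last 3 first.
      - exact: mO.
      - exact: (@integrableD _ _ R mu2 Omega mO _ _ i0 (i1 false)).
      - exact: (i1 true).
      rewrite RintegralD; last 3 first.
      - exact: mO.
      - exact: i0.
      - exact: (i1 false).
      by [].
    rewrite eL (si_eq ipO LL Ll Lp el) /gdot -addrA; congr (_ + _).
    have e i : dotO (weak_d i u) (weak_d i p) = dotO (f i) (q i).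
      have [_ _ e1] := wu i; have [_ _ e2] := wp i.
      rewrite (si_eq ipO (Wu i) (Lf i) (Wp i) e1) (siC ipO (Lf i) (Wp i)).
      by rewrite (si_eq ipO (Wp i) (Lq i) (Lf i) e2) (siC ipO (Lq i) (Lf i)).
    exact: (congr2 +%R (e false) (e true)).
  have e i : dot1 (k i) (trace_on (side_of i) p) = dot1 (k i) (r i).
    have [Lt et] := trace_onP i Vp.
    by rewrite (siC ip1 (Lk i) Lt) (si_eq ip1 Lt (Lr i) (Lk i) et) (siC ip1 (Lr i) (Lk i)).
  exact: (congr2 +%R (e true) (e false)).
split=> [[_ _ h] p q r Vp|h].
  by have [<- <-] := key p q r Vp; exact: h (Vtuple_V Vp).
split; [exact: (Lk true)|exact: (Lk false)|move=> phi /V_Vtuple[q [r Vp]]].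
by have [-> ->] := key phi q r Vp; exact: h Vp.
Qed.

Definition sides (a : (R -> R) * (R -> R)) (i : bool) := if i then a.1 else a.2.

Lemma wave_op_laplacian af (X Y : @state R) : wave_op af X Y -> is_laplacian X.1.1 Y.2.
Proof.
move=> [g [h [V V' [_ Ll] _ hid]]]; split => // phi tp.
have [Lu Lf Lg _] := V; have sp := test_Smooth tp; have [_ _ Lh _] := V'.
have := hid _ _ _ (Vtuple_test tp).
have z i : wside af i (h i) ((0 : bool -> R -> R) i) = 0.
  rewrite /wside /L2dot; rewrite (_ : (fun x => _) = cst 0); last first.
    by apply/funext => x /=; exact: mulr0.
  by rewrite Rintegral_unit_cst.
rewrite /wdot !z addr0 oppr0 => /eqP; rewrite addr_eq0 => /eqP e.
have w i := (is_weak_dE i _ _).1 (Vtuple_weak_d i V).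
have L i := Smooth_L2 (Smooth_pd i (Smooth_pd i sp)).
have e1 : dotO X.1.1 (lap phi) =
    dotO X.1.1 (pd false (pd false phi)) + dotO X.1.1 (pd true (pd true phi)).
  exact: (siDr ipO (L false) (L true) Lu).
have e2 i : dotO X.1.1 (pd i (pd i phi)) = - dotO (X.1.2 i) (pd i phi).
  exact: (w i).2 (test_pd i tp).
have e3 : dotO X.1.1 (lap phi) = dotO Y.2 phi.
  exact: (etrans e1 (etrans (congr2 +%R (e2 false) (e2 true)) (etrans (esym (opprD _ _)) (esym e)))).
exact: e3.
Qed.

(** The boundary condition, read through Green's formula, is the identity that
    defines wave_op. *)
Lemma A_domP (a : (R -> R) * (R -> R)) M u v : (forall i, measurable_fun I (sides a i)) ->
  (forall i x, I x -> 0 <= sides a i x <= M) ->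
  (A_dom a (u, v) <-> exists f k l, wave_op (sides a) (u, f, v) (v, k, l)).
Proof.
move=> ma aM.
have nd f g k h l : Vtuple u f g -> Vtuple v k h -> is_laplacian u l ->
    (normal_deriv u (fun x => - (a.1 x * trace_on bottom_side v x),
                     fun y => - (a.2 y * trace_on left_side v y)) <->
     forall p q r, Vtuple p q r -> dotO l p + gdot f q = - wdot (sides a) h r).
  move=> V W hl.
  pose K i x := - (sides a i x * trace_on (side_of i) v x).
  have Lt i : L2I (trace_on (side_of i) v) by have [] := trace_onP i W.
  have [_ _ Lh _] := W.
  have LK i : L2I (K i) := siN ip1 (L2_af ma aM i (Lt i)).
  have eK p q r i : Vtuple p q r -> dot1 (K i) (r i) = - wside (sides a) i (h i) (r i).
    move=> [_ _ Lr _]; have [_ et] := trace_onP i W.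
    rewrite -(wside_eq ma aM i (Lt i) (Lh i) (Lr i) et).
    have := siZl ip1 (-1) (L2_af ma aM i (Lt i)) (Lr i).
    by rewrite scaleN1r mulN1r.
  have ee p q r : Vtuple p q r ->
      dot1 (K true) (r true) + dot1 (K false) (r false) = - wdot (sides a) h r.
    move=> Vp; rewrite /wdot opprD addrC.
    exact: (congr2 +%R (eK p q r false Vp) (eK p q r true Vp)).
  apply: (iff_trans (normal_derivP V hl LK)); split=> h' p q r Vp.
    exact: (etrans (h' p q r Vp) (ee p q r Vp)).
  exact: (etrans (h' p q r Vp) (esym (ee p q r Vp))).
split.
  move=> [/= Vu Vv [l hl] hn]; have [f [g V]] := V_Vtuple Vu; have [k [h W]] := V_Vtuple Vv.
  exists f, k, l, g, h; split => //=; first by split; [case: W|case: hl].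
    by rewrite subrr (snorm0 ipO).
  exact/(nd _ _ _ _ _ V W hl).
move=> [f [k [l wo]]]; have hl := wave_op_laplacian wo.
have [g [h [V W _ _ hid]]] := wo.
split => /=; [exact: Vtuple_V V|exact: Vtuple_V W|by exists l|].
exact/(nd _ _ _ _ _ V W hl).
Qed.

Local Notation NE := (snorm energy).

(** By Poincare's inequality the energy norm is equivalent to that of V + L2. *)
Lemma V_L2norm_energy u f g w : Vtuple u f g -> L2_Omega w ->
  exists r, [/\ V_L2norm (u, w) = r%:E, 0 <= r, r <= 4 * NE (u, f, w) &
    NE (u, f, w) <= 3 * r].
Proof.
move=> V Lw; have S : in_state (u, f, w) by split; [exists g|].
have [Lu Lf _ _] := V.
exists (Num.sqrt (h1norm u f ^+ 2 + nO w ^+ 2)); split.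
- rewrite /V_L2norm /= (H1normE Lu (fun i => Vtuple_weak_d i V)).
  rewrite -(hypot_fin (h1norm u f) (nO w)).
  exact: (congr1 (hypot _) (L2normO Lw)).
- exact: sqrtr_ge0.
- have h0 : 0 <= h1norm u f by exact: sqrtr_ge0.
  apply: le_trans (sqrt_hypot_le h0 (snorm_ge0 _ _)) _.
  have := h1norm_le u f; have := Vtuple_poincare true V.
  have := snorm_energy_ge true S; have := snorm_energy_ge false S; have := snorm_energy_ge2 S.
  by move=> /=; move: (h1norm _ _) (NE _) (nO w) (nO u) (nO _) (nO _); clear => *; lra.
- apply: le_trans (snorm_energy_le S) _ => /=.
  have h0 : 0 <= h1norm u f by exact: sqrtr_ge0.
  have h1 := le_sqrt_hypotl (nO w) h0; have h2 := le_sqrt_hypotr (h1norm u f) (snorm_ge0 dotO w).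
  have sum3 (a b c h s : R) : a <= h -> b <= h -> h <= s -> c <= s -> a + b + c <= 3 * s.
    by clear => *; lra.
  exact: (sum3 _ _ _ _ _ (le_h1norm false u f) (le_h1norm true u f) h1 h2).
Qed.

Lemma A_graph_norm_energy af (X Y : @state R) : wave_op af X Y ->
  exists r, [/\ A_graph_norm (X.1.1, Y.1.1) = r%:E, 0 <= r & r <= 4 * (NE X + NE Y)].
Proof.
move=> wo; have [_ LL el] := laplacian_spec (wave_op_laplacian wo).
have [g [h [V W [Lw Ll] e _]]] := wo; have [Lv _ _ _] := W; have [_ Lf _ _] := V.
have [_ Lk _ _] := W.
have [r1 [e1 p1 q1 _]] := V_L2norm_energy V Lv.
have [r2 [e2 p2 q2 _]] := V_L2norm_energy W LL.
exists (Num.sqrt (r1 ^+ 2 + r2 ^+ 2)); split.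
- by rewrite /A_graph_norm /A_op /= e1 e2 hypot_fin.
- exact: sqrtr_ge0.
apply: le_trans (sqrt_hypot_le p1 p2) _.
have a1 : NE (X.1.1, X.1.2, Y.1.1) = NE X.
  rewrite /snorm /energy /=; congr (Num.sqrt (_ + _)).
  by rewrite -(snorm_sqr ipO Lw) -(snorm_sqr ipO Lv) (snorm_eq ipO Lw Lv e).
have a2 : NE (Y.1.1, Y.1.2, laplacian X.1.1) = NE Y.
  rewrite /snorm /energy /=; congr (Num.sqrt (_ + _)).
  by rewrite -(snorm_sqr ipO LL) -(snorm_sqr ipO Ll) (snorm_eq ipO LL Ll el).
by rewrite mulrDr -a1 -a2; exact: lerD.
Qed.

End Green.

(** * Existence of waves *)

Section Existence.
Context {R : realType}.
Local Notation mu := (@lebesgue_measure R).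
Local Notation mu2 := (@lebesgue2 R).
Local Notation I := (@unit_itv R).
Local Notation mO := (@measurable_Omega R).
Local Notation mI := (@measurable_unit_itv R).
Local Notation dotO := (L2dot mu2 Omega).
Local Notation dot1 := (L2dot mu I).
Local Notation nO := (snorm dotO).
Local Notation n1 := (snorm dot1).
Local Notation ipO := (@ipO R).
Local Notation ip1 := (@ip1 R).
Local Notation L2I := (L2 mu I).
Local Notation F := (R * R -> R).
Local Notation NE := (snorm (@energy R)).
Implicit Types (u v w : F) (f : bool -> F) (g : bool -> R -> R).

Lemma cvge0_spec (T : Type) (G : set_system T) (FG : Filter G) (h : T -> \bar R) :
  (forall e : R, 0 < e -> \forall x \near G, exists r : R, [/\ h x = r%:E, 0 <= r & r <= e]) ->
  h x @[x --> G] --> 0%E.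
Proof.
move=> H; have E : \forall x \near G, `|fine (h x)|%:E = h x.
  by apply: filterS (H 1 ltr01) => x [r [-> r0 _]] /=; rewrite ger0_norm.
apply: (cvg_trans (near_eq_cvg E)).
apply: cvge0_near => // e /H; apply: filterS => x [r [-> r0 re]] /=.
by rewrite ger0_norm.
Qed.

Lemma near_halfline t (P : R -> Prop) (d : R) : 0 < d ->
  (forall s, 0 <= s -> `|s - t| < d -> P s) ->
  \forall s \near within halfline (nbhs t), P s.
Proof.
move=> d0 h; rewrite near_withinE; apply/nbhs_ballP; exists d => //= s.
by rewrite /ball/= distrC => sd s0; exact: h.
Qed.

Lemma near_halfline_dnbhs t (P : R -> Prop) (d : R) : 0 < d ->
  (forall s, 0 <= s -> s != t -> `|s - t| < d -> P s) ->
  \forall s \near within halfline (dnbhs t), P s.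
Proof.
move=> d0 h; rewrite near_withinE /dnbhs near_withinE; apply/nbhs_ballP; exists d => //= s.
by rewrite /ball/= distrC => sd st s0; exact: h.
Qed.

Lemma Smooth0 : Smooth (0 : F).
Proof.
have sz : Smooth (tensor (cst 0) (cst 0) : F).
  by constructor; apply: smooth_tensor; exact: smooth1_cst.
by rewrite -(scale0r (tensor (cst 0) (cst 0))); exact: SmoothZ.
Qed.

Lemma pd0 : (fun i => pd i (0 : F)) = 0.
Proof.
by apply/funext => i; have := pdZ i 0 Smooth0; rewrite scaler0 scale0r.
Qed.

Lemma lap0 : lap (0 : F) = 0.
Proof.
have e i : pd i (0 : F) = 0 by have := pdZ i 0 Smooth0; rewrite scaler0 scale0r.
by rewrite /lap !e addr0.
Qed.

Lemma energy_swap u f w w' : (forall i, L2_Omega (f i)) -> L2_Omega w -> L2_Omega w' ->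
  nO (w - w') = 0 -> NE (u, f, w) = NE (u, f, w').
Proof.
move=> Lf Lw Lw' e; rewrite /snorm /energy /=; congr (Num.sqrt (_ + _)).
by rewrite -(snorm_sqr ipO Lw) -(snorm_sqr ipO Lw') (snorm_eq ipO Lw Lw' e).
Qed.

Lemma proj_comb (c : R) (X X' Y : @state R) :
  ((c *: (X - X') - Y).1.1, (c *: (X - X') - Y).2) =
  c *: ((X.1.1, X.2) - (X'.1.1, X'.2)) - (Y.1.1, Y.2).
Proof. by []. Qed.

Section Curves.
Variables (a : (R -> R) * (R -> R)) (M : R).
Hypothesis ma : forall i, measurable_fun I (sides a i).
Hypothesis aM : forall i x, I x -> 0 <= sides a i x <= M.
Let hG := wave_generator ma aM.

(** The initial state (phi, 0) lies in the domain, with image (0, lap phi).  That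
    image is approached by the states (0, eta) with eta a test function, which
    belong to the domain of every power of the operator, whatever the damping. *)
Lemma wave_curves phi : Smooth phi ->
  (forall i t, phi (side_pt i 1 t) = 0) -> (forall i t, pd i phi (side_pt i 0 t) = 0) ->
  (forall e, 0 < e -> exists2 eta, test_fun eta & nO (lap phi - eta) < e) ->
  exists U V : R -> @state R,
  [/\ nO ((U 0).1.1 - phi) = 0, nO (V 0).1.1 = 0,
      forall t, 0 <= t -> wave_op (sides a) (U t) (V t) /\ (U t).2 = (V t).1.1,
      forall t e, 0 <= t -> 0 < e -> exists2 d, 0 < d &
        forall s, 0 <= s -> `|s - t| < d -> NE (V s - V t) <= e &
      forall t e, 0 <= t -> 0 < e -> exists2 d, 0 < d &
        forall s, 0 <= s -> `|s - t| < d ->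
          NE (U s - U t - (s - t) *: V t) <= e * `|s - t| ].
Proof.
move=> sphi p1 pn papp.
have V00 : Vtuple (0 : F) (pd^~ 0) 0 by rewrite pd0; exact: Vtuple0.
have V0l : Vtuple (lap (0 : F)) (pd^~ (lap (0 : F))) 0 by rewrite lap0.
pose x : @state R := (phi, pd^~ phi, 0); pose y : @state R := (0, pd^~ 0, lap phi).
have Gxy : wave_op (sides a) x y := wave_op_smooth (sides a) sphi p1 pn V00.
have pd0' i t : pd i (0 : F) (side_pt i 0 t) = 0.
  by have -> : pd i (0 : F) = 0 by exact: (congr1 (@^~ i) pd0).
have Sy : in_state y.
  by split; [exists 0; exact: V00|exact: Smooth_L2 (Smooth_lap sphi)].
have ay : approachable in_state energy (wave_op (sides a)) y.
  split => // e e0; have [eta te he] := papp _ e0.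
  pose x' : @state R := (0, pd^~ 0, eta); pose y' : @state R := (eta, pd^~ eta, lap 0).
  pose z' : @state R := (lap 0, pd^~ (lap 0), lap eta).
  exists x', y', z'; split.
  - exact: (wave_op_smooth (sides a) Smooth0 (fun _ _ => erefl) pd0' (Vtuple_test te)).
  - have e1 i t : eta (side_pt i 1 t) = 0 := test_side i t te (or_intror erefl).
    have e2 i t : pd i eta (side_pt i 0 t) = 0 := test_side i t (test_pd i te) (or_introl erefl).
    exact: (wave_op_smooth (sides a) (test_Smooth te) e1 e2 V0l).
  - have Sx' : in_state x'.
      by split; [exists 0; exact: V00|exact: Smooth_L2 (test_Smooth te)].
    apply: le_lt_trans (snorm_energy_le (siB energy_inner Sy Sx')) _.
    have -> : (y - x').1.2 = 0 by exact: subrr.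
    have -> : (y - x').2 = lap phi - eta by [].
    have z i : nO ((0 : bool -> F) i) = 0 by exact: (snorm0 ipO).
    by rewrite !z !add0r.
have [U [V [U0 V0 GUV cV dU]]] := semigroup_orbit energy_inner (@energy_complete R) hG Gxy ay.
pose U' t : @state R := ((U t).1.1, (U t).1.2, (V t).1.1).
have SU t : 0 <= t -> in_state (U t).
  by move=> /GUV[g [h [Vg _ [Lw _] _ _]]]; split; [exists g|].
have SV t : 0 <= t -> in_state (V t).
  by move=> /GUV[g [h [_ Vh [_ Ll] _ _]]]; split; [exists h|].
exists U', V; split; [| | |exact: cV|].
- have [g [h [Vg _ _ _ _]]] := GUV 0 (lexx _).
  have Sx : in_state x by case: (gen_dom hG Gxy).
  apply/eqP; rewrite eq_le snorm_ge0 andbT.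
  apply: (@le_trans _ _ (NE (U 0 - x))); last by rewrite U0.
  have Vx := Vtuple_Smooth sphi p1.
  apply: le_trans (Vtuple_poincare true (VtupleB Vg Vx)) _.
  exact: (snorm_energy_ge true (siB energy_inner (SU _ (lexx _)) Sx)).
- have [g [h [_ Vh _ _ _]]] := GUV 0 (lexx _).
  apply/eqP; rewrite eq_le snorm_ge0 andbT.
  apply: (@le_trans _ _ (NE (V 0 - y))); last by rewrite V0.
  have := Vtuple_poincare true (VtupleB Vh V00); rewrite subr0 => h1.
  apply: le_trans h1 _.
  exact: (snorm_energy_ge true (siB energy_inner (SV _ (lexx _)) Sy)).
- move=> t t0; split => //; have [g [h [V1 V2 [Lw Ll] e hid]]] := GUV _ t0.
  exists g, h; split => //=; first by split => //; case: V2.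
  by rewrite subrr (snorm0 ipO).
- move=> t e t0 e0; have [d d0 hd] := dU t e t0 e0; exists d; [exact: d0|move=> s s0 st].
  apply: le_trans _ (hd s s0 st).
  have [g [h [V1 V2 [Lw Ll] e1 _]]] := GUV _ t0.
  have [g' [h' [V1' V2' [Lw' Ll'] e1' _]]] := GUV _ s0.
  have [Lv _ _ _] := V2; have [Lv' _ _ _] := V2'.
  have S1 := siB energy_inner (siB energy_inner (SU _ s0) (SU _ t0))
    (siZ energy_inner (s - t) (SV _ t0)).
  have [[g'' VW] L1] := S1; have [_ LW _ _] := VW.
  have L2 : L2_Omega ((V s).1.1 - (V t).1.1 - (s - t) *: (V t).2).
    exact: (siB ipO (siB ipO Lv' Lv) (siZ ipO _ Ll)).
  have D : nO ((U s - U t - (s - t) *: V t).2 - ((V s).1.1 - (V t).1.1 - (s - t) *: (V t).2)) = 0.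
    have -> : (U s - U t - (s - t) *: V t).2 - ((V s).1.1 - (V t).1.1 - (s - t) *: (V t).2) =
        ((U s).2 - (V s).1.1) - ((U t).2 - (V t).1.1).
      change ((U s).2 - (U t).2 - (s - t) *: (V t).2 -
         ((V s).1.1 - (V t).1.1 - (s - t) *: (V t).2) =
         ((U s).2 - (V s).1.1) - ((U t).2 - (V t).1.1)).
      by apply/funext => p; rewrite /GRing.add /GRing.opp /GRing.scale /=; ring.
    have B1 := siB ipO Lw' Lv'; have B2 := siB ipO Lw Lv.
    apply/eqP; rewrite eq_le snorm_ge0 andbT.
    apply: le_trans (snormD ipO B1 (siN ipO B2)) _.
    by rewrite (snormN ipO B2) e1 e1' addr0.
  have := energy_swap (U s - U t - (s - t) *: V t).1.1 LW L1 L2 D.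
  have -> : ((U s - U t - (s - t) *: V t).1.1, (U s - U t - (s - t) *: V t).1.2,
    (U s - U t - (s - t) *: V t).2) = U s - U t - (s - t) *: V t.
    by rewrite -!surjective_pairing.
  by move=> ->.
Qed.

(** The norms of the graph and of V + L2 are controlled by energies of U and V. *)
Lemma curves_wave (tau : R) phi (U V : R -> @state R) : L2_Omega phi ->
  nO ((U 0).1.1 - phi) = 0 -> nO (V 0).1.1 = 0 ->
  (forall t, 0 <= t -> wave_op (sides a) (U t) (V t) /\ (U t).2 = (V t).1.1) ->
  (forall t e, 0 <= t -> 0 < e -> exists2 d, 0 < d &
        forall s, 0 <= s -> `|s - t| < d -> NE (V s - V t) <= e) ->
  (forall t e, 0 <= t -> 0 < e -> exists2 d, 0 < d &
        forall s, 0 <= s -> `|s - t| < d ->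
          NE (U s - U t - (s - t) *: V t) <= e * `|s - t|) ->
  is_wave tau a phi (cst 0) (fun t => (U t).1.1).
Proof.
move=> Lphi U0 V0 GUV cV dU.
have SU t : 0 <= t -> in_state (U t).
  by move=> /GUV[[g [h [Vg _ [Lw _] _ _]]] _]; split; [exists g|].
have SV t : 0 <= t -> in_state (V t).
  by move=> /GUV[[g [h [_ Vh [_ Ll] _ _]]] _]; split; [exists h|].
have cU t e : 0 <= t -> 0 < e -> exists2 d, 0 < d &
    forall s, 0 <= s -> `|s - t| < d -> NE (U s - U t) <= e.
  move=> t0 e0; have [d d0 hd] := dU t 1 t0 ltr01.
  have n0 := snorm_ge0 (@energy R) (V t).
  have q0 : 0 < e / (1 + NE (V t)) by apply: divr_gt0 => //; apply: ltr_pwDl.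
  exists (Num.min d (e / (1 + NE (V t)))); first by rewrite lt_min d0 q0.
  move=> s s0; rewrite lt_min => /andP[s1 s2].
  have h1 := hd s s0 s1.
  have B1 := siB energy_inner (SU s s0) (SU t t0).
  have h2 := snormB_le energy_inner B1 (siZ energy_inner (s - t) (SV t t0)).
  apply: le_trans h2 _; rewrite (snormZ energy_inner _ (SV t t0)).
  have h3 : `|s - t| * (1 + NE (V t)) <= e.
    by rewrite -ler_pdivlMr ?ltW//; apply: ltr_pwDl.
  by apply: le_trans _ h3; rewrite mulrDr mulr1 addrC lerD2r -[leRHS]mul1r.
have VL2 (X : @state R) : in_state X -> exists r, [/\ V_L2norm (X.1.1, X.2) = r%:E, 0 <= r &
    r <= 4 * NE X].
  move=> [[g VX] LX]; have [r [e1 r0 r1 _]] := V_L2norm_energy VX LX.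
  exists r; split; [exact: e1|exact: r0|apply: le_trans r1 _].
  by rewrite -!surjective_pairing.
have contV t (X : R -> @state R) : (forall s, 0 <= s -> in_state (X s)) -> 0 <= t ->
    (forall e, 0 < e -> exists2 d, 0 < d &
       forall s, 0 <= s -> `|s - t| < d -> NE (X s - X t) <= e) ->
    V_L2norm ((X s).1.1 - (X t).1.1, (X s).2 - (X t).2) @[s --> within halfline (nbhs t)] --> 0%E.
  move=> SX t0 cX; apply: cvge0_spec => e e0; have e40 : 0 < e / 4 by rewrite divr_gt0.
  have [d d0 hd] := cX _ e40; apply: (near_halfline d0) => s s0 st.
  have [r [e1 r0 r1]] := VL2 _ (siB energy_inner (SX s s0) (SX t t0)).
  exists r; split; [exact: e1|exact: r0|apply: le_trans r1 _].
  by rewrite -ler_pdivlMl// mulrC; exact: hd.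
exists (fun t => (V t).1.1), (fun t => (V t).2); split.
- move=> t t0; split.
    apply/(A_domP _ _ ma aM); exists (U t).1.2, (V t).1.2, (V t).2.
    have [wo e] := GUV t t0.
    have eU : ((U t).1.1, (U t).1.2, (V t).1.1) = U t by rewrite -e -!surjective_pairing.
    have eV : ((V t).1.1, (V t).1.2, (V t).2) = V t by rewrite -!surjective_pairing.
    by rewrite eU eV.
  apply: cvge0_spec => e e0; have e80 : 0 < e / 8 by rewrite divr_gt0.
  have [d1 d10 h1] := cU _ _ t0 e80; have [d2 d20 h2] := cV _ _ t0 e80.
  have d0 : 0 < Num.min d1 d2 by rewrite lt_min d10 d20.
  apply: (near_halfline d0) => s s0; rewrite lt_min => /andP[/(h1 _ s0) {}h1 /(h2 _ s0) {}h2].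
  have wo := gen_lin hG (-1) (GUV s s0).1 (GUV t t0).1; rewrite !scaleN1r in wo.
  have [r [e1 r0 r1]] := A_graph_norm_energy wo.
  exists r; split; [exact: e1|exact: r0|apply: le_trans r1 _].
  by move: h1 h2; move: (NE _) (NE _); clear => *; lra.
- split.
  + move=> t t0; have [wo e] := GUV t t0; split.
      by have [[g Vg] LU] := SU t t0; split => /=; [exact: Vtuple_V Vg|rewrite -e].
    have := contV t U SU t0 (cU t ^~ t0).
    apply: cvg_trans; apply: near_eq_cvg.
    apply: (near_halfline ltr01) => s s0 _ /=.
    by rewrite (GUV s s0).2 e.
  + move=> t t0; apply: cvge0_spec => e e0; have e40 : 0 < e / 4 by rewrite divr_gt0.
    have [d d0 hd] := dU _ _ t0 e40; apply: (near_halfline_dnbhs d0) => s s0 st sd.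
    have S1 := siB energy_inner (siZ energy_inner (s - t)^-1
      (siB energy_inner (SU s s0) (SU t t0))) (SV t t0).
    have [r [e1 r0 r1]] := VL2 _ S1.
    exists r; split; last 2 first.
    * exact: r0.
    * apply: le_trans r1 _.
      have st0 : s - t != 0 by rewrite subr_eq0.
      have -> : (s - t)^-1 *: (U s - U t) - V t = (s - t)^-1 *: (U s - U t - (s - t) *: V t).
        by rewrite [RHS]scalerBr scalerA mulVf// scale1r.
      have S2 := siB energy_inner (siB energy_inner (SU s s0) (SU t t0))
        (siZ energy_inner (s - t) (SV t t0)).
      rewrite (snormZ energy_inner _ S2) normfV -ler_pdivlMl// mulrC ler_pdivrMr ?normr_gt0//.
      by rewrite mulrC [4^-1 * e]mulrC mulrC; exact: hd.
    * have e2 := proj_comb (s - t)^-1 (U s) (U t) (V t).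
      rewrite (GUV s s0).2 (GUV t t0).2 in e2.
      exact: (etrans (congr1 V_L2norm (esym e2)) e1).
  + move=> t t0; have [wo e] := GUV t t0; split.
      by have [[g Vg] LU] := SV t t0; split => /=; [exact: Vtuple_V Vg|].
    exact: (contV t V SV t0 (cV t ^~ t0)).
- move=> t /andP[/ltW t0 _]; have [wo _] := GUV t t0.
  have hl := wave_op_laplacian wo; have [_ LL el] := laplacian_spec hl.
  rewrite (snormBC ipO LL hl.1) in el.
  have h := (@snorm_ae _ _ R mu2 Omega mO _ _ hl.1 LL).1 el.
  exact: h.
- have [[g Vg] _] := SU 0 (lexx _); have [Lu _ _ _] := Vg.
  have h := (@snorm_ae _ _ R mu2 Omega mO _ _ Lu Lphi).1 U0.
  exact: h.
- have [[g Vg] _] := SV 0 (lexx _); have [Lu _ _ _] := Vg.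
  rewrite -[(V 0).1.1]subr0 in V0.
  have h := (@snorm_ae _ _ R mu2 Omega mO _ _ Lu (si0 ipO)).1 V0.
  exact: h.
Qed.

End Curves.
End Existence.

(** * The first eigenfunction *)

Section Eigenfunction.
Context {R : realType}.
Local Notation mu := (@lebesgue_measure R).
Local Notation mu2 := (@lebesgue2 R).
Local Notation I := (@unit_itv R).
Local Notation mO := (@measurable_Omega R).
Local Notation mI := (@measurable_unit_itv R).
Local Notation dotO := (L2dot mu2 Omega).
Local Notation dot1 := (L2dot mu I).
Local Notation nO := (snorm dotO).
Local Notation n1 := (snorm dot1).
Local Notation ipO := (@ipO R).
Local Notation ip1 := (@ip1 R).
Local Notation L2I := (L2 mu I).
Local Notation F := (R * R -> R).

Definition profile (x : R) : R := cos (pi / 2 * x + 0).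

Let profile' (x : R) : R := - (pi / 2) * sin (pi / 2 * x + 0).

Lemma smooth1_profile : smooth1 profile.
Proof.
change (smooth1 (fun x : R => cos (pi / 2 * x + 0))).
by apply: smooth1_affine; have [_ h] := @smooth1_trig R.
Qed.

Lemma profile_derive : profile^`()%classic = profile'.
Proof.
apply: is_derive_derive1 => x.
have d1 := is_derive_affine (pi / 2) 0 x.
have d2 := @is_derive1_comp R cos (fun y => pi / 2 * y + 0) x _ _ (is_derive_cos _) d1.
by apply: (is_derive_eq d2); rewrite /profile'; ring.
Qed.

Lemma profile_derive2 : profile^`()^`()%classic = (fun x => - (pi / 2) ^+ 2 * profile x).
Proof.
rewrite profile_derive; apply: is_derive_derive1 => x.
have d1 := is_derive_affine (pi / 2) 0 x.
have d2 := @is_derive1_comp R sin (fun y => pi / 2 * y + 0) x _ _ (is_derive_sin _) d1.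
have d3 := @is_deriveM R R (cst (- (pi / 2))) _ x 1 _ _ (is_derive_cst _ _ _) d2.
apply: (is_derive_eq d3); rewrite /profile /cst /= scaler0 addr0.
change (- (pi / 2) * (cos (pi / 2 * x + 0) * (pi / 2)) =
  - (pi / 2) ^+ 2 * cos (pi / 2 * x + 0)).
by ring.
Qed.

Lemma profile1 : profile 1 = 0.
Proof. by rewrite /profile mulr1 addr0 cos_pihalf. Qed.

Lemma profile0 : profile 0 = 1.
Proof. by rewrite /profile mulr0 addr0 cos0. Qed.

(** The first eigenfunction of the Laplacian with the mixed boundary conditions. *)
Definition mode : F := tensor profile profile.

Definition eigenvalue : R := 2 * (pi / 2) ^+ 2.

Lemma Smooth_mode : Smooth mode.
Proof. by constructor; apply: smooth_tensor; exact: smooth1_profile. Qed.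

Lemma mode_side1 i t : mode (side_pt i 1 t) = 0.
Proof. by case: i; rewrite /mode /tensor /= profile1 ?mulr0 ?mul0r. Qed.

Lemma mode_side0 i : mode \o side_pt i 0 = profile.
Proof. by apply/funext => t; case: i; rewrite /mode /tensor /= profile0 ?mulr1 ?mul1r. Qed.

Lemma mode_neumann i t : pd i mode (side_pt i 0 t) = 0.
Proof.
have p0 : profile^`()%classic 0 = 0 by rewrite profile_derive /profile' mulr0 addr0 sin0 mulr0.
rewrite /mode (pd_tensor i smooth1_profile smooth1_profile).
by case: i; rewrite /tensor /= p0 ?mulr0 ?mul0r.
Qed.

Lemma lap_mode : lap mode = - eigenvalue *: mode.
Proof.
have s1 := smooth1_profile; have s2 := smooth1_derive s1.
have e i : pd i (pd i mode) = - (pi / 2) ^+ 2 *: mode.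
  rewrite /mode (pd_tensor i s1 s1); case: i.
    rewrite (pd_tensor true s1 s2) profile_derive2.
    apply/funext => p.
    change (profile p.1 * (- (pi / 2) ^+ 2 * profile p.2) =
      - (pi / 2) ^+ 2 * (profile p.1 * profile p.2)); ring.
  rewrite (pd_tensor false s2 s1) profile_derive2.
  apply/funext => p.
  change (- (pi / 2) ^+ 2 * profile p.1 * profile p.2 =
      - (pi / 2) ^+ 2 * (profile p.1 * profile p.2)); ring.
by rewrite /lap (e false) (e true) -scalerDl /eigenvalue; congr (_ *: _); ring.
Qed.

Lemma profile_itv x : 0 <= x <= 1 -> 0 <= profile x <= 1.
Proof.
move=> /andP[x0 x1]; rewrite cos_le1 andbT cos_ge0_pihalf//.
have p0 := pi_gt0 R; rewrite addr0; apply/andP; split.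
  by apply: (@le_trans _ _ 0); [lra|rewrite mulr_ge0//; lra].
by rewrite ler_piMr//; lra.
Qed.

Definition cutoff n (x : R) : R := profile x * plateau 0 1 n x.

Lemma cutoff_test n : test_fun1 (cutoff n).
Proof.
have [s [K cK K0]] := plateau_test1 n (lexx 0) (lexx (1 : R)).
split; first exact: (smooth1M smooth1_profile s).
by exists K => // x /K0 h; rewrite /cutoff h mulr0.
Qed.

(** Dominated convergence: the plateaus tend to 1 inside the interval. *)
Lemma mode_cutoff e : 0 < e -> exists n, nO (mode - tensor (cutoff n) (cutoff n)) < e.
Proof.
move=> e0; pose eta n := tensor (cutoff n) (cutoff n).
have Lm := Smooth_L2 Smooth_mode.
have Le n : L2_Omega (eta n).
  by apply: Smooth_L2; apply: test_Smooth; apply: test_tensor; exact: cutoff_test.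
have LB n := siB ipO Lm (Le n).
have iB n := L2_integ_mul (m := mu2) mO (LB n) (LB n).
have mB n := measurable_int _ (iB n).
have [|||||_ _] := @dominated_convergence _ _ R mu2 Omega mO
    (fun n p => ((mode - eta n) p * (mode - eta n) p)%:E) (cst 0%E) (cst 1%E).
- exact: mB.
- exact: measurable_cst.
- apply: nearW => p /Omega_itv[/andP[p1 p2] /andP[p3 p4]].
  rewrite -[X in _ --> X]/((0 : R)%:E); apply: cvg_EFin; first exact: nearW.
  have c1 : plateau 0 1 n p.1 @[n --> \oo] --> (1 : R).
    have := @plateau_cvg R 0 1 p.1; rewrite indicE mem_set//.
    by rewrite /= in_itv /= p1 p2.
  have c2 : plateau 0 1 n p.2 @[n --> \oo] --> (1 : R).
    have := @plateau_cvg R 0 1 p.2; rewrite indicE mem_set//.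
    by rewrite /= in_itv /= p3 p4.
  have c3 : (mode - eta n) p @[n --> \oo] --> (0 : R).
    have -> : (0 : R) = mode p - (profile p.1 * 1) * (profile p.2 * 1).
      by rewrite !mulr1 /mode /tensor subrr.
    apply: cvgB; first exact: cvg_cst.
    by apply: cvgM; apply: cvgM => //; exact: cvg_cst.
  by rewrite -[X in _ --> X](mulr0 (0 : R)); exact: cvgM.
- have := integ_cst (m := mu2) mO 1 (@mu2_Omega_fin R).
  by [].
- apply: nearW => p n /Omega_itv[/andP[p1 p2] /andP[p3 p4]]; rewrite lee_fin.
  have /andP[a0 a1] : 0 <= profile p.1 <= 1 by apply: profile_itv; rewrite !ltW.
  have /andP[b0 b1] : 0 <= profile p.2 <= 1 by apply: profile_itv; rewrite !ltW.
  have /andP[c0 c1] := plateau_itv 0 1 n p.1; have /andP[d0 d1] := plateau_itv 0 1 n p.2.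
  have m0 : 0 <= mode p <= 1.
    by rewrite /mode /tensor mulr_ge0//= -[leRHS]mulr1 ler_pM.
  have m1 : 0 <= eta n p <= mode p.
    rewrite /eta /mode /tensor /cutoff !mulr_ge0//=.
    by apply: ler_pM; rewrite ?mulr_ge0// ler_piMr.
  have m2 : 0 <= (mode - eta n) p <= 1.
    change (0 <= mode p - eta n p <= 1); move: m0 m1 => /andP[? ?] /andP[? ?].
    by apply/andP; split; lra.
  move: m2 => /andP[z0 z1]; rewrite ger0_norm ?mulr_ge0//.
  by rewrite -[leRHS]mulr1; apply: ler_pM.
rewrite integral0.
have en n : (\int[mu2]_(p in Omega) ((mode - eta n) p * (mode - eta n) p)%:E)%E =
    (nO (mode - eta n) ^+ 2)%:E.
  have fin : (\int[mu2]_(p in Omega) ((mode - eta n) p * (mode - eta n) p)%:E)%E \is a fin_num.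
    by apply: integrable_fin_num; [exact: mO|exact: (iB n)].
  by rewrite (snorm_sqr ipO (LB n)); exact: (esym (fineK fin)).
under eq_fun do rewrite en; move=> cv.
have e2 : 0 < e ^+ 2 by rewrite exprn_gt0.
have [k hk] := cvge0_seq (fun n => sqr_ge0 _) cv e2.
exists k; have := hk k (leqnn _); rewrite /= ltr_pXn2r// ?nnegrE ?snorm_ge0//; exact: ltW.
Qed.

Lemma mode_approx c e : 0 < e -> exists2 eta, test_fun eta & nO (c *: mode - eta) < e.
Proof.
move=> e0; have c0 : 0 < 1 + `|c| by apply: ltr_pwDl.
have [n hn] := mode_cutoff (divr_gt0 e0 c0).
have Lt := Smooth_L2 (test_Smooth (test_tensor (cutoff_test n) (cutoff_test n))).
exists (tensor (fun x => c * cutoff n x) (cutoff n)).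
  apply: test_tensor (cutoff_test n); have [s [K cK K0]] := cutoff_test n.
  split; last by exists K => // x /K0 ->; rewrite mulr0.
  change (smooth1 (cst c \* cutoff n)); apply: smooth1M; first exact: smooth1_cst.
  exact: s.
have -> : c *: mode - tensor (fun x => c * cutoff n x) (cutoff n) =
    c *: (mode - tensor (cutoff n) (cutoff n)).
  apply/funext => p.
  change (c * mode p - c * cutoff n p.1 * cutoff n p.2 = c * (mode p - cutoff n p.1 * cutoff n p.2)).
  by ring.
rewrite (snormZ ipO _ (siB ipO (Smooth_L2 Smooth_mode) Lt)).
apply: (@le_lt_trans _ _ ((1 + `|c|) * nO (mode - tensor (cutoff n) (cutoff n)))).
  by apply: ler_wpM2r; rewrite ?snorm_ge0// lerDr.
by rewrite mulrC -ltr_pdivlMr.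
Qed.

End Eigenfunction.

(** * Sections of functions on a product *)

Section ProductSections.
Context {R : realType}.
Local Notation mu := (@lebesgue_measure R).
Local Notation mu2 := (@lebesgue2 R).
Variables (A B : set R).
Hypotheses (mA : measurable A) (mB : measurable B).
Implicit Types (u : R * R -> R) (g : R -> R).

Let mAB : measurable (A `*` B) := measurableX mA mB.

Lemma measurable_section u t : measurable_fun (A `*` B) u -> B t ->
  measurable_fun A (fun x => u (x, t)).
Proof.
move=> mu_ Bt; apply: (measurable_comp mAB _ mu_ (g := fun x => (x, t))).
  by move=> p [x Ax <-].
exact: measurable_funTS (measurable_pair2 t).
Qed.

Lemma ae_section_integrable u : mu2.-integrable (A `*` B) (EFin \o u) ->
  {ae mu, forall t, B t -> mu.-integrable A (EFin \o (fun x => u (x, t)))}.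
Proof.
move=> iu; pose F := ((EFin \o u) \_ (A `*` B) : R * R -> \bar R).
have iF : mu2.-integrable setT F.
  by have := (@integrable_mkcond _ _ R mu2 (A `*` B) (EFin \o u) mAB).1 iu.
apply: filterS (@ae_integrable2 _ _ _ _ R mu mu F iF) => t it Bt.
apply: (@integrable_mkcond _ _ R mu A _ mA).2.
apply: eq_integrable it => // x _; rewrite /F /patch.
suff -> : ((x, t) \in A `*` B) = (x \in A) by [].
by apply/idP/idP; rewrite !inE; [case|split].
Qed.

Lemma L2_section u : L2 mu2 (A `*` B) u ->
  {ae mu, forall t, B t -> L2 mu A (fun x => u (x, t))}.
Proof.
move=> Lu; have [m1 i1] := (@L2P _ _ R mu2 (A `*` B) mAB u).1 Lu.
apply: (ae_mono (m := mu) (ae_section_integrable i1)) => t it Bt.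
by apply: (@L2P _ _ R mu A mA _).2; split; [exact: measurable_section|exact: it].
Qed.

Lemma Rfubini2_integrable u : mu2.-integrable (A `*` B) (EFin \o u) ->
  mu.-integrable B (EFin \o (fun t => \int[mu]_(x in A) u (x, t))).
Proof.
move=> iu; pose F := ((EFin \o u) \_ (A `*` B) : R * R -> \bar R).
have iF : mu2.-integrable setT F.
  by have := (@integrable_mkcond _ _ R mu2 (A `*` B) (EFin \o u) mAB).1 iu.
pose K := fubini_G mu F.
have iK : mu.-integrable setT K.
  have mF := measurable_int _ iF.
  apply/integrableP; split; first exact: measurable_fubini_G iF.
  have fin : (\int[mu]_y \int[mu]_x `|F (x, y)| < +oo)%E :=
    (@integrable21ltyP _ _ _ _ R mu mu F mF).1 iF.
  refine (le_lt_trans _ fin); apply: ge0_le_integral => //.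
  - by apply: measurableT_comp => //; exact: measurable_fubini_G iF.
  - refine (@measurable_fun_fubini_tonelli_G _ _ (measurableTypeR R) (measurableTypeR R)
      R mu (abse \o F) _ _); last by move=> p; exact: abse_ge0.
    exact: (measurableT_comp (@abse_measurable R setT) mF).
  - move=> y _; apply: le_abse_integral => //.
    exact: (measurableT_comp mF (measurable_pair2 y)).
have e t : B t -> K t = (\int[mu]_(x in A) (u (x, t))%:E)%E.
  move=> Bt; rewrite /K /fubini_G /F [RHS]integral_mkcond; apply: eq_integral => x _; rewrite /patch.
  suff -> : ((x, t) \in A `*` B) = (x \in A) by [].
  by apply/idP/idP; rewrite !inE; [case|split].
have iKB : mu.-integrable B K by apply: (@integrableS _ _ R mu setT).
have iKf : mu.-integrable B (EFin \o fine \o K).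
  have mK := measurable_int _ iKB.
  apply: (@le_integrable _ _ R mu B mB _ K _ _ iKB).
    apply/measurable_EFinP; exact: (measurableT_comp (fine_measurable measurableT)).
  by move=> t _ /=; case: (K t) => [r| |] //=; rewrite leey.
apply: eq_integrable iKf => // t /set_mem Bt; rewrite /= (e t Bt).
by [].
Qed.

Lemma L2_fst g : (mu B < +oo)%E -> L2 mu A g -> L2 mu2 (A `*` B) (fun p => g p.1).
Proof.
move=> Bfin Lg; have [mg ig] := (@L2P _ _ R mu A mA g).1 Lg.
have mf : measurable_fun (A `*` B) (fun p : R * R => g p.1).
  apply: (measurable_comp mA _ mg (g := fst)); first by move=> x [p [Ap _] <-].
  exact: measurable_funTS measurable_fst.
apply: (@L2P _ _ R mu2 (A `*` B) mAB _).2; split => //.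
apply: (@integrable_mkcond _ _ R mu2 (A `*` B) _ mAB).2.
set f := (_ \_ _).
have mff : measurable_fun setT f.
  apply: (measurable_restrictT _ mAB).1; apply/measurable_EFinP.
  exact: measurable_funX.
apply: (@integrable12ltyP _ _ _ _ R mu mu f mff).2.
pose c := ((fun x => (g x ^+ 2)%:E) \_ A : R -> \bar R).
have c0 x : (0 <= c x)%E.
  by rewrite /c /patch; case: ifP => // _; rewrite lee_fin sqr_ge0.
have ic := ((@integrable_mkcond _ _ R mu A _ mA).1 ig : mu.-integrable setT c).
have e x : (\int[mu]_y `|f (x, y)| = c x * mu B)%E.
  rewrite -(@integral_cst _ _ R mu B mB (c x)) [RHS]integral_mkcond.
  apply: eq_integral => y _; rewrite /f /c /patch.
  have [xA|xA] := boolP (x \in A); have [yB|yB] := boolP (y \in B).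
  - have -> : (x, y) \in A `*` B by rewrite inE; split; exact: set_mem.
    by rewrite /= ger0_norm ?sqr_ge0.
  - rewrite ifF ?abse0//; apply/negP; rewrite inE => -[_ /= /mem_set].
    by rewrite (negbTE yB).
  - rewrite ifF ?abse0//; apply/negP; rewrite inE => -[/= /mem_set].
    by rewrite (negbTE xA).
  - rewrite ifF ?abse0//; apply/negP; rewrite inE => -[/= /mem_set].
    by rewrite (negbTE xA).
under eq_integral do rewrite e.
have finB : mu B \is a fin_num by rewrite ge0_fin_numE.
have mc : measurable_fun setT c by have /integrableP[] := ic.
have -> : (\int[mu]_x (c x * mu B) = (\int[mu]_x c x) * mu B)%E.
  by apply: ge0_integralZr => //; exact: measure_ge0.
rewrite -(fineK finB); apply: lte_mul_pinfty.
- by apply: integral_ge0 => x _.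
- by apply: integrable_fin_num.
- exact: ltry.
Qed.

End ProductSections.

(** * Joint measurability of continuous curves *)

Section Lateral.
Context {R : realType}.
Local Notation mu := (@lebesgue_measure R).
Local Notation mu2 := (@lebesgue2 R).
Local Notation I := (@unit_itv R).
Local Notation mI := (@measurable_unit_itv R).
Local Notation dot1 := (L2dot mu I).
Local Notation n1 := (snorm dot1).
Local Notation ip1 := (@ip1 R).
Local Notation L2I := (L2 mu I).
Variable tau : R.
Hypothesis tau0 : 0 < tau.
Local Notation B := (`]0, tau[%classic : set R).
Local Notation Lat := (lateral tau).
Local Notation dotL := (L2dot mu2 Lat).
Implicit Types (h H : R * R -> R) (G : R -> R -> R).

Let mB : measurable B := measurable_itv _.

Lemma measurable_lateral : measurable Lat.
Proof. exact: (measurableX mI mB). Qed.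

Lemma mu_time : mu B = tau%:E.
Proof. by rewrite lebesgue_measure_itv /= lte_fin tau0 oppr0 adde0. Qed.

Lemma mu_time_fin : (mu B < +oo)%E.
Proof. by rewrite mu_time ltry. Qed.

Lemma mu2_lateral_fin : (mu2 Lat < +oo)%E.
Proof.
rewrite /lebesgue2 product_measure1E; [|exact: mI|exact: mB].
apply: (@le_lt_trans _ _ (mu I * mu B)%E); first by [].
by rewrite mu_unit_itv mul1e mu_time_fin.
Qed.

Definition ipL : semi_inner (L2 mu2 Lat) dotL := L2dot_inner mu2 measurable_lateral.

Lemma Rintegral_time_cst (c : R) : \int[mu]_(t in B) c = c * tau.
Proof.
transitivity (c * fine (mu B)); last by rewrite mu_time.
exact: (Rintegral_cst mu mB c).
Qed.

Lemma dot_lateral h : L2 mu2 Lat h ->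
  mu.-integrable B (EFin \o (fun t => dot1 (fun x => h (x, t)) (fun x => h (x, t)))) /\
  dotL h h = \int[mu]_(t in B) dot1 (fun x => h (x, t)) (fun x => h (x, t)).
Proof.
move=> Lh; have ih := L2_integ_mul (m := mu2) measurable_lateral Lh Lh.
split; first exact: (Rfubini2_integrable mI mB ih).
exact: (Rfubini2 mI mB ih).
Qed.

Lemma lateral_le h c : L2 mu2 Lat h ->
  (forall t, B t -> dot1 (fun x => h (x, t)) (fun x => h (x, t)) <= c) -> dotL h h <= c * tau.
Proof.
move=> Lh hc; have [ih ->] := dot_lateral Lh; rewrite -Rintegral_time_cst.
apply: le_Rintegral => //.
exact: (integ_cst (m := mu) mB c mu_time_fin).
Qed.

Variable G : R -> R -> R.
Hypothesis LG : forall t, 0 <= t -> L2I (G t).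
Hypothesis cG : forall t e, 0 <= t -> 0 < e -> exists2 d, 0 < d &
  forall s, 0 <= s -> `|s - t| < d -> n1 (G s - G t) <= e.

(** Heine's theorem: the interval of time is compact. *)
Lemma curve_uniform e : 0 < e -> exists2 d, 0 < d & forall s t, 0 <= s <= tau -> 0 <= t <= tau ->
  `|s - t| < d -> n1 (G s - G t) <= e.
Proof.
move=> e0; have e20 : 0 < e / 2 by rewrite divr_gt0.
pose P (d t : R) := 0 <= t -> forall s, 0 <= s <= tau -> `|s - t| < d -> n1 (G s - G t) <= e.
have K := (compact_near_coveringP _).1 (@segment_compact R 0 tau).
have : \forall d \near (0 : R)^'+, [set` `[0, tau]] `<=` P d.
  apply: K => t; rewrite /= in_itv /= => /andP[t0 t1].
  have [d d0 hd] := cG t0 e20; have d20 : 0 < d / 2 by rewrite divr_gt0.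
  exists ([set t' | `|t' - t| < d / 2], [set d' | d' < d / 2]) => /=.
    split; last exact: nbhs_right_lt.
    by apply: filterS (nbhsx_ballx t _ d20) => t' /=; rewrite /ball /= distrC.
  move=> [t' d'] /= [h1 h2] t'0 s /andP[s0 s1] h3.
  have h4 : `|s - t| < d.
    have -> : s - t = (s - t') + (t' - t) by ring.
    by apply: le_lt_trans (ler_normD _ _) _; move: h1 h2 h3; lra.
  have h5 : `|t' - t| < d by apply: lt_trans h1 _; rewrite ltr_pdivrMr// ltr_pMr// ltr1n.
  have := snormB ip1 (LG s0) (LG t0) (LG t'0); rewrite (snormBC ip1 (LG t0) (LG t'0)).
  have := hd _ s0 h4; have := hd _ t'0 h5.
  by move: (n1 _) (n1 _) (n1 _); clear => *; lra.
case=> d /= d0 hd; exists (d / 2); first by rewrite divr_gt0.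
move=> s t s01 t01; have /andP[t0 _] := t01; apply: (hd (d / 2)).
- by rewrite /= sub0r normrN gtr0_norm ?divr_gt0// ltr_pdivrMr// ltr_pMr// ltr1n.
- by rewrite divr_gt0.
- by rewrite /= in_itv.
- exact: t0.
- exact: s01.
Qed.

(** The curve is frozen between consecutive dyadic times. *)
Lemma step_approx e : 0 < e -> exists h, L2 mu2 Lat h /\
  forall t, B t -> L2I (fun x => h (x, t)) /\ n1 ((fun x => h (x, t)) - G t) <= e.
Proof.
move=> e0; have [d d0 hd] := curve_uniform e0.
have [n hn] := @dyadic_lt R _ d0; have {}hn := hn n (leqnn n).
have dy0 := @dyadic_gt0 R n.
set dy : R := dyadic n in hn dy0.
pose J (j : nat) : set R := `[j%:R * dy, j%:R * dy + dy[%classic.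
pose k (j : nat) : R * R -> R := fun p => \1_(J j) p.2 * G (j%:R * dy) p.1.
pose N := (dstep n tau).+1.
have Lk j : L2 mu2 Lat (k j).
  have LGj : L2I (G (j%:R * dy)) by apply: LG; rewrite mulr_ge0// ltW.
  apply: (L2_mul_bounded (m := mu2) measurable_lateral _ _ (L2_fst mI mB mu_time_fin LGj) (M := 1)).
    have mi : measurable_fun setT (\1_(J j) : R -> R) by apply: measurable_indic; exact: measurable_itv.
    apply: measurable_funTS; exact: (measurableT_comp mi measurable_snd).
  by move=> p _; rewrite indicE; case: (_ \in _); rewrite /= ?normr0 ?normr1.
pose h : R * R -> R := \sum_(j < N) k j.
have eh t : B t -> (fun x => h (x, t)) = G ((dstep n t)%:R * dy).
  rewrite /= in_itv /= => /andP[t0 t1]; apply/funext => x.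
  rewrite /h fct_sumE.
  have jN : (dstep n t < N)%N by rewrite /N ltnS; apply: dstep_mono; exact: ltW.
  have l1 := @dstep_le R n t (ltW t0); have l2 := @dstep_gt R n t.
  rewrite (bigD1 (Ordinal jN)) //= big1 ?addr0.
    rewrite /k indicE mem_set ?mul1r//= /J /= in_itv /=.
    by rewrite l1 l2.
  move=> j /eqP jj; rewrite /k indicE memNset ?mul0r// /J /= in_itv /= => /andP[a1 a2].
  apply: jj; apply/val_inj => /=; apply/eqP; rewrite eqn_leq; apply/andP; split.
    rewrite leqNgt; apply/negP => lt.
    have : (dstep n t).+1%:R * dy <= j%:R * dy by rewrite ler_pM2r// ler_nat.
    by move: a1 l2; rewrite -/dy -natr1 mulrDl mul1r; lra.
  rewrite leqNgt; apply/negP => lt.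
  have : j.+1%:R * dy <= (dstep n t)%:R * dy by rewrite ler_pM2r// ler_nat.
  by move: a2 l1; rewrite -/dy -natr1 mulrDl mul1r; lra.
exists h; split.
  by rewrite /h; apply: big_ind => [|u v Lu Lv|j _];
    [exact: (si0 ipL)|exact: (siD ipL Lu Lv)|exact: Lk].
move=> t Bt; rewrite (eh t Bt); move: Bt; rewrite /= in_itv /= => /andP[t0 t1].
have l1 := @dstep_le R n t (ltW t0); have l2 := @dstep_gt R n t; rewrite -/dy in l1 l2.
have j0 : 0 <= (dstep n t)%:R * dy by rewrite mulr_ge0// ltW.
split; first exact: LG.
apply: hd; first by rewrite j0 (le_trans l1)// ltW.
  by rewrite !ltW.
by rewrite ler0_norm ?subr_le0// opprB; lra.
Qed.

(** The step functions in time form a Cauchy sequence on the lateral boundary.  By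
    Markov's inequality their sections get close to those of the limit H for almost
    every time, while they converge uniformly to G. *)
Lemma lateral_version : exists H, L2 mu2 Lat H /\
  {ae mu, forall t, B t -> L2I (fun x => H (x, t)) /\ n1 ((fun x => H (x, t)) - G t) = 0}.
Proof.
have n0 n : 0 < n.+1%:R^-1 :> R by rewrite invr_gt0.
have inv e : 0 < e -> exists k, forall n, (k <= n)%N -> n.+1%:R^-1 < e :> R.
  move=> e0; have /cvgr0Pnorm_lt/(_ _ e0)[k _ hk] := @invS_cvg0 R.
  by exists k => n /hk /=; rewrite ger0_norm// invr_ge0.
have /choice[h hh] := fun n => step_approx (n0 n).
have Lh n : L2 mu2 Lat (h n) by case: (hh n).
have LGB t : B t -> L2I (G t) by rewrite /= in_itv /= => /andP[/ltW t0 _]; exact: LG.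
have cau : scauchy dotL h.
  move=> e e0; pose c := e / (2 * (1 + Num.sqrt tau)).
  have s0 := sqrtr_ge0 tau.
  have s1 : 0 < 2 * (1 + Num.sqrt tau) by lra.
  have c0 : 0 < c by apply: divr_gt0.
  have [k hk] := inv _ c0; exists k => m n /hk lm /hk ln.
  have LB := siB ipL (Lh m) (Lh n).
  have le : snorm dotL (h m - h n) <= 2 * c * Num.sqrt tau.
    rewrite (snorm_le ipL LB); last by rewrite !mulr_ge0// ltW.
    rewrite exprMn (sqr_sqrtr (ltW tau0)); apply: (lateral_le LB) => t Bt.
    have [Lm dm] := (hh m).2 t Bt; have [Ln dn] := (hh n).2 t Bt.
    have LD : L2I (fun x => (h m - h n) (x, t)) := siB ip1 Lm Ln.
    rewrite -(snorm_le ip1 LD); last by rewrite mulr_ge0// ltW.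
    have := snormB ip1 Lm (LGB t Bt) Ln; rewrite (snormBC ip1 (LGB t Bt) Ln).
    move: dm dn lm ln.
    change (n1 (fun x => (h m - h n) (x, t))) with (n1 ((fun x => h m (x, t)) - (fun x => h n (x, t)))).
    move: (n1 _) (n1 _) (n1 _) (m.+1%:R^-1) (n.+1%:R^-1); clear => *; lra.
  apply: le_lt_trans le _; rewrite /c.
  rewrite [X in _ < X](_ : e = 2 * (e / (2 * (1 + Num.sqrt tau))) * (1 + Num.sqrt tau)); last first.
    by field; lra.
  by rewrite ltr_pM2l ?ltrDr//; apply: mulr_gt0.
have [H LH hH] := @L2_complete _ _ R mu2 Lat measurable_lateral mu2_lateral_fin h Lh cau.
exists H; split => //.
pose r n t := dot1 (fun x => (H - h n) (x, t)) (fun x => (H - h n) (x, t)).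
have LB n := siB ipL LH (Lh n).
have ir n : mu.-integrable B (EFin \o r n) := (dot_lateral (LB n)).1.
have r0 n t : 0 <= r n t.
  by apply: Rintegral_ge0 => x _; rewrite -expr2 sqr_ge0.
have mr n : measurable_fun B (r n) by apply/measurable_EFinP; exact: measurable_int (ir n).
pose c k : R := (k.+1%:R^-1) ^+ 2.
have c0 k : 0 < c k by rewrite exprn_gt0.
pose S k n := B `&` [set t | c k <= r n t].
have mS k n : measurable (S k n).
  have -> : S k n = B `&` r n @^-1` `[c k, +oo[%classic.
    by congr (_ `&` _); apply/seteqP; split => t /=; rewrite in_itv /= andbT.
  by apply: (mr n) => //; exact: measurable_itv.
have markov k n : (mu (S k n) <= ((c k)^-1 * dotL (H - h n) (H - h n))%:E)%E.
  rewrite EFinM lee_pdivlMl//.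
  rewrite -(@integral_cst _ _ R mu _ (mS k n) (c k)%:E).
  have fin : (\int[mu]_(t in B) (r n t)%:E)%E \is a fin_num.
    by apply: integrable_fin_num; [exact: mB|exact: (ir n)].
  rewrite (dot_lateral (LB n)).2 /Rintegral fineK//.
  apply: (@le_trans _ _ (\int[mu]_(t in S k n) (r n t)%:E)%E).
    apply: ge0_le_integral => //.
    - exact: mS.
    - by move=> t _; rewrite /= lee_fin ltW.
    - by apply/measurable_EFinP; apply: measurable_funS (mr n) => // t [].
    - by move=> t [_ /= h1]; rewrite lee_fin.
  apply: (@ge0_subset_integral _ _ R mu _ _ (mS k n) mB).
  - exact: (measurable_int _ (ir n)).
  - by move=> t _; rewrite lee_fin.
  - by move=> t [].
have null k : mu.-negligible (\bigcap_n S k (k + n)%N).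
  have mC : measurable (\bigcap_n S k (k + n)%N).
    by apply: bigcapT_measurable => n; exact: mS.
  exists (\bigcap_n S k (k + n)%N); split; [exact: mC| |by []].
  apply/eqP; rewrite eq_le measure_ge0 andbT; apply/lee_addgt0Pr => e e0; rewrite add0e.
  have ce : 0 < Num.sqrt (c k * e) by rewrite sqrtr_gt0 mulr_gt0.
  have [m hm] := hH _ ce; have {}hm := hm (k + m)%N (leq_addl _ _).
  apply: (@le_trans _ _ (mu (S k (k + m)%N))).
    apply: le_measure; rewrite ?inE; [exact: mC|exact: mS|].
    by move=> t ht; exact: (ht m Logic.I).
  apply: le_trans (markov _ _) _; rewrite lee_fin mulrC ler_pdivrMr// mulrC.
  have LBk := LB (k + m)%N; rewrite (snormBC ipL (Lh _) LH) in hm.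
  rewrite -(snorm_sqr ipL LBk) -[leRHS]sqr_sqrtr ?mulr_ge0 ?ltW//.
  by rewrite ltr_pXn2r// ?nnegrE ?snorm_ge0// sqrtr_ge0.
have nullU : mu.-negligible (\bigcup_k \bigcap_n S k (k + n)%N) by exact: negligible_bigcup.
have good : {ae mu, forall t, ~ (\bigcup_k \bigcap_n S k (k + n)%N) t}.
  apply: negligibleS nullU => t /= nt; exact: contrapT.
have sec := L2_section mI mB LH.
apply: (ae_mono (m := mu) (ae_and (m := mu) good sec)) => t [ng Ht] Bt.
have LHt := Ht Bt; split => //.
apply/eqP; rewrite eq_le snorm_ge0 andbT; apply/ler_addgt0Pr => e e0; rewrite add0r.
have e20 : 0 < e / 2 by rewrite divr_gt0.
have [k hk] := inv _ e20.
have [n kn rn] : exists2 n, (k <= n)%N & r n t < c k.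
  apply: contrapT => nn; apply: ng; exists k => // n _; split => //=.
  rewrite leNgt; apply/negP => lt; apply: nn; exists (k + n)%N => //; exact: leq_addr.
have [Ln dn] := (hh n).2 t Bt.
have LD : L2I (fun x => (H - h n) (x, t)) := siB ip1 LHt Ln.
have dH : n1 (fun x => (H - h n) (x, t)) <= k.+1%:R^-1.
  by rewrite (snorm_le ip1 LD) ?(ltW (n0 _))//; exact: ltW.
have := snormB ip1 LHt Ln (LGB t Bt); have := hk _ kn; have := hk _ (leqnn k).
move: dH dn.
change (n1 (fun x => (H - h n) (x, t))) with (n1 ((fun x => H (x, t)) - (fun x => h n (x, t)))).
move: (n1 _) (n1 _) (n1 _) (k.+1%:R^-1) (n.+1%:R^-1); clear => *; lra.
Qed.

End Lateral.

(** * The initial-to-boundary operator *)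

Section LambdaSpec.
Context {R : realType}.
Local Notation mu := (@lebesgue_measure R).
Local Notation mu2 := (@lebesgue2 R).
Local Notation I := (@unit_itv R).
Local Notation mO := (@measurable_Omega R).
Local Notation mI := (@measurable_unit_itv R).
Local Notation dotO := (L2dot mu2 Omega).
Local Notation dot1 := (L2dot mu I).
Local Notation nO := (snorm dotO).
Local Notation n1 := (snorm dot1).
Local Notation ipO := (@ipO R).
Local Notation ip1 := (@ip1 R).
Local Notation L2I := (L2 mu I).
Local Notation F := (R * R -> R).
Local Notation NE := (snorm (@energy R)).
Implicit Types (u v w : F) (f : bool -> F) (g : bool -> R -> R).

Lemma test1_ends (psi : R -> R) : test_fun1 psi -> psi 0 = 0 /\ psi 1 = 0.
Proof.
move=> [_ [K [_ KI] K0]]; split; apply: K0 => /KI; rewrite /unit_itv /= in_itv /= ltxx ?andbF //.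
Qed.

Lemma V_with_trace i (psi : R -> R) : test_fun1 psi ->
  exists p q r, [/\ Vtuple p q r, r i = psi & r (~~ i) = 0].
Proof.
move=> tp; have [z0 z1] := test1_ends tp.
pose p := if i then tensor psi profile else tensor profile psi.
have sp : Smooth p.
  constructor; rewrite /p; case: (i).
    exact: (smooth_tensor (test1_smooth tp) smooth1_profile).
  exact: (smooth_tensor smooth1_profile (test1_smooth tp)).
have p1 j t : p (side_pt j 1 t) = 0.
  by rewrite /p /tensor; case: (i); case: j; rewrite /= ?z1 ?profile1 ?mulr0 ?mul0r.
exists p, (pd^~ p), (fun j => p \o side_pt j 0); split; first exact: (Vtuple_Smooth sp p1).
  by apply/funext => t; rewrite /p /tensor; case: (i); rewrite /= ?profile0 ?mulr1 ?mul1r.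
by apply/funext => t; rewrite /p /tensor; case: (i); rewrite /= ?z0 ?mulr0 ?mul0r.
Qed.

Lemma dot_trace i (k : R -> R) p q r : L2I k -> Vtuple p q r ->
  dot1 k (trace_on (side_of i) p) = dot1 k (r i).
Proof.
move=> Lk Vp; have [_ _ Lr _] := Vp; have [Lt et] := trace_onP i Vp.
by rewrite (siC ip1 Lk Lt) (si_eq ip1 Lt (Lr i) Lk et) (siC ip1 (Lr i) Lk).
Qed.

(** Every test function on a side of Gamma_1 is the trace of an element of V that
    vanishes on the other side. *)
Lemma normal_deriv_unique v (k k' : bool -> R -> R) :
  normal_deriv v (k true, k false) -> normal_deriv v (k' true, k' false) ->
  forall i, n1 (k i - k' i) = 0.
Proof.
move=> [L1 L2 h] [L1' L2' h'] i.
have Lk j : L2I (k j) by case: j.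
have Lk' j : L2I (k' j) by case: j.
apply: (@snorm_ae _ _ R mu I mI _ _ (Lk i) (Lk' i)).2.
have LB := siB ip1 (Lk i) (Lk' i).
suff sep : forall psi, test_fun1 psi -> \int[mu]_(x in I) ((k i - k' i) x * psi x) = 0.
  apply: (ae_mono (m := mu) (test1_separating LB sep)) => x /[apply] e.
  by apply/eqP; rewrite -subr_eq0; apply/eqP.
move=> psi tp; have [p [q [r [Vp ri rj]]]] := V_with_trace i tp.
have Lpsi : L2I psi by have [_ _ Lr _] := Vp; rewrite -ri; exact: Lr.
have e : dot1 (k true) (r true) + dot1 (k false) (r false) =
    dot1 (k' true) (r true) + dot1 (k' false) (r false).
  have s1 := congr2 +%R (dot_trace true (Lk true) Vp) (dot_trace false (Lk false) Vp).
  have s2 := congr2 +%R (dot_trace true (Lk' true) Vp) (dot_trace false (Lk' false) Vp).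
  exact: (etrans (esym s1) (etrans (esym (h p (Vtuple_V Vp))) (etrans (h' p (Vtuple_V Vp)) s2))).
have z (g : R -> R) : dot1 g 0 = 0.
  rewrite /L2dot; under eq_Rintegral do rewrite mulr0.
  exact: Rintegral_unit_cst.
change (dot1 (k i - k' i) psi = 0).
rewrite (siBl ip1 (Lk i) (Lk' i) Lpsi) -ri; apply/eqP; rewrite subr_eq0; apply/eqP.
by move: e; case: i ri rj {LB} => /= ri ->; rewrite !z ?addr0 ?add0r.
Qed.

Lemma cvge0_inv (T : Type) (G : set_system T) {FG : Filter G} (h : T -> \bar R) (e : R) :
  h x @[x --> G] --> 0%E -> 0 < e -> \forall x \near G, (h x < e%:E)%E.
Proof.
move=> cv e0; apply: (cv [set y | (y < e%:E)%E]).
by apply: open_nbhs_nbhs; split; [exact: open_ereal_lt_ereal|rewrite /= lte_fin].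
Qed.

Lemma halfline_near t (P : R -> Prop) :
  (\forall s \near within halfline (nbhs t), P s) ->
  exists2 d, 0 < d & forall s, 0 <= s -> `|s - t| < d -> P s.
Proof.
rewrite near_withinE => /nbhs_ballP[d /= d0 hd]; exists d => // s s0 sd.
by apply: hd => //; rewrite /ball/= distrC.
Qed.

Lemma halfline_near_dnbhs t (P : R -> Prop) :
  (\forall s \near within halfline (dnbhs t), P s) ->
  exists2 d, 0 < d & forall s, 0 <= s -> s != t -> `|s - t| < d -> P s.
Proof.
rewrite near_withinE /dnbhs near_withinE => /nbhs_ballP[d /= d0 hd]; exists d => // s s0 st sd.
by apply: hd => //; rewrite /ball/= distrC.
Qed.

Lemma energy_V_L2norm (X : @state R) e : in_state X -> (V_L2norm (X.1.1, X.2) < e%:E)%E ->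
  NE X <= 3 * e.
Proof.
move=> [[g VX] LX]; have [r [e1 r0 _ r1]] := V_L2norm_energy VX LX.
rewrite e1 lte_fin => re; apply: le_trans (_ : 3 * r <= _); last first.
  by rewrite ler_pM2l//; exact: ltW.
by move: r1; rewrite -!surjective_pairing.
Qed.

Section Data.
Variables (tau : R) (a : (R -> R) * (R -> R)) (M : R).
Hypothesis ma : forall i, measurable_fun I (sides a i).
Hypothesis aM : forall i x, I x -> 0 <= sides a i x <= M.

(** What a wave with initial data (phi, 0) provides: V is the derivative in time of
    U for the energy norm. *)
Definition orbit phi (U V : R -> @state R) :=
  [/\ forall t, (U t).2 = (V t).1.1,
      nO ((U 0).1.1 - phi) = 0 /\ nO (V 0).1.1 = 0,
      forall t, 0 <= t -> in_state (U t) /\ in_state (V t),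
      forall t, 0 < t < tau -> wave_op (sides a) (U t) (V t) &
      (forall t e, 0 <= t -> 0 < e -> exists2 d, 0 < d &
        forall s, 0 <= s -> `|s - t| < d -> NE (V s - V t) <= e) /\
      (forall t e, 0 <= t -> 0 < e -> exists2 d, 0 < d &
        forall s, 0 <= s -> `|s - t| < d ->
          NE (U s - U t - (s - t) *: V t) <= e * `|s - t|)].

Lemma wave_orbit phi (u : R -> F) : L2_Omega phi -> is_wave tau a phi (cst 0) u ->
  exists U V, orbit phi U V /\ forall t, (U t).1.1 = u t.
Proof.
move=> Lphi [ut [utt [cA [cU dU cV] eqn i0 i1]]].
have /choice[x hx] : forall t, exists x : (bool -> F) * (bool -> F) * F, 0 <= t ->
    wave_op (sides a) (u t, x.1.1, ut t) (ut t, x.1.2, x.2).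
  move=> t; have [t0|t0] := pselect (is_true (0 <= t)); last by exists (0, 0, 0).
  have [/(A_domP _ _ ma aM)[f [k [l wo]]] _] := cA t t0.
  by exists (f, k, l).
pose U t : @state R := (u t, (x t).1.1, ut t); pose V t : @state R := (ut t, (x t).1.2, utt t).
have SU t : 0 <= t -> in_state (U t).
  by move=> /hx[g [h [V1 _ [L1 _] _ _]]]; split; [exists g|].
have SV t : 0 <= t -> in_state (V t).
  move=> t0; have [g [h [_ V2 _ _ _]]] := hx t t0.
  by have [[_ Lutt] _] := cV t t0; split; [exists h|].
exists U, V; split; last by [].
split.
- by [].
- have [[g Vg] _] := SU 0 (lexx _); have [Lu _ _ _] := Vg.
  have [[h Vh] _] := SV 0 (lexx _); have [Lv _ _ _] := Vh.
  split; first exact: ((@snorm_ae _ _ R mu2 Omega mO _ _ Lu Lphi).2 i0).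
  have := (@snorm_ae _ _ R mu2 Omega mO _ _ Lv (si0 ipO)).2 i1.
  by rewrite subr0.
- by move=> t t0; split; [exact: SU|exact: SV].
- move=> t tt; have t0 : 0 <= t by case/andP: tt => /ltW.
  have wo := hx t t0; have [_ LL el] := laplacian_spec (wave_op_laplacian wo).
  have [g [h [V1 V2 [L1 L2] e hid]]] := wo; have [_ Lutt] := SV t t0.
  have eu : nO (utt t - laplacian (u t)) = 0.
    exact: ((@snorm_ae _ _ R mu2 Omega mO _ _ Lutt LL).2 (eqn t tt)).
  exists g, h; split; [exact: V1|exact: V2|by split|exact: e|].
  move=> p q r Vp; have [Lp _ _ _] := Vp.
  have := hid p q r Vp; rewrite /= => <-; congr (_ + _).
  exact: (etrans (si_eq ipO Lutt LL Lp eu) (si_eq ipO LL L2 Lp el)).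
split.
  move=> t e t0 e0; have e30 : 0 < e / 3 by rewrite divr_gt0.
  have [_ cv] := cV t t0; have nr : \forall s \near within halfline (nbhs t),
      (V_L2norm ((ut s, utt s) - (ut t, utt t))%R < (e / 3)%:E)%E .
    by apply: cvge0_inv cv e30.
  have [d d0 hd] := @halfline_near t (fun s => (V_L2norm ((ut s, utt s) - (ut t, utt t))%R < (e / 3)%:E)%E) nr; exists d; [exact: d0|move=> s s0 sd].
  have h := energy_V_L2norm (siB energy_inner (SV s s0) (SV t t0)) (hd s s0 sd).
  by apply: le_trans h _; rewrite mulrC divfK.
move=> t e t0 e0; have e30 : 0 < e / 3 by rewrite divr_gt0.
have nr : \forall s \near within halfline (dnbhs t),
    (V_L2norm ((s - t)^-1 *: ((u s, ut s) - (u t, ut t)) - (ut t, utt t))%R < (e / 3)%:E)%E.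
  by apply: cvge0_inv (dU t t0) e30.
have [d d0 hd] := @halfline_near_dnbhs t
  (fun s => (V_L2norm ((s - t)^-1 *: ((u s, ut s) - (u t, ut t)) - (ut t, utt t))%R < (e / 3)%:E)%E) nr; exists d; [exact: d0|move=> s s0 sd].
have SD := siB energy_inner (SU s s0) (SU t t0).
have [->|st] := eqVneq s t.
  by rewrite !subrr scale0r subr0 (snorm0 energy_inner) normr0 mulr0.
have SX := siB energy_inner (siZ energy_inner (s - t)^-1 SD) (SV t t0).
have h : NE ((s - t)^-1 *: (U s - U t) - V t) <= e.
  apply: le_trans (energy_V_L2norm SX (hd s s0 st sd)) _.
  by rewrite mulrC divfK.
have st0 : s - t != 0 by rewrite subr_eq0.
have -> : U s - U t - (s - t) *: V t = (s - t) *: ((s - t)^-1 *: (U s - U t) - V t).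
  by rewrite [RHS]scalerBr scalerA divff// scale1r.
by rewrite (snormZ energy_inner _ SX) mulrC ler_wpM2r.
Qed.

Lemma damping_norm i (g : R -> R) : L2I g -> n1 (fun x => sides a i x * g x) <= M * n1 g.
Proof.
move=> Lg; have Lag := L2_af ma aM i Lg.
have := wside_le ma aM i Lg Lag; rewrite /wside -[L2dot mu I _ _](snorm_sqr ip1 Lag).
have M0 : 0 <= M.
  have /(aM true)/andP[h1 h2] : I 2^-1 by rewrite /unit_itv /= in_itv/=; lra.
  exact: le_trans h1 h2.
move: (snorm_ge0 dot1 g) (snorm_ge0 dot1 (fun x => sides a i x * g x)).
move: (n1 g) (n1 (fun x => sides a i x * g x)) => x y x0 y0; rewrite ger0_norm ?sqr_ge0// expr2.
have [->|yn] := eqVneq y 0; first by move=> _; apply: mulr_ge0.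
by rewrite ler_pM2r// lt_neqAle eq_sym yn.
Qed.

Hypothesis tau0 : 0 < tau.

(** The boundary condition forces the normal derivative to be - a times the trace
    of the velocity.  That trace is continuous in time, so it has a jointly
    measurable version, and Lambda is indeed a lateral normal derivative of the
    wave; uniqueness at almost every time then identifies it. *)
Lemma Lambda_spec phi : L2_Omega phi -> (exists u : R -> F, is_wave tau a phi (cst 0) u) ->
  exists U V, orbit phi U V /\ exists h : R -> bool -> R -> R,
    (forall t, 0 <= t -> Vtuple (V t).1.1 (V t).1.2 (h t)) /\
    let H (i : bool) := if i then (Lambda tau a phi).1 else (Lambda tau a phi).2 in
    (forall i, L2 mu2 (lateral tau) (H i)) /\
    {ae mu, forall t, `]0, tau[%classic t -> forall i, L2I (fun x => H i (x, t)) /\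
      n1 ((fun x => H i (x, t)) - (fun x => - (sides a i x * h t i x))) = 0}.
Proof.
move=> Lphi [u0 wu0]; pose u := wave tau a phi (cst 0).
have wu : is_wave tau a phi (cst 0) u.
  by rewrite /u /wave; case: xgetP => [w _ //|/(_ u0)].
have [U [V [orb eu]]] := wave_orbit Lphi wu; exists U, V; split; first exact: orb.
have [U2 _ SUV wo [cV dU]] := orb.
have /choice[h hh] : forall t, exists h, 0 <= t -> Vtuple (V t).1.1 (V t).1.2 h.
  move=> t; have [t0|t0] := pselect (is_true (0 <= t)); last by exists 0.
  by have [_ [[h Vh] _]] := SUV t t0; exists h.
exists h; split; first exact: hh.
pose G i t : R -> R := fun x => - (sides a i x * h t i x).
have Lh t i : 0 <= t -> L2I (h t i) by move=> /hh[].
have LG i t : 0 <= t -> L2I (G i t).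
  by move=> t0; exact: (siN ip1 (L2_af ma aM i (Lh t i t0))).
have M0 : 0 <= M.
  have /(aM true)/andP[h1 h2] : I 2^-1 by rewrite /unit_itv /= in_itv/=; lra.
  exact: le_trans h1 h2.
have cG i t e : 0 <= t -> 0 < e -> exists2 d, 0 < d &
    forall s, 0 <= s -> `|s - t| < d -> n1 (G i s - G i t) <= e.
  move=> t0 e0; have k0 : 0 < 2 * (1 + M) by lra.
  have [d d0 hd] := cV t _ t0 (divr_gt0 e0 k0); exists d; [exact: d0|move=> s s0 sd].
  have Lhs := Lh s i s0; have Lht := Lh t i t0; have LD := siB ip1 Lhs Lht.
  have -> : G i s - G i t = - (fun x => sides a i x * (h s i - h t i) x).
    apply/funext => x.
    by change (- (sides a i x * h s i x) - - (sides a i x * h t i x) =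
      - (sides a i x * (h s i x - h t i x))); ring.
  rewrite (snormN ip1 (L2_af ma aM i LD)).
  apply: le_trans (damping_norm i LD) _.
  have VB := VtupleB (hh s s0) (hh t t0).
  have t1 := Vtuple_trace i VB.
  have t2 := snorm_energy_ge i (siB energy_inner (SUV s s0).2 (SUV t t0).2).
  have t3 := hd s s0 sd; rewrite ler_pdivlMr// in t3.
  have {t1}t1 : n1 (h s i - h t i) <= 2 * NE (V s - V t).
    by apply: le_trans t1 _; rewrite ler_pM2l.
  apply: le_trans (ler_wpM2l M0 t1) _.
  have n0 := snorm_ge0 (@energy R) (V s - V t).
  by move: t3 n0; move: (NE _) => x; clear => *; lra.
have /choice[H hH] : forall i, exists H : R * R -> R, L2 mu2 (lateral tau) H /\
    {ae mu, forall t, `]0, tau[%classic t -> L2I (fun x => H (x, t)) /\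
       n1 ((fun x => H (x, t)) - G i t) = 0}.
  by move=> i; exact: (lateral_version tau0 (LG i) (cG i)).
have ND t (k : bool -> R -> R) : `]0, tau[%classic t -> (forall i, L2I (k i)) ->
    (forall i, n1 (k i - G i t) = 0) -> normal_deriv (u t) (k true, k false).
  rewrite /= in_itv /= => tt Lk ek; have t0 : 0 <= t by case/andP: tt => /ltW.
  have [g [h' [V1 V2 [L1 L2] e hid]]] := wo t tt; rewrite eu in V1.
  have hl := wave_op_laplacian (wo t tt); rewrite eu in hl.
  apply/(normal_derivP V1 hl Lk) => p q r Vp; rewrite (hid p q r Vp).
  have [_ _ Lr _] := Vp; have [_ _ Lh' _] := V2.
  have e1 i : dot1 (k i) (r i) = - wside (sides a) i (h' i) (r i).
    rewrite (si_eq ip1 (Lk i) (LG i t t0) (Lr i) (ek i)).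
    have et : n1 (h t i - h' i) = 0.
      have VB := VtupleB (hh t t0) V2; have := Vtuple_trace i VB.
      have -> : ((V t).1.2 - (V t).1.2) i = 0 by rewrite subrr.
      rewrite (snorm0 ipO) mulr0 => n0.
      by apply/eqP; rewrite eq_le n0 snorm_ge0.
    rewrite -(wside_eq ma aM i (Lh t i t0) (Lh' i) (Lr i) et).
    have := siZl ip1 (-1) (L2_af ma aM i (Lh t i t0)) (Lr i).
    by rewrite scaleN1r mulN1r.
  by rewrite /wdot opprD addrC; exact: (congr2 +%R (esym (e1 true)) (esym (e1 false))).
have lnd : lateral_normal_deriv tau u (H true, H false).
  split; [exact: (hH true).1|exact: (hH false).1|].
  apply: (ae_mono (m := mu) (ae_and (m := mu) (hH true).2 (hH false).2)) => t [h1 h2] tt.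
  have Bt : `]0, tau[%classic t by rewrite /= in_itv.
  by apply: (ND t (fun i x => H i (x, t)) Bt); case; case: (h1 Bt); case: (h2 Bt).
have lnd' : lateral_normal_deriv tau u (Lambda tau a phi).
  by rewrite /Lambda; case: xgetP => [w _ //|/(_ (H true, H false))].
move=> H'; have [LH1 LH2 ndH] := lnd'.
have LH' i : L2 mu2 (lateral tau) (H' i) by rewrite /H'; case: i.
split; first exact: LH'.
have mB : measurable (`]0, tau[%classic : set R) by exact: measurable_itv.
have sec i := L2_section mI mB (LH' i).
apply: (ae_mono (m := mu) (ae_and (m := mu) ndH (ae_and (m := mu) (sec true) (sec false)))).
move=> t [nd [s1 s2]] Bt i; split; first by case: i; [exact: s1|exact: s2].
have tt : 0 < t < tau by move: Bt; rewrite /= in_itv.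
have t0 : 0 <= t by case/andP: tt => /ltW.
have nd2 : normal_deriv (u t) (G true t, G false t).
  apply: (ND t (fun i => G i t) Bt) => j; first exact: LG.
  by rewrite subrr (snorm0 ip1).
exact: (normal_deriv_unique (k := fun i x => H' i (x, t)) (k' := fun i => G i t) (nd tt) nd2 i).
Qed.

End Data.

End LambdaSpec.

(** * Curves on the half-line *)

Section RealCurves.
Context {R : realType}.
Local Notation mu := (@lebesgue_measure R).
Implicit Types (f g : R -> R).

(** Differentiability with derivative f', from the right only when t is 0. *)
Definition rdiff f (f' t : R) := forall e, 0 < e -> exists2 d, 0 < d &
  forall s, 0 <= s -> `|s - t| < d -> `|f s - f t - (s - t) * f'| <= e * `|s - t|.

Lemma rdiff_is_derive f (f' t : R) : is_derive t (1 : R) f f' -> rdiff f f' t.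
Proof.
move=> df e e0.
have cv : h^-1 *: (f (h *: 1 + t) - f t) @[h --> 0^'] --> f'.
  have := @ex_derive _ _ _ _ _ _ _ df; rewrite /derivable => /cvg_ex[l cl].
  by have := @derive_val _ _ _ _ _ _ _ df; rewrite /derive (cvg_lim _ cl)// => <-.
have /cvgrPdist_le/(_ _ e0) := cv.
rewrite /dnbhs near_withinE => /nbhs_ballP[d /= d0 hd]; exists d; [exact: d0|move=> s s0 sd].
have [->|st] := eqVneq s t; first by rewrite !subrr mul0r subr0 normr0 mulr0.
have st0 : s - t != 0 by rewrite subr_eq0.
have := hd (s - t); rewrite /ball/= sub0r normrN => /(_ sd st0).
have -> : (s - t) *: 1 + t = s by rewrite /GRing.scale /= mulr1 subrK.
have -> : f s - f t - (s - t) * f' = - ((f' - (s - t)^-1 *: (f s - f t)) * (s - t)).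
  by rewrite /GRing.scale /=; field.
by rewrite normrN normrM => h; rewrite ler_wpM2r.
Qed.

Lemma rdiff_continuous f (f' t : R) : rdiff f f' t -> forall e, 0 < e -> exists2 d, 0 < d &
  forall s, 0 <= s -> `|s - t| < d -> `|f s - f t| <= e.
Proof.
move=> df e e0; have [d d0 hd] := df 1 ltr01.
have q0 : 0 < e / (1 + `|f'|) by apply: divr_gt0 => //; apply: ltr_pwDl.
exists (Num.min d (e / (1 + `|f'|))); first by rewrite lt_min d0 q0.
move=> s s0; rewrite lt_min => /andP[s1 s2].
have h1 := hd s s0 s1.
have h3 : `|s - t| * (1 + `|f'|) <= e by rewrite -ler_pdivlMr ?ltW//; apply: ltr_pwDl.
have h4 := ler_normD (f s - f t - (s - t) * f') ((s - t) * f').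
rewrite subrK normrM in h4; apply: le_trans h4 _.
by apply: le_trans _ h3; rewrite mulrDr mulr1 lerD2r -[leRHS]mul1r.
Qed.

Lemma clamp_continuous f : (forall t e, 0 <= t -> 0 < e -> exists2 d, 0 < d &
    forall s, 0 <= s -> `|s - t| < d -> `|f s - f t| <= e) ->
  continuous (fun t : R => f (Num.max t 0)).
Proof.
move=> cf t; apply/cvgrPdist_le => e e0.
have t0 : 0 <= Num.max t 0 by rewrite le_max lexx orbT.
have [d d0 hd] := cf _ e t0 e0; apply: filterS (nbhsx_ballx t _ d0) => s /=.
rewrite /ball /= distrC => sd; rewrite distrC; apply: hd.
  by rewrite le_max lexx orbT.
apply: le_lt_trans _ sd.
by have [?|?] := leP s 0; have [?|?] := leP t 0;
  rewrite ?subrr ?normr0 ?normr_ge0// ler_norml; apply/andP; split;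
  have := ler_norm (s - t); have := ler_norm (- (s - t)); rewrite normrN; lra.
Qed.

(** The difference between f and the primitive of d has a nonpositive derivative. *)
Lemma growth (f f' d : R -> R) (T : R) : 0 < T -> (forall t, 0 <= t -> rdiff f (f' t) t) ->
  continuous d -> (forall t, 0 < t < T -> f' t <= d t) ->
  f T - f 0 <= \int[mu]_(t in `[0, T]%classic) d t.
Proof.
move=> T0 df cd fd.
pose g : R -> R := fun t => f (Num.max t 0).
have cg : continuous g.
  by apply: clamp_continuous => t e t0; exact: (rdiff_continuous (df t t0)).
have id : mu.-integrable `[0, T] (EFin \o d).
  apply: continuous_compact_integrable; first exact: segment_compact.
  exact: continuous_subspaceT.
pose D : R -> R := fun t => parameterized_integral mu 0 t d.
have dg (t : R) : 0 < t -> is_derive t (1 : R) g (f' t).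
  move=> t0.
  have cv : h^-1 *: ((g \o shift t) (h *: 1) - g t) @[h --> 0^'] --> f' t.
    apply/cvgrPdist_le => e e0; have [r r0 hr] := df t (ltW t0) e e0.
    rewrite /dnbhs near_withinE; apply/nbhs_ballP; exists (Num.min r t); first by rewrite /= lt_min r0.
    move=> h; rewrite /ball/= sub0r normrN lt_min => /andP[hh1 hh2] hn0.
    have -> : h *: 1 + t = h + t by rewrite /GRing.scale /= mulr1.
    have s0 : 0 <= h + t by have := ler_norm (- h); rewrite normrN; lra.
    have := hr (h + t) s0; rewrite addrK => /(_ hh1).
    rewrite /g !max_l ?(ltW t0)//.
    have -> : f (h + t) - f t - h * f' t = - (h * (f' t - h^-1 *: (f (h + t) - f t))).
      by rewrite /GRing.scale /=; field.
    by rewrite normrN normrM mulrC ler_pM2r// normr_gt0.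
  by split; [exact: cvgP cv|exact: cvg_lim cv].
have dD (t : R) : 0 < t < T -> is_derive t (1 : R) D (d t).
  move=> /andP[t0 tT].
  have [h1 h2] := @continuous_FTC1_closed R d 0 t T tT id t0 (cd t).
  by split; [exact: h1|rewrite -derive1E].
have dH (t : R) : 0 < t < T -> is_derive t (1 : R) (g - D) (f' t - d t).
  move=> tt; have t0 : 0 < t by case/andP: tt.
  have d1 := dg t t0; have d2 := dD t tt; exact: is_deriveB.
have cD : {within `[0, T], continuous D} by apply: parameterized_integral_continuous => //; exact: ltW.
have cH : {within `[0, T], continuous (g - D)}.
  move=> x; apply: cvgB; last exact: cD.
  by apply: continuous_subspaceT => y; exact: cg.
have inT t : t \in `]0, T[%R -> 0 < t < T by rewrite in_itv.
have h1 (x : R) : x \in `]0, T[%R -> derivable (g - D) x 1.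
  by move=> /inT xT; have := dH x xT; case.
have h2 (x : R) : x \in `]0, T[%R -> (g - D)^`()%classic x <= 0.
  move=> /inT xT; rewrite derive1E; have := dH x xT => h; rewrite (@derive_val _ _ _ _ _ _ _ h).
  by rewrite subr_le0; exact: fd.
have mono := ler0_derive1_le_cc h1 h2 cH.
have := mono T 0; rewrite !in_itv /= !lexx (ltW T0) => /(_ isT isT isT).
have -> : (g - D) T = f T - \int[mu]_(t in `[0, T]%classic) d t.
  by change (g T - D T = f T - D T); rewrite /g max_l// ltW.
have -> : (g - D) 0 = f 0.
  change (g 0 - D 0 = f 0); rewrite /g max_l// /D /parameterized_integral set_itv1.
  by rewrite Rintegral_set1 subr0.
lra.
Qed.

End RealCurves.

Section Curves.
Context {R : realType} {E : lmodType R}.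
Variables (S : set E) (b : E -> E -> R).
Hypothesis hb : semi_inner S b.
Local Notation N := (snorm b).
Implicit Types (X Y : R -> E) (k : E).

Let small_div (e a n : R) : 0 < e -> 0 <= a -> 0 <= n -> e / (1 + n) * a * n <= e * a.
Proof.
move=> e0 a0 n0; have k0 : 0 < 1 + n by apply: ltr_pwDl.
have -> : e / (1 + n) * a * n = e * a * (n / (1 + n)) by field; lra.
by apply: ler_piMr; [apply: mulr_ge0 => //; exact: ltW|rewrite ler_pdivrMr// mul1r lerDr].
Qed.

(** Differentiability of a curve for a seminorm. *)
Definition cdiff X (Y : E) (t : R) := forall e, 0 < e -> exists2 d, 0 < d &
  forall s, 0 <= s -> `|s - t| < d -> N (X s - X t - (s - t) *: Y) <= e * `|s - t|.

Lemma cdiffB X X' (Y Y' : E) t : (forall s, 0 <= s -> S (X s)) -> (forall s, 0 <= s -> S (X' s)) ->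
  S Y -> S Y' -> 0 <= t ->
  cdiff X Y t -> cdiff X' Y' t -> cdiff (fun s => X s - X' s) (Y - Y') t.
Proof.
move=> SX SX' SY SY' t0 h h' e e0; have e20 : 0 < e / 2 by rewrite divr_gt0.
have [d d0 hd] := h _ e20; have [d' d0' hd'] := h' _ e20.
exists (Num.min d d'); first by rewrite lt_min d0.
move=> s s0; rewrite lt_min => /andP[/(hd s s0) h1 /(hd' s s0) h2].
have -> : X s - X' s - (X t - X' t) - (s - t) *: (Y - Y') =
  (X s - X t - (s - t) *: Y) - (X' s - X' t - (s - t) *: Y') by lin R.
have S1 := siB hb (siB hb (SX s s0) (SX t t0)) (siZ hb (s - t) SY).
have S2 := siB hb (siB hb (SX' s s0) (SX' t t0)) (siZ hb (s - t) SY').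
apply: le_trans (snormD hb S1 (siN hb S2)) _; rewrite (snormN hb S2).
by rewrite (splitr e) mulrDl; exact: lerD.
Qed.

Lemma cdiffZ (c : R -> R) (c' : R) k t : S k -> rdiff c c' t ->
  cdiff (fun s => c s *: k) (c' *: k) t.
Proof.
move=> Sk h e e0; have n0 := snorm_ge0 b k.
have q0 : 0 < e / (1 + N k) by apply: divr_gt0 => //; apply: ltr_pwDl.
have [d d0 hd] := h _ q0; exists d; [exact: d0|move=> s s0 /(hd s s0) h1].
have -> : c s *: k - c t *: k - (s - t) *: (c' *: k) = (c s - c t - (s - t) * c') *: k by lin R.
rewrite (snormZ hb _ Sk); apply: le_trans (ler_wpM2r n0 h1) _.
have a0 := normr_ge0 (s - t).
exact: small_div.
Qed.

Lemma cdiff_near X (Y : E) t : (forall s, 0 <= s -> S (X s)) -> S Y -> 0 <= t -> cdiff X Y t ->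
  exists2 d, 0 < d & forall s, 0 <= s -> `|s - t| < d -> N (X s - X t) <= `|s - t| * (1 + N Y).
Proof.
move=> SX SY t0 h; have [d d0 hd] := h 1 ltr01; exists d; [exact: d0|move=> s s0 /(hd s s0) h1].
have h2 := snormB_le hb (siB hb (SX s s0) (SX t t0)) (siZ hb (s - t) SY).
apply: le_trans h2 _; rewrite (snormZ hb _ SY) mulrDr mulr1 addrC lerD2r.
by rewrite -[leRHS]mul1r.
Qed.

Lemma cdiff_dot X (Y : E) k t : (forall s, 0 <= s -> S (X s)) -> S Y -> S k -> 0 <= t ->
  cdiff X Y t -> rdiff (fun s => b (X s) k) (b Y k) t.
Proof.
move=> SX SY Sk t0 h e e0; have n0 := snorm_ge0 b k.
have q0 : 0 < e / (1 + N k) by apply: divr_gt0 => //; apply: ltr_pwDl.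
have [d d0 hd] := h _ q0; exists d; [exact: d0|move=> s s0 /(hd s s0) h1].
have SD := siB hb (SX s s0) (SX t t0); have SZ := siZ hb (s - t) SY.
have -> : b (X s) k - b (X t) k - (s - t) * b Y k = b (X s - X t - (s - t) *: Y) k.
  by rewrite (siBl hb SD SZ Sk) (siBl hb (SX s s0) (SX t t0) Sk) (siZl hb _ SY Sk).
apply: le_trans (si_cs hb (siB hb SD SZ) Sk) _.
apply: le_trans (ler_wpM2r n0 h1) _.
have a0 := normr_ge0 (s - t).
exact: small_div.
Qed.

Lemma cdiff_sqr X (Y : E) t : (forall s, 0 <= s -> S (X s)) -> S Y -> 0 <= t ->
  cdiff X Y t -> rdiff (fun s => b (X s) (X s)) (2 * b Y (X t)) t.
Proof.
move=> SX SY t0 h e e0; have e20 : 0 < e / 2 by rewrite divr_gt0.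
have e40 : 0 < e / 2 / 2 by rewrite divr_gt0.
have [d1 d10 h1] := cdiff_dot SX SY (SX t t0) t0 h e40.
have [d2 d20 h2] := cdiff_near SX SY t0 h.
pose K := 1 + N Y; have K0 : 0 < K by apply: ltr_pwDl => //; exact: snorm_ge0.
have d30 : 0 < e / 2 / K ^+ 2 by rewrite divr_gt0// exprn_gt0.
exists (Num.min d1 (Num.min d2 (e / 2 / K ^+ 2))); first by rewrite !lt_min d10 d20 d30.
move=> s s0; rewrite !lt_min => /and3P[/(h1 s s0) {}h1 /(h2 s s0) {}h2 h3].
have SD := siB hb (SX s s0) (SX t t0).
have := si_line hb 1 (SX t t0) SD; rewrite scale1r expr1n mul1r mulr1.
have -> : X t + (X s - X t) = X s by rewrite addrC subrK.
rewrite (siC hb (SX t t0) SD) (siBl hb (SX s s0) (SX t t0) (SX t t0)) => ->.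
have h4 : b (X s - X t) (X s - X t) <= e / 2 * `|s - t|.
  rewrite -(snorm_sqr hb SD).
  apply: (@le_trans _ _ ((`|s - t| * K) ^+ 2)).
    by rewrite ler_pXn2r// ?nnegrE ?snorm_ge0// mulr_ge0// ltW.
  rewrite exprMn expr2 mulrAC ler_wpM2r// -ler_pdivlMr ?exprn_gt0//; exact: ltW.
have h5 := si_ge0 hb SD; move: h1 h4 h5.
move: (b (X s - X t) _) (b (X s) (X t)) (b (X t) (X t)) (b Y (X t)) => u v w z.
rewrite !ler_norml; move: `|s - t| => a h1 h4 h5.
by move: h1 => /andP[h1 h1']; apply/andP; split; lra.
Qed.

End Curves.

(** * The energy estimate *)

Section TimeIntegral.
Context {R : realType}.
Local Notation mu := (@lebesgue_measure R).
Local Notation mu2 := (@lebesgue2 R).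
Local Notation I := (@unit_itv R).
Local Notation dot1 := (L2dot mu I).
Variables (tau T : R).
Hypotheses (T0 : 0 < T) (Ttau : T <= tau).
Local Notation B := (`]0, tau[%classic : set R).
Local Notation J := (`]0, T[%classic : set R).

(** The Cauchy-Schwarz inequality in time; by Fubini's theorem the square of D
    integrates to the squared norm of H. *)
Lemma time_cs (D : R -> R) (H : R * R -> R) : continuous D -> (forall t, 0 <= D t) ->
  L2 mu2 (lateral tau) H ->
  {ae mu, forall t, B t -> dot1 (fun x => H (x, t)) (fun x => H (x, t)) = D t ^+ 2} ->
  \int[mu]_(t in `[0, T]%classic) D t <= Num.sqrt T * snorm (L2dot mu2 (lateral tau)) H.
Proof.
move=> cD D0 LH ae.
have mB : measurable B by exact: measurable_itv.
have mJ : measurable J by exact: measurable_itv.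
have mDf A : measurable_fun A D.
  by apply: measurable_funTS; exact: continuous_measurable_fun.
have int c (f : R -> R) : continuous f -> mu.-integrable `]0, c[%classic (EFin \o f).
  move=> cf; apply: (@integrableS _ _ R mu `[0, c]%classic).
  - exact: measurable_itv.
  - exact: measurable_itv.
  - exact: subset_itv_oo_cc.
  - apply: continuous_compact_integrable; first exact: segment_compact.
    exact: continuous_subspaceT.
have cD2 : continuous (fun t => D t ^+ 2).
  move=> t; have -> : (fun t : R => D t ^+ 2) = (fun t : R => D t * D t).
    by apply/funext => s; rewrite expr2.
  exact: cvgM (cD t) (cD t).
have LD : L2 mu J D by apply: (@L2P _ _ R mu J mJ D).2; split; [exact: mDf|exact: int].
have mJT : mu J = T%:E by rewrite lebesgue_measure_itv /= lte_fin T0 oppr0 adde0.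
have finJ : (mu J < +oo)%E by rewrite mJT ltry.
have L1 := L2_cst (m := mu) mJ 1 finJ.
have ipJ := L2dot_inner mu mJ.
have eJ : \int[mu]_(t in `[0, T]%classic) D t = L2dot mu J D (cst 1).
  rewrite -Rintegral_itv_obnd_cbnd; last first.
    apply: (@integrableS _ _ R mu `[0, T]%classic).
    - exact: measurable_itv.
    - exact: measurable_itv.
    - exact: subset_itv_oc_cc.
    - apply: continuous_compact_integrable; first exact: segment_compact.
      exact: continuous_subspaceT.
  rewrite -Rintegral_itv_bndo_bndc; last exact: int.
  by apply: eq_Rintegral => t _; rewrite mulr1.
have n1 : snorm (L2dot mu J) (cst 1) = Num.sqrt T.
  congr Num.sqrt; transitivity (\int[mu]_(t in J) (1 : R)).
    by apply: eq_Rintegral => t _; rewrite mulr1.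
  transitivity (1 * fine (mu J)); first exact: (Rintegral_cst mu mJ 1).
  by rewrite mJT mul1r.
rewrite eJ mulrC -n1; apply: le_trans (ler_norm _) _.
apply: le_trans (si_cs ipJ LD L1) _; apply: ler_wpM2r; first exact: snorm_ge0.
rewrite (snorm_le ipJ LD); last exact: snorm_ge0.
rewrite (snorm_sqr (ipL tau) LH); have [iH ->] := dot_lateral LH.
rewrite /L2dot /Rintegral; apply: fine_le.
- by apply: integrable_fin_num => //; exact: (L2_integ_mul (m := mu) mJ LD LD).
- by apply: integrable_fin_num => //.
have mH := measurable_int _ iH.
have -> : (\int[mu]_(t in B) (\int[mu]_(x in I) (H (x, t) * H (x, t)))%:E =
  \int[mu]_(t in B) (D t ^+ 2)%:E)%E.
  apply: ge0_ae_eq_integral => //.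
  - by apply/measurable_EFinP; apply: measurable_funX; exact: mDf.
  - by move=> t _; rewrite lee_fin Rintegral_ge0// => x _; rewrite -expr2 sqr_ge0.
  - by move=> t _; rewrite lee_fin sqr_ge0.
  - by apply: (ae_mono (m := mu) ae) => t h Bt; rewrite /= -(h Bt).
under eq_integral do rewrite -expr2.
apply: (@ge0_subset_integral _ _ R mu _ _ mJ mB).
- by apply/measurable_EFinP; apply: measurable_funX; exact: mDf.
- by move=> t _; rewrite lee_fin sqr_ge0.
- by move=> t /=; rewrite !in_itv /= => /andP[-> h]; exact: lt_le_trans h Ttau.
Qed.

End TimeIntegral.

Section EnergyEstimate.
Context {R : realType}.
Local Notation mu := (@lebesgue_measure R).
Local Notation mu2 := (@lebesgue2 R).
Local Notation I := (@unit_itv R).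
Local Notation mO := (@measurable_Omega R).
Local Notation mI := (@measurable_unit_itv R).
Local Notation dotO := (L2dot mu2 Omega).
Local Notation dot1 := (L2dot mu I).
Local Notation nO := (snorm dotO).
Local Notation n1 := (snorm dot1).
Local Notation ipO := (@ipO R).
Local Notation ip1 := (@ip1 R).
Local Notation L2I := (L2 mu I).
Local Notation F := (R * R -> R).
Local Notation NE := (snorm (@energy R)).
Local Notation ipE := (@energy_inner R).

Definition omega : R := Num.sqrt eigenvalue.

Lemma omega_sqr : omega ^+ 2 = eigenvalue.
Proof. by rewrite /omega sqr_sqrtr// /eigenvalue mulr_ge0// sqr_ge0. Qed.

Lemma omega_ge0 : 0 <= omega. Proof. exact: sqrtr_ge0. Qed.

Definition osc (t : R) : R := cos (omega * t + 0).
(** The opposite of the derivative of osc. *)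
Definition osc' (t : R) : R := omega * sin (omega * t + 0).

Lemma rdiff_osc t : rdiff osc (- osc' t) t.
Proof.
apply: rdiff_is_derive.
have d1 := is_derive_affine omega 0 t.
have d2 := @is_derive1_comp R cos (fun y => omega * y + 0) t _ _ (is_derive_cos _) d1.
by apply: (is_derive_eq d2); rewrite /osc'; ring.
Qed.

Lemma rdiff_osc' t : rdiff osc' (eigenvalue * osc t) t.
Proof.
apply: rdiff_is_derive.
have d1 := is_derive_affine omega 0 t.
have d2 := @is_derive1_comp R sin (fun y => omega * y + 0) t _ _ (is_derive_sin _) d1.
have d3 := @is_deriveM R R (cst omega) _ t 1 _ _ (is_derive_cst _ _ _) d2.
apply: (is_derive_eq d3); rewrite /cst /= scaler0 addr0 -omega_sqr.
change (omega * (cos (omega * t + 0) * omega) = omega ^+ 2 * cos (omega * t + 0)).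
by ring.
Qed.

Lemma osc'_le t : `|osc' t| <= omega.
Proof.
rewrite /osc' normrM (ger0_norm omega_ge0) ler_piMr ?omega_ge0//.
by rewrite ler_norml sin_geN1 sin_le1.
Qed.

(** Test functions determine the weak derivatives. *)
Lemma Vtuple_eq0 u f g : Vtuple u f g -> nO u = 0 -> forall i, nO (f i) = 0 /\ n1 (g i) = 0.
Proof.
move=> V u0 i; have [Lu Lf Lg _] := V.
have wu := ((is_weak_dE i u (f i)).1 (Vtuple_weak_d i V)).2.
have f0 : nO (f i) = 0.
  have := @dot_separating R (f i) 0 (Lf i) (si0 ipO); rewrite subr0; apply.
  move=> p tp; have sp := test_Smooth tp.
  have z1 : dotO u (pd i p) = 0.
    have Lp := Smooth_L2 (Smooth_pd i sp).
    apply/eqP; rewrite -normr_eq0 eq_le normr_ge0 andbT.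
    by have := si_cs ipO Lu Lp; rewrite u0 mul0r.
  have z2 : dotO 0 p = 0.
    have Lp := Smooth_L2 sp.
    by have := siBl ipO Lp Lp Lp; rewrite !subrr.
  by apply/eqP; rewrite z2 -oppr_eq0 -(wu p tp) z1.
split => //; apply/eqP; rewrite eq_le snorm_ge0 andbT.
by have := Vtuple_trace i V; rewrite f0 mulr0.
Qed.

Variables (tau T abar M kappa : R) (a : (R -> R) * (R -> R)).
Hypothesis tau0 : 0 < tau.
Hypotheses (T0 : 0 < T) (Ttau : T <= tau) (abar0 : 0 < abar).
Hypothesis ma : forall i, measurable_fun I (sides a i).
Hypothesis aM : forall i x, I x -> 0 <= sides a i x <= M.
Hypothesis ale : forall i x, I x -> abar <= sides a i x.
Let phi : F := kappa *: mode.
Let tr : R -> R := kappa *: profile.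
Let b := n1 tr.

Lemma Smooth_phi : Smooth phi. Proof. exact: SmoothZ Smooth_mode. Qed.

Lemma phi_side1 i t : phi (side_pt i 1 t) = 0.
Proof. by change (kappa * mode (side_pt i 1 t) = 0); rewrite mode_side1 mulr0. Qed.

Lemma phi_neumann i t : pd i phi (side_pt i 0 t) = 0.
Proof.
rewrite /phi (pdZ i kappa Smooth_mode).
by change (kappa * pd i mode (side_pt i 0 t) = 0); rewrite mode_neumann mulr0.
Qed.

Lemma Vtuple_phi : Vtuple phi (pd^~ phi) (fun=> tr).
Proof.
have := Vtuple_Smooth Smooth_phi phi_side1.
have -> : (fun i => phi \o side_pt i 0) = (fun=> tr) => //.
apply/funext => i; rewrite /tr -(mode_side0 i); exact: erefl.
Qed.

Lemma lap_phi : lap phi = - eigenvalue *: phi.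
Proof.
have e i : pd i (pd i phi) = kappa *: pd i (pd i mode).
  by rewrite /phi (pdZ i kappa Smooth_mode) (pdZ i kappa (Smooth_pd i Smooth_mode)).
have -> : lap phi = kappa *: lap mode.
  by rewrite /lap (e false) (e true) -scalerDr.
by rewrite lap_mode /phi !scalerA mulrC.
Qed.

Lemma L2_tr : L2I tr.
Proof. by have [_ _ Lg _] := Vtuple_phi; exact: (Lg true). Qed.

Lemma damping_ge i (g : R -> R) : L2I g -> abar * n1 g <= n1 (fun x => sides a i x * g x).
Proof.
move=> Lg; have Lag := L2_af ma aM i Lg; have La := siZ ip1 abar Lg.
have := snormZ ip1 abar Lg; rewrite (gtr0_norm abar0) => <-.
rewrite (snorm_le ip1 La) ?snorm_ge0// (snorm_sqr ip1 Lag).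
apply: le_Rintegral; first exact: mI.
- exact: (L2_integ_mul (m := mu) mI La La).
- exact: (L2_integ_mul (m := mu) mI Lag Lag).
move=> x Ix; change (abar * g x * (abar * g x) <= sides a i x * g x * (sides a i x * g x)).
have h := ale i Ix.
have -> : abar * g x * (abar * g x) = abar ^+ 2 * g x ^+ 2 by ring.
have -> : sides a i x * g x * (sides a i x * g x) = sides a i x ^+ 2 * g x ^+ 2 by ring.
apply: ler_wpM2r; first exact: sqr_ge0.
by apply: lerXn2r => //; rewrite nnegrE ltW// (lt_le_trans abar0).
Qed.

Variables (U V : R -> @state R) (h : R -> bool -> R -> R).
Hypothesis orb : orbit tau a phi U V.
Hypothesis hh : forall t, 0 <= t -> Vtuple (V t).1.1 (V t).1.2 (h t).

Let Phi1 : @state R := (phi, pd^~ phi, 0).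
Let Phi2 : @state R := (0, 0, - phi).
Let W t : @state R := U t - osc t *: Phi1 - osc' t *: Phi2.
Let W' t : @state R := V t - (- osc' t) *: Phi1 - (eigenvalue * osc t) *: Phi2.
Let d i t := n1 (fun x => sides a i x * h t i x).

Let SPhi1 : in_state Phi1.
Proof. by split; [exists (fun=> tr); exact: Vtuple_phi|exact: si0 ipO]. Qed.

Let SPhi2 : in_state Phi2.
Proof.
by split; [exists 0; exact: Vtuple0|exact: (siN ipO (Smooth_L2 Smooth_phi))].
Qed.

Let state_comb (X : @state R) c m : X - c *: Phi1 - m *: Phi2 =
  (X.1.1 - c *: phi, X.1.2 - c *: pd^~ phi, X.2 + m *: phi).
Proof.
case: X => [[u f] w]; congr (_, _, _).
- by change (u - c *: phi - m *: 0 = u - c *: phi); rewrite scaler0 subr0.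
- by change (f - c *: pd^~ phi - m *: 0 = f - c *: pd^~ phi); rewrite scaler0 subr0.
- change (w - c *: 0 - m *: - phi = w + m *: phi).
  by rewrite scaler0 subr0 scalerN opprK.
Qed.

Let SUV t : 0 <= t -> in_state (U t) /\ in_state (V t). Proof. by have [_ _ SS _ _] := orb; exact: SS. Qed.

Let SW t : 0 <= t -> in_state (W t).
Proof.
move=> /SUV[SU _]; exact: (siB ipE (siB ipE SU (siZ ipE _ SPhi1)) (siZ ipE _ SPhi2)).
Qed.

Let SW' t : 0 <= t -> in_state (W' t).
Proof.
move=> /SUV[_ SV]; exact: (siB ipE (siB ipE SV (siZ ipE _ SPhi1)) (siZ ipE _ SPhi2)).
Qed.

Let Lh t i : 0 <= t -> L2I (h t i). Proof. by move=> /hh[]. Qed.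

Let cdiffW t : 0 <= t -> cdiff (@energy R) W (W' t) t.
Proof.
move=> t0; have [_ _ _ _ [_ dU]] := orb.
have SU s : 0 <= s -> in_state (U s) by move=> /SUV[].
apply: (cdiffB ipE _ _ _ _ t0).
- move=> s s0; exact: (siB ipE (SU s s0) (siZ ipE _ SPhi1)).
- move=> s s0; exact: (siZ ipE _ SPhi2).
- exact: (siB ipE (SUV t0).2 (siZ ipE _ SPhi1)).
- exact: (siZ ipE _ SPhi2).
- apply: (cdiffB ipE SU _ (SUV t0).2 (siZ ipE _ SPhi1) t0).
  + move=> s s0; exact: (siZ ipE _ SPhi1).
  + by move=> e e0; exact: dU.
  + exact: (cdiffZ ipE SPhi1 (rdiff_osc t)).
- exact: (cdiffZ ipE SPhi2 (rdiff_osc' t)).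
Qed.

Let traces_eq t (h' : bool -> R -> R) : 0 <= t -> Vtuple (V t).1.1 (V t).1.2 h' ->
  forall i, n1 (h' i - h t i) = 0.
Proof.
move=> t0 Vh i; have VB := VtupleB Vh (hh t0).
by apply: (Vtuple_eq0 VB _ i).2; rewrite subrr (snorm0 ipO).
Qed.

(** W is the difference between the wave and the undamped wave osc(t) phi, so it
    solves the wave equation: its energy varies only through the boundary, where the
    damping of the wave dissipates, and the velocity of the undamped wave is paired
    with a u_t. *)
Let energy_rate t : 0 < t < tau ->
  energy (W' t) (W t) <= omega * b * (d false t + d true t).
Proof.
move=> tt; have t0 : 0 <= t by case/andP: tt => /ltW.
have [U2 _ _ /(_ t tt) [g [h' [V1 V2 [L1 L2] _ hid]]] _] := orb.
have Vp := Vtuple_lin (osc' t) V2 Vtuple_phi.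
have [Lp Lq Lr _] := Vp; have [_ Lf _ _] := V1; have [_ _ Lh' _] := V2.
have Lphi := Smooth_L2 Smooth_phi; have [_ Lpd _ _] := Vtuple_phi.
set p := (V t).1.1 + osc' t *: phi in Vp Lp; set q := (V t).1.2 + osc' t *: _ in Vp Lq.
set r := h' + osc' t *: _ in Vp Lr.
have gr := green_neumann Smooth_phi Vp phi_neumann.
rewrite lap_phi (siZl ipO _ Lphi Lp) in gr.
have id := hid p q r Vp.
have eW : W t = ((U t).1.1 - osc t *: phi, (U t).1.2 + (- osc t) *: pd^~ phi, p).
  by rewrite /W state_comb U2 scaleNr.
have eW' : W' t = (p, q, (V t).2 + (eigenvalue * osc t) *: phi).
  by rewrite /W' state_comb scaleNr opprK scaleNr opprK.
have e1 : gdot q ((U t).1.2 + (- osc t) *: pd^~ phi) =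
    gdot (U t).1.2 q + (- osc t) * gdot (pd^~ phi) q.
  have Ls i : L2_Omega (((U t).1.2 + (- osc t) *: pd^~ phi) i).
    exact: (siD ipO (Lf i) (siZ ipO _ (Lpd i))).
  by rewrite (gdotC Lq Ls); exact: (gdot_lin _ Lf Lpd Lq).
have e2 : dotO ((V t).2 + (eigenvalue * osc t) *: phi) p =
    dotO (V t).2 p + eigenvalue * osc t * dotO phi p.
  by rewrite (siDl ipO L2 (siZ ipO _ Lphi) Lp) (siZl ipO _ Lphi Lp).
have ws i : - wside (sides a) i (h' i) (r i) <= omega * b * d i t.
  have et := traces_eq t0 V2 i.
  have L3 := L2_af ma aM i (Lh i t0).
  have e3 : wside (sides a) i (h t i) (r i) =
      wside (sides a) i (h t i) (h' i) + osc' t * dot1 (fun x => sides a i x * h t i x) tr.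
    have h1 := siDr ip1 (Lh' i) (siZ ip1 (osc' t) L2_tr) L3.
    have h2 := siZr ip1 (osc' t) L2_tr L3.
    exact: (etrans h1 (congr1 _ h2)).
  rewrite (wside_eq ma aM i (Lh' i) (Lh i t0) (Lr i) et) e3.
  rewrite (wsideC (sides a) i (Lh i t0) (Lh' i)) (wside_eq ma aM i (Lh' i) (Lh i t0) (Lh i t0) et).
  have p1 := wside_ge0 aM i (h t i).
  have p2 := si_cs ip1 L3 L2_tr; rewrite -/b in p2.
  have p3 : `|osc' t * dot1 (fun x => sides a i x * h t i x) tr| <= omega * (d i t * b).
    by rewrite normrM; apply: ler_pM => //; exact: osc'_le.
  have -> : omega * b * d i t = omega * (d i t * b) by ring.
  move: p3; rewrite ler_norml => /andP[p3 _]; move: p1 p3.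
  move: (wside _ _ _ _) (osc' t * _) (omega * _) => x y z q1 q2; lra.
rewrite eW eW' /energy /= e1 e2.
have key (A B1 C Dd o l w1 w2 x1 x2 : R) : - l * B1 + Dd = 0 -> A + C = - (w1 + w2) ->
    - w1 <= x1 -> - w2 <= x2 -> C + - o * Dd + (A + l * o * B1) <= x1 + x2.
  move=> h1 h2 h3 h4; have -> : Dd = l * B1 by move: h1; lra.
  have -> : C + - o * (l * B1) + (A + l * o * B1) = A + C by ring.
  by rewrite h2; lra.
rewrite [leRHS]mulrDr.
exact: (key _ _ _ _ _ _ _ _ _ _ gr id (ws false) (ws true)).
Qed.

Let init : NE (W 0) = 0.
Proof.
have [U2 [u0 v0] _ _ _] := orb.
have [[[g Vg] _] [[k Vk] _]] := SUV (lexx 0).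
have osc0 : osc 0 = 1 by rewrite /osc mulr0 addr0 cos0.
have osc'0 : osc' 0 = 0 by rewrite /osc' mulr0 addr0 sin0 mulr0.
apply/eqP; rewrite eq_le snorm_ge0 andbT.
apply: le_trans (snorm_energy_le (SW (lexx 0))) _.
have -> : W 0 = ((U 0).1.1 - phi, (U 0).1.2 - pd^~ phi, (V 0).1.1).
  by rewrite /W state_comb osc0 osc'0 !scale1r scale0r addr0 U2.
have VB := VtupleB Vg Vtuple_phi.
have z i := (Vtuple_eq0 VB u0 i).1.
by rewrite (z false) (z true) v0 !addr0.
Qed.

Let D i t := d i (Num.max t 0).

Let D_continuous i : continuous (D i).
Proof.
apply: clamp_continuous => t e t0 e0.
have M0 : 0 <= M.
  have /(aM true)/andP[h1 h2] : I 2^-1 by rewrite /unit_itv /= in_itv/=; lra.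
  exact: le_trans h1 h2.
have k0 : 0 < 2 * (1 + M) by lra.
have [_ _ _ _ [cV _]] := orb.
have [r r0 hr] := cV t _ t0 (divr_gt0 e0 k0); exists r; [exact: r0|move=> s s0 sr].
have L1 := Lh i s0; have L2 := Lh i t0; have LD := siB ip1 L1 L2.
have A1 := L2_af ma aM i L1; have A2 := L2_af ma aM i L2.
have le1 : n1 ((fun x => sides a i x * h s i x) - (fun x => sides a i x * h t i x)) <= e.
  have -> : (fun x => sides a i x * h s i x) - (fun x => sides a i x * h t i x) =
      (fun x => sides a i x * (h s i - h t i) x).
    apply/funext => x.
    by change (sides a i x * h s i x - sides a i x * h t i x =
      sides a i x * (h s i x - h t i x)); ring.
  apply: le_trans (damping_norm ma aM i LD) _.
  have t1 := Vtuple_trace i (VtupleB (hh s0) (hh t0)).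
  have t2 := snorm_energy_ge i (siB ipE (SUV s0).2 (SUV t0).2).
  have t3 := hr s s0 sr; rewrite ler_pdivlMr// in t3.
  have {}t1 : n1 (h s i - h t i) <= 2 * NE (V s - V t).
    by apply: le_trans t1 _; rewrite ler_pM2l.
  apply: le_trans (ler_wpM2l M0 t1) _.
  have n0 := snorm_ge0 (@energy R) (V s - V t).
  by move: t3 n0; move: (NE _) => x; lra.
have h1 := snormB_le ip1 A1 A2; have h2 := snormB_le ip1 A2 A1.
rewrite (snormBC ip1 A2 A1) in h2.
have ab (x y z : R) : x <= y + z -> y <= x + z -> z <= e -> `|x - y| <= e.
  by move=> *; rewrite ler_norml; apply/andP; split; lra.
exact: (ab _ _ _ h1 h2 le1).
Qed.

Variable H : bool -> R * R -> R.
Hypothesis LH : forall i, L2 mu2 (lateral tau) (H i).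
Hypothesis aeH : {ae mu, forall t, `]0, tau[%classic t -> forall i, L2I (fun x => H i (x, t)) /\
      n1 ((fun x => H i (x, t)) - (fun x => - (sides a i x * h t i x))) = 0}.
Let eps i := snorm (L2dot mu2 (lateral tau)) (H i).

Let D_integral i : \int[mu]_(t in `[0, T]%classic) D i t <= Num.sqrt T * eps i.
Proof.
have Dn t : 0 <= D i t by exact: snorm_ge0.
have ae : {ae mu, forall t, `]0, tau[%classic t ->
    dot1 (fun x => H i (x, t)) (fun x => H i (x, t)) = D i t ^+ 2}.
  apply: (ae_mono (m := mu) aeH) => t ht Bt; have [L1 e] := ht Bt i.
  have t0 : 0 <= t by move: Bt; rewrite /= in_itv /= => /andP[/ltW].
  have A := L2_af ma aM i (Lh i t0).
  have -> : D i t = n1 (fun x => H i (x, t)).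
    rewrite /D max_l// (snorm_eq ip1 L1 (siN ip1 A) e); exact: (esym (snormN ip1 A)).
  by rewrite (snorm_sqr ip1 L1).
exact: (time_cs T0 Ttau (@D_continuous i) Dn (LH i) ae).
Qed.

Let D_lin k : \int[mu]_(t in `[0, T]%classic) (k * (D false t + D true t)) =
  k * (\int[mu]_(t in `[0, T]%classic) D false t + \int[mu]_(t in `[0, T]%classic) D true t).
Proof.
have int i : mu.-integrable `[0, T]%classic (EFin \o D i).
  apply: continuous_compact_integrable; first exact: segment_compact.
  by apply: continuous_subspaceT; exact: D_continuous.
rewrite RintegralZl; last 2 first.
- exact: measurable_itv.
- apply: continuous_compact_integrable; first exact: segment_compact.
  apply: continuous_subspaceT => t.
  exact: (cvgD (@D_continuous false t) (@D_continuous true t)).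
by rewrite RintegralD//; exact: measurable_itv.
Qed.

Let wave_close : NE (W T) ^+ 2 <= 2 * omega * b * Num.sqrt T * (eps false + eps true).
Proof.
have g := growth T0 (f := fun s => energy (W s) (W s)) (f' := fun t => 2 * energy (W' t) (W t))
  (d := fun t => 2 * omega * b * (D false t + D true t)).
have := g _ _ _; rewrite D_lin -!(snorm_sqr ipE (SW _)) ?(ltW T0)// init expr0n subr0 => {}g.
have b0 : 0 <= b by exact: snorm_ge0.
have o0 := omega_ge0; have k0 : 0 <= 2 * omega * b by rewrite !mulr_ge0.
have := ler_wpM2l k0 (lerD (D_integral false) (D_integral true)).
rewrite -mulrDr mulrA; apply: le_trans; apply: g.
- move=> t t0; exact: (cdiff_sqr ipE SW (SW' t0) t0 (cdiffW t0)).
- move=> t; apply: cvgM; first exact: cvg_cst.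
  exact: (cvgD (@D_continuous false t) (@D_continuous true t)).
move=> t /andP[t0 tT]; have tt : 0 < t < tau by rewrite t0 (lt_le_trans tT).
have := energy_rate tt; rewrite /D max_l ?(ltW t0)//.
have -> : 2 * omega * b * (d false t + d true t) = 2 * (omega * b * (d false t + d true t)) by ring.
by rewrite ler_pM2l.
Qed.

(** The trace of the wave hardly moves, since a is bounded from below and a u_t is
    small; by wave_close the trace of osc(t) phi is close to it, yet it moves from
    phi to osc(T) phi. *)
Lemma energy_estimate : b ^+ 2 * (1 - osc T) <=
  2 * b * Num.sqrt (2 * omega * b * Num.sqrt T * (eps false + eps true)) +
  b / abar * (Num.sqrt T * (eps false + eps true)).
Proof.
have /choice[g hg] : forall t, exists g, 0 <= t -> Vtuple (U t).1.1 (U t).1.2 g.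
  move=> t; have [t0|t0] := pselect (is_true (0 <= t)); last by exists 0.
  by have [[[g Vg] _] _] := SUV t0; exists g.
have Lg t i : 0 <= t -> L2I (g t i) by move=> /hg[].
pose k : R -> R := - tr; have Lk : L2I k := siN ip1 L2_tr.
have nk : n1 k = b by exact: (snormN ip1 L2_tr).
have b0 : 0 <= b by exact: snorm_ge0.
have cg i t : 0 <= t -> cdiff dot1 (fun s => g s i) (h t i) t.
  move=> t0 e e0; have [_ _ _ _ [_ dU]] := orb; have e20 : 0 < e / 2 by rewrite divr_gt0.
  have [r r0 hr] := dU t _ t0 e20; exists r; [exact: r0|move=> s s0 sr].
  have VB := VtupleB (VtupleB (hg s s0) (hg t t0)) (VtupleZ (s - t) (hh t0)).
  have t1 := Vtuple_trace i VB.
  have t2 := snorm_energy_ge i (siB ipE (siB ipE (SUV s0).1 (SUV t0).1) (siZ ipE (s - t) (SUV t0).2)).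
  have t3 := le_trans t2 (hr s s0 sr).
  apply: le_trans t1 _; rewrite mulrC -ler_pdivlMr// mulrAC; exact: t3.
have rd i t : 0 <= t -> rdiff (fun s => dot1 (g s i) k) (dot1 (h t i) k) t.
  move=> t0; apply: (cdiff_dot ip1 _ (Lh i t0) Lk t0 (cg i t t0)).
  by move=> s s0; exact: Lg.
have gr := growth T0 (f := fun s => dot1 (g s true) k) (f' := fun t => dot1 (h t true) k)
  (d := fun t => b / abar * (D false t + D true t)) (rd true).
have {gr}gr : dot1 (g T true) k - dot1 (g 0 true) k <=
    b / abar * (Num.sqrt T * (eps false + eps true)).
  apply: (@le_trans _ _ (\int[mu]_(t in `[0, T]%classic) (b / abar * (D false t + D true t)))).
    apply: gr.
      move=> t; apply: cvgM; first exact: cvg_cst.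
      exact: (cvgD (@D_continuous false t) (@D_continuous true t)).
    move=> t /andP[t0 tT]; have t0' := ltW t0.
    rewrite /D max_l//; apply: le_trans (ler_norm _) _.
    apply: le_trans (si_cs ip1 (Lh true t0') Lk) _; rewrite nk mulrC.
    have h1 := damping_ge true (Lh true t0').
    have d0 : 0 <= d false t by exact: snorm_ge0.
    rewrite -mulrA; apply: ler_wpM2l => //; rewrite mulrC ler_pdivlMr// mulrC.
    by apply: le_trans h1 _; rewrite lerDr.
  rewrite D_lin; apply: ler_wpM2l; first by rewrite divr_ge0// ltW.
  by rewrite mulrDr; apply: lerD; exact: D_integral.
have T0' := ltW T0.
have [_ [u0 _] _ _ _] := orb.
have e0 : dot1 (g 0 true) k = - b ^+ 2.
  have VB := VtupleB (hg 0 (lexx 0)) Vtuple_phi.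
  have z := (Vtuple_eq0 VB u0 true).2.
  have L0 := Lg 0 true (lexx 0).
  rewrite (si_eq ip1 L0 L2_tr Lk z) (snorm_sqr ip1 L2_tr) (siC ip1 L2_tr Lk).
  by have := siZl ip1 (-1) L2_tr L2_tr; rewrite scaleN1r mulN1r.
have eT : - (osc T * b ^+ 2 + 2 * NE (W T) * b) <= dot1 (g T true) k.
  have VB := VtupleB (hg T T0') (VtupleZ (osc T) Vtuple_phi).
  have t1 := Vtuple_trace true VB.
  have t2 := snorm_energy_ge true (SW T0').
  have LT := Lg T true T0'; have Lo := siZ ip1 (osc T) L2_tr; have LB := siB ip1 LT Lo.
  have t3 := si_cs ip1 LB Lk; rewrite nk (siBl ip1 LT Lo Lk) (siZl ip1 _ L2_tr Lk) in t3.
  have e1 : dot1 tr k = - b ^+ 2.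
    rewrite (snorm_sqr ip1 L2_tr) (siC ip1 L2_tr Lk).
    by have := siZl ip1 (-1) L2_tr L2_tr; rewrite scaleN1r mulN1r.
  have t4 : n1 (g T true - osc T *: tr) <= 2 * NE (W T).
    apply: le_trans t1 _; rewrite ler_pM2l//; apply: le_trans _ t2.
    by rewrite /W state_comb.
  rewrite e1 in t3; have t5 := le_trans t3 (ler_wpM2r b0 t4).
  by move: t5; rewrite ler_norml => /andP[t5 _]; lra.
have sq : NE (W T) <= Num.sqrt (2 * omega * b * Num.sqrt T * (eps false + eps true)).
  have n0 := snorm_ge0 (@energy R) (W T).
  by rewrite -[leLHS](ger0_norm n0) -sqrtr_sqr; apply: ler_wsqrtr; exact: wave_close.
have := ler_wpM2l b0 sq; move: gr eT; rewrite e0.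
move: (NE (W T)) (Num.sqrt (_ * _)) (dot1 _ _) (_ / abar * _) => x y z w; lra.
Qed.

End EnergyEstimate.

(** * Admissible coefficients *)

Section Coefficients.
Context {R : realType}.
Local Notation mu := (@lebesgue_measure R).
Local Notation I := (@unit_itv R).
Local Notation L2I := (L2 mu I).
Implicit Types (c : R -> R) (a : (R -> R) * (R -> R)).

Lemma hoelder_measurable alpha c : 0 < alpha -> hoelder_continuous alpha c ->
  measurable_fun I c.
Proof.
move=> a0 [K hK]; apply: subspace_continuous_measurable_fun; first exact: measurable_unit_itv.
have oI : open I by exact: interval_open.
rewrite continuous_open_subspace// => x /set_mem Ix.
apply/cvgrPdist_le => e e0.
have k0 : 0 < 1 + `|K| by apply: ltr_pwDl.
have q0 : 0 < e / (1 + `|K|) by rewrite divr_gt0.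
have d0 : 0 < (e / (1 + `|K|)) `^ alpha^-1 by exact: powR_gt0.
have := nbhsx_ballx x _ d0; have := open_nbhs_nbhs (conj oI Ix).
apply: filterS2 => y Iy; rewrite /ball /= => xy.
have in01 z : I z -> z \in `[0, 1]%R by rewrite /unit_itv /= !in_itv /= => /andP[/ltW-> /ltW->].
apply: le_trans (hK x y (in01 _ Ix) (in01 _ Iy)) _.
have h1 : `|x - y| `^ alpha <= e / (1 + `|K|).
  have -> : e / (1 + `|K|) = ((e / (1 + `|K|)) `^ alpha^-1) `^ alpha.
    by rewrite -powRrM mulVf ?gt_eqF// powRr1// ltW.
  by apply: (ge0_ler_powR (ltW a0)); rewrite ?nnegrE; [exact: normr_ge0|exact: ltW|exact: ltW].
apply: le_trans (ler_norm _) _; rewrite normrM (ger0_norm (powR_ge0 _ _)).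
apply: le_trans (ler_wpM2l (normr_ge0 K) h1) _.
by rewrite mulrA ler_pdivrMr// mulrC ler_wpM2l ?(ltW e0)// lerDr.
Qed.

Lemma hoelder_bounded alpha c : 0 < alpha -> hoelder_continuous alpha c ->
  exists M, forall x, I x -> c x <= M.
Proof.
move=> a0 [K hK]; exists (`|c 0| + `|K|) => x; rewrite /unit_itv /= in_itv /= => /andP[x0 x1].
have h := hK x 0; rewrite !in_itv /= lexx ler01 (ltW x0) (ltW x1) in h.
have {h} := h isT isT; rewrite subr0 (gtr0_norm x0) => h.
have p1 : x `^ alpha <= 1.
  have -> : 1 = 1 `^ alpha :> R by rewrite powR1.
  by apply: (ge0_ler_powR (ltW a0)); rewrite ?nnegrE; [exact: ltW|exact: ler01|exact: ltW].
have p2 : K * x `^ alpha <= `|K|.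
  apply: le_trans (ler_norm _) _; rewrite normrM (ger0_norm (powR_ge0 _ _)).
  by rewrite ler_piMr.
have := ler_norm (c x - c 0); have := ler_norm (c 0); lra.
Qed.

Lemma coeff_damping alpha abar aleph a : 2^-1 < alpha <= 1 -> 0 < abar ->
  coeff_bounded alpha abar aleph a -> exists M,
  [/\ forall i, measurable_fun I (sides a i), forall i x, I x -> 0 <= sides a i x <= M &
      forall i x, I x -> abar <= sides a i x].
Proof.
move=> /andP[al _] ab0 [[h1 h2 _ _] _ ge _].
have al0 : 0 < alpha by apply: lt_trans al; rewrite invr_gt0.
have [M1 b1] := hoelder_bounded al0 h1; have [M2 b2] := hoelder_bounded al0 h2.
have ale i x : I x -> abar <= sides a i x.
  rewrite /unit_itv /= in_itv /= => /andP[x0 x1].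
  have xx : x \in `[0, 1]%R by rewrite in_itv /= !ltW.
  by have [g1 g2] := ge x xx; case: i.
exists (Num.max M1 M2); split; last exact: ale.
- by case; [exact: hoelder_measurable h1|exact: hoelder_measurable h2].
move=> i x Ix; rewrite (le_trans (ltW ab0) (ale i x Ix)) /=.
by case: i; rewrite le_max /= ?(b1 _ Ix)// (b2 _ Ix) orbT.
Qed.

Lemma coeff_norm_le alpha abar aleph a : coeff_bounded alpha abar aleph a ->
  (L2norm2 mu I (a - 0)%R <= (Num.sqrt aleph)%:E)%E.
Proof.
move=> [_ [[L1 [w1 hw1]] [L2 [w2 hw2]]] _ hb].
have W (c w : R -> R) : is_weak_deriv1 c w -> L2I (weak_deriv1 c).
  by move=> h; rewrite /weak_deriv1; case: xgetP => [v _ []//|/(_ w)].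
have W1 := W _ _ hw1; have W2 := W _ _ hw2.
have n (c : R -> R) : L2I c -> L2norm mu I c = (snorm (L2dot mu I) c)%:E.
  exact: (L2norm_snorm (m := mu) (@measurable_unit_itv R)).
have e1 : (a - 0).1 = a.1 by change (a.1 - 0 = a.1); rewrite subr0.
have e2 : (a - 0).2 = a.2 by change (a.2 - 0 = a.2); rewrite subr0.
move: hb; rewrite /L2norm2 e1 e2 /H1norm_itv (n _ L1) (n _ L2) (n _ W1) (n _ W2) !hypot_fin.
rewrite -EFin_expe !lee_fin => hb; apply: ler_wsqrtr.
have key (r s p q k : R) : Num.sqrt (Num.sqrt (r ^+ 2 + s ^+ 2) ^+ 2 +
    Num.sqrt (p ^+ 2 + q ^+ 2) ^+ 2) ^+ 2 <= k -> r ^+ 2 + p ^+ 2 <= k.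
  rewrite !sqr_sqrtr ?addr_ge0 ?sqr_ge0//.
  by have := sqr_ge0 s; have := sqr_ge0 q; lra.
exact: (key _ _ _ _ _ hb).
Qed.

End Coefficients.

(** * The lower bound and the stability estimate *)

Section LowerBound.
Context {R : realType}.
Local Notation mu := (@lebesgue_measure R).
Local Notation mu2 := (@lebesgue2 R).
Local Notation I := (@unit_itv R).
Local Notation mO := (@measurable_Omega R).
Local Notation mI := (@measurable_unit_itv R).
Local Notation dotO := (L2dot mu2 Omega).
Local Notation dot1 := (L2dot mu I).
Local Notation nO := (snorm dotO).
Local Notation n1 := (snorm dot1).
Local Notation ipO := (@ipO R).
Local Notation ip1 := (@ip1 R).
Local Notation L2I := (L2 mu I).
Local Notation F := (R * R -> R).

Lemma profile_norm_gt0 : 0 < n1 (@profile R).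
Proof.
have Lp : L2I profile by apply: L2_continuous1; exact: smooth1_continuous smooth1_profile.
have L1 : L2I (cst 1) by apply: L2_continuous1; exact: cst_continuous.
rewrite lt_neqAle snorm_ge0 andbT eq_sym; apply/negP => /eqP n0.
have z : dot1 profile (cst 1) = 0.
  apply/eqP; rewrite -normr_eq0 eq_le normr_ge0 andbT.
  by have := si_cs ip1 Lp L1; rewrite n0 mul0r.
have pi0 := pi_gt0 R.
pose f (x : R) := 2 / pi * sin (pi / 2 * x + 0).
have df (x : R) : is_derive x (1 : R) f (profile x).
  have d1 := is_derive_affine (pi / 2) 0 x.
  have d2 := @is_derive1_comp R sin (fun y => pi / 2 * y + 0) x _ _ (is_derive_sin _) d1.
  have d3 := @is_deriveM R R (cst (2 / pi)) _ x 1 _ _ (is_derive_cst _ _ _) d2.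
  apply: (is_derive_eq d3); rewrite /cst /= scaler0 addr0.
  change (2 / pi * (cos (pi / 2 * x + 0) * (pi / 2)) = cos (pi / 2 * x + 0)).
  by field; lra.
have := ftc df (smooth1_continuous smooth1_profile) (ltr01 : 0 < 1).
have -> : \int[mu]_(x in `]0, 1[%classic) profile x = dot1 profile (cst 1).
  by apply: eq_Rintegral => x _; rewrite mulr1.
rewrite z /f mulr0 mulr1 !addr0 sin0 sin_pihalf mulr0 mulr1 subr0 => e.
have : 0 < 2 / pi :> R by rewrite divr_gt0.
by rewrite -e ltxx.
Qed.

(** As omega is pi divided by the square root of 2, the time T is less than half
    a period. *)
Lemma osc_lt1 (T : R) : 0 < T <= 1 -> osc T < 1.
Proof.
move=> /andP[T0 T1]; have pi0 := pi_gt0 R.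
have o0 : 0 < @omega R by rewrite sqrtr_gt0 /eigenvalue mulr_gt0// exprn_gt0// divr_gt0.
have o1 : @omega R < pi.
  rewrite -(@ltr_pXn2r _ 2) ?nnegrE ?ltW// omega_sqr /eigenvalue expr_div_n.
  by have := mulr_gt0 pi0 pi0; rewrite -!expr2; lra.
have oT : 0 < omega * T + 0 < pi.
  rewrite addr0 mulr_gt0//=; apply: le_lt_trans _ o1.
  by rewrite -[leRHS]mulr1 ler_pM2l.
have s0 := sin_gt0_pi oT; have := cos2Dsin2 (omega * T + 0).
rewrite /osc; move: (sin _) (cos _) s0 => s c s0 e.
rewrite ltNge; apply/negP => c1.
have : 0 < s ^+ 2 by rewrite exprn_gt0.
have : 1 <= c ^+ 2 by rewrite exprn_ege1.
by move: e; lra.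
Qed.

Lemma scaled_sum_le1 (q x y z w : R) : q * (1 + (x + (y + z) + w)) = 1 -> 0 < q ->
  q * x + (q * y + q * z) + q * w <= 1.
Proof.
move=> h q0; have -> : q * x + (q * y + q * z) + q * w = q * (1 + (x + (y + z) + w)) - q by ring.
by rewrite h; lra.
Qed.

Lemma half_le_hypot (c e1 e2 s : R) : c <= e2 + e1 -> e1 <= s -> e2 <= s -> c / 2 <= s.
Proof. by move=> *; lra. Qed.

(** A factor that puts the eigenfunction in the unit ball of the initial data. *)
Definition unit_scale : R := (1 + (nO (@mode R) + (nO (pd false mode) + nO (pd true mode)) + nO (lap mode)))^-1.

Lemma unit_scaleE : unit_scale *
  (1 + (nO (@mode R) + (nO (pd false mode) + nO (pd true mode)) + nO (lap mode))) = 1.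
Proof.
by apply: mulVf; rewrite gt_eqF//; apply: ltr_pwDl => //; rewrite !addr_ge0// snorm_ge0.
Qed.

Let k := unit_scale.
Let phi : F := k *: mode.

Lemma unit_scale_gt0 : 0 < k.
Proof. by rewrite invr_gt0; apply: ltr_pwDl => //; rewrite !addr_ge0// snorm_ge0. Qed.

Lemma phi_laplacian : is_laplacian phi (lap phi).
Proof.
have V0 : Vtuple (0 : F) (pd^~ 0) 0 by rewrite pd0; exact: Vtuple0.
exact: (wave_op_laplacian (wave_op_smooth (fun _ _ => 0) (Smooth_phi k) (phi_side1 k) (phi_neumann k) V0)).
Qed.

Lemma phi_U0 : U0_space phi.
Proof.
have V := Vtuple_phi k; split; first exact: Vtuple_V V.
  by exists (lap phi); exact: phi_laplacian.
have L0 (i : bool) : L2I ((fun=> cst 0) i : R -> R) by exact: (si0 ip1).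
apply: ((normal_derivP V phi_laplacian L0).2) => p q r Vp.
rewrite (green_neumann (Smooth_phi k) Vp (phi_neumann k)).
have [_ _ Lr _] := Vp.
have z i : dot1 (cst 0) (r i) = 0.
  have := siBl ip1 (Lr i) (Lr i) (Lr i); rewrite !subrr; exact.
by rewrite /= !z addr0.
Qed.

Lemma phi_U0norm : (U0norm phi <= 1)%E.
Proof.
have V := Vtuple_phi k; have [_ LL el] := laplacian_spec phi_laplacian.
have sp := Smooth_phi k; have Lphi := Smooth_L2 sp; have Llap := Smooth_L2 (Smooth_lap sp).
have k0 := unit_scale_gt0; have gk : `|k| = k by rewrite gtr0_norm.
rewrite /U0norm (H1normE Lphi (fun i => Vtuple_weak_d i V)) (L2normO LL).
rewrite (hypot_fin (h1norm phi (pd^~ phi)) (nO (laplacian phi))) lee_fin.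
have h0 : 0 <= h1norm phi (pd^~ phi) by exact: sqrtr_ge0.
apply: le_trans (sqrt_hypot_le h0 (snorm_ge0 _ _)) _.
have e0 : nO (laplacian phi) = nO (lap phi) := snorm_eq ipO LL Llap el.
have sm := @Smooth_mode R.
have e1 : nO phi = k * nO mode by rewrite -[X in X * _]gk; exact: (snormZ ipO k (Smooth_L2 sm)).
have e2 i : nO (pd i phi) = k * nO (pd i mode).
  have -> : pd i phi = k *: pd i mode by exact: (pdZ i k sm).
  by rewrite -[X in _ = X * _]gk; exact: (snormZ ipO k (Smooth_L2 (Smooth_pd i sm))).
have e3 : nO (lap phi) = k * nO (lap mode).
  have -> : lap phi = k *: lap mode.
    by rewrite (lap_phi k) lap_mode /phi !scalerA mulrC.
  by rewrite -[X in _ = X * _]gk; exact: (snormZ ipO k (Smooth_L2 (Smooth_lap sm))).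
have hl := h1norm_le phi (pd^~ phi).
have kk : k * nO mode + (k * nO (pd false mode) + k * nO (pd true mode)) + k * nO (lap mode) <= 1
  := @scaled_sum_le1 k (nO mode) (nO (pd false mode)) (nO (pd true mode)) (nO (lap mode)) unit_scaleE k0.
have es : nO phi + (nO (pd false phi) + nO (pd true phi)) + nO (laplacian phi) =
    k * nO mode + (k * nO (pd false mode) + k * nO (pd true mode)) + k * nO (lap mode)
  := congr2 +%R (congr2 +%R e1 (congr2 +%R (e2 false) (e2 true))) (etrans e0 e3).
apply: le_trans (lerD hl (lexx (nO (laplacian phi)))) _.
apply: (le_trans _ kk); rewrite -es; exact: lexx.
Qed.

Lemma wave_exists (tau M : R) a : (forall i, measurable_fun I (sides a i)) ->
  (forall i x, I x -> 0 <= sides a i x <= M) ->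
  exists u : R -> F, is_wave tau a phi (cst 0) u.
Proof.
move=> ma aM.
have app e : 0 < e -> exists2 eta, test_fun eta & nO (lap phi - eta) < e.
  move=> e0; have [eta te he] := mode_approx (- eigenvalue * k) e0; exists eta => //.
  have -> : lap phi = (- eigenvalue * k) *: mode by rewrite (lap_phi k) /phi scalerA.
  exact: he.
have [U [V [h1 h2 h3 h4 h5]]] := wave_curves ma aM (Smooth_phi k) (phi_side1 k) (phi_neumann k) app.
exists (fun t => (U t).1.1).
exact: (curves_wave ma aM tau (Smooth_L2 (Smooth_phi k)) h1 h2 h3 h4 h5).
Qed.

Lemma lateral_zero (tau : R) (H : R * R -> R) : 0 < tau -> L2 mu2 (lateral tau) H ->
  {ae mu, forall t, `]0, tau[%classic t -> dot1 (fun x => H (x, t)) (fun x => H (x, t)) = 0} ->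
  snorm (L2dot mu2 (lateral tau)) H = 0.
Proof.
move=> tau0 LH ae.
rewrite /snorm (dot_lateral LH).2.
have [iH _] := dot_lateral LH; have mH := measurable_int _ iH.
rewrite (_ : \int[mu]_(t in _) _ = 0) ?sqrtr0//.
rewrite /Rintegral (_ : (\int[mu]_(t in _) _)%E = 0%E)//.
rewrite -(@integral0 _ _ R mu `]0, tau[%classic).
apply: ge0_ae_eq_integral => //.
- by move=> t _; rewrite lee_fin Rintegral_ge0// => x _; rewrite -expr2 sqr_ge0.
- by apply: (ae_mono (m := mu) ae) => t h Bt; rewrite /= (h Bt).
Qed.

(** When e is at most 1, the right-hand side is at most a multiple of the square
    root of e. *)
Lemma lower_constant (A b1 k1 k2 : R) : 0 < A -> 0 <= b1 -> 0 <= k1 -> 0 <= k2 ->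
  exists2 c, 0 < c & forall e, 0 <= e -> A <= b1 * Num.sqrt (k1 * e) + k2 * e -> c <= e.
Proof.
move=> A0 b0 k10 k20; have s0 := sqrtr_ge0 k1.
pose Q := b1 * Num.sqrt k1 + k2 + 1.
have Q0 : 0 < Q by apply: ltr_wpDl => //; rewrite addr_ge0// mulr_ge0.
exists (Num.min 1 ((A / Q) ^+ 2)); first by rewrite lt_min ltr01 exprn_gt0// divr_gt0.
move=> e e0 h; rewrite leNgt; apply/negP; rewrite lt_min => /andP[e1 e2].
have q0 := sqrtr_ge0 e.
have se : Num.sqrt e ^+ 2 = e by rewrite sqr_sqrtr.
have s1 : Num.sqrt e <= 1 by rewrite -sqrtr1; apply: ler_wsqrtr; exact: ltW.
have s2 : Num.sqrt e < A / Q.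
  by rewrite -(@ltr_pXn2r _ 2) ?nnegrE ?se// ltW// divr_gt0.
have h1 : e <= Num.sqrt e by rewrite -{1}se expr2 ler_piMr.
rewrite ltr_pdivlMr// in s2.
have h2 := ler_wpM2l k20 h1; move: h s2; rewrite (sqrtrM _ k10) /Q.
have -> : Num.sqrt e * (b1 * Num.sqrt k1 + k2 + 1) =
  b1 * (Num.sqrt k1 * Num.sqrt e) + k2 * Num.sqrt e + Num.sqrt e by ring.
by move: h2 q0; lra.
Qed.

(** The normalised eigenfunction is an admissible datum, on which Lambda(0) vanishes
    almost everywhere and Lambda(a) cannot be small, by the energy estimate. *)
Lemma Lambda_lower_bound (tau abar : R) : 0 < tau -> 0 < abar -> exists2 c : R, 0 < c &
  forall (a : (R -> R) * (R -> R)) M, (forall i, measurable_fun I (sides a i)) ->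
    (forall i x, I x -> 0 <= sides a i x <= M) -> (forall i x, I x -> abar <= sides a i x) ->
    (c%:E <= Lambda_norm tau (Lambda tau a - Lambda tau 0)%R)%E.
Proof.
move=> tau0 ab0; pose T := Num.min tau 1.
have T0 : 0 < T by rewrite lt_min tau0 ltr01.
have Ttau : T <= tau by rewrite ge_min lexx.
have T1 : T <= 1 by rewrite ge_min lexx orbT.
pose b := n1 (k *: @profile R).
have Lp : L2I profile by apply: L2_continuous1; exact: smooth1_continuous smooth1_profile.
have k0 := unit_scale_gt0.
have b0 : 0 < b by rewrite /b (snormZ ip1 _ Lp) mulr_gt0 ?profile_norm_gt0// normr_gt0 gt_eqF.
have A0 : 0 < b ^+ 2 * (1 - osc T).
  by rewrite mulr_gt0 ?exprn_gt0// subr_gt0 osc_lt1// T0.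
have o0 := @omega_ge0 R; have q0 := sqrtr_ge0 T.
have k10 : 0 <= 2 * omega * b * Num.sqrt T by rewrite !mulr_ge0// ltW.
have k20 : 0 <= b / abar * Num.sqrt T by rewrite mulr_ge0// divr_ge0// ltW.
have b20 : 0 <= 2 * b by rewrite mulr_ge0// ltW.
have [c c0 hc] := lower_constant A0 b20 k10 k20.
exists (c / 2); first by rewrite divr_gt0.
move=> a M ma aM ale.
have Lphi := Smooth_L2 (Smooth_phi k).
have [U [V [orb [h [hh [LH aeH]]]]]] := Lambda_spec ma aM tau0 Lphi (wave_exists tau ma aM).
have s0 i x : sides (0 : (R -> R) * (R -> R)) i x = 0 by case: i.
have ma0 i : measurable_fun I (sides (0 : (R -> R) * (R -> R)) i).
  by case: i; exact: measurable_cst.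
have aM0 i x : I x -> 0 <= sides (0 : (R -> R) * (R -> R)) i x <= 0 by rewrite s0 lexx.
have [U' [V' [_ [h' [_ [LH0 aeH0]]]]]] :=
  Lambda_spec ma0 aM0 tau0 Lphi (wave_exists tau ma0 aM0).
pose H (i : bool) := if i then (Lambda tau a phi).1 else (Lambda tau a phi).2.
pose H0 (i : bool) := if i then (Lambda tau 0 phi).1 else (Lambda tau 0 phi).2.
have {}LH i : L2 mu2 (lateral tau) (H i) := LH i.
have {}LH0 i : L2 mu2 (lateral tau) (H0 i) := LH0 i.
have ipLat := ipL tau.
have H0z i : snorm (L2dot mu2 (lateral tau)) (H0 i) = 0.
  apply: (lateral_zero tau0 (LH0 i)); apply: (ae_mono (m := mu) aeH0) => t ht Bt.
  have [L1 e] := ht Bt i.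
  transitivity (n1 (fun x => H0 i (x, t)) ^+ 2); first exact: (esym (snorm_sqr ip1 L1)).
  have z : (fun x => - (sides 0 i x * h' t i x)) = 0 :> (R -> R).
    by apply/funext => x; rewrite s0 mul0r oppr0.
  rewrite z subr0 in e; have -> : n1 (fun x => H0 i (x, t)) = 0 by exact: e.
  by rewrite expr0n.
pose eps i := snorm (L2dot mu2 (lateral tau)) (H i).
have eps0 i : 0 <= eps i by exact: snorm_ge0.
have est := energy_estimate (H := H) T0 Ttau ab0 ma aM ale orb hh LH aeH.
have ce : c <= eps false + eps true.
  apply: hc; first exact: addr_ge0.
  by apply: (le_trans est); rewrite (mulrA (b / abar)); exact: lexx.
have D i : snorm (L2dot mu2 (lateral tau)) (H i - H0 i) = eps i.
  apply: (snorm_eq ipLat (siB ipLat (LH i) (LH0 i)) (LH i)).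
  have -> : H i - H0 i - H i = - H0 i by rewrite addrAC subrr add0r.
  by rewrite (snormN ipLat (LH0 i)).
have N i : L2norm mu2 (lateral tau) (H i - H0 i) = (eps i)%:E.
  rewrite -(D i); apply: (L2norm_snorm (m := mu2) (measurable_lateral tau)).
  exact: (siB ipLat (LH i) (LH0 i)).
have val : L2norm2 mu2 (lateral tau) ((Lambda tau a - Lambda tau 0)%R phi) =
    (Num.sqrt (eps true ^+ 2 + eps false ^+ 2))%:E.
  rewrite -hypot_fin -(N true) -(N false); exact: erefl.
apply: (@le_trans _ _ (L2norm2 mu2 (lateral tau) ((Lambda tau a - Lambda tau 0)%R phi))).
  rewrite val lee_fin.
  have l1 := le_sqrt_hypotl (eps false) (eps0 true).
  have l2 := le_sqrt_hypotr (eps true) (eps0 false).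
  exact: (half_le_hypot ce l1 l2).
apply: ereal_sup_ubound; exists phi => //; split; first exact: phi_U0.
exact: phi_U0norm.
Qed.

End LowerBound.

Theorem theorem6p1 (R : realType) (tau abar aleph delta : R)
  (htau : 0 < tau) (habar : 0 < abar) (haleph : abar <= aleph)
  (hdelta : 0 < delta < 1) :
  exists C : R, 0 < C /\
    forall (alpha : R) (a : (R -> R) * (R -> R)),
      2^-1 < alpha <= 1 ->
      coeff_bounded alpha abar aleph a ->
      (L2norm2 lebesgue_measure unit_itv (a - 0)%R <=
       C%:E * Lambda_norm tau (Lambda tau a - Lambda tau 0)%R
                `^ (delta / (2 * (2 + delta))))%E.
Proof.
have [c c0 hc] := Lambda_lower_bound htau habar.
have al0 : 0 < aleph := lt_le_trans habar haleph.
set theta := delta / _.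
have th0 : 0 <= theta.
  by case/andP: hdelta => d0 d1; rewrite divr_ge0 ?(ltW d0)// mulr_ge0// addr_ge0 ?(ltW d0).
have ct : 0 < c `^ theta by exact: powR_gt0.
exists (Num.sqrt aleph / c `^ theta); split; first by rewrite divr_gt0 ?sqrtr_gt0.
move=> alpha a halpha ha; have [M [ma aM ale]] := coeff_damping halpha habar ha.
apply: le_trans (coeff_norm_le ha) _.
have h := hc a M ma aM ale.
have L0 : (0 <= Lambda_norm tau (Lambda tau a - Lambda tau 0)%R)%E.
  by apply: le_trans h; rewrite lee_fin ltW.
have h2 : ((c `^ theta)%:E <= Lambda_norm tau (Lambda tau a - Lambda tau 0)%R `^ theta)%E.
  rewrite -poweR_EFin; apply: gt0_ler_poweR => //.
  - by rewrite in_itv /= leey andbT lee_fin ltW.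
  - by rewrite in_itv /= leey andbT.
have k0 : (0 <= (Num.sqrt aleph / c `^ theta)%:E)%E by rewrite lee_fin divr_ge0 ?sqrtr_ge0// ltW.
apply: le_trans (lee_wpmul2l k0 h2).
by rewrite -EFinM lee_fin divfK// gt_eqF.
Qed.
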